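(* Let $m,n\ge 1$ be integers. There is a proper algebraic subset $V$ of $((\mathbb{P}^n)^* )^{2n+2}$ with the following property. Let $H_1,\dots,H_{2n+2}$ be hyperplanes in $\mathbb{P}^n$ such that $(H_1,\dots,H_{2n+2})\notin V$. Let $f$ and $g$ be meromorphic maps of $\mathbb{C}^m$ into $\mathbb{P}^n$ such that $f(\mathbb{C}^m)\not\subseteq H_j$, $g(\mathbb{C}^m)\not\subseteq H_j$ and $f^*(H_j)=g^*(H_j)$ for all $1\le j\le 2n+2$. If $g$ is algebraically non-degenerate, then $f=g$.
   Context: $\mathbb{P}^n$ is the $n$-dimensional complex projective space. $(\mathbb{P}^n)^*$ is the set of all hyperplanes in $\mathbb{P}^n$, identified with $\mathbb{P}^n$ in the natural way (the hyperplane $a_0x_0+\dots+a_nx_n=0$ corresponds to $[a_0:\dots:a_n]$), and $((\mathbb{P}^n)^* )^{2n+2}$ is the Cartesian product of $2n+2$ copies of it. For a meromorphic map $f:\mathbb{C}^m\to\mathbb{P}^n$, $I(f)$ is its indeterminacy locus, an analytic subset of $\mathbb{C}^m$ of codimension $\ge 2$; $f(\mathbb{C}^m)$ means the image of $\mathbb{C}^m\setminus I(f)$. A reduced representation of $f$ is an $(n+1)$-tuple $(f_0,\dots,f_n)$ of holomorphic functions on $\mathbb{C}^m$ with $\{f_0=\dots=f_n=0\}=I(f)$ and $f(z)=[f_0(z):\dots:f_n(z)]$ for all $z\in\mathbb{C}^m\setminus I(f)$; one always exists. If $H$ is the hyperplane defined by the linear form $a_0X_0+\dots+a_nX_n$,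 put $(f,H):=a_0f_0+\dots+a_nf_n$. When $f(\mathbb{C}^m)\not\subseteq H$, the pullback divisor $f^*(H)$ is the zero divisor (with multiplicities) of the holomorphic function $(f,H)$; it does not depend on the choices made. A meromorphic map of $\mathbb{C}^m$ into $\mathbb{P}^n$ is algebraically non-degenerate if its image is not contained in any hypersurface in $\mathbb{P}^n$. *)

(* Defs.v *)
From HB Require Import structures.
From mathcomp Require Import all_boot all_order all_algebra.
From mathcomp Require Import complex.
From mathcomp Require Import all_classical all_reals all_analysis.
From mathcomp Require mpoly.
(* The notations of mpoly are incompatible with those of MathComp-Analysis. *)
Import -(notations) mpoly.

Set Implicit Arguments.
Unset Strict Implicit.
Unset Printing Implicit Defensive.

Import Order.TTheory GRing.Theory Num.Theory.
Import numFieldNormedType.Exports.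

Local Open Scope classical_set_scope.
Local Open Scope ring_scope.

(* C^m, where C = R[i] for R : realType. *)
Definition Cn (R : realType) (m : nat) : normedModType R[i] := 'rV[R[i]]_m.

(* P^n is the set of lines through the origin in C^(n+1).  The dual space
   (P^n)^* is identified with it. *)
Definition projspace (R : realType) (n : nat) : Type :=
  {L : {vspace 'rV[R[i]]_n.+1} | \dim L == 1%N}.

(* p = [x_0 : ... : x_n].  As p is one-dimensional, this forces x != 0. *)
Definition hcoord (R : realType) (n : nat) (x : 'rV[R[i]]_n.+1)
    (p : projspace R n) : Prop :=
  sval p = <[x]>%VS.

(* The hyperplane a_0 X_0 + ... + a_n X_n = 0, where H = [a_0 : ... : a_n]. *)
Definition hyperplane (R : realType) (n : nat) (H : projspace R n) :
    set (projspace R n) :=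
  [set p | forall a x : 'rV[R[i]]_n.+1, hcoord a H -> hcoord x p ->
     \sum_(i < n.+1) a 0 i * x 0 i = 0].

Definition hypersurface (R : realType) (n : nat) (X : set (projspace R n)) :
    Prop :=
  exists (d : nat) (P : mpoly.mpoly n.+1 R[i]),
    [/\ (0 < d)%N, P != 0, P \is mpoly.ishomog1 d mpoly.mdeg &
        X = [set p | forall x : 'rV[R[i]]_n.+1, hcoord x p ->
               mpoly.meval (fun i => x 0 i) P = 0]].

(* The variables of P are the entries of an N x (n+1) matrix, in the order of
   mxvec; row j holds the homogeneous coordinates on the j-th factor. *)
Definition multihomogeneous (R : realType) (N n : nat)
    (P : mpoly.mpoly (N * n.+1) R[i]) : Prop :=
  exists d : 'I_N -> nat,
    forall mon, mon \in mpoly.msupp P ->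
    forall j : 'I_N, (\sum_(i < n.+1) mon (mxvec_index j i))%N = d j.

(* Algebraic subsets of the product of N copies of P^n: the common zero sets of
   finitely many multihomogeneous polynomials. *)
Definition algebraic_subset (R : realType) (N n : nat)
    (V : set ('I_N -> projspace R n)) : Prop :=
  exists S : seq (mpoly.mpoly (N * n.+1) R[i]),
    (forall P, P \in S -> multihomogeneous P) /\
    V = [set H | forall P, P \in S -> forall A : 'M[R[i]]_(N, n.+1),
           (forall j, hcoord (row j A) (H j)) ->
           mpoly.meval (fun k => mxvec A 0 k) P = 0].

Definition holomorphic (R : realType) (m : nat) (F : Cn R m -> R[i]^o) :
    Prop :=
  forall z, differentiable F z.

(* Near a, A is a complex submanifold of codimension c. *)
Definition regular_point (R : realType) (m : nat) (A : set (Cn R m))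
    (a : Cn R m) (c : nat) : Prop :=
  exists (U : set (Cn R m)) (F : Cn R m -> Cn R c),
    [/\ open U /\ U a,
        forall z, U z -> differentiable F z,
        \rank ('J F a) = c & A `&` U = [set z | U z /\ F z = 0]].

(* For an analytic set A.  The dimension of A is the largest dimension of A at
   a regular point; in particular the empty set has codimension >= k for all
   k. *)
Definition codim_ge (R : realType) (m : nat) (A : set (Cn R m)) (k : nat) :
    Prop :=
  forall (a : Cn R m) (c : nat), A a -> regular_point A a c -> (k <= c)%N.

(* A meromorphic map is encoded as a total function to option (projspace R n),
   whose value is None exactly on the indeterminacy locus I(f). *)
Definition indet (R : realType) (m n : nat)
    (f : Cn R m -> option (projspace R n)) : set (Cn R m) :=
  [set z | f z = None].

Definition mer_image (R : realType) (m n : nat)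
    (f : Cn R m -> option (projspace R n)) : set (projspace R n) :=
  [set p | exists z, f z = Some p].

Definition reduced_rep (R : realType) (m n : nat)
    (f : Cn R m -> option (projspace R n))
    (F : 'I_n.+1 -> Cn R m -> R[i]^o) : Prop :=
  [/\ forall i, holomorphic (F i),
      [set z | forall i, F i z = 0] = indet f &
      forall z p, f z = Some p -> hcoord (\row_i F i z) p].

(* On C^m, every meromorphic map to P^n has a global reduced representation.
   The existence of one makes I(f) analytic, and f holomorphic outside I(f). *)
Definition meromorphic_map (R : realType) (m n : nat)
    (f : Cn R m -> option (projspace R n)) : Prop :=
  codim_ge (indet f) 2 /\ exists F, reduced_rep f F.

Definition alg_nondegenerate (R : realType) (m n : nat)
    (f : Cn R m -> option (projspace R n)) : Prop :=
  forall X, hypersurface X -> ~ mer_image f `<=` X.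

Definition iter_partial (R : realType) (m : nat) (s : seq 'I_m)
    (F : Cn R m -> R[i]^o) : Cn R m -> R[i]^o :=
  foldr (fun (i : 'I_m) (G : Cn R m -> R[i]^o) =>
           'D_(delta_mx 0 i) G) F s.

(* F vanishes at z to order exactly k: the expansion of F at z into homogeneous
   polynomials in the coordinates of w - z starts in degree k. *)
Definition vanishing_order (R : realType) (m : nat)
    (F : Cn R m -> R[i]^o) (z : Cn R m) (k : nat) : Prop :=
  (forall s : seq 'I_m, (size s < k)%N -> iter_partial s F z = 0) /\
  (exists2 s : seq 'I_m, size s = k & iter_partial s F z <> 0).

(* The zero divisor with multiplicities of a holomorphic function F that is not
   identically zero, encoded as its multiplicity function on C^m. *)
Definition zero_divisor (R : realType) (m : nat)
    (F : Cn R m -> R[i]^o) : Cn R m -> nat :=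
  fun z => xget 0%N (vanishing_order F z).

(* The function (f, H) for the coefficient vector a and the representation F. *)
Definition pairing (R : realType) (m n : nat)
    (F : 'I_n.+1 -> Cn R m -> R[i]^o) (a : 'rV[R[i]]_n.+1) :
    Cn R m -> R[i]^o :=
  fun z => \sum_(i < n.+1) a 0 i * F i z.

(* f^*(H), for some reduced representation of f and some linear form defining
   H; it does not depend on these choices. *)
Definition pullback (R : realType) (m n : nat)
    (f : Cn R m -> option (projspace R n)) (H : projspace R n) :
    Cn R m -> nat :=
  zero_divisor (pairing (xget (fun _ _ => 0) (reduced_rep f))
                        (vpick (sval H))).

(* Main.v *)
Require Import Defs.
From HB Require Import structures.
From mathcomp Require Import all_boot all_order all_algebra.
From mathcomp Require Import complex.
From mathcomp Require Import all_classical all_reals all_analysis.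
From mathcomp Require Import ring lra.
Set Implicit Arguments.
Unset Strict Implicit.
Unset Printing Implicit Defensive.
Import Order.TTheory GRing.Theory Num.Theory.
Import numFieldNormedType.Exports.
Local Open Scope classical_set_scope.
Local Open Scope ring_scope.
Local Open Scope complex_scope.
Local Notation Re := complex.Re.
Local Notation Im := complex.Im.

(** Write [F_j], [G_j] for the values of linear forms defining the hyperplanes on
    reduced representations of the two maps, and [h_j] for [F_j / G_j], with
    [2n+2] indices [j].

    Equality of the divisors makes each of [F_j] and [G_j] locally dominated by
    the other ([compare]), so that [h_j] becomes a zero-free entire function on
    every line through a point where no form vanishes ([line_units]).  The
    equations [F_j = h_j G_j] say that the pair [(f, - g)] is in the kernel of
    the square matrix with rows [(a_j, h_j a_j)].  Its determinant therefore
    vanishes, and the expansion of the determinant is a linear relation between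
    the products of [n+1] of the [h_j] ([det_expand]).  By the theorem of Borel
    on units ([borel], [borel_sets]) the terms belonging to proportional
    products cancel among themselves.

    Let [L] be the space of the real vectors orthogonal to all integer vectors
    [M] of sum zero for which the product of the [h_j ^ M_j] is constant.  It
    contains the constant vectors and the differences of the vectors
    [ln |h_j|] at two points.  A vector of [L] is a weight that is constant on
    the classes of proportional products, and the terms of largest weight form
    a union of classes.  So the determinant still vanishes after dropping the
    second block of the rows whose weight is below a threshold and the first
    block of those whose weight is above it ([lam_det], [threshold]).  For
    generic hyperplanes such a determinant is not zero if the remaining [h_j]
    are equal and the numbers of rows allow it ([generic_blocks], [no_block]).
    This has two consequences.  No weight has [n+1] positive and [n+1] negative
    coordinates, and this bounds the dimension of [L] by [n+1] ([balanced]).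
    And if the threshold is the median of a generic weight, the units [h_j] at
    the median, whose quotients have constant modulus and hence are constant
    ([unit_const]), cannot all be equal unless there are at least [n+2] of
    them, in which case a linear relation between the forms makes the two maps
    agree ([many_proportional]).

    It remains to show that the quotient [c] of two units at the median is 1.
    Here algebraic nondegeneracy enters.  The point [f z] solves a system of
    algebraic equations with parameter [g z]: the multiplicative relations
    between the [h_j], and [F_i G_k = c F_k G_i].  By elimination of
    quantifiers the system is then solvable for generic parameters
    ([solvable_generic], [generic_solution]).  Let the parameter tend to the
    common zero of the forms in a set [J] of [n] indices, the forms tending to
    zero at generic rates.  If the coordinates outside [J] determine the
    vectors of [L], a comparison of growth rates shows that exactly [n] forms
    of the solution tend to zero, and that [c] is a quotient of ratios of
    minors ([degeneration]).  The bound on the dimension of [L] leaves at least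
    two choices for [J] ([two_sets]), and for generic hyperplanes the two
    resulting expressions for [c] agree only if they are 1 ([generic_ratios]).

    The conditions on the hyperplanes are multihomogeneous polynomial
    conditions, each satisfied by some matrix ([generic_hyperplanes]). *)

(** * Modulus, continuity and derivatives of complex functions *)

Section Modulus.
Variable R : realType.
Implicit Types z w x y : R[i].

Definition nm (z : R[i]) : R := Normc.normc z.

Lemma nmE z : `|z| = (nm z)%:C. Proof. by []. Qed.

Lemma nm0 : nm 0 = 0. Proof. exact: Normc.normc0. Qed.
Lemma nm1 : nm 1 = 1. Proof. exact: Normc.normc1. Qed.
Lemma nmM z w : nm (z * w) = nm z * nm w. Proof. exact: Normc.normcM. Qed.
Lemma nmV z : nm z^-1 = (nm z)^-1. Proof. exact: Normc.normcV. Qed.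
Lemma nmN z : nm (- z) = nm z. Proof. exact: normcN. Qed.
Lemma nmD z w : nm (z + w) <= nm z + nm w. Proof. exact: le_normcD. Qed.
Lemma nm_ge0 z : 0 <= nm z.
Proof. by case: z => a b; exact: sqrtr_ge0. Qed.
Lemma nm_eq0 z : (nm z == 0) = (z == 0).
Proof.
by apply/eqP/eqP => [/Normc.eq0_normc//|->]; exact: nm0.
Qed.
Lemma nm_gt0 z : (0 < nm z) = (z != 0).
Proof. by rewrite lt0r nm_eq0 nm_ge0 andbT. Qed.
Lemma nmB z w : nm (z - w) <= nm z + nm w.
Proof. by rewrite -(nmN w) nmD. Qed.
Lemma nmBC z w : nm (z - w) = nm (w - z).
Proof. by rewrite -nmN opprB. Qed.
Lemma nmX z n : nm (z ^+ n) = nm z ^+ n.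
Proof. by elim: n => [|n IH]; rewrite ?expr0 ?nm1// !exprS nmM IH. Qed.
Lemma nmR (r : R) : nm r%:C = `|r|.
Proof. by rewrite /nm /= expr0n addr0 sqrtr_sqr. Qed.
Lemma nm_tri z w x : nm (z - x) <= nm (z - w) + nm (w - x).
Proof. by rewrite -[z - x](subrKA w) nmD. Qed.
Lemma nm_sub z w : nm z - nm w <= nm (z - w).
Proof. by have := nmD (z - w) w; rewrite subrK; lra. Qed.
Lemma nm_sum I (r : seq I) (P : pred I) (F : I -> R[i]) :
  nm (\sum_(i <- r | P i) F i) <= \sum_(i <- r | P i) nm (F i).
Proof.
elim/big_ind2: _ => [|x u y v xu yv|//]; first by rewrite nm0.
by apply: le_trans (nmD _ _) _; exact: lerD.
Qed.
Lemma nm_prod I (r : seq I) (P : pred I) (F : I -> R[i]) :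
  nm (\prod_(i <- r | P i) F i) = \prod_(i <- r | P i) nm (F i).
Proof. by apply: (big_morph nm nmM nm1). Qed.
Lemma nm_Re z : `|Re z| <= nm z.
Proof.
case: z => a b /=; rewrite -sqrtr_sqr ler_wsqrtr// lerDl; exact: sqr_ge0.
Qed.
Lemma nm_Im z : `|Im z| <= nm z.
Proof.
case: z => a b /=; rewrite -sqrtr_sqr ler_wsqrtr// lerDr; exact: sqr_ge0.
Qed.
Lemma nm_le z : nm z <= `|Re z| + `|Im z|.
Proof.
rewrite [X in nm X]complexE; apply: le_trans (nmD _ _) _; rewrite nmM !nmR.
suff -> : nm ('i : R[i]) = 1 by rewrite mul1r.
by rewrite /nm /= expr0n expr1n add0r sqrtr1.
Qed.
Lemma nm_sqr z : nm z ^+ 2 = Re z ^+ 2 + Im z ^+ 2.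
Proof. by case: z => a b /=; rewrite sqr_sqrtr// addr_ge0 ?sqr_ge0. Qed.
Lemma nm_prod_le2 z w a b : nm z <= a -> nm w <= b -> nm (z * w) <= a * b.
Proof. by move=> za wb; rewrite nmM ler_pM ?nm_ge0. Qed.
Lemma nmJ z : nm (conjc z) = nm z. Proof. by case: z => a b /=; rewrite /nm /= sqrrN. Qed.
Lemma mulcJ z : z * (conjc z) = (nm z ^+ 2)%:C.
Proof.
rewrite nm_sqr; case: z => a b /=; apply/eqP; rewrite eq_complex /=.
by rewrite mulrN opprK -!expr2 eqxx /= mulrN addrC mulrC subrr.
Qed.

Lemma ReD z w : Re (z + w) = Re z + Re w. Proof. by case: z; case: w. Qed.
Lemma ImD z w : Im (z + w) = Im z + Im w. Proof. by case: z; case: w. Qed.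
Lemma ReN z : Re (- z) = - Re z. Proof. by case: z. Qed.
Lemma ImN z : Im (- z) = - Im z. Proof. by case: z. Qed.
Lemma ReM z w : Re (z * w) = Re z * Re w - Im z * Im w.
Proof. by case: z; case: w. Qed.
Lemma ImM z w : Im (z * w) = Re z * Im w + Im z * Re w.
Proof. by case: z => a b; case: w => c d /=. Qed.
Lemma eqC z w : Re z = Re w -> Im z = Im w -> z = w.
Proof. by case: z => a b; case: w => c d /= -> ->. Qed.

Lemma eq0_le_eps z : (forall e : R, 0 < e -> nm z <= e) -> z = 0.
Proof.
move=> H; apply/eqP; rewrite -nm_eq0; apply/negP => /negP z0.
have zp : 0 < nm z by rewrite lt0r z0 nm_ge0.
by have := H (nm z / 2); rewrite divr_gt0// => /(_ isT); lra.
Qed.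

Lemma unimod z : exists2 c : R[i], nm c = 1 & c * z = (nm z)%:C.
Proof.
have [->|z0] := eqVneq z 0.
  by exists 1; rewrite ?nm1// mulr0 nm0.
exists ((conjc z) / (nm z)%:C).
  rewrite nmM nmV nmJ nmR ger0_norm ?nm_ge0// divff// nm_eq0//.
have nz : (nm z)%:C != 0 :> R[i] by rewrite -nm_gt0 nmR normr_gt0 nm_eq0.
by rewrite mulrAC [conjc z * z]mulrC mulcJ rmorphXn /= expr2 mulfK.
Qed.

Lemma nm_natr n : nm (n%:R) = n%:R.
Proof.
by rewrite -(rmorph_nat (real_complex R)) nmR ger0_norm.
Qed.

Lemma Re_le_nm z : Re z <= nm z.
Proof. by apply: le_trans (nm_Re z); exact: ler_norm. Qed.

Lemma nmC_ge0 (r : R) : 0 <= r -> nm r%:C = r.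
Proof. by move=> r0; rewrite nmR ger0_norm. Qed.
End Modulus.
Arguments nm : simpl never.
Arguments nm0 {R}.
Arguments nm1 {R}.
#[global] Hint Extern 0 (is_true (_ <= nm _)) => solve [apply: nm_ge0] : core.

Section Continuity.
Variable R : realType.
Local Notation C := R[i].
Implicit Types (f g : C -> C) (z w d : C).

Definition ccont f z := forall e : R, 0 < e ->
  exists2 dl : R, 0 < dl & forall w, nm (w - z) < dl -> nm (f w - f z) < e.

Lemma ccont_cst c z : ccont (fun=> c) z.
Proof. by move=> e e0; exists 1 => // w _; rewrite subrr nm0. Qed.

Lemma ccont_id z : ccont id z.
Proof. by move=> e e0; exists e. Qed.

Lemma ccontD f g z : ccont f z -> ccont g z -> ccont (fun w => f w + g w) z.
Proof.
move=> cf cg e e0; have e2 : 0 < e / 2 by rewrite divr_gt0.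
have [d1 d10 H1] := cf _ e2; have [d2 d20 H2] := cg _ e2.
exists (Num.min d1 d2) => [|w]; first by rewrite lt_min d10.
rewrite lt_min => /andP[/H1 h1 /H2 h2].
have -> : f w + g w - (f z + g z) = (f w - f z) + (g w - g z) by ring.
by have := nmD (f w - f z) (g w - g z); lra.
Qed.

Lemma ccontN f z : ccont f z -> ccont (fun w => - f w) z.
Proof.
move=> cf e e0; have [d1 d10 H1] := cf _ e0; exists d1 => // w /H1.
by rewrite -opprD nmN.
Qed.

Lemma ccontB f g z : ccont f z -> ccont g z -> ccont (fun w => f w - g w) z.
Proof. by move=> cf /ccontN; exact: ccontD. Qed.

Lemma ccont_bd f z : ccont f z ->
  exists2 dl : R, 0 < dl & forall w, nm (w - z) < dl -> nm (f w) <= nm (f z) + 1.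
Proof.
move=> /(_ _ ltr01) [dl dl0 H]; exists dl => // w /H h.
by have := nm_sub (f w) (f z); lra.
Qed.

Lemma ccontM f g z : ccont f z -> ccont g z -> ccont (fun w => f w * g w) z.
Proof.
move=> cf cg e e0.
set K := nm (f z) + nm (g z) + 1.
have K0 : 0 < K by rewrite /K; have := nm_ge0 (f z); have := nm_ge0 (g z); lra.
have eK : 0 < e / (2 * K) by rewrite divr_gt0// mulr_gt0.
have [d0 d00 H0] := ccont_bd cf.
have [d1 d10 H1] := cf _ eK; have [d2 d20 H2] := cg _ eK.
exists (Num.min d0 (Num.min d1 d2)) => [|w].
  by rewrite !lt_min d00 d10.
rewrite !lt_min => /and3P[/H0 h0 /H1 h1 /H2 h2].
have -> : f w * g w - f z * g z = f w * (g w - g z) + (f w - f z) * g z by ring.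
apply: le_lt_trans (nmD _ _) _; rewrite !nmM.
have fK : nm (f w) <= K by rewrite /K; have := nm_ge0 (g z); lra.
have gK : nm (g z) <= K by rewrite /K; have := nm_ge0 (f z); lra.
have A : nm (f w) * nm (g w - g z) <= K * nm (g w - g z) by apply: ler_wpM2r.
have B : nm (f w - f z) * nm (g z) <= nm (f w - f z) * K by apply: ler_wpM2l.
have E : e = K * (e / (2 * K)) + (e / (2 * K)) * K by field; rewrite gt_eqF.
have A' : K * nm (g w - g z) < K * (e / (2 * K)) by rewrite ltr_pM2l.
have B' : nm (f w - f z) * K < (e / (2 * K)) * K by rewrite ltr_pM2r.
lra.
Qed.

Lemma ccont_neq0 f z : ccont f z -> f z != 0 ->
  exists2 dl : R, 0 < dl & forall w, nm (w - z) < dl -> nm (f z) / 2 < nm (f w).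
Proof.
rewrite -nm_gt0 => cf fz; have f2 : 0 < nm (f z) / 2 by rewrite divr_gt0.
have [dl dl0 H] := cf _ f2; exists dl => // w /H h.
by have := nm_sub (f z) (f w); rewrite nmBC; lra.
Qed.

Lemma ccontV f z : ccont f z -> f z != 0 -> ccont (fun w => (f w)^-1) z.
Proof.
move=> cf fz e e0; have [d0 d00 H0] := ccont_neq0 cf fz.
have fp : 0 < nm (f z) by rewrite nm_gt0.
have e1 : 0 < e * (nm (f z) ^+ 2 / 2) by rewrite !mulr_gt0// ?exprn_gt0.
have [d1 d10 H1] := cf _ e1.
exists (Num.min d0 d1) => [|w]; first by rewrite lt_min d00.
rewrite lt_min => /andP[/H0 h0 /H1 h1].
have fw : 0 < nm (f w) by apply: le_lt_trans h0; rewrite divr_ge0.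
have fw0 : f w != 0 by rewrite -nm_gt0.
have -> : (f w)^-1 - (f z)^-1 = (f z - f w) / (f w * f z) by field; rewrite fz.
rewrite !nmM nmV nmM nmBC ltr_pdivrMr ?mulr_gt0//.
apply: lt_le_trans h1 _; rewrite ler_pM2l//.
by rewrite expr2 mulrAC ler_pM2r// ltW.
Qed.

Lemma ccont_comp f g z : ccont g z -> ccont f (g z) -> ccont (fun w => f (g w)) z.
Proof.
move=> cg cf e /cf [d d0 /= H]; have [d1 d10 H1] := cg _ d0.
by exists d1 => // w /H1; exact: H.
Qed.

Lemma ccont_near f g z (r : R) : 0 < r -> (forall w, nm (w - z) < r -> f w = g w) ->
  ccont f z -> ccont g z.
Proof.
move=> r0 fg cf e /cf [d d0 H]; exists (Num.min r d) => [|w].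
  by rewrite lt_min r0.
have fgz : f z = g z by apply: fg; rewrite subrr nm0.
rewrite lt_min => /andP[h1 h2]; rewrite -(fg w)// -fgz; exact: H.
Qed.

(** Caratheodory's form of the derivative: the algebraic rules and the chain
    rule then reduce to the continuity of the slope function. *)
Definition cderiv f z d := exists phi : C -> C,
  [/\ forall w, f w = f z + phi w * (w - z), ccont phi z & phi z = d].

Lemma cderivP f z d : cderiv f z d <-> forall e : R, 0 < e ->
  exists2 dl : R, 0 < dl & forall w, nm (w - z) < dl ->
    nm (f w - f z - d * (w - z)) <= e * nm (w - z).
Proof.
split=> [[phi [E cphi <-]] e /cphi [dl dl0 H]|H].
  exists dl => // w /H /ltW h; rewrite E.
  have -> : f z + phi w * (w - z) - f z - phi z * (w - z) =
    (phi w - phi z) * (w - z) by ring.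
  by rewrite nmM ler_wpM2r.
exists (fun w => if w == z then d else (f w - f z) / (w - z)); split.
- move=> w; case: eqVneq => [->|wz]; first by rewrite subrr mulr0 addr0.
  by rewrite divfK ?subr_eq0// addrC subrK.
- move=> e e0; have e2 : 0 < e / 2 by rewrite divr_gt0.
  have [dl dl0 H1] := H _ e2; exists dl => // w /H1.
  rewrite eqxx; case: eqVneq => [->|wz]; first by rewrite [d - d]subrr nm0.
  have wz0 : w - z != 0 by rewrite subr_eq0.
  move=> h; have -> : (f w - f z) / (w - z) - d = (f w - f z - d * (w - z)) / (w - z).
    by field.
  rewrite nmM nmV ltr_pdivrMr ?nm_gt0//; apply: le_lt_trans h _.
  by rewrite ltr_pM2r ?nm_gt0//; lra.
- by rewrite eqxx.
Qed.

Lemma cderiv_cont f z d : cderiv f z d -> ccont f z.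
Proof.
move=> [phi [E cphi _]].
have : ccont (fun w => f z + phi w * (w - z)) z.
  apply: ccontD; first exact: ccont_cst.
  by apply: ccontM => //; apply: ccontB; [exact: ccont_id|exact: ccont_cst].
by apply: (ccont_near ltr01) => w _; rewrite -E.
Qed.

Lemma cderiv_near f g z d (r : R) : 0 < r ->
  (forall w, nm (w - z) < r -> f w = g w) -> cderiv f z d -> cderiv g z d.
Proof.
move=> r0 fg /cderivP H; apply/cderivP => e /H [dl dl0 {}H].
exists (Num.min r dl) => [|w]; first by rewrite lt_min r0.
have fgz : f z = g z by apply: fg; rewrite subrr nm0.
rewrite lt_min => /andP[h1 h2]; rewrite -(fg w)// -fgz; exact: H.
Qed.

Lemma cderiv_ext f g z d : f =1 g -> cderiv f z d -> cderiv g z d.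
Proof. by move=> fg; apply: (cderiv_near ltr01) => w _. Qed.

Lemma cderiv_uniq f z d d' : cderiv f z d -> cderiv f z d' -> d = d'.
Proof.
move=> /cderivP H /cderivP H'; apply/eqP; rewrite -subr_eq0; apply/eqP.
apply: eq0_le_eps => e e0; have e2 : 0 < e / 2 by rewrite divr_gt0.
have [r r0 {}H] := H _ e2; have [r' r'0 {}H'] := H' _ e2.
set s := Num.min r r' / 2.
have m0 : 0 < Num.min r r' by rewrite lt_min r0.
have s0 : 0 < s by rewrite divr_gt0.
have sC : nm (s%:C : C) = s by rewrite nmC_ge0// ltW.
have sm : s < Num.min r r' by rewrite /s; lra.
move: (sm); rewrite lt_min => /andP[sr sr'].
have E : z + s%:C - z = s%:C by rewrite addrC addKr.
have := H (z + s%:C); have := H' (z + s%:C).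
rewrite E sC => /(_ sr') h' /(_ sr) h.
have := nmB (f (z + s%:C) - f z - d' * s%:C) (f (z + s%:C) - f z - d * s%:C).
have -> : f (z + s%:C) - f z - d' * s%:C - (f (z + s%:C) - f z - d * s%:C) =
  (d - d') * s%:C by ring.
by rewrite nmM sC => h3; rewrite -(ler_pM2r s0); lra.
Qed.

Lemma cderiv_cst c z : cderiv (fun=> c) z 0.
Proof.
exists (fun=> 0); split=> // [w|]; first by rewrite mul0r addr0.
exact: ccont_cst.
Qed.

Lemma cderiv_id z : cderiv id z 1.
Proof.
exists (fun=> 1); split=> // [w|]; first by rewrite mul1r addrC subrK.
exact: ccont_cst.
Qed.

Lemma cderivD f g z d d' : cderiv f z d -> cderiv g z d' ->
  cderiv (fun w => f w + g w) z (d + d').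
Proof.
move=> [p [E cp <-]] [q [E' cq <-]]; exists (fun w => p w + q w); split=> //.
  by move=> w; rewrite (E w) (E' w); ring.
exact: ccontD.
Qed.

Lemma cderivM f g z d d' : cderiv f z d -> cderiv g z d' ->
  cderiv (fun w => f w * g w) z (d * g z + f z * d').
Proof.
move=> Df Dg; have cg := cderiv_cont Dg.
case: Df => [p [E cp <-]]; case: Dg => [q [E' cq <-]].
exists (fun w => p w * g w + f z * q w); split=> //.
  move=> w; transitivity ((f z + p w * (w - z)) * g w); first by rewrite -E.
  rewrite mulrDl {1}(E' w); ring.
apply: ccontD; first exact: ccontM.
by apply: ccontM => //; exact: ccont_cst.
Qed.

Lemma cderivN f z d : cderiv f z d -> cderiv (fun w => - f w) z (- d).
Proof.
move=> [p [E cp <-]]; exists (fun w => - p w); split=> //.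
  by move=> w; rewrite (E w); ring.
exact: ccontN.
Qed.

Lemma cderivB f g z d d' : cderiv f z d -> cderiv g z d' ->
  cderiv (fun w => f w - g w) z (d - d').
Proof. by move=> Df /cderivN; exact: cderivD. Qed.

Lemma cderivZ c f z d : cderiv f z d -> cderiv (fun w => c * f w) z (c * d).
Proof.
move=> Df; have := cderivM (cderiv_cst c z) Df.
by rewrite mul0r add0r.
Qed.

Lemma cderivV f z d : cderiv f z d -> f z != 0 ->
  cderiv (fun w => (f w)^-1) z (- d / f z ^+ 2).
Proof.
move=> Df fz; have cf := cderiv_cont Df; have [r r0 H] := ccont_neq0 cf fz.
case: Df => p [E cp <-].
have fw0 w : nm (w - z) < r -> f w != 0.
  by move=> /H; rewrite -nm_gt0; apply: le_lt_trans; rewrite divr_ge0.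
have cV : ccont (fun w => - p w / (f w * f z)) z.
  apply: ccontM; first exact: ccontN.
  apply: ccontV; last by rewrite mulf_neq0.
  by apply: ccontM => //; exact: ccont_cst.
suff : cderiv (fun w => (f z)^-1 + (- p w / (f w * f z)) * (w - z)) z (- p z / f z ^+ 2).
  apply: (cderiv_near r0) => w /fw0 fw.
  have Ep : p w * (w - z) = f w - f z by rewrite (E w) addrAC subrr add0r.
  by rewrite mulrAC mulNr Ep; field; rewrite fw fz.
exists (fun w => - p w / (f w * f z)); split=> //.
by move=> w; rewrite subrr mulr0 addr0.
Qed.

Lemma cderiv_comp f g z d d' : cderiv g z d -> cderiv f (g z) d' ->
  cderiv (fun w => f (g w)) z (d' * d).
Proof.
move=> Dg; have cg := cderiv_cont Dg; case: Dg => p [E cp <-] [q [E' cq <-]].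
exists (fun w => q (g w) * p w); split=> //.
  move=> w; rewrite (E' (g w)) {2}(E w); ring.
by apply: ccontM => //; exact: ccont_comp.
Qed.

Lemma cderiv_affine a b z : cderiv (fun t => a + t * b) z b.
Proof.
exists (fun=> b); split=> // [w|]; first ring.
exact: ccont_cst.
Qed.

Lemma cderiv_line f a b t d : cderiv f (a + t * b) d ->
  cderiv (fun s => f (a + s * b)) t (d * b).
Proof. exact: cderiv_comp (cderiv_affine a b t). Qed.
End Continuity.

(** * Integrals along segments *)

Section Curves.
Variable R : realType.
Local Notation C := R[i].
Local Notation mu := (@lebesgue_measure R).

Lemma cont_eps (u : R -> R) t :
  (forall e : R, 0 < e -> exists2 dl : R, 0 < dl &
    forall s, `|s - t| < dl -> `|u s - u t| < e) -> {for t, continuous u}.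
Proof.
move=> H; apply/cvgrPdist_lt => e /H [dl dl0 {}H]; apply/nbhs_ballP.
by exists dl => // s /=; rewrite /ball /= distrC => /H; rewrite distrC.
Qed.

Lemma is_derive_eps (u : R -> R) t c :
  (forall e : R, 0 < e -> exists2 dl : R, 0 < dl &
    forall s, `|s| < dl -> `|u (t + s) - u t - c * s| <= e * `|s|) ->
  is_derive t (1 : R) u c.
Proof.
move=> H.
have cv : (fun h : R => h^-1 *: (u (h *: 1 + t) - u t)) @ 0^' --> c.
  apply/cvgrPdist_le => e /H [dl dl0 {}H]; near=> h.
  have h0 : h != 0 by near: h; exact: nbhs_dnbhs_neq.
  have hd : `|h| < dl by near: h; exact: dnbhs0_lt.
  rewrite [h *: 1](_ : _ = h); last by rewrite /GRing.scale /= mulr1.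
  have := H _ hd; rewrite (addrC t) => {}H'.
  have -> : c - h^-1 *: (u (h + t) - u t) = - (h^-1 * (u (h + t) - u t - c * h)).
    by rewrite /GRing.scale /=; field.
  by rewrite normrN normrM normfV mulrC ler_pdivrMr ?normr_gt0.
by split; [exact: (cvgP _ cv)|exact: cvg_lim].
Unshelve. all: by end_near. Qed.

Definition rderiv (g : R -> C) (t : R) (d : C) :=
  is_derive t (1 : R) (fun s => Re (g s)) (Re d) /\
  is_derive t (1 : R) (fun s => Im (g s)) (Im d).

Lemma rderiv_eps (g : R -> C) t d :
  (forall e : R, 0 < e -> exists2 dl : R, 0 < dl &
    forall s, `|s| < dl -> nm (g (t + s) - g t - d * s%:C) <= e * `|s|) ->
  rderiv g t d.
Proof.
move=> H; split; apply: is_derive_eps => e /H [dl dl0 {}H];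
  exists dl => // s /H h; apply: le_trans h.
- apply: le_trans (nm_Re _); rewrite !ReD !ReN ReM /= mulr0 subr0 //.
- apply: le_trans (nm_Im _); rewrite !ImD !ImN ImM /= mulr0 add0r //.
Qed.

Lemma rderiv_line (f : C -> C) a b t d :
  cderiv f (a + t%:C * b) d -> rderiv (fun s => f (a + s%:C * b)) t (d * b).
Proof.
move=> /cderiv_line/cderivP H; apply: rderiv_eps => e /H [dl dl0 {}H].
exists dl => // s sd; have := H (t + s)%:C.
have -> : (t + s)%:C - t%:C = s%:C :> C by rewrite -rmorphB /= addrC addKr.
by rewrite nmR => /(_ sd).
Qed.

Lemma rderiv_ext g h t d : g =1 h -> rderiv g t d -> rderiv h t d.
Proof. by move=> /funext ->. Qed.

Lemma rderivD g h t d d' : rderiv g t d -> rderiv h t d' ->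
  rderiv (fun s => g s + h s) t (d + d').
Proof.
move=> [g1 g2] [h1 h2]; split.
- rewrite (_ : (fun s => _) = (fun s => Re (g s)) + (fun s => Re (h s))).
    by rewrite ReD; exact: is_deriveD.
  by apply/funext => s; rewrite ReD.
- rewrite (_ : (fun s => _) = (fun s => Im (g s)) + (fun s => Im (h s))).
    by rewrite ImD; exact: is_deriveD.
  by apply/funext => s; rewrite ImD.
Qed.

Lemma rderivZ c g t d : rderiv g t d -> rderiv (fun s => c * g s) t (c * d).
Proof.
move=> [g1 g2]; split.
- rewrite (_ : (fun s => _) = (Re c *: (fun s => Re (g s))) - (Im c *: (fun s => Im (g s)))).
    by rewrite ReM; apply: is_deriveB; exact: is_deriveZ.
  by apply/funext => s; rewrite ReM.
- rewrite (_ : (fun s => _) = (Re c *: (fun s => Im (g s))) + (Im c *: (fun s => Re (g s)))).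
    by rewrite ImM; apply: is_deriveD; exact: is_deriveZ.
  by apply/funext => s; rewrite ImM.
Qed.

Lemma rderivB g h t d d' : rderiv g t d -> rderiv h t d' ->
  rderiv (fun s => g s - h s) t (d - d').
Proof.
move=> Dg /(rderivZ (-1)) Dh; rewrite -(mulN1r d').
by apply: rderiv_ext (rderivD Dg Dh) => s; rewrite mulN1r.
Qed.

Lemma rderiv_reparam g (p q t : R) d : rderiv g (p + q * t) d ->
  rderiv (fun s => g (p + q * s)) t (d * q%:C).
Proof.
have D : is_derive t (1 : R) (fun s : R => p + q * s) q.
  apply: is_derive_eps => e e0; exists 1 => // s _.
  have -> : p + q * (t + s) - (p + q * t) - q * s = 0 by ring.
  by rewrite normr0; apply: mulr_ge0 => //; exact: ltW.
move=> [g1 g2]; split.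
- rewrite ReM /= mulr0 subr0.
  apply: (@is_derive1_comp _ (fun s => Re (g s)) (fun s : R => p + q * s) t).
- rewrite ImM /= mulr0 add0r.
  apply: (@is_derive1_comp _ (fun s => Im (g s)) (fun s : R => p + q * s) t).
Qed.

Lemma rderiv_mv g d (M : R) : (forall t : R, 0 <= t <= 1 -> rderiv g t (d t)) ->
  (forall t : R, 0 <= t <= 1 -> nm (d t) <= M) -> nm (g 1 - g 0) <= M.
Proof.
move=> Dg dM; have [c c1 cE] := unimod (g 1 - g 0).
pose u s := Re (c * g s).
have Du (t : R) : 0 <= t <= 1 -> is_derive t (1 : R) u (Re (c * d t)).
  by move=> /Dg /(rderivZ c) [].
have cu : {within `[0, 1], continuous u}.
  apply: derivable_within_continuous => x; rewrite in_itv /= => xI.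
  by have [] := Du x xI.
have Du' (x : R) : x \in `]0, 1[%R -> is_derive x (1 : R) u (Re (c * d x)).
  by rewrite in_itv /= => /andP[x0 x1]; apply: Du; rewrite !ltW.
have [x] := MVT ltr01 Du' cu; rewrite in_itv /= => /andP[x0 x1] E.
have -> : nm (g 1 - g 0) = Re (c * d x).
  rewrite -[LHS]/(Re (nm (g 1 - g 0))%:C) -cE mulrBr ReD ReN.
  by rewrite -/(u 1) -/(u 0) E subr0 mulr1.
apply: le_trans (Re_le_nm _) _; rewrite nmM c1 mul1r; apply: dM.
by rewrite !ltW.
Qed.

Lemma rderiv_diff g h d : (forall t : R, 0 <= t <= 1 -> rderiv g t (d t)) ->
  (forall t : R, 0 <= t <= 1 -> rderiv h t (d t)) -> g 1 - g 0 = h 1 - h 0.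
Proof.
move=> Dg Dh; apply/eqP; rewrite -subr_eq0 -nm_eq0 -[_ == 0]andbT.
rewrite eq_le nm_ge0 !andbT.
have -> : g 1 - g 0 - (h 1 - h 0) = (g 1 - h 1) - (g 0 - h 0) by ring.
apply: (@rderiv_mv (fun s => g s - h s) (fun t => d t - d t)) => t t01.
  by apply: rderivB; [exact: Dg|exact: Dh].
by rewrite subrr nm0.
Qed.

Definition primR (u : R -> R) (t : R) : R := (\int[mu]_(x in `[-1, t]) u x)%R.

Lemma primRP (u : R -> R) (t : R) : continuous u -> -1 < t -> is_derive t (1 : R) (primR u) (u t).
Proof.
move=> cu t1; have tt : t < t + 1 by rewrite ltrDl.
have iu : mu.-integrable `[-1, t + 1] (EFin \o u).
  apply: continuous_compact_integrable; first exact: segment_compact.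
  exact: continuous_subspaceT.
have [D E] := continuous_FTC1_closed tt iu t1 (cu t).
split; first exact: D.
by rewrite -derive1E; exact: E.
Qed.

Definition clamp (t : R) : R := Num.max 0 (Num.min 1 t).

Lemma clamp_id t : 0 <= t <= 1 -> clamp t = t.
Proof. by move=> /andP[t0 t1]; rewrite /clamp min_r// max_r. Qed.

Lemma clamp01 t : 0 <= clamp t <= 1.
Proof. by rewrite /clamp le_max lexx /= ge_max ler01 ge_min lexx. Qed.

Lemma clampP t : [\/ t <= 0 /\ clamp t = 0, 0 <= t <= 1 /\ clamp t = t |
  1 <= t /\ clamp t = 1].
Proof.
have [t0|t0] := leP t 0.
  by apply: Or31; split=> //; rewrite /clamp min_r ?max_l// (le_trans t0).
have [t1|t1] := leP t 1.
  by apply: Or32; rewrite clamp_id ?(ltW t0) ?t1.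
by apply: Or33; rewrite /clamp min_l ?max_r ?ltW ?ltr01.
Qed.

Lemma clamp_lip s t : `|clamp s - clamp t| <= `|s - t|.
Proof.
have A := ler_norm (s - t); have B := ler_norm (- (s - t)).
rewrite normrN in B; rewrite ler_norml.
case: (clampP s) => -[sP ->]; case: (clampP t) => -[tP ->]; apply/andP; lra.
Qed.

Definition seg (a b : C) (t : R) : C := a + t%:C * (b - a).

Lemma seg0 a b : seg a b 0 = a. Proof. by rewrite /seg mul0r addr0. Qed.
Lemma seg1 a b : seg a b 1 = b. Proof. by rewrite /seg mul1r addrC subrK. Qed.

Definition cseg (f : C -> C) a b := forall t : R, 0 <= t <= 1 -> ccont f (seg a b t).

Definition I01 (g : R -> C) : C :=
  (primR (fun t => Re (g (clamp t))) 1 - primR (fun t => Re (g (clamp t))) 0) +i*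
  (primR (fun t => Im (g (clamp t))) 1 - primR (fun t => Im (g (clamp t))) 0).

(** The integral of [f] along the segment from [a] to [b]. *)
Definition J f a b : C := (b - a) * I01 (fun t => f (seg a b t)).

Lemma cseg_cont f a b : cseg f a b -> forall e t : R, 0 < e ->
  exists2 dl : R, 0 < dl & forall s, `|s - t| < dl ->
    nm (f (seg a b (clamp s)) - f (seg a b (clamp t))) < e.
Proof.
move=> cf e t /(cf _ (clamp01 t)) [dl dl0 H].
have K0 : 0 < nm (b - a) + 1 by rewrite ltr_wpDl.
exists (dl / (nm (b - a) + 1)) => [|s]; first by rewrite divr_gt0.
rewrite ltr_pdivlMr// => sd; apply: H.
have -> : seg a b (clamp s) - seg a b (clamp t) =
  (clamp s - clamp t)%:C * (b - a) by rewrite /seg rmorphB /=; ring.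
rewrite nmM nmR; apply: le_lt_trans sd.
by apply: ler_pM => //; [exact: clamp_lip|rewrite lerDl].
Qed.

Lemma J_ex f a b : cseg f a b -> exists2 g : R -> C,
  (forall t : R, 0 <= t <= 1 -> rderiv g t (f (seg a b t) * (b - a))) &
  J f a b = g 1 - g 0.
Proof.
move=> cf; pose h t := f (seg a b (clamp t)).
have cR : continuous (fun t => Re (h t)).
  move=> t; apply: cont_eps => e /(cseg_cont cf t) [dl dl0 H].
  exists dl => // s /H; apply: le_lt_trans.
  by apply: le_trans (nm_Re _); rewrite ReD ReN.
have cI : continuous (fun t => Im (h t)).
  move=> t; apply: cont_eps => e /(cseg_cont cf t) [dl dl0 H].
  exists dl => // s /H; apply: le_lt_trans.
  by apply: le_trans (nm_Im _); rewrite ImD ImN.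
exists (fun t => (b - a) * (primR (fun t => Re (h t)) t +i* primR (fun t => Im (h t)) t)).
  move=> t t01; rewrite mulrC; apply: rderivZ.
  have t1 : -1 < t by move: t01 => /andP[t0 _]; apply: lt_le_trans t0; rewrite oppr_lt0.
  have -> : f (seg a b t) = h t by rewrite /h clamp_id.
  by split; [exact: (primRP cR t1)|exact: (primRP cI t1)].
rewrite /J -mulrBr; congr (_ * _); apply: eqC; rewrite ?ReD ?ReN ?ImD ?ImN//.
Qed.

Lemma J_prim f a b g : cseg f a b ->
  (forall t : R, 0 <= t <= 1 -> rderiv g t (f (seg a b t) * (b - a))) ->
  J f a b = g 1 - g 0.
Proof. by move=> /J_ex [h Dh ->] Dg; exact: rderiv_diff Dh Dg. Qed.

Lemma J_FTC f F a b : cseg f a b ->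
  (forall t : R, 0 <= t <= 1 -> cderiv F (seg a b t) (f (seg a b t))) ->
  J f a b = F b - F a.
Proof.
move=> cf DF; rewrite (@J_prim f a b (fun t => F (seg a b t)))// ?seg0 ?seg1//.
by move=> t /DF; exact: rderiv_line.
Qed.

Lemma J_bound f a b (M : R) : cseg f a b ->
  (forall t : R, 0 <= t <= 1 -> nm (f (seg a b t)) <= M) ->
  nm (J f a b) <= nm (b - a) * M.
Proof.
move=> /J_ex [g Dg ->] fM; apply: rderiv_mv Dg _ => t /fM h.
by rewrite nmM mulrC ler_wpM2l.
Qed.

Lemma J_ext f g a b : cseg f a b ->
  (forall t : R, 0 <= t <= 1 -> f (seg a b t) = g (seg a b t)) -> cseg g a b ->
  J f a b = J g a b.
Proof.
move=> /J_ex [h Dh ->] fg cg; apply/esym/J_prim => // t t01; rewrite -fg//.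
exact: Dh.
Qed.

Lemma csegD f g a b : cseg f a b -> cseg g a b -> cseg (fun z => f z + g z) a b.
Proof. by move=> cf cg t t01; apply: ccontD; [exact: cf|exact: cg]. Qed.

Lemma csegZ c f a b : cseg f a b -> cseg (fun z => c * f z) a b.
Proof. by move=> cf t t01; apply: ccontM; [exact: ccont_cst|exact: cf]. Qed.

Lemma JD f g a b : cseg f a b -> cseg g a b ->
  J (fun z => f z + g z) a b = J f a b + J g a b.
Proof.
move=> cf cg; have [h Dh ->] := J_ex cf; have [k Dk ->] := J_ex cg.
rewrite (@J_prim _ a b (fun t => h t + k t)); first ring; first exact: csegD.
by move=> t t01; rewrite mulrDl; apply: rderivD; [exact: Dh|exact: Dk].
Qed.

Lemma JZ c f a b : cseg f a b -> J (fun z => c * f z) a b = c * J f a b.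
Proof.
move=> cf; have [h Dh ->] := J_ex cf.
rewrite (@J_prim _ a b (fun t => c * h t)) ?mulrBr//; first exact: csegZ.
by move=> t t01; rewrite -mulrA; apply: rderivZ; exact: Dh.
Qed.

Lemma seg_rev a b t : seg b a t = seg a b (1 - t).
Proof. by rewrite /seg rmorphB rmorph1; ring. Qed.

Lemma J_rev f a b : cseg f a b -> J f b a = - J f a b.
Proof.
move=> cf; have [h Dh ->] := J_ex cf.
have r01 (t : R) : 0 <= t <= 1 -> 0 <= 1 - t <= 1 by lra.
have cf' : cseg f b a by move=> t /r01 t01; rewrite seg_rev; exact: cf.
rewrite (@J_prim _ b a (fun t => h (1 + (-1) * t)))//.
  by rewrite mulr0 addr0 mulr1 subrr opprB.
move=> t /r01 t01; have E : 1 - t = 1 + (-1) * t by ring.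
have -> : f (seg b a t) * (a - b) = f (seg a b (1 + -1 * t)) * (b - a) * (-1)%:C.
  by rewrite -E -seg_rev rmorphN rmorph1; ring.
by apply: rderiv_reparam; apply: Dh; rewrite -E.
Qed.

Lemma J_split f a b (s : R) : 0 <= s <= 1 -> cseg f a b ->
  J f a b = J f a (seg a b s) + J f (seg a b s) b.
Proof.
move=> s01 cf; have [h Dh ->] := J_ex cf.
have E1 t : seg a (seg a b s) t = seg a b (0 + s * t).
  by rewrite /seg add0r rmorphM /=; ring.
have E2 t : seg (seg a b s) b t = seg a b (s + (1 - s) * t).
  by rewrite /seg rmorphD rmorphM rmorphB rmorph1 /=; ring.
have r1 (t : R) : 0 <= t <= 1 -> 0 <= 0 + s * t <= 1 by nra.
have r2 (t : R) : 0 <= t <= 1 -> 0 <= s + (1 - s) * t <= 1 by nra.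
rewrite (@J_prim _ a (seg a b s) (fun t => h (0 + s * t))); first last.
- move=> t t01; rewrite E1.
  have -> : f (seg a b (0 + s * t)) * (seg a b s - a) =
    f (seg a b (0 + s * t)) * (b - a) * s%:C by rewrite /seg; ring.
  by apply: rderiv_reparam; apply: Dh; exact: r1.
- by move=> t t01; rewrite E1; apply: cf; exact: r1.
rewrite (@J_prim _ (seg a b s) b (fun t => h (s + (1 - s) * t))); first last.
- move=> t t01; rewrite E2.
  have -> : f (seg a b (s + (1 - s) * t)) * (b - seg a b s) =
    f (seg a b (s + (1 - s) * t)) * (b - a) * (1 - s)%:C.
    by rewrite /seg rmorphB rmorph1; ring.
  by apply: rderiv_reparam; apply: Dh; exact: r2.
- by move=> t t01; rewrite E2; apply: cf; exact: r2.
by rewrite !mulr0 !mulr1 !add0r addr0 (addrC s) subrK; ring.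
Qed.
End Curves.

(** * Theorems of Goursat and Morera *)

Section Goursat.
Variable R : realType.
Local Notation C := R[i].
Implicit Types (f g : C -> C) (a b c z w : C).

Lemma nested_point (x y : nat -> R) : (forall n m, x n <= y m) ->
  exists l, forall n, x n <= l <= y n.
Proof.
move=> xy; pose S := [set x n | n in [set: nat]].
have S0 : S !=set0 by exists (x 0%N); exists 0%N.
have uS n : ubound S (y n) by move=> _ [m _ <-].
have hS : has_sup S by split=> //; exists (y 0%N).
exists (sup S) => n; apply/andP; split; last exact: ge_sup.
by apply: sup_upper_bound => //; exists n.
Qed.

Lemma half_small (D e : R) : 0 < e -> exists n : nat, D * (2^-1) ^+ n < e.
Proof.
move=> e0.
have [n nD] : exists n : nat, D / e < n%:R.
  exists (Num.bound `|D / e|).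
  exact: le_lt_trans (ler_norm _) (archi_boundP (normr_ge0 _)).
exists n; rewrite exprVn ltr_pdivrMr ?exprn_gt0// mulrC -ltr_pdivrMr//.
apply: lt_le_trans nD _.
by rewrite -natrX ler_nat ltnW// ltn_expl.
Qed.

Lemma real_half_limit (u : nat -> R) (D : R) :
  (forall n, `|u n.+1 - u n| <= D * (2^-1) ^+ n) ->
  exists l, forall n, `|l - u n| <= 2 * D * (2^-1) ^+ n.
Proof.
move=> H; pose q n : R := (2^-1) ^+ n.
have qS n : q n.+1 = q n / 2 by rewrite /q exprSr.
have q0 n : 0 <= q n by rewrite exprn_ge0// invr_ge0.
have D0 : 0 <= D by have := H 0%N; rewrite expr0 mulr1; apply: le_trans.
have up n k : u n - 2 * D * q n <= u (n + k)%N - 2 * D * q (n + k)%N.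
  elim: k => [|k IH]; rewrite ?addn0// addnS; apply: le_trans IH _.
  by have := H (n + k)%N; rewrite -/(q _) qS ler_norml => /andP[]; lra.
have dn n k : u (n + k)%N + 2 * D * q (n + k)%N <= u n + 2 * D * q n.
  elim: k => [|k IH]; rewrite ?addn0// addnS; apply: le_trans _ IH.
  by have := H (n + k)%N; rewrite -/(q _) qS ler_norml => /andP[]; lra.
have [|l lP] := @nested_point (fun n => u n - 2 * D * q n) (fun n => u n + 2 * D * q n).
  move=> n m; have := up n m; have := dn m n; rewrite (addnC m).
  have := mulr_ge0 (mulr_ge0 (ler0n R 2) D0) (q0 (n + m)%N); lra.
by exists l => n; have := lP n; rewrite -/(q n) ler_norml => /andP[]; lra.
Qed.

Lemma cplx_half_limit (u : nat -> C) (D : R) :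
  (forall n, nm (u n.+1 - u n) <= D * (2^-1) ^+ n) ->
  exists l, forall n, nm (l - u n) <= 4 * D * (2^-1) ^+ n.
Proof.
move=> H.
have [|x xP] := @real_half_limit (fun n => Re (u n)) D.
  by move=> n; apply: le_trans (H n); rewrite -ReN -ReD; exact: nm_Re.
have [|y yP] := @real_half_limit (fun n => Im (u n)) D.
  by move=> n; apply: le_trans (H n); rewrite -ImN -ImD; exact: nm_Im.
exists (x +i* y) => n; apply: le_trans (nm_le _) _.
have := xP n; have := yP n; rewrite ReD ImD ReN ImN /=.
set q := _ ^+ n; lra.
Qed.

Definition hol (r : R) f := forall z, nm z < r -> exists d, cderiv f z d.

Lemma hol_cont r f : hol r f -> forall z, nm z < r -> ccont f z.
Proof. by move=> fh z /fh [d]; exact: cderiv_cont. Qed.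

Lemma nm_seg a b (s t : R) : nm a <= s -> nm b <= s -> 0 <= t <= 1 ->
  nm (seg a b t) <= s.
Proof.
move=> as_ bs /andP[t0 t1].
have -> : seg a b t = (1 - t)%:C * a + t%:C * b.
  by rewrite /seg rmorphB rmorph1; ring.
apply: le_trans (nmD _ _) _; rewrite !nmM !nmC_ge0 ?subr_ge0//.
have A : (1 - t) * nm a <= (1 - t) * s by rewrite ler_wpM2l ?subr_ge0.
have B : t * nm b <= t * s by rewrite ler_wpM2l.
lra.
Qed.

Lemma nm_segB a b p (s t : R) : nm (a - p) <= s -> nm (b - p) <= s -> 0 <= t <= 1 ->
  nm (seg a b t - p) <= s.
Proof.
move=> as_ bs t01.
by have -> : seg a b t - p = seg (a - p) (b - p) t; [rewrite /seg; ring|exact: nm_seg].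
Qed.

Definition T f a b c := J f a b + J f b c + J f c a.

Definition mid a b := seg a b 2^-1.

Lemma midE a b : mid a b = (a + b) / 2.
Proof. by rewrite /mid /seg fmorphV rmorph_nat; field. Qed.

Lemma half01 : 0 <= (2^-1 : R) <= 1.
Proof. by rewrite invr_ge0 ler0n/= invf_le1// ler1n. Qed.

Section OnDisc.
Variables (f : C -> C) (s : R).
Hypothesis cf : forall z, nm z <= s -> ccont f z.

Lemma disc_cseg a b : nm a <= s -> nm b <= s -> cseg f a b.
Proof. by move=> as_ bs t t01; apply: cf; exact: nm_seg. Qed.

Lemma nm_mid a b : nm a <= s -> nm b <= s -> nm (mid a b) <= s.
Proof. by move=> as_ bs; apply: nm_seg => //; exact: half01. Qed.

Lemma J_mid a b : nm a <= s -> nm b <= s -> J f a b = J f a (mid a b) + J f (mid a b) b.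
Proof. by move=> as_ bs; apply: J_split; [exact: half01|exact: disc_cseg]. Qed.

Lemma T_subdiv a b c : nm a <= s -> nm b <= s -> nm c <= s ->
  T f a b c = T f a (mid a b) (mid c a) + T f (mid a b) b (mid b c) +
    T f (mid c a) (mid b c) c + T f (mid a b) (mid b c) (mid c a).
Proof.
move=> as_ bs cs.
have m1 := nm_mid as_ bs; have m2 := nm_mid bs cs; have m3 := nm_mid cs as_.
rewrite /T (J_mid as_ bs) (J_mid bs cs) (J_mid cs as_).
rewrite (J_rev (disc_cseg m1 m2)) (J_rev (disc_cseg m2 m3)) (J_rev (disc_cseg m3 m1)).
ring.
Qed.
End OnDisc.

Definition tri : Type := (C * C * C)%type.
Definition okT (s D : R) (t : tri) := let: (a, b, c) := t in
  [/\ nm a <= s, nm b <= s & nm c <= s] /\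
  [/\ nm (b - a) <= D, nm (c - b) <= D & nm (a - c) <= D].
Definition TT f (t : tri) := let: (a, b, c) := t in T f a b c.
Definition fstT (t : tri) := let: (a, b, c) := t in a.

Lemma T_step f (s D : R) t : (forall z, nm z <= s -> ccont f z) -> okT s D t ->
  exists t', [/\ okT s (D / 2) t', nm (TT f t) <= 4 * nm (TT f t') &
    nm (fstT t' - fstT t) <= D].
Proof.
case: t => [[a b] c] cf [[as_ bs cs] [ab bc ca]] /=.
have D0 : 0 <= D by apply: le_trans ab.
have m1 := nm_mid as_ bs; have m2 := nm_mid bs cs; have m3 := nm_mid cs as_.
have h2 x y : nm (x - y) <= D -> nm ((x - y) / 2) <= D / 2.
  by move=> xy; rewrite nmM nmV nm_natr ler_pM2r// invr_gt0.
have ab' : nm (a - b) <= D by rewrite nmBC.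
have bc' : nm (b - c) <= D by rewrite nmBC.
have ca' : nm (c - a) <= D by rewrite nmBC.
have D2 : D / 2 <= D by lra.
have e1 : mid a b - a = (b - a) / 2 by rewrite midE; field.
have e2 : mid c a - mid a b = (c - b) / 2 by rewrite !midE; field.
have e3 : a - mid c a = (a - c) / 2 by rewrite midE; field.
have e4 : b - mid a b = (b - a) / 2 by rewrite midE; field.
have e5 : mid b c - b = (c - b) / 2 by rewrite midE; field.
have e6 : mid a b - mid b c = (a - c) / 2 by rewrite !midE; field.
have e7 : mid b c - mid c a = (b - a) / 2 by rewrite !midE; field.
have e8 : c - mid b c = (c - b) / 2 by rewrite midE; field.
have e9 : mid c a - c = (a - c) / 2 by rewrite midE; field.
have f1 : mid b c - mid a b = (c - a) / 2 by rewrite !midE; field.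
have f2 : mid c a - mid b c = (a - b) / 2 by rewrite !midE; field.
have f3 : mid a b - mid c a = (b - c) / 2 by rewrite !midE; field.
have f4 : mid c a - a = (c - a) / 2 by rewrite midE; field.
rewrite (T_subdiv cf as_ bs cs).
set T1 := T f a _ _; set T2 := T f _ b _; set T3 := T f _ _ c; set T4 := T f _ _ (mid c a).
have tr : nm (T1 + T2 + T3 + T4) <= nm T1 + nm T2 + nm T3 + nm T4.
  have := nmD (T1 + T2 + T3) T4; have := nmD (T1 + T2) T3; have := nmD T1 T2; lra.
have [H1|H1] := leP (nm (T1 + T2 + T3 + T4)) (4 * nm T1).
  exists (a, mid a b, mid c a) => /=; split=> //; last by rewrite subrr nm0.
  by split; split=> //; rewrite ?e1 ?e2 ?e3; apply: h2.
have [H2|H2] := leP (nm (T1 + T2 + T3 + T4)) (4 * nm T2).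
  exists (mid a b, b, mid b c) => /=; split=> //; last by rewrite e1 (le_trans (h2 _ _ ab)).
  by split; split=> //; rewrite ?e4 ?e5 ?e6; apply: h2.
have [H3|H3] := leP (nm (T1 + T2 + T3 + T4)) (4 * nm T3).
  exists (mid c a, mid b c, c) => /=; split=> //; last by rewrite f4 (le_trans (h2 _ _ ca')).
  by split; split=> //; rewrite ?e7 ?e8 ?e9; apply: h2.
exists (mid a b, mid b c, mid c a) => /=; split.
- by split; split=> //; rewrite ?f1 ?f2 ?f3; apply: h2.
- by rewrite -/T4; lra.
- by rewrite e1 (le_trans (h2 _ _ ab)).
Qed.

(** Goursat: in a nested sequence of triangles with shrinking diameters the
    affine approximation at the limit point makes the integral negligible
    compared with the square of the diameter. *)
Theorem goursat (r s : R) f a b c : hol r f -> s < r ->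
  nm a <= s -> nm b <= s -> nm c <= s -> T f a b c = 0.
Proof.
move=> fh sr as_ bs cs.
have cf z : nm z <= s -> ccont f z.
  by move=> zs; apply: (hol_cont fh); apply: le_lt_trans sr.
pose D : R := nm (b - a) + nm (c - b) + nm (a - c).
have D0 : 0 <= D by rewrite /D !addr_ge0.
pose rel (x y : nat * tri) := y.1 = x.1.+1 /\ (okT s (D * (2^-1) ^+ x.1) x.2 ->
  [/\ okT s (D * (2^-1) ^+ y.1) y.2, nm (TT f x.2) <= 4 * nm (TT f y.2) &
      nm (fstT y.2 - fstT x.2) <= D * (2^-1) ^+ x.1]).
have stepr x : {y | rel x y}.
  apply/cid; case: x => n t; have [ok|nok] := pselect (okT s (D * (2^-1) ^+ n) t).
    have [t' [ok' h1 h2]] := T_step cf ok; exists (n.+1, t'); split=> //= _; split=> //.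
    by rewrite exprSr mulrA.
  by exists (n.+1, t); split.
have [u [u0 uS]] := dependent_choice stepr (0%N, (a, b, c)).
have un n : (u n).1 = n by elim: n => [|n IH]; [rewrite u0|rewrite (uS n).1 IH].
have uok n : okT s (D * (2^-1) ^+ n) (u n).2.
  elim: n => [|n IH].
    rewrite u0 /= expr0 mulr1; split; split=> //; rewrite /D;
    have := nm_ge0 (b - a); have := nm_ge0 (c - b); have := nm_ge0 (a - c); lra.
  by have [_] := uS n; rewrite un => /(_ IH) []; rewrite un.
have uT n : nm (T f a b c) <= 4 ^+ n * nm (TT f (u n).2).
  elim: n => [|n IH]; first by rewrite u0 expr0 mul1r.
  apply: le_trans IH _; rewrite exprSr -mulrA ler_pM2l ?exprn_gt0//.
  by have [_] := uS n; rewrite un => /(_ (uok n)) [].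
have ud n : nm (fstT (u n.+1).2 - fstT (u n).2) <= D * (2^-1) ^+ n.
  by have [_] := uS n; rewrite un => /(_ (uok n)) [].
have [p pP] := cplx_half_limit ud.
have ps : nm p <= s.
  apply/ler_addgt0Pr => e e0; have [n nP] := half_small (4 * D) e0.
  have A : nm (fstT (u n).2) <= s by have := uok n; case: (u n).2 => [[x y] z] [[]].
  by have := pP n; have := nm_sub p (fstT (u n).2); lra.
have [d /cderivP fd] := fh _ (le_lt_trans ps sr).
apply: eq0_le_eps => e e0; have e' : 0 < e / (15 * (D ^+ 2 + 1)).
  by rewrite divr_gt0// mulr_gt0// ltr_wpDl// sqr_ge0.
have [dl dl0 {}fd] := fd _ e'.
have [n nP] := half_small (5 * D) dl0.
have := uT n; have := pP n; have := uok n.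
set q := D * (2^-1) ^+ n.
have -> : 4 * D * 2^-1 ^+ n = 4 * q by rewrite -mulrA.
have nP' : 5 * q < dl by rewrite mulrA.
have q0 : 0 <= q by rewrite mulr_ge0// exprn_ge0// invr_ge0.
case: (u n).2 => [[x y] z] [[xs ys zs] [xy yz zx]] /= px Tn.
have xp : nm (x - p) <= 5 * q by rewrite nmBC; lra.
have yp : nm (y - p) <= 5 * q by have := nm_tri y x p; rewrite (nmBC x p); lra.
have zp : nm (z - p) <= 5 * q.
  by have := nm_tri z x p; rewrite (nmBC x p) (nmBC z x); lra.
pose A w := f p + d * (w - p); pose P w := f p * w + d * ((w - p) * (w - p) / 2).
have DP w : cderiv P w (A w).
  have H0 : cderiv (fun w => w - p) w (1 - 0) by apply: cderivB; [exact: cderiv_id|exact: cderiv_cst].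
  have H1 := cderivZ d (cderivM (cderivM H0 H0) (cderiv_cst (2^-1) w)).
  have H2 := cderivD (cderivZ (f p) (cderiv_id w)) H1.
  rewrite /P; have -> : A w = f p * 1 + d * (((1 - 0) * (w - p) + (w - p) * (1 - 0)) / 2 +
    (w - p) * (w - p) * 0) by rewrite /A; field.
  exact: H2.
have cA w : ccont A w.
  rewrite /A; apply: ccontD; first exact: ccont_cst.
  apply: ccontM; first exact: ccont_cst.
  by apply: ccontB; [exact: ccont_id|exact: ccont_cst].
have JA v w : J A v w = P w - P v by apply: J_FTC => t t01; [exact: cA|exact: DP].
pose g w := f w - A w.
have Jg v w : nm v <= s -> nm w <= s -> nm (v - p) <= 5 * q -> nm (w - p) <= 5 * q ->
    nm (w - v) <= q ->
    nm (J f v w - (P w - P v)) <= q * (e / (15 * (D ^+ 2 + 1)) * (5 * q)).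
  move=> vs ws vp wp vw.
  have cg : cseg g v w.
    by move=> t t01; apply: ccontB; [exact: (disc_cseg cf)|exact: cA].
  have -> : J f v w - (P w - P v) = J g v w.
    have cA' : cseg A v w by move=> t _; exact: cA.
    suff -> : J f v w = J g v w + J A v w by rewrite JA addrK.
    rewrite -JD//; apply: J_ext; [exact: (disc_cseg cf)| |exact: csegD].
    by move=> t _; rewrite /g subrK.
  apply: le_trans (J_bound cg (M := e / (15 * (D ^+ 2 + 1)) * (5 * q)) _) _.
    move=> t t01; have h : nm (seg v w t - p) <= 5 * q by exact: nm_segB.
    have := fd (seg v w t) (le_lt_trans h nP').
    rewrite /g /A opprD addrA => /le_trans; apply.
    by rewrite ler_wpM2l// ltW.
  apply: ler_wpM2r => //; apply: mulr_ge0; [exact: ltW|by rewrite mulr_ge0].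
have B1 := Jg _ _ xs ys xp yp xy; have B2 := Jg _ _ ys zs yp zp yz.
have B3 := Jg _ _ zs xs zp xp zx.
have TE : T f x y z = (J f x y - (P y - P x)) + (J f y z - (P z - P y)) +
   (J f z x - (P x - P z)) by rewrite /T; ring.
have TB : nm (T f x y z) <= 3 * (q * (e / (15 * (D ^+ 2 + 1)) * (5 * q))).
  rewrite TE; have := nmD (J f x y - (P y - P x) + (J f y z - (P z - P y))) (J f z x - (P x - P z)).
  by have := nmD (J f x y - (P y - P x)) (J f y z - (P z - P y)); lra.
apply: le_trans Tn _.
have q4 : 4 ^+ n * (q * q) = D ^+ 2.
  rewrite /q -[4]/((2 * 2)%:R) natrM exprMn.
  have h1 : 2 ^+ n * (2^-1) ^+ n = 1 :> R by rewrite -exprMn divff// expr1n.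
  transitivity (D ^+ 2 * ((2 ^+ n * (2^-1) ^+ n) * (2 ^+ n * (2^-1) ^+ n))); first ring.
  by rewrite h1 !mulr1.
have p4 : 0 < (4 : R) ^+ n by rewrite exprn_gt0.
apply: le_trans (_ : 4 ^+ n * (3 * (q * (e / (15 * (D ^+ 2 + 1)) * (5 * q)))) <= _).
  by rewrite ler_pM2l.
have -> : 4 ^+ n * (3 * (q * (e / (15 * (D ^+ 2 + 1)) * (5 * q)))) =
  (4 ^+ n * (q * q)) * (15 * (e / (15 * (D ^+ 2 + 1)))) by ring.
rewrite q4.
have D1 : 0 < D ^+ 2 + 1 by rewrite ltr_wpDl// sqr_ge0.
have -> : D ^+ 2 * (15 * (e / (15 * (D ^+ 2 + 1)))) = e * (D ^+ 2 / (D ^+ 2 + 1)).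
  by field; rewrite gt_eqF.
by rewrite ler_piMr ?(ltW e0)// ler_pdivrMr// mul1r lerDl.
Qed.

(** Morera: vanishing of the triangle integrals makes the integral from the
    centre a primitive. *)
Theorem morera (r : R) f : (forall z, nm z < r -> ccont f z) ->
  (forall a b c, nm a < r -> nm b < r -> nm c < r -> T f a b c = 0) ->
  forall z, nm z < r -> cderiv (J f 0) z (f z).
Proof.
move=> cf T0 z zr; apply/cderivP => e e0.
have r0 : 0 < r by apply: le_lt_trans zr.
have cs a b : nm a < r -> nm b < r -> cseg f a b.
  move=> ar br t t01; apply: cf.
  have m1 : nm a <= Num.max (nm a) (nm b) by rewrite le_max lexx.
  have m2 : nm b <= Num.max (nm a) (nm b) by rewrite le_max lexx orbT.
  by apply: le_lt_trans (nm_seg m1 m2 t01) _; rewrite gt_max ar.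
have [dl dl0 H] := cf _ zr _ e0.
exists (Num.min dl (r - nm z)) => [|w]; first by rewrite lt_min dl0 subr_gt0.
rewrite lt_min => /andP[wd wr].
have wr' : nm w < r by have := nm_sub w z; lra.
have n0 : nm (0 : C) < r by rewrite nm0.
have E : J f 0 w - J f 0 z = J f z w.
  have := T0 _ _ _ n0 zr wr'; rewrite /T (J_rev (cs _ _ n0 wr')) => /eqP.
  by rewrite subr_eq0 => /eqP <-; rewrite addrAC subrr add0r.
have cz : cseg (fun=> f z) z w by move=> t _; exact: ccont_cst.
have Ez : J (fun=> f z) z w = f z * (w - z).
  rewrite (@J_FTC _ _ (fun v => f z * v)) ?mulrBr// => t _.
  by rewrite -[X in cderiv _ _ X]mulr1; exact/cderivZ/cderiv_id.
have cg : cseg (fun v => f v - f z) z w.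
  by move=> t t01; apply: ccontB; [exact: cs|exact: ccont_cst].
have -> : J f 0 w - J f 0 z - f z * (w - z) = J (fun v => f v - f z) z w.
  apply/eqP; rewrite E subr_eq -Ez -JD//; apply/eqP; apply: J_ext; first exact: cs.
    by move=> t _; rewrite subrK.
  by apply: csegD.
rewrite mulrC; apply: J_bound => // t t01; apply/ltW/H.
have -> : seg z w t - z = t%:C * (w - z) by rewrite /seg; ring.
rewrite nmM nmC_ge0; last by case/andP: t01.
apply: le_lt_trans wd; rewrite ler_piMl//; by case/andP: t01.
Qed.

Theorem hol_primitive (r : R) f : hol r f ->
  forall z, nm z < r -> cderiv (J f 0) z (f z).
Proof.
move=> fh; apply: morera; first exact: hol_cont.
move=> a b c ar br cr.
apply: (@goursat r (Num.max (nm a) (Num.max (nm b) (nm c)))) => //.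
- by rewrite !gt_max ar br.
- by rewrite le_max lexx.
- by rewrite !le_max lexx orbT.
- by rewrite !le_max lexx !orbT.
Qed.
End Goursat.

(** * Compactness of closed discs *)

Section DiscCompact.
Variable R : realType.
Local Notation C := R[i].
Implicit Types (f g F : C -> C) (a b c z w : C).

(** Compactness of a closed disc, in covering form; [Q w d] is meant to be
    monotone in the scale [d]. *)
Lemma disc_cover (s : R) (Q : C -> R -> Prop) :
  (forall w (d d' : R), 0 < d' -> d' <= d -> Q w d -> Q w d') ->
  (forall z, nm z <= s -> exists2 d : R, 0 < d &
     forall w, nm (w - z) < d -> nm w <= s -> Q w d) ->
  exists2 d : R, 0 < d & forall w, nm w <= s -> Q w d.
Proof.
move=> Qm Qloc; apply: contrapT => Hno0.
have Hno (d : R) : 0 < d -> ~ (forall w, nm w <= s -> Q w d).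
  by move=> d0 H; apply: Hno0; exists d.
have s0 : 0 <= s.
  rewrite leNgt; apply/negP => s0; apply: (Hno 1 ltr01) => w ws.
  by have := nm_ge0 w; lra.
pose bad (x : C * R) := forall d : R, 0 < d -> exists w,
  [/\ `|Re (w - x.1)| <= x.2, `|Im (w - x.1)| <= x.2, nm w <= s & ~ Q w d].
pose rel (x y : C * R) := bad x -> [/\ bad y, y.2 = x.2 / 2 & nm (y.1 - x.1) <= x.2].
have step x : {y | rel x y}.
  apply/cid; case: x => c l; have [bx|nb] := pselect (bad (c, l)); last by exists (c, l).
  have l0 : 0 <= l by have [w [/= + _ _ _]] := bx _ ltr01; apply: le_trans.
  pose q (i j : bool) : C := c + ((-1) ^+ i * (l / 2)) +i* ((-1) ^+ j * (l / 2)).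
  suff [i [j bij]] : exists i j, bad (q i j, l / 2).
    exists (q i j, l / 2) => _; split=> //=; rewrite /q addrAC subrr add0r.
    apply: le_trans (nm_le _) _ => /=; rewrite !normrMsign.
    by rewrite ger0_norm ?divr_ge0//; lra.
  apply: contrapT => /forallNP Hn.
  have Hd i j : exists2 d : R, 0 < d & forall w, `|Re (w - q i j)| <= l / 2 ->
      `|Im (w - q i j)| <= l / 2 -> nm w <= s -> Q w d.
    have := Hn i; move/forallNP => /(_ j) /existsNP [d].
    move=> /not_implyP [d0 /forallNP H]; exists d => // w w1 w2 w3.
    by apply: contrapT => nq; apply: (H w).
  have [d1 d10 H1] := Hd false false; have [d2 d20 H2] := Hd false true.
  have [d3 d30 H3] := Hd true false; have [d4 d40 H4] := Hd true true.
  have m0 : 0 < Num.min (Num.min d1 d2) (Num.min d3 d4) by rewrite !lt_min d10 d20 d30.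
  have [w [/= w1 w2 w3]] := bx _ m0; apply.
  have mm : [/\ Num.min (Num.min d1 d2) (Num.min d3 d4) <= d1,
     Num.min (Num.min d1 d2) (Num.min d3 d4) <= d2,
     Num.min (Num.min d1 d2) (Num.min d3 d4) <= d3 &
     Num.min (Num.min d1 d2) (Num.min d3 d4) <= d4].
    by rewrite !ge_min !lexx !orbT.
  case: mm => m1 m2 m3 m4.
  move: w1 w2; rewrite ReD ImD ReN ImN !ler_norml => /andP[r1 r2] /andP[i1 i2].
  have [rp|rn] := leP (Re c) (Re w); have [ip|inn] := leP (Im c) (Im w).
  - apply: (Qm _ _ _ m0 m1); apply: H1 => //;
    rewrite /q ?ReD ?ImD ?ReN ?ImN ?ReD ?ImD /= expr0 mul1r ler_norml; apply/andP; lra.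
  - apply: (Qm _ _ _ m0 m2); apply: H2 => //;
    rewrite /q ?ReD ?ImD ?ReN ?ImN ?ReD ?ImD /= ?expr0 ?expr1 ?mul1r ?mulN1r ler_norml; apply/andP; lra.
  - apply: (Qm _ _ _ m0 m3); apply: H3 => //;
    rewrite /q ?ReD ?ImD ?ReN ?ImN ?ReD ?ImD /= ?expr0 ?expr1 ?mul1r ?mulN1r ler_norml; apply/andP; lra.
  - apply: (Qm _ _ _ m0 m4); apply: H4 => //;
    rewrite /q ?ReD ?ImD ?ReN ?ImN ?ReD ?ImD /= ?expr0 ?expr1 ?mul1r ?mulN1r ler_norml; apply/andP; lra.
have [u [u0 uS]] := dependent_choice step (0, s).
have b0 : bad (0, s).
  move=> d /Hno /existsNP [w /not_implyP [ws nQ]]; exists w; split=> //=; rewrite subr0.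
    exact: le_trans (nm_Re _) ws.
  exact: le_trans (nm_Im _) ws.
have un n : bad (u n) /\ (u n).2 = s * (2^-1) ^+ n.
  elim: n => [|n [IH1 IH2]]; first by rewrite u0 expr0 mulr1.
  by have [b1 b2 _] := uS n IH1; split; rewrite // b2 IH2 exprSr mulrA.
have ud n : nm ((u n.+1).1 - (u n).1) <= s * (2^-1) ^+ n.
  by have [un1 un2] := un n; have [_ _] := uS n un1; rewrite un2.
have [p pP] := cplx_half_limit ud.
have near_bad n d : 0 < d -> exists w, [/\ nm (w - p) <= 6 * s * (2^-1) ^+ n,
    nm w <= s & ~ Q w d].
  move=> d0; have [bn l2] := un n; have [w [w1 w2 w3 w4]] := bn _ d0; exists w; split=> //.
  rewrite l2 in w1 w2; have := pP n; have := nm_le (w - (u n).1).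
  have := nm_tri w (u n).1 p; rewrite (nmBC p) -!mulrA.
  set q := _ ^+ n in w1 w2 *; lra.
have ps : nm p <= s.
  apply/ler_addgt0Pr => e e0; have [n nP] := half_small (6 * s) e0.
  have [w [w1 w2 _]] := near_bad n 1 ltr01.
  by have := nm_sub p w; rewrite nmBC; lra.
have [d d0 Qd] := Qloc _ ps; have [n nP] := half_small (6 * s) d0.
have [w [w1 w2 nQ]] := near_bad n d d0.
by apply/nQ/Qd => //; exact: le_lt_trans nP.
Qed.

Lemma disc_bounded (s : R) f : (forall z, nm z <= s -> ccont f z) ->
  exists2 M : R, 0 < M & forall z, nm z <= s -> nm (f z) <= M.
Proof.
move=> cf; have [|z zs|d d0 H] := @disc_cover s (fun w d => nm (f w) <= d^-1).
- move=> w d d' d'0 d'd /le_trans; apply.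
  by rewrite lef_pV2// posrE (lt_le_trans d'0).
- have [dl dl0 H] := ccont_bd (cf _ zs).
  have K0 : 0 < nm (f z) + 1 by rewrite ltr_wpDl.
  exists (Num.min dl (nm (f z) + 1)^-1) => [|w]; first by rewrite lt_min dl0 invr_gt0.
  rewrite lt_min => /andP[/H h _] _; apply: le_trans h _.
  rewrite -[leLHS]invrK lef_pV2 ?posrE ?lt_min ?invr_gt0 ?dl0//.
  by rewrite ge_min lexx orbT.
- by exists d^-1 => //; rewrite invr_gt0.
Qed.

Lemma disc_unif_cont (s : R) f : (forall z, nm z <= s -> ccont f z) ->
  forall e : R, 0 < e -> exists2 d : R, 0 < d & forall z w, nm z <= s -> nm w <= s ->
    nm (w - z) < d -> nm (f w - f z) <= e.
Proof.
move=> cf e e0; have e2 : 0 < e / 2 by rewrite divr_gt0.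
have [|z zs|d d0 H] := @disc_cover s (fun z d => forall w, nm w <= s ->
    nm (w - z) < d -> nm (f w - f z) <= e).
- by move=> w d d' d'0 d'd H v vs vw; apply: H => //; exact: lt_le_trans d'd.
- have [dl dl0 H] := cf _ zs _ e2; exists (dl / 2) => [|w wz ws v vs vw].
    by rewrite divr_gt0.
  have h1 : nm (w - z) < dl by lra.
  have h2 : nm (v - z) < dl by have := nm_tri v w z; lra.
  have := nm_tri (f v) (f z) (f w); have := H _ h1; have := H _ h2.
  by rewrite (nmBC (f z)); lra.
- by exists d => // z w zs ws wz; exact: H.
Qed.

End DiscCompact.

(** * Contour integrals *)

Section Cauchy.
Variable R : realType.
Local Notation C := R[i].
Implicit Types (f g F : C -> C) (a b c z w : C).

Section Square.
Variable r : R.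
Hypothesis r0 : 0 < r.

Let p (k : nat) : C := r%:C * 'i%C ^+ k * (1 - 'i%C).

Definition onC z := exists k (t : R), [/\ (k < 4)%N, 0 <= t <= 1 & z = seg (p k) (p k.+1) t].

Let pE k t : seg (p k) (p k.+1) t = r%:C * 'i%C ^+ k * (1 + 'i%C * (2 * t - 1)%:C).
Proof.
have -> : (2 * t - 1)%:C = 2 * t%:C - 1 :> C by rewrite rmorphB rmorphM rmorph1 /= rmorph_nat.
by rewrite /seg /p exprS; move: ('i%C ^+ k) => q; have := @sqr_i R; rewrite expr2 => ii; ring: ii.
Qed.

Let nmi : nm ('i%C : C) = 1.
Proof. by rewrite /nm /= expr0n expr1n add0r sqrtr1. Qed.

Let Re1i (x : R) : Re (1 + 'i%C * x%:C) = 1.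
Proof. by rewrite ReD ReM /=; ring. Qed.

Lemma onC_nm z : onC z -> r <= nm z <= 2 * r.
Proof.
move=> [k [t [_ t01 ->]]]; rewrite pE !nmM nmX nmi expr1n mulr1 nmC_ge0 ?(ltW r0)//.
have A := nmD 1 ('i%C * (2 * t - 1)%:C : C); rewrite nm1 nmM nmi mul1r nmR in A.
have B := nm_Re (1 + 'i%C * (2 * t - 1)%:C : C).
rewrite Re1i normr1 in B.
have D : `|2 * t - 1| <= 1 by rewrite ler_norml; apply/andP; lra.
by apply/andP; split; [rewrite ler_peMr ?(ltW r0)//; lra|rewrite mulrC ler_pM2r//; lra].
Qed.

Definition Cint f := \sum_(k < 4) J f (p k) (p k.+1).
Definition ccC f := forall z, onC z -> ccont f z.

Let ccC_seg f (k : 'I_4) : ccC f -> cseg f (p k) (p k.+1).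
Proof. by move=> cf t t01; apply: cf; exists k, t. Qed.

Lemma CintD f g : ccC f -> ccC g -> Cint (fun z => f z + g z) = Cint f + Cint g.
Proof.
by move=> cf cg; rewrite /Cint -big_split; apply: eq_bigr => k _; rewrite JD//; exact: ccC_seg.
Qed.

Lemma CintZ c f : ccC f -> Cint (fun z => c * f z) = c * Cint f.
Proof.
by move=> cf; rewrite /Cint mulr_sumr; apply: eq_bigr => k _; rewrite JZ//; exact: ccC_seg.
Qed.

Lemma Cint_bound f (M : R) : ccC f -> (forall z, onC z -> nm (f z) <= M) ->
  nm (Cint f) <= 8 * r * M.
Proof.
move=> cf fM; apply: le_trans (nm_sum _ _ _) _.
have side (k : 'I_4) : nm (J f (p k) (p k.+1)) <= 2 * r * M.
  have h := @J_bound R f (p k) (p k.+1) M (@ccC_seg f k cf); apply: le_trans (h _) _.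
    by move=> t t01; apply: fM; exists k, t.
  suff -> : nm (p k.+1 - p k) = 2 * r by [].
  have -> : p k.+1 - p k = r%:C * 'i%C ^+ k * (2 * 'i%C).
    by rewrite /p exprS; move: ('i%C ^+ k) => q; have := @sqr_i R; rewrite expr2 => ii; ring: ii.
  by rewrite !nmM nmX nmi expr1n nm_natr nmC_ge0 ?(ltW r0)//; ring.
apply: le_trans (ler_sum _ (fun k _ => side k)) _.
by rewrite sumr_const card_ord -mulr_natl -!mulrA; lra.
Qed.

Lemma Cint_FTC f F : ccC f -> (forall z, onC z -> cderiv F z (f z)) -> Cint f = 0.
Proof.
move=> cf DF; have E (k : 'I_4) : J f (p k) (p k.+1) = F (p k.+1) - F (p k).
  by apply: J_FTC; [exact: ccC_seg|move=> t t01; apply: DF; exists k, t].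
rewrite /Cint (eq_bigr _ (fun k _ => E k)).
rewrite !big_ord_recr big_ord0 /= add0r.
have -> : p 4 = p 0 by rewrite /p (exprM _ 2 2) sqr_i -signr_odd expr0.
ring.
Qed.

Lemma rderiv_Im_ge (g : R -> C) d (m : R) : (forall t : R, 0 <= t <= 1 -> rderiv g t (d t)) ->
  (forall t : R, 0 <= t <= 1 -> m <= Im (d t)) -> m <= Im (g 1 - g 0).
Proof.
move=> Dg dm; pose u (s : R) := Im (g s).
have Du (t : R) : 0 <= t <= 1 -> is_derive t (1 : R) u (Im (d t)) by move=> /Dg [].
have cu : {within `[0, 1], continuous u}.
  apply: derivable_within_continuous => x; rewrite in_itv /= => xI.
  by have [] := Du x xI.
have Du' (x : R) : x \in `]0, 1[%R -> is_derive x (1 : R) u (Im (d x)).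
  by rewrite in_itv /= => /andP[x0 x1]; apply: Du; rewrite !ltW.
have [x] := MVT ltr01 Du' cu; rewrite in_itv /= => /andP[x0 x1] E.
by rewrite ImD ImN -/(u 1) -/(u 0) E subr0 mulr1; apply: dm; rewrite !ltW.
Qed.

Definition kap : C := Cint (fun z => z^-1).

Let onC_neq z b : onC z -> nm b < r -> z - b != 0.
Proof.
move=> /onC_nm /andP[h _] br; rewrite subr_eq0; apply: contraTneq h => ->.
by rewrite -ltNge.
Qed.

Lemma ccC_inv b : nm b < r -> ccC (fun z => (z - b)^-1).
Proof.
move=> br z zC; apply: ccontV; last exact: onC_neq.
by apply: ccontB; [exact: ccont_id|exact: ccont_cst].
Qed.

Lemma ccC_kap : ccC (fun z => z^-1).
Proof.
move=> z zC; apply: ccontV; first exact: ccont_id.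
by rewrite -[z]subr0; apply: onC_neq => //; rewrite nm0.
Qed.

Lemma kap_ge : 4 <= nm kap.
Proof.
apply: le_trans (nm_Im _); apply: le_trans (ler_norm _).
have side (k : 'I_4) : 1 <= Im (J (fun z => z^-1) (p k) (p k.+1)).
  have [g Dg ->] := J_ex (@ccC_seg _ k ccC_kap).
  apply: rderiv_Im_ge Dg _ => t t01; rewrite pE.
  have -> : p k.+1 - p k = r%:C * 'i%C ^+ k * (2 * 'i%C).
    by rewrite /p exprS; move: ('i%C ^+ k) => q; have := @sqr_i R; rewrite expr2 => ii; ring: ii.
  set x := 2 * t - 1; have x2 : x ^+ 2 <= 1 by rewrite /x; nra.
  have u0 : r%:C * 'i%C ^+ k != 0 :> C.
    by rewrite -nm_gt0 nmM nmX nmi expr1n mulr1 nmC_ge0 ?(ltW r0).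
  have v0 : 1 + 'i%C * x%:C != 0 :> C.
    rewrite -nm_gt0; apply: lt_le_trans (nm_Re _).
    by rewrite Re1i normr1.
  have -> : (r%:C * 'i%C ^+ k * (1 + 'i%C * x%:C))^-1 * (r%:C * 'i%C ^+ k * (2 * 'i%C)) =
    (1 + 'i%C * x%:C)^-1 * (2 * 'i%C) by rewrite invfM mulrACA mulVf// mul1r.
  have -> : (1 + 'i%C * x%:C)^-1 = (1 + x ^+ 2)^-1%:C * (1 - 'i%C * x%:C) :> C.
    apply: (mulfI v0); rewrite mulfV// mulrCA.
    have -> : (1 + 'i%C * x%:C) * (1 - 'i%C * x%:C) = (1 + x ^+ 2)%:C :> C.
      have -> : (1 + x ^+ 2)%:C = 1 + x%:C * x%:C :> C by rewrite -rmorphM -(rmorph1 (real_complex R)) -rmorphD expr2.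
      have := @sqr_i R; rewrite expr2 => ii; ring: ii.
    by rewrite -rmorphM mulVf// gt_eqF// ltr_pwDl// sqr_ge0.
  rewrite [1 - _](_ : _ = 1 +i* (- x)); last by apply: eqC; rewrite ?ReD ?ImD /=; ring.
  have -> : (2 * 'i%C : C) = 0 +i* 2.
    by rewrite -(rmorph_nat (real_complex R)) /=; apply: eqC => /=; ring.
  rewrite /= mul0r; have x1 : 0 < 1 + x ^+ 2 by rewrite ltr_pwDl// sqr_ge0.
  by rewrite !(mulr0, mul0r, subr0, addr0, add0r, oppr0, mulr1) mulrC ler_pdivlMr//; lra.
rewrite /Cint (big_morph (fun z : C => Im z) (@ImD R) (erefl : Im (0 : C) = 0)).
apply: le_trans (ler_sum _ (fun k _ => side k)).
by rewrite sumr_const card_ord.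
Qed.

Lemma kap_neq0 : kap != 0.
Proof. by rewrite -nm_gt0; apply: lt_le_trans kap_ge. Qed.
End Square.
End Cauchy.

(** * The Cauchy kernel *)

Section CauchyFormula.
Variable R : realType.
Local Notation C := R[i].
Implicit Types (f g F : C -> C) (a b c z w : C).

Lemma cmv F f a b (M : R) :
  (forall t : R, 0 <= t <= 1 -> cderiv F (seg a b t) (f (seg a b t))) ->
  (forall t : R, 0 <= t <= 1 -> nm (f (seg a b t)) <= M) ->
  nm (F b - F a) <= M * nm (b - a).
Proof.
move=> DF fM.
have := @rderiv_mv R (fun t => F (seg a b t)) (fun t => f (seg a b t) * (b - a))
  (M * nm (b - a)); rewrite seg0 seg1; apply.
  by move=> t /DF; exact: rderiv_line.
by move=> t /fM h; rewrite nmM ler_wpM2r.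
Qed.

Definition cder f z : C := xget 0 (cderiv f z).

Lemma cderP f z d : cderiv f z d -> cderiv f z (cder f z).
Proof. by move=> Df; apply: (xgetPex 0 (P := cderiv f z)); exists d. Qed.

Lemma cder_eq f z d : cderiv f z d -> cder f z = d.
Proof. by move=> Df; apply: cderiv_uniq (cderP Df) Df. Qed.

Lemma hol_cder (r : R) f z : hol r f -> nm z < r -> cderiv f z (cder f z).
Proof. by move=> fh /fh [d]; exact: cderP. Qed.

Section Kernels.
Variables (r : R).
Hypothesis r0 : 0 < r.
Local Notation Cint := (Cint r).

Lemma Cint0 : Cint (fun=> 0) = 0 :> C.
Proof.
apply: (Cint_FTC (F := fun=> 0)) => z _; [exact: ccont_cst|exact: cderiv_cst].
Qed.

Lemma ccC_sum (I : Type) (s : seq I) (k : I -> C -> C) : (forall i, ccC r (k i)) ->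
  ccC r (fun z => \sum_(i <- s) k i z).
Proof.
move=> ck z zC; elim: s => [|i s IH].
  apply: (ccont_near ltr01) (ccont_cst 0 z) => w _; by rewrite big_nil.
apply: (ccont_near ltr01) (ccontD (ck i z zC) IH) => w _; by rewrite big_cons.
Qed.

Lemma Cint_sum0 (I : Type) (s : seq I) (k : I -> C -> C) : (forall i, ccC r (k i)) ->
  (forall i, Cint (k i) = 0) -> Cint (fun z => \sum_(i <- s) k i z) = 0.
Proof.
move=> ck k0; elim: s => [|i s IH].
  rewrite (_ : (fun z => _) = fun=> 0) ?Cint0//.
  by apply/funext => z; rewrite big_nil.
rewrite (_ : (fun z => _) = fun z => k i z + \sum_(j <- s) k j z).
  by rewrite CintD// ?k0 ?IH ?addr0//; exact: ccC_sum.
by apply/funext => z; rewrite big_cons.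
Qed.

Lemma ccC_inv1 b : nm b < r -> ccC r (fun z => (z - b)^-1).
Proof. exact: ccC_inv. Qed.

Lemma ccCM f g : ccC r f -> ccC r g -> ccC r (fun z => f z * g z).
Proof. by move=> cf cg z zC; apply: ccontM; [exact: cf|exact: cg]. Qed.

Lemma ccC_invn b n : nm b < r -> ccC r (fun z => ((z - b)^-1) ^+ n).
Proof.
move=> br z zC; elim: n => [|n IH]; first exact: ccont_cst.
apply: (ccont_near ltr01) (ccontM (ccC_inv1 br zC) IH) => w _; by rewrite exprS.
Qed.

Variables (phi : C -> C) (M : R).
Hypothesis cphi : ccC r phi.
Hypothesis phiM : forall z, onC r z -> nm (phi z) <= M.

Definition K n b : C := Cint (fun z => phi z * ((z - b)^-1) ^+ n).

Lemma ccC_K n b : nm b < r -> ccC r (fun z => phi z * ((z - b)^-1) ^+ n).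
Proof. by move=> br; apply: ccCM => //; exact: ccC_invn. Qed.

Let X b : R := 2 / (r - nm b).

Lemma kernel_rel b c z : nm b < r -> nm (c - b) < (r - nm b) / 2 -> onC r z ->
  [/\ (z - c)^-1 - (z - b)^-1 = (c - b) * ((z - b)^-1 * (z - c)^-1),
      nm (z - b)^-1 <= X b & nm (z - c)^-1 <= X b].
Proof.
move=> br cb /(onC_nm r0) /andP[zr _].
have m0 : 0 < r - nm b by rewrite subr_gt0.
have zb : r - nm b <= nm (z - b) by have := nm_sub z b; lra.
have zc : (r - nm b) / 2 <= nm (z - c).
  have := nm_tri z c b; lra.
have zb0 : z - b != 0 by rewrite -nm_gt0; lra.
have zc0 : z - c != 0 by rewrite -nm_gt0; lra.
split.
- field; by rewrite zb0 zc0.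
- rewrite nmV /X -[leRHS]invrK lef_pV2 ?posrE ?nm_gt0// ?invr_gt0 ?divr_gt0//.
  by rewrite invf_div; lra.
- rewrite nmV /X -[leRHS]invrK lef_pV2 ?posrE ?nm_gt0// ?invr_gt0 ?divr_gt0//.
  by rewrite invf_div; lra.
Qed.

Let M0 : 0 <= M.
Proof.
have zC : onC r (seg (r%:C * 'i ^+ 0 * (1 - 'i)) (r%:C * 'i ^+ 1 * (1 - 'i)) 0).
  by exists 0%N, 0; rewrite lexx ler01.
exact: le_trans (phiM zC).
Qed.

Lemma kernel_deriv m n b (B : R) :
  nm b < r -> 0 <= B ->
  (forall c z, nm (c - b) < (r - nm b) / 2 -> onC r z ->
     nm ((z - c)^-1 ^+ m - (z - b)^-1 ^+ m - (c - b) * (n%:R * (z - b)^-1 ^+ m.+1))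
       <= nm (c - b) ^+ 2 * B) ->
  cderiv (K m) b (n%:R * K m.+1 b).
Proof.
move=> br B0 H; apply/cderivP => e e0.
have m0 : 0 < r - nm b by rewrite subr_gt0.
have E0 : 0 < 8 * r * (M * B) + 1.
  by rewrite ltr_wpDl// mulr_ge0 ?mulr_ge0// ltW.
exists (Num.min ((r - nm b) / 2) (e / (8 * r * (M * B) + 1))) => [|c].
  by rewrite lt_min !divr_gt0.
rewrite lt_min => /andP[cb ce].
have cr : nm c < r by have := nm_sub c b; lra.
have cc1 := ccC_K m cr; have cc2 := ccC_K m br; have cc3 := ccC_K m.+1 br.
pose G z := phi z * (z - c)^-1 ^+ m + ((-1) * (phi z * (z - b)^-1 ^+ m) +
   (- (c - b) * n%:R) * (phi z * (z - b)^-1 ^+ m.+1)).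
have ccz k f : ccC r f -> ccC r (fun z => k * f z).
  by move=> cf; apply: ccCM => // z _; exact: ccont_cst.
have ccd f g : ccC r f -> ccC r g -> ccC r (fun z => f z + g z).
  by move=> cf cg z zC; apply: ccontD; [exact: cf|exact: cg].
have -> : K m c - K m b - n%:R * K m.+1 b * (c - b) = Cint G.
  rewrite /G (CintD cc1); last by apply: ccd; exact: ccz.
  rewrite (CintD (ccz _ _ cc2) (ccz _ _ cc3)) !CintZ// -/(K m c) -/(K m b) -/(K m.+1 b).
  by move: (K m c) (K m b) (K m.+1 b) => x y t; ring.
apply: le_trans (Cint_bound r0 (M := M * (nm (c - b) ^+ 2 * B)) _ _) _.
- by apply: (ccd _ _) => //; apply: (ccd _ _); exact: ccz.
- move=> z zC; rewrite /G.
  have -> : phi z * (z - c)^-1 ^+ m + (-1 * (phi z * (z - b)^-1 ^+ m) +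
     - (c - b) * n%:R * (phi z * (z - b)^-1 ^+ m.+1)) =
     phi z * ((z - c)^-1 ^+ m - (z - b)^-1 ^+ m - (c - b) * (n%:R * (z - b)^-1 ^+ m.+1)).
    by move: ((z - c)^-1 ^+ m) ((z - b)^-1 ^+ m) ((z - b)^-1 ^+ m.+1) => x y t; ring.
  by apply: nm_prod_le2; [exact: phiM|exact: H].
have -> : 8 * r * (M * (nm (c - b) ^+ 2 * B)) = (8 * r * (M * B)) * nm (c - b) * nm (c - b) by ring.
apply: ler_wpM2r => //.
have h : nm (c - b) * (8 * r * (M * B) + 1) <= e by rewrite -ler_pdivlMr// ltW.
by apply: le_trans h; rewrite mulrC ler_wpM2l// lerDl.
Qed.

Lemma K1_deriv b : nm b < r -> cderiv (K 1) b (K 2 b).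
Proof.
move=> br; have := @kernel_deriv 1 1 b (X b ^+ 3) br; rewrite mul1r; apply.
  by rewrite exprn_ge0// divr_ge0// subr_ge0 ltW.
move=> c z cb zC; have [E x1 y1] := kernel_rel br cb zC.
move: ((z - b)^-1) ((z - c)^-1) E x1 y1 => x y E x1 y1.
have -> : y ^+ 1 - x ^+ 1 - (c - b) * (1 * x ^+ 2) = (c - b) ^+ 2 * (x ^+ 2 * y).
  by rewrite !expr1 E mul1r; transitivity ((c - b) * x * (y - x)); [ring|rewrite E; ring].
rewrite nmM nmX ler_wpM2l ?exprn_ge0//.
by rewrite [X b ^+ 3]exprSr; apply: nm_prod_le2 => //; rewrite !expr2; exact: nm_prod_le2.
Qed.

Lemma K2_deriv b : nm b < r -> cderiv (K 2) b (2 * K 3 b).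
Proof.
move=> br; have X0 : 0 <= X b by rewrite divr_ge0// subr_ge0 ltW.
apply: (@kernel_deriv 2 2 b (X b ^+ 3 * (3 * X b)) br).
  by apply: mulr_ge0; [exact: exprn_ge0|exact: mulr_ge0].
move=> c z cb zC; have [E x1 y1] := kernel_rel br cb zC.
move: ((z - b)^-1) ((z - c)^-1) E x1 y1 => x y E x1 y1.
have -> : y ^+ 2 - x ^+ 2 - (c - b) * (2 * x ^+ 3) = (c - b) ^+ 2 * (x ^+ 2 * y * (2 * x + y)).
  have yE : y = x + (c - b) * (x * y) by rewrite -E addrC subrK.
  transitivity ((c - b) * x * (x * (y - x) + (y - x) * (y + x))).
    by transitivity ((y - x) * (y + x) - (c - b) * (2 * x ^+ 3)); [ring|rewrite {1}E; ring].
  by rewrite E; ring.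
rewrite nmM nmX ler_wpM2l ?exprn_ge0//.
apply: nm_prod_le2.
  by rewrite [X b ^+ 3]exprSr; apply: nm_prod_le2 => //; rewrite !expr2; exact: nm_prod_le2.
by apply: le_trans (nmD _ _) _; rewrite nmM nm_natr; lra.
Qed.

Lemma K3_cont b : nm b < r -> ccont (K 3) b.
Proof.
move=> br e e0; have X0 : 0 <= X b by rewrite divr_ge0// subr_ge0 ltW.
have m0 : 0 < r - nm b by rewrite subr_gt0.
set B := X b * X b * (3 * (X b * X b)); have B0 : 0 <= B by rewrite /B; apply: mulr_ge0; apply: mulr_ge0 => //; apply: mulr_ge0.
have E0 : 0 < 8 * r * (M * B) + 1.
  by rewrite ltr_wpDl//; apply: mulr_ge0; [rewrite mulr_ge0// ltW|exact: mulr_ge0].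
exists (Num.min ((r - nm b) / 2) (e / (8 * r * (M * B) + 1))) => [|c].
  by rewrite lt_min !divr_gt0.
rewrite lt_min => /andP[cb ce].
have cr : nm c < r by have := nm_sub c b; lra.
have cc1 := ccC_K 3 cr; have cc2 := ccC_K 3 br.
have ccN : ccC r (fun z => (-1) * (phi z * (z - b)^-1 ^+ 3)).
  by apply: ccCM => // z _; exact: ccont_cst.
have -> : K 3 c - K 3 b = Cint (fun z => phi z * (z - c)^-1 ^+ 3 + (-1) * (phi z * (z - b)^-1 ^+ 3)).
  by rewrite CintD// CintZ// mulN1r.
apply: le_lt_trans (Cint_bound r0 (M := M * (nm (c - b) * B)) _ _) _.
- by move=> z zC; apply: ccontD; [exact: cc1|exact: ccN].
- move=> z zC; have [E x1 y1] := kernel_rel br cb zC.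
  move: ((z - b)^-1) ((z - c)^-1) E x1 y1 => x y E x1 y1.
  have -> : phi z * y ^+ 3 + -1 * (phi z * x ^+ 3) =
      phi z * ((c - b) * (x * y * (y ^+ 2 + x * y + x ^+ 2))).
    transitivity (phi z * ((y - x) * (y ^+ 2 + x * y + x ^+ 2))); first ring.
    by rewrite E; ring.
  apply: nm_prod_le2; first exact: phiM.
  rewrite nmM ler_wpM2l//; apply: nm_prod_le2; first exact: nm_prod_le2.
  apply: le_trans (nmD _ _) _; apply: le_trans (lerD (nmD _ _) (lexx _)) _.
  have := nm_prod_le2 x1 x1; have := nm_prod_le2 x1 y1; have := nm_prod_le2 y1 y1.
  rewrite !expr2; lra.
have -> : 8 * r * (M * (nm (c - b) * B)) = (8 * r * (M * B)) * nm (c - b) by ring.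
have h : nm (c - b) * (8 * r * (M * B) + 1) < e by rewrite -ltr_pdivlMr.
by apply: le_lt_trans h; rewrite mulrC ler_wpM2l// lerDl.
Qed.
End Kernels.
End CauchyFormula.

(** * Cauchy's formula *)

Section HolDer.
Variable R : realType.
Local Notation C := R[i].
Implicit Types (f g F : C -> C) (a b c z w : C).

Lemma div_nat_01 (j N : nat) : (j <= N)%N -> (0 < N)%N -> 0 <= (j%:R / N%:R : R) <= 1.
Proof.
move=> jN N0; rewrite divr_ge0//= ler_pdivrMr ?ltr0n// mul1r ler_nat //.
Qed.

(** The difference quotient of a function with continuous derivative is a
    uniform limit of averages of the derivative along segments, each of which
    has a primitive. *)
Lemma cauchy_quotient (r rho : R) F f b : 0 < r -> 2 * r < rho ->
  (forall z, nm z < rho -> cderiv F z (f z)) -> (forall z, nm z < rho -> ccont f z) ->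
  nm b < r -> Cint r (fun z => (F z - F b) * (z - b)^-1) = 0.
Proof.
move=> r0 rr DF cf br.
have b2 : nm b <= 2 * r by lra.
have ds z : nm z <= 2 * r -> nm z < rho by move=> /le_lt_trans; apply.
have cq : ccC r (fun z => (F z - F b) * (z - b)^-1).
  move=> z zC; have /andP[_ z2] := onC_nm r0 zC.
  apply: ccontM; last exact: (ccC_inv1 r0 br zC).
  by apply: ccontB; [exact: cderiv_cont (DF _ (ds _ z2))|exact: ccont_cst].
apply: eq0_le_eps => e e0; have e1 : 0 < e / (8 * r + 1) by rewrite divr_gt0//; lra.
have [d d0 ud] := @disc_unif_cont R (2 * r) f (fun z zs => cf _ (ds _ zs)) _ e1.
have [n nP] := half_small (3 * r) d0.
pose N := (2 ^ n)%N; have N0 : (0 < N)%N by rewrite /N expn_gt0.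
have Nn0 : N%:R != 0 :> R by rewrite pnatr_eq0 -lt0n.
have Nd : 3 * r / N%:R < d by move: nP; rewrite exprVn -natrX.
pose x j z := seg b z (j%:R / N%:R).
pose S z := \sum_(j < N) (N%:R^-1 : R)%:C * f (x j z).
have xin (j : 'I_N) z : nm z <= 2 * r -> nm (x j z) <= 2 * r.
  by move=> z2; apply: nm_seg => //; apply: div_nat_01 => //; exact: ltnW.
have xin1 (j : 'I_N) z : nm z <= 2 * r -> nm (x j.+1 z) <= 2 * r.
  by move=> z2; apply: nm_seg => //; apply: div_nat_01.
have x_line j z : x j z = b * (1 - (j%:R / N%:R)%:C) + z * (j%:R / N%:R)%:C.
  by rewrite /x /seg; ring.
have cSj (j : 'I_N) : ccC r (fun z => (N%:R^-1 : R)%:C * f (x j z)).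
  move=> z zC; have /andP[_ z2] := onC_nm r0 zC.
  apply: ccontM; first exact: ccont_cst.
  apply: ccont_comp; last by apply: cf; apply: ds; exact: xin.
  apply: (@ccont_near _ (fun z => b * (1 - (j%:R / N%:R)%:C) + z * (j%:R / N%:R)%:C) _ _ 1) => //.
  exact: cderiv_cont (cderiv_affine _ _ _).
have SI : Cint r S = 0.
  apply: Cint_sum0 => // j; have [j0|j0] := eqVneq (j : nat) 0%N.
    apply: (Cint_FTC (F := fun z => ((N%:R^-1 : R)%:C * f b) * z)) => // z zC.
    rewrite x_line j0 mul0r subr0 mulr1 mulr0 addr0 -[X in cderiv _ _ X]mulr1.
    exact/cderivZ/cderiv_id.
  apply: (Cint_FTC (F := fun z => (j%:R^-1 : R)%:C * F (x j z))) => // z zC.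
  have /andP[_ z2] := onC_nm r0 zC.
  have -> : (N%:R^-1 : R)%:C * f (x j z) = (j%:R^-1 : R)%:C * (f (x j z) * (j%:R / N%:R)%:C).
    rewrite {1}(_ : N%:R^-1 = j%:R^-1 * (j%:R / N%:R) :> R).
      by rewrite rmorphM /= -mulrA [X in _ * X]mulrC.
    by rewrite mulrA mulVf ?mul1r// pnatr_eq0.
  apply: cderivZ; apply: (@cderiv_ext _ (fun z => F (b * (1 - (j%:R / N%:R)%:C) + z * (j%:R / N%:R)%:C))).
    by move=> w; rewrite x_line.
  apply: cderiv_line; rewrite -x_line; apply: DF; apply: ds; exact: xin.
have cS : ccC r S by apply: ccC_sum.
have -> : Cint r (fun z => (F z - F b) * (z - b)^-1) =
   Cint r (fun z => (F z - F b) * (z - b)^-1 + (-1) * S z).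
  have cN : ccC r (fun z => -1 * S z) by move=> z zC; apply: ccontM; [exact: ccont_cst|exact: cS].
  by rewrite CintD// CintZ// SI mulr0 addr0.
apply: le_trans (Cint_bound r0 (M := e / (8 * r + 1)) _ _) _.
- move=> z zC; apply: ccontD; first exact: cq.
  by apply: ccontM; [exact: ccont_cst|exact: cS].
- move=> z zC; have /andP[_ z2] := onC_nm r0 zC.
  have zb0 : z - b != 0.
    by have /andP[z1 _] := onC_nm r0 zC; rewrite subr_eq0; apply: contraTneq z1 => ->; rewrite -ltNge.
  have -> : (F z - F b) * (z - b)^-1 + (-1) * S z = (F z - F b - (z - b) * S z) / (z - b).
    by field.
  rewrite nmM nmV ler_pdivrMr ?nm_gt0//.
  have -> : F z - F b = \sum_(j < N) (F (x j.+1 z) - F (x j z)).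
    rewrite -(big_mkord xpredT (fun j => F (x j.+1 z) - F (x j z))) telescope_sumr//.
    by rewrite /x divff// seg1 mul0r seg0.
  rewrite mulr_sumr -sumrB.
  apply: le_trans (nm_sum _ _ _) _.
  have step (j : 'I_N) : nm (F (x j.+1 z) - F (x j z) - (z - b) * ((N%:R^-1 : R)%:C * f (x j z)))
      <= e / (8 * r + 1) * (nm (z - b) / N%:R).
    have E : x j.+1 z - x j z = (z - b) * (N%:R^-1 : R)%:C.
      rewrite /x /seg; transitivity ((z - b) * (j.+1%:R / N%:R - j%:R / N%:R)%:C).
        by rewrite rmorphB /=; ring.
      by rewrite -mulrBl -natrB// subSnn mul1r.
    have En : nm (x j.+1 z - x j z) = nm (z - b) / N%:R.
      by rewrite E nmM nmC_ge0// invr_ge0.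
    have -> : F (x j.+1 z) - F (x j z) - (z - b) * ((N%:R^-1 : R)%:C * f (x j z)) =
      (F (x j.+1 z) - f (x j z) * x j.+1 z) - (F (x j z) - f (x j z) * x j z).
      transitivity (F (x j.+1 z) - F (x j z) - f (x j z) * (x j.+1 z - x j z)).
        by rewrite E; ring.
      by move: (F (x j.+1 z)) (F (x j z)) (f (x j z)) => u v t; ring.
    rewrite -En; apply: (@cmv R (fun w => F w - f (x j z) * w) (fun w => f w - f (x j z)) (x j z) (x j.+1 z)) => t t01.
      apply: cderivB; first by apply: DF; apply: ds; apply: nm_seg => //; [exact: xin|exact: xin1].
      by rewrite -[X in cderiv _ _ X]mulr1; exact/cderivZ/cderiv_id.
    apply: ud; [exact: xin|by apply: nm_seg => //; [exact: xin|exact: xin1]|].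
    have -> : seg (x j z) (x j.+1 z) t - x j z = t%:C * (x j.+1 z - x j z) by rewrite /seg; ring.
    rewrite nmM En nmC_ge0; last by case/andP: t01.
    have h1 : nm (z - b) / N%:R <= 3 * r / N%:R.
      by rewrite ler_pM2r ?invr_gt0 ?ltr0n//; have := nmB z b; lra.
    apply: le_lt_trans (le_lt_trans h1 Nd).
    by rewrite ler_piMl// ?divr_ge0//; case/andP: t01.
  apply: le_trans (ler_sum _ (fun j _ => step j)) _.
  rewrite sumr_const card_ord -[X in X <= _]mulr_natl.
  by rewrite mulrCA [N%:R * _]mulrC divfK.
have h : 0 < 8 * r + 1 by lra.
have -> : 8 * r * (e / (8 * r + 1)) = e * (8 * r / (8 * r + 1)) by field; rewrite lt0r_neq0.
by rewrite ler_piMr ?(ltW e0)// ler_pdivrMr//; lra.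
Qed.

Lemma kap_const (r : R) b : 0 < r -> nm b < r -> Cint r (fun z => (z - b)^-1) = kap r :> C.
Proof.
move=> r0 br.
pose ph := fun _ : C => 1 : C.
have cph : ccC r ph by move=> z _; exact: ccont_cst.
have phM : forall z, onC r z -> nm (ph z) <= 1 by move=> z _; rewrite nm1.
have KE c : Cint r (fun z => (z - c)^-1) = K r ph 1 c.
  by rewrite /K; congr Cint; apply/funext => z; rewrite mul1r expr1.
have K20 c : nm c < r -> K r ph 2 c = 0.
  move=> cr; rewrite /K (_ : (fun z => _) = fun z => (z - c)^-1 ^+ 2); last first.
    by apply/funext => z; rewrite mul1r.
  apply: (Cint_FTC (F := fun z => - (z - c)^-1)); first exact: ccC_invn.
  move=> z zC; have z0 : z - c != 0.
    by have /andP[z1 _] := onC_nm r0 zC; rewrite subr_eq0; apply: contraTneq z1 => ->; rewrite -ltNge.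
  have := cderivN (cderivV (cderivB (cderiv_id z) (cderiv_cst c z)) z0).
  by rewrite subr0 mulNr opprK mul1r exprVn.
have := @cmv R (K r ph 1) (K r ph 2) 0 b 0.
rewrite mul0r => H.
have {H} : nm (K r ph 1 b - K r ph 1 0) <= 0.
  have sr (t : R) : 0 <= t <= 1 -> nm (seg 0 b t) < r.
    by move=> t01; apply: le_lt_trans br; apply: nm_seg => //; rewrite nm0.
  by apply: H => t /sr h; [exact: (K1_deriv r0 cph phM)|rewrite K20// nm0].
move=> h; have : nm (K r ph 1 b - K r ph 1 0) == 0 by rewrite eq_le h nm_ge0.
rewrite nm_eq0 subr_eq0 => /eqP; rewrite -!KE => ->.
by congr Cint; apply/funext => z; rewrite subr0.
Qed.

Lemma cauchy_C1 (r rho : R) F f b : 0 < r -> 2 * r < rho ->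
  (forall z, nm z < rho -> cderiv F z (f z)) -> (forall z, nm z < rho -> ccont f z) ->
  nm b < r -> F b = (kap r)^-1 * K r F 1 b.
Proof.
move=> r0 rr DF cf br; have := cauchy_quotient r0 rr DF cf br.
have cF : ccC r F.
  by move=> z zC; have /andP[_ z2] := onC_nm r0 zC; apply: (@cderiv_cont _ F z (f z)); apply: DF; lra.
have c1 : ccC r (fun z => F z * (z - b)^-1) by apply: ccCM => //; exact: ccC_inv1.
have c2 := ccC_inv1 r0 br.
have c3 : ccC r (fun z => - F b * (z - b)^-1) by apply: ccCM => // z _; exact: ccont_cst.
rewrite (_ : (fun z => _) = fun z => F z * (z - b)^-1 + (- F b) * (z - b)^-1); last first.
  by apply/funext => z; rewrite mulrBl mulNr.
rewrite CintD// CintZ// kap_const// => /eqP; rewrite mulNr subr_eq0 => /eqP E.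
have -> : K r F 1 b = F b * kap r.
  by rewrite -E /K; congr Cint; apply/funext => z; rewrite expr1.
by rewrite mulrC mulfK// kap_neq0.
Qed.

Lemma cder_line f a z d : cderiv f (a + z) d -> cderiv (fun w => f (a + w)) z d.
Proof.
move=> Df; have := @cderiv_line _ f a 1 z d; rewrite !mulr1 => /(_ Df).
by apply: cderiv_ext => w; rewrite mulr1.
Qed.

Lemma cderiv_shift f a z d : cderiv (fun w => f (a + w)) z d -> cderiv f (a + z) d.
Proof.
move=> Df; have := @cder_line (fun w => f (a + w)) (- a) (a + z) d.
rewrite addKr => /(_ Df); apply: cderiv_ext => w; by rewrite addNKr.
Qed.

Lemma hol_shift (r : R) f a : hol r f -> hol (r - nm a) (fun w => f (a + w)).
Proof.
move=> fh z zr; have [d Df] : exists d, cderiv f (a + z) d.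
  by apply: fh; have := nmD a z; lra.
by exists d; exact: cder_line.
Qed.

(** Two rounds of the integral formula: applied to a primitive it shows that
    the derivative is continuous, applied to the function itself that the
    derivative is again differentiable. *)
Lemma hol_cder0 (rho : R) f : 0 < rho -> hol rho f -> exists2 r : R, 0 < r &
  (forall z, nm z < r -> ccont (cder f) z) /\ hol r (cder f).
Proof.
move=> rho0 fh; pose r := rho / 3.
have r0 : 0 < r by rewrite divr_gt0.
have rr : 2 * r < rho by rewrite /r; lra.
pose F := J f 0.
have DF z : nm z < rho -> cderiv F z (f z) by exact: hol_primitive.
have onF (s : R) z : 0 < s -> 2 * s < rho -> onC s z -> nm z < rho.
  by move=> s0 ss /(onC_nm s0) /andP[_]; lra.
have cF : ccC r F by move=> z /(onF r z r0 rr) /DF; exact: cderiv_cont.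
have bd (g : C -> C) (s s' : R) : 0 < s -> 2 * s < s' -> (forall z, nm z < s' -> ccont g z) ->
    exists M : R, forall z, onC s z -> nm (g z) <= M.
  move=> s0 ss cg; have [z zs|M _ H] := @disc_bounded R (2 * s) g.
    by apply: cg; lra.
  by exists M => z /(onC_nm s0) /andP[_]; exact: H.
have [M FM] : exists M : R, forall z, onC r z -> nm (F z) <= M.
  by apply: (bd _ _ _ r0 rr) => z /DF; exact: cderiv_cont.
have FE b : nm b < r -> F b = (kap r)^-1 * K r F 1 b.
  by apply: (cauchy_C1 r0 rr DF); exact: hol_cont.
have fE b : nm b < r -> f b = (kap r)^-1 * K r F 2 b.
  move=> br; apply: (@cderiv_uniq _ F b); first by apply: DF; lra.
  apply: (@cderiv_near _ (fun c => (kap r)^-1 * K r F 1 c) _ _ _ (r - nm b)).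
  - by rewrite subr_gt0.
  - by move=> c cb; rewrite FE//; have := nm_sub c b; lra.
  - by apply: cderivZ; exact: (K1_deriv r0 cF FM).
have Df b : nm b < r -> cderiv f b ((kap r)^-1 * (2 * K r F 3 b)).
  move=> br; apply: (@cderiv_near _ (fun c => (kap r)^-1 * K r F 2 c) _ _ _ (r - nm b)).
  - by rewrite subr_gt0.
  - by move=> c cb; rewrite fE//; have := nm_sub c b; lra.
  - by apply: cderivZ; exact: (K2_deriv r0 cF FM).
have cf' b : nm b < r -> ccont (cder f) b.
  move=> br; apply: (@ccont_near _ (fun c => (kap r)^-1 * (2 * K r F 3 c)) _ _ (r - nm b)).
  - by rewrite subr_gt0.
  - by move=> c cb; rewrite (cder_eq (Df c _))//; have := nm_sub c b; lra.
  - apply: ccontM; first exact: ccont_cst.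
    by apply: ccontM; [exact: ccont_cst|exact: (K3_cont r0 cF FM)].
pose s := r / 3.
have s0 : 0 < s by rewrite divr_gt0.
have ss : 2 * s < r by rewrite /s; lra.
have Dfc z : nm z < r -> cderiv f z (cder f z) by move=> /Df; exact: cderP.
have cfs : ccC s f by move=> z /(onC_nm s0) /andP[_ z2]; apply: (hol_cont fh); lra.
have [M' fM] : exists M : R, forall z, onC s z -> nm (f z) <= M.
  by apply: (bd _ _ _ s0 ss) => z zr; apply: (hol_cont fh); lra.
have fE1 b : nm b < s -> f b = (kap s)^-1 * K s f 1 b by apply: (cauchy_C1 s0 ss Dfc).
have fE2 b : nm b < s -> cder f b = (kap s)^-1 * K s f 2 b.
  move=> bs; apply: cder_eq.
  apply: (@cderiv_near _ (fun c => (kap s)^-1 * K s f 1 c) _ _ _ (s - nm b)).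
  - by rewrite subr_gt0.
  - by move=> c cb; rewrite fE1//; have := nm_sub c b; lra.
  - by apply: cderivZ; exact: (K1_deriv s0 cfs fM).
exists s => //; split=> b bs; first by apply: cf'; lra.
exists ((kap s)^-1 * (2 * K s f 3 b)).
apply: (@cderiv_near _ (fun c => (kap s)^-1 * K s f 2 c) _ _ _ (s - nm b)).
- by rewrite subr_gt0.
- by move=> c cb; rewrite fE2//; have := nm_sub c b; lra.
- by apply: cderivZ; exact: (K2_deriv s0 cfs fM).
Qed.

Theorem hol_der (rho : R) f : hol rho f -> hol rho (cder f).
Proof.
move=> fh z zr; have z0 : 0 < rho - nm z by rewrite subr_gt0.
have [r r0 [_ H]] := hol_cder0 z0 (hol_shift fh).
have [|d Dd] := H 0; first by rewrite nm0.
exists d; rewrite -[z]addr0; apply: cderiv_shift.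
apply: (@cderiv_near _ (cder (fun w => f (z + w))) _ _ _ (rho - nm z)) => // w.
rewrite subr0 => wr; apply: cder_eq; apply: cder_line; apply: (hol_cder fh).
by have := nmD z w; lra.
Qed.

Theorem cauchy_formula (r rho : R) f b : 0 < r -> 2 * r < rho -> hol rho f ->
  nm b < r -> f b = (kap r)^-1 * K r f 1 b.
Proof.
move=> r0 rr fh; apply: (@cauchy_C1 r rho f (cder f)) => //.
- by move=> z; exact: hol_cder.
- exact/hol_cont/hol_der.
Qed.

Lemma cauchy_bound (r rho : R) f b (M : R) : 0 < r -> 2 * r < rho -> hol rho f ->
  nm b <= r / 2 -> (forall z, r <= nm z <= 2 * r -> nm (f z) <= M) ->
  nm (f b) <= 4 * M.
Proof.
move=> r0 rr fh br fM; rewrite (cauchy_formula r0 rr fh); last by lra.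
have b1 : nm b < r by lra.
have M0 : 0 <= M by apply: le_trans (fM r%:C _); rewrite ?nmC_ge0 ?(ltW r0)//; lra.
have cf : ccC r f by move=> z /(onC_nm r0) /andP[_ z2]; apply: (hol_cont fh); lra.
have fM' z : onC r z -> nm (f z) <= M by move=> /(onC_nm r0); exact: fM.
rewrite nmM nmV mulrC ler_pdivrMr; last by apply: lt_le_trans (kap_ge r0).
apply: le_trans (Cint_bound r0 (M := M * (2 / r)) _ _) _.
- exact: ccC_K.
- move=> z zC; rewrite expr1; apply: nm_prod_le2; first exact: fM'.
  have /andP[z1 _] := onC_nm r0 zC.
  have zb : r / 2 <= nm (z - b) by have := nm_sub z b; lra.
  have h : 0 < nm (z - b) by lra.
  by rewrite nmV -[leRHS]invrK invf_div lef_pV2 ?posrE ?divr_gt0.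
have -> : 8 * r * (M * (2 / r)) = 4 * M * 4 by field; rewrite gt_eqF.
by rewrite ler_wpM2l ?mulr_ge0//; exact: kap_ge.
Qed.
End HolDer.

(** * Removable singularities and the maximum principle *)

Section MaxPrinciple.
Variable R : realType.
Local Notation C := R[i].
Implicit Types (f g F : C -> C) (a b c z w : C).

Lemma hol_le (r s : R) f : s <= r -> hol r f -> hol s f.
Proof. by move=> sr fh z zs; apply: fh; exact: lt_le_trans sr. Qed.

Lemma holB_cst (r : R) f c : hol r f -> hol r (fun z => f z - c).
Proof.
move=> fh z /fh [d Dd]; exists (d - 0); apply: cderivB => //; exact: cderiv_cst.
Qed.

Definition quot f a z : C := if z == a then cder f a else f z / (z - a).

Lemma quotE f a z : f a = 0 -> f z = (z - a) * quot f a z.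
Proof.
rewrite /quot; case: eqVneq => [-> ->|za _]; first by rewrite subrr mul0r.
by rewrite mulrC divfK// subr_eq0.
Qed.

(** Removable singularity of [f z / (z - a)], by the second order Taylor
    estimate at [a]. *)
Lemma hol_quot (r : R) f a : hol r f -> nm a < r -> f a = 0 -> hol r (quot f a).
Proof.
move=> fh ar fa z zr; have [->|za] := eqVneq z a; last first.
  have z0 : z - a != 0 by rewrite subr_eq0.
  exists (cder f z * (z - a)^-1 + f z * (- (1 - 0) / (z - a) ^+ 2)).
  apply: (@cderiv_near _ (fun w => f w * (w - a)^-1) _ _ _ (nm (z - a))).
  - by rewrite nm_gt0.
  - move=> w wz; rewrite /quot; case: eqVneq wz => // ->.
    by rewrite nmBC ltxx.
  - apply: cderivM; first exact: hol_cder fh zr.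
    by apply: cderivV => //; apply: cderivB; [exact: cderiv_id|exact: cderiv_cst].
have [d2 D2] := hol_der fh ar.
exists (d2 / 2); apply/cderivP => e e0.
have [dl dl0 H] := (cderivP _ _ _).1 D2 _ e0.
have ra : 0 < r - nm a by rewrite subr_gt0.
exists (Num.min dl (r - nm a)) => [|w]; first by rewrite lt_min dl0.
rewrite lt_min => /andP[wd wr].
have [->|wa] := eqVneq w a; first by rewrite !subrr mulr0 subrr nm0 mulr0.
have w0 : w - a != 0 by rewrite subr_eq0.
pose G v := f v - cder f a * v - d2 / 2 * ((v - a) * (v - a)).
pose G' v := cder f v - cder f a - d2 * (v - a).
have segw (t : R) : 0 <= t <= 1 -> nm (seg a w t - a) <= nm (w - a).
  by move=> t01; apply: nm_segB => //; rewrite subrr nm0.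
have : nm (G w - G a) <= e * nm (w - a) * nm (w - a).
  apply: (@cmv R G G') => t t01; last first.
    apply: le_trans (H _ _) _; first by apply: le_lt_trans (segw _ t01) wd.
    by rewrite ler_wpM2l ?(ltW e0)//; exact: segw.
  apply: cderivB.
    apply: cderivB; last by rewrite -[X in cderiv _ _ X]mulr1; exact/cderivZ/cderiv_id.
    apply: (hol_cder fh); have := segw _ t01; have := nm_sub (seg a w t) a; lra.
  set v := seg a w t; have Hv : cderiv (fun v => v - a) v (1 - 0).
    by apply: cderivB; [exact: cderiv_id|exact: cderiv_cst].
  have := cderivZ (d2 / 2) (cderivM Hv Hv).
  by rewrite (_ : d2 / 2 * _ = d2 * (v - a))//; field.
rewrite /G subrr !mulr0 subr0 fa sub0r => h.
rewrite /quot eqxx (negbTE wa).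
have -> : f w / (w - a) - cder f a - d2 / 2 * (w - a) =
  (f w - cder f a * w - d2 / 2 * ((w - a) * (w - a)) - - (cder f a * a)) / (w - a).
  by field.
by rewrite nmM nmV ler_pdivrMr ?nm_gt0.
Qed.

Lemma hol_div (r : R) f a : hol r f -> nm a < r -> f a = 0 ->
  exists2 g, hol r g & forall z, f z = (z - a) * g z.
Proof. by move=> fh ar fa; exists (quot f a) => [|z]; [exact: hol_quot|exact: quotE]. Qed.

Lemma no_local_max (r : R) f g c l : 0 < r -> c != 0 -> (0 < l)%N -> hol r g -> g 0 = c ->
  (forall z, f z = f 0 + z ^+ l * g z) -> exists2 z, nm z < r & nm (f 0) < nm (f z).
Proof.
move=> r0 c0 l0 gh g0 fE.
have cn : 0 < nm c by rewrite nm_gt0.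
have n0r : nm (0 : C) < r by rewrite nm0.
have [dl dl0 H] : exists2 dl : R, 0 < dl & forall w, nm (w - 0) < dl -> nm (g w - g 0) < nm c / 2.
  by apply: (hol_cont gh n0r); rewrite divr_gt0.
have [u un uE] : exists2 u : C, nm u = 1 & f 0 = (nm (f 0))%:C * u.
  have [v v1 vE] := unimod (f 0); exists v^-1; first by rewrite nmV v1 invr1.
  have v0 : v != 0 by rewrite -nm_gt0 v1.
  by rewrite -vE mulrC mulKf.
pose y := u * (nm c)%:C / c; pose x := l.-root y.
have xl : x ^+ l = y by rewrite rootCK.
have y1 : nm y = 1 by rewrite !nmM nmV un nmC_ge0// mul1r divff// gt_eqF.
have x1 : nm x = 1.
  by have := nmX x l; rewrite xl y1 => /esym/eqP; rewrite pexpr_eq1// => /eqP.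
pose t := Num.min dl r / 2.
have m0 : 0 < Num.min dl r by rewrite lt_min dl0.
have t0 : 0 < t by rewrite divr_gt0.
have tm : t < Num.min dl r by rewrite /t; lra.
have znm : nm (t%:C * x) = t by rewrite nmM x1 mulr1 nmC_ge0// ltW.
exists (t%:C * x); first by rewrite znm; move: tm; rewrite lt_min => /andP[].
rewrite (fE (t%:C * x)); set z := t%:C * x.
have gz : nm (g z - c) < nm c / 2.
  by rewrite -{1}g0; apply: H; rewrite subr0 znm; move: tm; rewrite lt_min => /andP[].
have -> : f 0 + z ^+ l * g z = (nm (f 0) + t ^+ l * nm c)%:C * u + z ^+ l * (g z - c).
  rewrite mulrBr rmorphD rmorphM /= mulrDl -uE /z exprMn xl rmorphXn /= /y.
  have -> : t%:C ^+ l * (u * (nm c)%:C / c) * c = t%:C ^+ l * (nm c)%:C * u by field.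
  by ring.
have tl : 0 < t ^+ l by rewrite exprn_gt0.
have A0 : 0 <= nm (f 0) + t ^+ l * nm c by rewrite addr_ge0// mulr_ge0// ltW.
have := nm_sub ((nm (f 0) + t ^+ l * nm c)%:C * u) (- (z ^+ l * (g z - c))).
rewrite opprK nmN !nmM nmX znm un mulr1 nmC_ge0//.
have : t ^+ l * nm (g z - c) < t ^+ l * (nm c / 2) by rewrite ltr_pM2l.
have : 0 < t ^+ l * nm c by rewrite mulr_gt0.
lra.
Qed.

(** Either some Taylor coefficient is non-zero and the modulus increases in a
    suitable direction, or all vanish and the Cauchy bound makes the function
    constant near the point. *)
Lemma local_max_const (r : R) f : 0 < r -> hol r f ->
  (forall z, nm z < r -> nm (f z) <= nm (f 0)) ->
  exists2 s : R, 0 < s & forall z, nm z < s -> f z = f 0.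
Proof.
move=> r0 fh fm; have n0r : nm (0 : C) < r by rewrite nm0.
have P l : exists2 g, hol r g & forall z, f z = f 0 + z ^+ l * g z.
  elim: l => [|l [g gh fE]].
    by exists (fun z => f z - f 0) => [|z]; [exact: holB_cst|rewrite mul1r addrC subrK].
  have [g0|g0] := eqVneq (g 0) 0.
    have [h hh gE] := hol_div gh n0r g0; exists h => // z.
    by rewrite fE gE subr0 exprSr mulrA.
  case: l fE => [|l] fE.
    have := fE 0; rewrite mul1r => /eqP; rewrite addrC -subr_eq subrr => /eqP g00.
    by rewrite -g00 eqxx in g0.
  have [z zr] := no_local_max r0 g0 (ltn0Sn l) gh (erefl _) fE.
  by rewrite ltNge fm.
pose s := r / 3; have s0 : 0 < s by rewrite divr_gt0.
have ss : 2 * s < r by rewrite /s; lra.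
exists (s / 2) => [|z zs]; first by rewrite divr_gt0.
apply/eqP; rewrite -subr_eq0; apply/eqP; apply: eq0_le_eps => e e0.
have [l lP] := half_small (8 * nm (f 0)) e0.
have [g gh fE] := P l.
have gM : nm (g z) <= 4 * (2 * nm (f 0) / s ^+ l).
  apply: (cauchy_bound s0 ss gh (ltW zs)) => w /andP[w1 w2].
  have w0 : 0 < nm w by lra.
  have wl : 0 < nm w ^+ l by rewrite exprn_gt0.
  have sl : 0 < s ^+ l by rewrite exprn_gt0.
  have -> : g w = (f w - f 0) / w ^+ l.
    by rewrite fE addrC addKr mulrC mulKf// expf_neq0// -nm_gt0.
  rewrite nmM nmV nmX ler_pM ?invr_ge0 ?(ltW wl)//.
    by have := nmB (f w) (f 0); have := fm w; have := nm_ge0 (f 0); lra.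
  by rewrite lef_pV2 ?posrE//; apply: lerXn2r => //; rewrite nnegrE ltW.
rewrite fE addrC addKr; apply: ltW; apply: le_lt_trans lP.
have sl : 0 < s ^+ l by rewrite exprn_gt0.
have -> : 8 * nm (f 0) * 2^-1 ^+ l = (s / 2) ^+ l * (4 * (2 * nm (f 0) / s ^+ l)).
  by rewrite exprMn; field; rewrite gt_eqF//= expf_neq0.
by apply: nm_prod_le2 => //; rewrite nmX; apply: lerXn2r; rewrite ?nnegrE// ltW// divr_gt0.
Qed.

Theorem max_principle (rho r M : R) f : 0 < r -> r < rho -> hol rho f ->
  (forall z, nm z = r -> nm (f z) <= M) -> forall z, nm z <= r -> nm (f z) <= M.
Proof.
move=> r0 rr fh fM z1 z1r; rewrite leNgt; apply/negP => fz1.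
have cf z : nm z <= r -> ccont f z by move=> zr; apply: (hol_cont fh); exact: le_lt_trans rr.
have [B _ fB] := disc_bounded cf.
pose S := [set nm (f z) | z in [set z | nm z <= r]].
have hS : has_sup S.
  by split; [exists (nm (f z1)); exists z1|exists B => _ [z zr <-]; exact: fB].
set A := sup S.
have fA z : nm z <= r -> nm (f z) <= A by move=> zr; apply: sup_upper_bound => //; exists z.
have [z2 [z2r z2A]] : exists z, nm z <= r /\ nm (f z) = A.
  apply: contrapT => /forallNP no.
  have lt z : nm z <= r -> nm (f z) < A.
    by move=> zr; rewrite lt_neqAle fA// andbT; apply/eqP => E; apply: (no z).
  have [|z zr|d d0 H] := @disc_cover R r (fun w d => nm (f w) <= A - d).
  - by move=> w d d' _ d'd /le_trans; apply; lra.
  - have e0 : 0 < (A - nm (f z)) / 2 by rewrite divr_gt0// subr_gt0 lt.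
    have [dl dl0 H] := cf _ zr _ e0; exists (Num.min dl ((A - nm (f z)) / 2)).
      by rewrite lt_min dl0.
    move=> w; rewrite lt_min => /andP[/H h _] _.
    have m : Num.min dl ((A - nm (f z)) / 2) <= (A - nm (f z)) / 2 by rewrite ge_min lexx orbT.
    by have := nm_sub (f w) (f z); lra.
  - have : A <= A - d by apply: ge_sup => [|_ [z zr <-]]; [case: hS|exact: H].
    lra.
pose S2 := [set nm z | z in [set z | nm z <= r /\ nm (f z) = A]].
have hS2 : has_sup S2.
  by split; [exists (nm z2); exists z2|exists r => _ [z [zr _] <-]].
set s := sup S2.
have sz z : nm z <= r -> nm (f z) = A -> nm z <= s.
  by move=> zr zA; apply: sup_upper_bound => //; exists z.
have [b [br bA bs]] : exists b, [/\ nm b <= r, nm (f b) = A & nm b = s].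
  apply: contrapT => /forallNP no.
  have lt z : nm z <= r -> nm (f z) = A -> nm z < s.
    by move=> zr zA; rewrite lt_neqAle sz// andbT; apply/eqP => E; apply: (no z).
  have [|z zr|d d0 H] := @disc_cover R r (fun w d => nm (f w) = A -> nm w <= s - d).
  - by move=> w d d' _ d'd H /H /le_trans; apply; lra.
  - have [zA|zA] := eqVneq (nm (f z)) A.
      have e0 : 0 < (s - nm z) / 2 by rewrite divr_gt0// subr_gt0 lt.
      by exists ((s - nm z) / 2) => // w wz _ _; have := nm_sub w z; lra.
    have e0 : 0 < A - nm (f z) by rewrite subr_gt0 lt_neqAle zA fA.
    have [dl dl0 H] := cf _ zr _ e0; exists dl => // w /H h _ wA.
    by have := nm_sub (f w) (f z); lra.
  - have : s <= s - d by apply: ge_sup => [|_ [z [zr zA] <-]]; [case: hS2|exact: H].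
    lra.
have AM : M < A by apply: lt_le_trans fz1 _; exact: fA.
have [sr|sr] := leP r s.
  have : nm b = r by apply/eqP; rewrite eq_le br bs.
  by move=> /fM; rewrite bA; lra.
have e0 : 0 < r - nm b by rewrite bs subr_gt0.
have fbh : hol (r - nm b) (fun w => f (b + w)).
  by apply: (hol_le _ (hol_shift (a := b) fh)); lra.
have [w wr|d d0 H] := local_max_const e0 fbh.
  rewrite addr0 bA; apply: fA; have := nmD b w; lra.
have [u u1 ub] : exists2 u : C, nm u = 1 & forall t : R, 0 <= t -> nm (b + t%:C * u) = nm b + t.
  have [v v1 vE] := unimod b; have v0 : v != 0 by rewrite -nm_gt0 v1.
  exists v^-1; first by rewrite nmV v1 invr1.
  move=> t t0; have -> : b + t%:C * v^-1 = (nm b + t)%:C * v^-1.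
    by rewrite rmorphD /= mulrDl -vE [v * b]mulrC mulfK.
  by rewrite nmM nmV v1 invr1 mulr1 nmC_ge0// addr_ge0.
pose t := Num.min d (r - nm b) / 2.
have m0 : 0 < Num.min d (r - nm b) by rewrite lt_min d0.
have t0 : 0 < t by rewrite divr_gt0.
have tm : t < Num.min d (r - nm b) by rewrite /t; lra.
move: tm; rewrite lt_min => /andP[td tr].
have := ub t (ltW t0); set z := b + _ => zE.
have : nm z <= s.
  apply: sz; first by lra.
  by rewrite /z H ?addr0// nmM u1 mulr1 nmC_ge0// ltW.
by rewrite zE bs; lra.
Qed.

Lemma schwarz (rho r M : R) f : 0 < r -> r < rho -> hol rho f -> f 0 = 0 ->
  (forall z, nm z = r -> nm (f z) <= M) -> forall z, nm z <= r -> nm (f z) <= M / r * nm z.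
Proof.
move=> r0 rr fh f0 fM z zr; have [|g gh gE] := hol_div fh _ f0; first by rewrite nm0; lra.
have gM w : nm w = r -> nm (g w) <= M / r.
  move=> wr; rewrite ler_pdivlMr// -wr mulrC -nmM -[w in w * _]subr0 -gE; exact: fM.
by rewrite gE subr0 nmM mulrC ler_wpM2r//; exact: (max_principle r0 rr gh gM).
Qed.

Lemma cauchy_est (rho r M : R) f : 0 < r -> r < rho -> hol rho f ->
  (forall z, nm z <= r -> nm (f z) <= M) -> nm (cder f 0) <= 2 * M / r.
Proof.
move=> r0 rr fh fM; have n0 : nm (0 : C) < rho by rewrite nm0; lra.
have fh0 := holB_cst (f 0) fh; have f00 : f 0 - f 0 = 0 by rewrite subrr.
have gh := hol_quot fh0 n0 f00.
have -> : cder f 0 = quot (fun z => f z - f 0) 0 0.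
  rewrite /quot eqxx; apply/esym/cder_eq; rewrite -[X in cderiv _ _ X]subr0.
  by apply: cderivB; [exact: hol_cder fh n0|exact: cderiv_cst].
have f0M : nm (f 0) <= M by apply: fM; rewrite nm0 ltW.
apply: (max_principle r0 rr gh); last by rewrite nm0 ltW.
move=> w wr; have w0 : w != 0 by rewrite -nm_gt0 wr.
rewrite /quot (negbTE w0) subr0 nmM nmV wr ler_pM2r ?invr_gt0//.
by have := nmB (f w) (f 0); have := fM w; rewrite wr lexx => /(_ isT); lra.
Qed.

Lemma taylor2 (rho r M : R) f : 0 < r -> r < rho -> hol rho f ->
  (forall z, nm z <= r -> nm (f z) <= M) -> forall z, nm z <= r ->
  nm (f z - f 0 - z * cder f 0) <= 4 * M / r ^+ 2 * nm z ^+ 2.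
Proof.
move=> r0 rr fh fM z zr; have n0 : nm (0 : C) < rho by rewrite nm0; lra.
have f0M : nm (f 0) <= M by apply: fM; rewrite nm0 ltW.
have f00 : f 0 - f 0 = 0 by rewrite subrr.
have [g gh gE] := hol_div (holB_cst (f 0) fh) n0 f00.
have g0 : cder f 0 = g 0.
  apply: cder_eq; have [d Dg] := gh _ n0.
  have := cderivM (cderivB (cderiv_id 0) (cderiv_cst 0 0)) Dg.
  have -> : (1 - 0) * g 0 + (id 0 - 0) * d = g 0 by rewrite !subr0 mul0r addr0 mul1r.
  move=> H; have := cderivD H (cderiv_cst (f 0) 0); rewrite addr0.
  by apply: cderiv_ext => w; rewrite -gE subrK.
have gM w : nm w <= r -> nm (g w) <= 2 * M / r.
  apply: (max_principle r0 rr gh) => v vr; have v0 : 0 < nm v by rewrite vr.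
  rewrite ler_pdivlMr// -[in X in _ * X]vr mulrC -nmM -[v in v * _]subr0 -gE.
  by have := nmB (f v) (f 0); have := fM v; rewrite vr lexx => /(_ isT); lra.
have -> : f z - f 0 - z * cder f 0 = z * (g z - g 0) by rewrite gE g0 subr0 mulrBr.
have := @schwarz rho r (4 * M / r) (fun w => g w - g 0) r0 rr (holB_cst _ gh).
rewrite subrr => /(_ erefl) H.
rewrite nmM; have -> : 4 * M / r ^+ 2 * nm z ^+ 2 = nm z * (4 * M / r / r * nm z).
  by field; rewrite gt_eqF.
rewrite ler_wpM2l//; apply: H => // w wr.
have := nmB (g w) (g 0); have := gM w; have := gM 0; rewrite nm0 wr lexx ltW// => /(_ isT) + /(_ isT).
have -> : 4 * M / r = 2 * M / r + 2 * M / r by ring.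
lra.
Qed.
End MaxPrinciple.

(** * Entire functions and their zeros *)

Section Entire.
Variable R : realType.
Local Notation C := R[i].
Implicit Types (f g F : C -> C) (a b c z w : C).

Definition entire f := forall z, exists d, cderiv f z d.

Lemma entire_hol f r : entire f -> hol r f.
Proof. by move=> fe z _; exact: fe. Qed.
Lemma hol_entire f : (forall r, hol r f) -> entire f.
Proof. by move=> fh z; apply: (fh (nm z + 1)); rewrite ltrDl. Qed.
Lemma entire_cont f z : entire f -> ccont f z.
Proof. by move=> /(_ z) [d]; exact: cderiv_cont. Qed.
Lemma entire_cder f z : entire f -> cderiv f z (cder f z).
Proof. by move=> /(_ z) [d]; exact: cderP. Qed.
Lemma entire_der f : entire f -> entire (cder f).
Proof. by move=> fe; apply: hol_entire => r; apply: hol_der; exact: entire_hol. Qed.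
Lemma entire_cst c : entire (fun=> c).
Proof. by move=> z; exists 0; exact: cderiv_cst. Qed.
Lemma entire_id : entire id.
Proof. by move=> z; exists 1; exact: cderiv_id. Qed.
Lemma entireD f g : entire f -> entire g -> entire (fun z => f z + g z).
Proof. by move=> fe ge z; have [d D] := fe z; have [d' D'] := ge z; exists (d + d'); exact: cderivD. Qed.
Lemma entireM f g : entire f -> entire g -> entire (fun z => f z * g z).
Proof.
move=> fe ge z; have [d D] := fe z; have [d' D'] := ge z.
by exists (d * g z + f z * d'); exact: cderivM.
Qed.
Lemma entireN f : entire f -> entire (fun z => - f z).
Proof. by move=> fe z; have [d D] := fe z; exists (- d); exact: cderivN. Qed.
Lemma entireB f g : entire f -> entire g -> entire (fun z => f z - g z).
Proof. by move=> fe /entireN; exact: entireD. Qed.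
Lemma entireZ c f : entire f -> entire (fun z => c * f z).
Proof. exact/entireM/entire_cst. Qed.
Lemma entireV f : entire f -> (forall z, f z != 0) -> entire (fun z => (f z)^-1).
Proof. by move=> fe f0 z; have [d D] := fe z; exists (- d / f z ^+ 2); exact: cderivV. Qed.
Lemma entire_ext f g : f =1 g -> entire f -> entire g.
Proof. by move=> fg fe z; have [d D] := fe z; exists d; exact: cderiv_ext D. Qed.
Lemma entire_line f a b : entire f -> entire (fun t => f (a + t * b)).
Proof. by move=> fe t; have [d D] := fe (a + t * b); exists (d * b); exact: cderiv_line. Qed.
Lemma entireX f n : entire f -> entire (fun z => f z ^+ n).
Proof.
move=> fe; elim: n => [|n IH]; first exact: entire_cst.
by apply: entire_ext (entireM fe IH) => z; rewrite exprS.
Qed.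
Lemma entire_sum I (s : seq I) (P : pred I) (F : I -> C -> C) :
  (forall i, P i -> entire (F i)) -> entire (fun z => \sum_(i <- s | P i) F i z).
Proof.
move=> Fe; elim: s => [|i s IH].
  by apply: entire_ext (entire_cst 0) => z; rewrite big_nil.
case Pi : (P i).
  by apply: entire_ext (entireD (Fe _ Pi) IH) => z; rewrite big_cons Pi.
by apply: entire_ext IH => z; rewrite big_cons Pi.
Qed.
Lemma entire_prod I (s : seq I) (P : pred I) (F : I -> C -> C) :
  (forall i, P i -> entire (F i)) -> entire (fun z => \prod_(i <- s | P i) F i z).
Proof.
move=> Fe; elim: s => [|i s IH].
  by apply: entire_ext (entire_cst 1) => z; rewrite big_nil.
case Pi : (P i).
  by apply: entire_ext (entireM (Fe _ Pi) IH) => z; rewrite big_cons Pi.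
by apply: entire_ext IH => z; rewrite big_cons Pi.
Qed.
Lemma entire_quot f a : entire f -> f a = 0 ->
  exists2 g, entire g & forall z, f z = (z - a) * g z.
Proof.
move=> fe fa; exists (quot f a) => [|z]; last exact: quotE.
apply: hol_entire => r; set m := Num.max r (nm a + 1).
have rm : r <= m by rewrite le_max lexx.
have am : nm a < m by rewrite lt_max ltrDl ltr01 orbT.
exact: hol_le rm (hol_quot (entire_hol fe) am fa).
Qed.
Lemma entire_bounded f (s : R) : entire f -> exists2 M : R, 0 < M & forall z, nm z <= s -> nm (f z) <= M.
Proof. by move=> fe; apply: disc_bounded => z _; exact: entire_cont. Qed.

Lemma entire_ord f z1 a : entire f -> f z1 != 0 ->
  exists l g, [/\ entire g, g a != 0 & forall z, f z = (z - a) ^+ l * g z].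
Proof.
move=> fe f1; apply: contrapT => no.
have P l : exists2 g, entire g & forall z, f z = (z - a) ^+ l * g z.
  elim: l => [|l [g ge gE]]; first by exists f => // z; rewrite mul1r.
  have [g0|g0] := eqVneq (g a) 0; last by case: no; exists l, g.
  have [h he hE] := entire_quot ge g0; exists h => // z.
  by rewrite gE hE exprSr mulrA.
move/eqP: f1; apply; apply: eq0_le_eps => e e0.
have [s sE] : exists s : R, s = 2 * nm (z1 - a) + 1 by eexists.
have s0 : 0 < s by rewrite sE; have := nm_ge0 (z1 - a); lra.
have [M M0 fM] := entire_bounded (s + nm a) fe.
have [l lP] := half_small M e0.
have [g ge gE] := P l.
have ga : entire (fun w => g (a + w)).
  by apply: entire_ext (entire_line a 1 ge) => w; rewrite mulr1.
have sl : 0 < s ^+ l by rewrite exprn_gt0.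
have ss : s < s + 1 by rewrite ltrDl.
have gM : nm (g z1) <= M / s ^+ l.
  rewrite -(subrK a z1) addrC.
  apply: (@max_principle R (s + 1) s (M / s ^+ l) (fun w => g (a + w)) s0 ss (entire_hol ga)).
    move=> w ws; rewrite ler_pdivlMr// -ws -nmX -nmM mulrC.
    have := gE (a + w); rewrite [a + w - a]addrC addKr => <-; apply: fM.
    by apply: le_trans (nmD a w) _; rewrite ws addrC.
  by rewrite sE; have := nm_ge0 (z1 - a); lra.
apply: ltW; apply: le_lt_trans lP; rewrite gE.
have -> : M * 2^-1 ^+ l = (s / 2) ^+ l * (M / s ^+ l).
  by rewrite exprMn; field; rewrite expf_neq0 ?gt_eqF.
apply: nm_prod_le2 => //; rewrite nmX; apply: lerXn2r; rewrite ?nnegrE ?divr_ge0 ?(ltW s0)//.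
by rewrite sE; lra.
Qed.

Lemma entire_isolated f z1 a : entire f -> f z1 != 0 ->
  exists2 r : R, 0 < r & forall z, nm (z - a) < r -> z != a -> f z != 0.
Proof.
move=> fe f1; have [l [g [ge ga gE]]] := entire_ord a fe f1.
have [r r0 H] := ccont_neq0 (entire_cont a ge) ga.
exists r => // z /H h za; rewrite gE mulf_neq0 ?expf_neq0 ?subr_eq0//.
by rewrite -nm_gt0; apply: le_lt_trans h; rewrite divr_ge0.
Qed.

Lemma near_point a (r : R) : 0 < r -> exists z, nm (z - a) < r /\ z != a.
Proof.
move=> r0; exists (a + (r / 2)%:C).
have E : nm (a + (r / 2)%:C - a) = r / 2 by rewrite addrC addKr nmC_ge0// divr_ge0// ltW.
rewrite -subr_eq0 -nm_gt0 E; split; lra.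
Qed.

Lemma entire_domain f g : entire f -> entire g -> (forall z, f z * g z = 0) ->
  (forall z, f z = 0) \/ (forall z, g z = 0).
Proof.
move=> fe ge fg; have [|/existsNP [z1 /eqP f1]] := pselect (forall z, f z = 0); first by left.
right=> z2; apply: contrapT => /eqP g2.
have [r r0 H] := entire_isolated z2 fe f1; have [s s0 H'] := entire_isolated z2 ge g2.
have m0 : 0 < Num.min r s by rewrite lt_min r0.
have [z [+ zz]] := near_point z2 m0; rewrite lt_min => /andP[/H/(_ zz) fz /H'/(_ zz) gz].
by have := fg z; apply/eqP; rewrite mulf_neq0.
Qed.

Lemma entire_prod_neq0 (I : eqType) (s : seq I) (F : I -> C -> C) :
  (forall i, i \in s -> entire (F i)) -> (forall i, i \in s -> exists z, F i z != 0) ->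
  exists z, \prod_(i <- s) F i z != 0.
Proof.
elim: s => [|i s IH] Fe F0; first by exists 0; rewrite big_nil oner_neq0.
have [z1 h1] := F0 i (mem_head _ _).
have [|k ks|z2 h2] := IH; first by move=> k ks; apply: Fe; rewrite inE ks orbT.
  by apply: F0; rewrite inE ks orbT.
apply: contrapT => /forallNP no.
have pe : entire (fun z => \prod_(i <- s) F i z).
  rewrite (_ : (fun z => _) = (fun z => \prod_(i <- s | i \in s) F i z)).
    by apply: entire_prod => k ks; apply: Fe; rewrite inE ks orbT.
  by apply/funext => z; rewrite big_seq.
have [|H|H] := entire_domain (Fe i (mem_head _ _)) pe.
- by move=> z; have /negP := no z; rewrite big_cons negbK => /eqP.
- by rewrite H eqxx in h1.
- by rewrite H eqxx in h2.
Qed.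

Lemma zeros_count f g (l : seq C) (s M : R) z1 : 0 < s -> entire g ->
  (forall z, f z = \prod_(b <- l) (z - b) * g z) -> (forall b, b \in l -> nm b < s) ->
  nm z1 <= s -> (forall z, nm z <= 5 * s -> nm (f z) <= M) ->
  2 ^+ size l * nm (f z1) <= M.
Proof.
move=> s0 ge fE ls z1s fM.
have gM : nm (g z1) <= M / (4 * s) ^+ size l.
  have s5 : 0 < 5 * s by lra.
  have s51 : 5 * s < 5 * s + 1 by lra.
  apply: (@max_principle R (5 * s + 1) (5 * s) (M / (4 * s) ^+ size l) g s5 s51 (entire_hol ge)); last by lra.
    move=> w ws; rewrite ler_pdivlMr ?exprn_gt0 ?mulr_gt0// mulrC.
    apply: le_trans (fM w _); last by rewrite ws.
    rewrite fE nmM ler_wpM2r// nm_prod.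
    have : forall b, b \in l -> 4 * s <= nm (w - b).
      by move=> b /ls bs; have := nm_sub w b; lra.
    elim: l {fE ls} => [|b l IH] H; first by rewrite big_nil.
    rewrite big_cons /= exprS ler_pM ?mulr_ge0 ?exprn_ge0 ?mulr_ge0 ?(ltW s0)//.
      by apply: H; rewrite mem_head.
    by apply: IH => c cl; apply: H; rewrite inE cl orbT.
have pM : nm (\prod_(b <- l) (z1 - b)) <= (2 * s) ^+ size l.
  rewrite nm_prod.
  have : forall b, b \in l -> nm (z1 - b) <= 2 * s.
    by move=> b /ls bs; have := nmB z1 b; lra.
  elim: l {fE ls gM} => [|b l IH] H; first by rewrite big_nil.
  rewrite big_cons /= exprS ler_pM ?prodr_ge0//; first by apply: H; rewrite mem_head.
  by apply: IH => c cl; apply: H; rewrite inE cl orbT.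
have := nm_prod_le2 pM gM; rewrite -fE => /(ler_wpM2l (exprn_ge0 (size l) (ler0n R 2))).
move/le_trans; apply; rewrite !exprMn.
have -> : 2 ^+ size l * (2 ^+ size l * s ^+ size l * (M / (4 ^+ size l * s ^+ size l))) =
  M * ((2 * 2) ^+ size l / 4 ^+ size l).
  by rewrite exprMn; field; rewrite !expf_neq0 ?gt_eqF// pnatr_eq0.
by rewrite (_ : 2 * 2 = 4) ?divff ?mulr1// ?expf_neq0// -natrM.
Qed.

Lemma extract_uniq f (l : seq C) : entire f -> uniq l -> (forall b, b \in l -> f b = 0) ->
  exists2 g, entire g & forall z, f z = \prod_(b <- l) (z - b) * g z.
Proof.
elim: l f => [|b l IH] f fe; first by exists f => // z; rewrite big_nil mul1r.
move=> /= /andP[bl ul] H; have [g ge gE] := entire_quot fe (H b (mem_head _ _)).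
have [c cl|h he hE] := IH g ge ul.
  have := H c; rewrite inE cl orbT => /(_ isT) /eqP; rewrite gE mulf_eq0 subr_eq0.
  by case/orP => /eqP // cb; rewrite -cb cl in bl.
by exists h => // z; rewrite gE hE big_cons mulrA.
Qed.

Lemma extract_zeros f (s : R) z0 : 0 < s -> entire f -> f z0 != 0 ->
  exists l g, [/\ entire g, forall z, f z = \prod_(b <- l) (z - b) * g z,
    forall b, b \in l -> nm b < s & forall z, nm z < s -> g z != 0].
Proof.
move=> s0 fe f0.
have [z1 z1s f1] : exists2 z1, nm z1 <= s & f z1 != 0.
  have [r r0 H] := entire_isolated 0 fe f0.
  have m0 : 0 < Num.min r s by rewrite lt_min r0.
  have [z [+ zz]] := near_point 0 m0; rewrite subr0 lt_min => /andP[zr zs].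
  by exists z; [exact: ltW|apply: H; rewrite ?subr0].
have [M M0 fM] := entire_bounded (5 * s) fe.
have f1p : 0 < nm (f z1) by rewrite nm_gt0.
apply: contrapT => no.
have P n : exists l g, [/\ entire g, forall z, f z = \prod_(b <- l) (z - b) * g z,
    forall b, b \in l -> nm b < s & size l = n].
  elim: n => [|n [l [g [ge gE ls sl]]]].
    by exists [::], f; split=> // z; rewrite big_nil mul1r.
  have [H|/existsNP [b /not_implyP [bs /negP]]] :=
      pselect (forall z, nm z < s -> g z != 0); first by case: no; exists l, g.
  rewrite negbK => /eqP gb; have [h he hE] := entire_quot ge gb.
  exists (b :: l), h; split=> //.
  - by move=> z; rewrite gE hE big_cons; ring.
  - by move=> c; rewrite inE => /predU1P[->//|]; exact: ls.
  - by rewrite /= sl.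
have [n nP] := half_small M f1p.
have [l [g [ge gE ls sl]]] := P n.
have := zeros_count s0 ge gE ls z1s fM; rewrite sl.
have p2 : 0 < (2 : R) ^+ n by rewrite exprn_gt0.
by rewrite exprVn ltr_pdivrMr// in nP; rewrite mulrC; lra.
Qed.
End Entire.

(** * Exponential, logarithm and Harnack estimates *)

Section ExpLog.
Variable R : realType.
Local Notation C := R[i].
Implicit Types (f g F : C -> C) (a b c z w : C).

Lemma is_derive_epsP (u : R -> R) (t c : R) : is_derive t (1 : R) u c ->
  forall e : R, 0 < e -> exists2 dl : R, 0 < dl &
    forall s, `|s| < dl -> `|u (t + s) - u t - c * s| <= e * `|s|.
Proof.
move=> [D E] e e0.
have cv : (fun h : R => h^-1 *: (u (h *: 1 + t) - u t)) @ 0^' --> c by rewrite -E.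
move/cvgrPdist_le : cv => /(_ _ e0); rewrite near_withinE => /nbhs_ballP [dl dl0 H].
exists dl => // s sd; have [->|s0] := eqVneq s 0.
  by rewrite addr0 subrr mulr0 subr0 normr0 mulr0.
have := H s; rewrite /ball /= sub0r normrN => /(_ sd s0).
rewrite [s *: 1](_ : _ = s); last by rewrite /GRing.scale /= mulr1.
have -> : c - s^-1 *: (u (s + t) - u t) = - (s^-1 * (u (t + s) - u t - c * s)).
  by rewrite addrC /GRing.scale /= (addrC t); field.
by rewrite normrN normrM normfV mulrC ler_pdivrMr ?normr_gt0.
Qed.

Definition cexp z : C := (expR (Re z))%:C * (cos (Im z) +i* sin (Im z)).

Lemma cexpD z w : cexp (z + w) = cexp z * cexp w.
Proof.
rewrite /cexp ReD ImD expRD cosD sinD rmorphM /=.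
by apply: eqC; rewrite !(ReM, ImM) /=; ring.
Qed.

Lemma cexp0 : cexp 0 = 1.
Proof.
by rewrite /cexp /= expR0 cos0 sin0; apply: eqC; rewrite !(ReM, ImM) /=; ring.
Qed.

Lemma nm_cexp z : nm (cexp z) = expR (Re z).
Proof.
rewrite /cexp nmM nmC_ge0 ?expR_ge0// /nm /= cos2Dsin2 sqrtr1 mulr1 //.
Qed.

Lemma cexp_neq0 z : cexp z != 0.
Proof. by rewrite -nm_gt0 nm_cexp expR_gt0. Qed.

Lemma cderiv_cexp0 : cderiv cexp 0 1.
Proof.
apply/cderivP => e e0; have e1 : 0 < e / 8 by lra.
have [d1 d10 H1] := is_derive_epsP (is_derive_expR (0 : R)) e1.
have [d2 d20 H2] := is_derive_epsP (is_derive_cos (0 : R)) e1.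
have [d3 d30 H3] := is_derive_epsP (is_derive_sin (0 : R)) e1.
exists (Num.min (Num.min d1 d2) (Num.min d3 (Num.min 1 (e / 8)))) => [|w].
  by rewrite !lt_min d10 d20 d30 ltr01.
rewrite subr0 !lt_min => /andP[/andP[w1 w2] /and3P[w3 w4 w5]].
have [xw yw] := (nm_Re w, nm_Im w).
set x := Re w in xw *; set y := Im w in yw *.
have := H1 x (le_lt_trans xw w1); have := H2 y (le_lt_trans yw w2).
have := H3 y (le_lt_trans yw w3).
rewrite !add0r expR0 cos0 sin0 oppr0 mul0r !subr0 !addr0 !mul1r => hs hc he.
rewrite cexp0 ?mul1r; apply: le_trans (nm_le _) _.
have -> : Re (cexp w - 1 - w) = (expR x - 1 - x) * cos y + (1 + x) * (cos y - 1).
  by rewrite !ReD !ReN /cexp ReM /= -/x -/y; ring.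
have -> : Im (cexp w - 1 - w) = (expR x - 1 - x) * sin y + (1 + x) * (sin y - y) + x * y.
  by rewrite !ImD !ImN /cexp ImM /= -/x -/y; ring.
have c1 : `|cos y| <= 1 by rewrite ler_norml cos_geN1 cos_le1.
have s1 : `|sin y| <= 1 by rewrite ler_norml sin_geN1 sin_le1.
have x1 : `|1 + x| <= 2.
  by apply: le_trans (ler_normD _ _) _; rewrite normr1; lra.
have n0 := nm_ge0 w.
have p (a b a' b' : R) : `|a| <= a' -> `|b| <= b' -> `|a * b| <= a' * b'.
  by move=> ha hb; rewrite normrM ler_pM.
have e8 : 0 <= e / 8 by lra.
have hx : e / 8 * `|x| <= e / 8 * nm w by rewrite ler_wpM2l.
have hy : e / 8 * `|y| <= e / 8 * nm w by rewrite ler_wpM2l.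
have t1 := p _ _ _ _ (le_trans he hx) c1.
have t2 := p _ _ _ _ x1 (le_trans hc hy).
have t3 := p _ _ _ _ (le_trans he hx) s1.
have t4 : `|(1 + x) * (sin y - y)| <= 2 * (e / 8 * nm w).
  exact: p x1 (le_trans hs hy).
have t5 : `|x * y| <= e / 8 * nm w.
  exact: p (le_trans xw (ltW w5)) yw.
have en0 : 0 <= e * nm w by rewrite mulr_ge0// ltW.
have := ler_normD ((expR x - 1 - x) * cos y) ((1 + x) * (cos y - 1)).
have := ler_normD ((expR x - 1 - x) * sin y + (1 + x) * (sin y - y)) (x * y).
have := ler_normD ((expR x - 1 - x) * sin y) ((1 + x) * (sin y - y)).
lra.
Qed.

Lemma cderiv_cexp z : cderiv cexp z (cexp z).
Proof.
rewrite -[X in cderiv _ X _]addr0; apply: cderiv_shift.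
have := cderivZ (cexp z) cderiv_cexp0; rewrite mulr1.
by apply: cderiv_ext => w; rewrite cexpD.
Qed.

Lemma hol_const (r : R) f : (forall z, nm z < r -> cderiv f z 0) ->
  forall z, nm z < r -> f z = f 0.
Proof.
move=> Df z zr; have := @cmv R f (fun=> 0) 0 z 0.
rewrite mul0r => H; apply/eqP; rewrite -subr_eq0 -nm_eq0 eq_le nm_ge0 andbT.
apply: H => t t01; last by rewrite nm0.
by apply: Df; apply: le_lt_trans zr; apply: nm_seg => //; rewrite nm0.
Qed.

Definition lder f z := cder f z / f z.

Lemma hol_log (r : R) f : hol r f -> (forall z, nm z < r -> f z != 0) ->
  let g := J (lder f) 0 in
  [/\ forall z, nm z < r -> cderiv g z (lder f z), g 0 = 0 &
      forall z, nm z < r -> f z = f 0 * cexp (g z)].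
Proof.
move=> fh f0 g.
have lh : hol r (lder f).
  move=> z zr; have [d D] := hol_der fh zr.
  exists (d * (f z)^-1 + cder f z * (- cder f z / f z ^+ 2)).
  by apply: cderivM => //; apply: cderivV; [exact: hol_cder fh zr|exact: f0].
have Dg z : nm z < r -> cderiv g z (lder f z) by exact: hol_primitive.
have g0 : g 0 = 0 by rewrite /g /J subrr mul0r.
split=> // z zr.
have H w : nm w < r -> cderiv (fun v => f v * cexp (- g v)) w 0.
  move=> wr; have D1 := cderiv_comp (cderivN (Dg w wr)) (cderiv_cexp (- g w)).
  have := cderivM (hol_cder fh wr) D1.
  suff -> : cder f w * cexp (- g w) + f w * (cexp (- g w) * - lder f w) = 0 by [].
  by rewrite /lder; field; exact: f0.
have := hol_const H zr; rewrite g0 oppr0 cexp0 mulr1 => <-.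
by rewrite -mulrA -cexpD addNr cexp0 mulr1.
Qed.

(** Borel-Caratheodory, by the Schwarz lemma for [g / (2 A - g)]. *)
Lemma borel_caratheodory (r s A : R) g : 0 < s -> s < r -> hol r g -> g 0 = 0 -> 0 < A ->
  (forall z, nm z < r -> Re (g z) <= A) ->
  forall z, nm z < s -> nm (g z) * (s - nm z) <= 2 * A * nm z.
Proof.
move=> s0 sr gh g0 A0 gA z zs.
pose h w := g w / ((2 * A)%:C - g w).
have den w : nm w < r -> (2 * A)%:C - g w != 0.
  move=> /gA ga; rewrite -nm_gt0; apply: lt_le_trans (Re_le_nm _).
  by rewrite ReD ReN /=; lra.
have hh : hol r h.
  move=> w wr; have [d D] := gh w wr.
  exists (d * ((2 * A)%:C - g w)^-1 + g w * (- (0 - d) / ((2 * A)%:C - g w) ^+ 2)).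
  apply: cderivM => //; apply: cderivV; last exact: den.
  by apply: cderivB => //; exact: cderiv_cst.
have h1 w : nm w < r -> nm (h w) <= 1.
  move=> wr; rewrite nmM nmV ler_pdivrMr ?nm_gt0 ?den// mul1r.
  rewrite -(ler_pXn2r (n := 2)) ?nnegrE// !nm_sqr !(ReD, ImD, ReN, ImN) /=.
  by have := gA _ wr; nra.
have h0 : h 0 = 0 by rewrite /h g0 mul0r.
have zr : nm z < r by apply: lt_trans sr.
have hz : nm (h z) <= 1 / s * nm z.
  apply: (schwarz s0 sr hh h0) (ltW zs) => w ws; apply: h1; by rewrite ws.
have E : g z * (1 + h z) = (2 * A)%:C * h z.
  by have := den _ zr; rewrite /h; move: (2 * A)%:C (g z) => x y xy; field.
have gz : nm (g z) * (1 - nm z / s) <= 2 * A * (nm z / s).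
  have -> : 2 * A * (nm z / s) = 2 * A * (1 / s * nm z) by ring.
  apply: le_trans (_ : nm (g z * (1 + h z)) <= _).
    rewrite nmM ler_wpM2l//.
    by have := nm_sub 1 (- h z); rewrite opprK nm1 nmN; lra.
  rewrite E nmM nmC_ge0 ?mulr_ge0 ?(ltW A0)// ler_wpM2l//; first by rewrite mulr_ge0// ltW.
have := ler_wpM2r (ltW s0) gz.
have -> : nm (g z) * (1 - nm z / s) * s = nm (g z) * (s - nm z) by field; rewrite gt_eqF.
by have -> : 2 * A * (nm z / s) * s = 2 * A * nm z by field; rewrite gt_eqF.
Qed.

(** Harnack: a bounded zero-free function cannot be small away from the
    boundary unless it is small at the centre. *)
Lemma harnack (r s Y : R) B : 0 < s -> s < r -> hol r B -> (forall z, nm z < r -> B z != 0) ->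
  (forall z, nm z < r -> nm (B z) <= expR Y) ->
  forall z, nm z < s -> (ln (nm (B 0)) - ln (nm (B z))) * (s - nm z) <=
    2 * (Y - ln (nm (B 0)) + 1) * nm z.
Proof.
move=> s0 sr Bh B0 BY z zs; have r0 : 0 < r by lra.
have [Dg g0 gE] := hol_log Bh B0; set g := J _ _ in Dg g0 gE.
have gh : hol r g by move=> w /Dg D; exists (lder B w).
have n0 : nm (0 : C) < r by rewrite nm0.
have b0 : 0 < nm (B 0) by rewrite nm_gt0 B0.
have lnE w : nm w < r -> ln (nm (B w)) = ln (nm (B 0)) + Re (g w).
  by move=> wr; rewrite gE// nmM nm_cexp lnM ?posrE ?expR_gt0// expRK.
have lnY w : nm w < r -> ln (nm (B w)) <= Y.
  by move=> wr; rewrite -[Y]expRK ler_ln ?posrE ?expR_gt0 ?nm_gt0 ?B0//; exact: BY.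
have A0 : 0 < Y - ln (nm (B 0)) + 1 by have := lnY _ n0; lra.
have gA w : nm w < r -> Re (g w) <= Y - ln (nm (B 0)) + 1.
  by move=> wr; have := lnY _ wr; rewrite lnE//; lra.
apply: le_trans (borel_caratheodory s0 sr gh g0 A0 gA zs).
apply: ler_wpM2r; first by lra.
rewrite (lnE z); last by lra.
by have := nm_Re (g z); rewrite ler_norml => /andP[h1 h2]; lra.
Qed.
End ExpLog.

(** * Linear relations between zero-free entire functions *)

Section Borel1.
Variable R : realType.
Local Notation C := R[i].
Implicit Types (f g P Q : C -> C) (a b c z w : C).

Definition nz f := exists z, f z != 0.

Lemma nzN f : ~ nz f -> forall z, f z = 0.
Proof. by move=> /forallNP H z; apply/eqP; rewrite -[_ == _]negbK; apply/negP/H. Qed.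

Lemma nzM f g : entire f -> entire g -> nz f -> nz g -> nz (fun z => f z * g z).
Proof.
move=> fe ge [z fz] [w gw]; apply: contrapT => /nzN /(entire_domain fe ge) [] H.
  by rewrite H eqxx in fz.
by rewrite H eqxx in gw.
Qed.

Lemma cder_prod f g z : entire f -> entire g ->
  cder (fun w => f w * g w) z = cder f z * g z + f z * cder g z.
Proof. by move=> fe ge; apply/cder_eq/cderivM; exact: entire_cder. Qed.

Lemma cderiv_sum (I : Type) (s : seq I) (p : pred I) (F d : I -> C -> C) z :
  (forall i, p i -> cderiv (F i) z (d i z)) ->
  cderiv (fun w => \sum_(i <- s | p i) F i w) z (\sum_(i <- s | p i) d i z).
Proof.
move=> H; elim: s => [|i s IH].
  by rewrite big_nil; apply: cderiv_ext (cderiv_cst 0 z) => w; rewrite big_nil.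
rewrite big_cons; case pi : (p i).
  by apply: cderiv_ext (cderivD (H _ pi) IH) => w; rewrite big_cons pi.
by apply: cderiv_ext IH => w; rewrite big_cons pi.
Qed.

Lemma entire_lder f : entire f -> (forall z, f z != 0) -> entire (lder f).
Proof. by move=> fe f0; exact: entireM (entire_der fe) (entireV fe f0). Qed.

Lemma entire_log f : entire f -> (forall z, f z != 0) ->
  exists g, [/\ entire g, g 0 = 0, cder g = lder f & forall z, f z = f 0 * cexp (g z)].
Proof.
move=> fe f0; exists (J (lder f) 0).
have H r := @hol_log R r f (entire_hol fe) (fun z _ => f0 z).
have zz z : nm z < nm z + 1 by rewrite ltrDl.
have D z : cderiv (J (lder f) 0) z (lder f z) by have [+ _ _] := H (nm z + 1); exact.
split=> [z||| z]; first by exists (lder f z).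
- by have [_ -> _] := H 1.
- by apply/funext => z; exact: cder_eq.
- by have [_ _] := H (nm z + 1); apply.
Qed.

(** The quotient has derivative zero where it is defined. *)
Lemma wronskian2 P Q : entire P -> entire Q -> nz Q ->
  (forall z, cder P z * Q z = P z * cder Q z) -> exists c, forall z, P z = c * Q z.
Proof.
move=> Pe Qe [z0 Q0] W; exists (P z0 / Q z0).
have [r r0 Qr] := ccont_neq0 (entire_cont z0 Qe) Q0.
have Q1 w : nm w < r -> Q (z0 + w) != 0.
  move=> wr; rewrite -nm_gt0; apply: le_lt_trans (Qr _ _); first by rewrite divr_ge0.
  by rewrite addrC addKr.
have sh f w : entire f -> cderiv (fun w => f (z0 + w)) w (cder f (z0 + w)).
  by move=> fe; apply: cder_line; exact: entire_cder.
have H w : nm w < r -> cderiv (fun w => P (z0 + w) * (Q (z0 + w))^-1) w 0.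
  move=> wr; have := cderivM (sh P w Pe) (cderivV (sh Q w Qe) (Q1 _ wr)).
  congr cderiv; have := W (z0 + w); have := Q1 _ wr.
  move: (P _) (Q _) (cder P _) (cder Q _) => p q p' q' q0 E.
  transitivity ((p' * q - p * q') / q ^+ 2); first by field.
  by rewrite E subrr mul0r.
apply: contrapT => /existsNP [z1 /eqP].
rewrite -subr_eq0 => n1; have De := entireB Pe (entireZ (P z0 / Q z0) Qe).
have [s s0 Ds] := entire_isolated z0 De n1.
have m0 : 0 < Num.min r s by rewrite lt_min r0.
have [w []] := near_point z0 m0; rewrite lt_min => /andP[wr ws] wz.
have := Ds _ ws wz; have := hol_const H wr.
rewrite addr0 addrC subrK => <-.
by rewrite divfK ?subrr ?eqxx// -(subrK z0 w) addrC Q1.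
Qed.

Section Relation.
Variables (I : finType) (A : {set I}) (u : I -> C -> C).
Hypothesis ue : forall i, entire (u i).
Hypothesis u0 : forall i z, u i z != 0.

(** The coefficients produced from constants by differentiating quotients of
    the [u i]; what matters is that their growth is controlled by that of the
    logarithms of the [u i]. *)
Inductive dcoef : (C -> C) -> Prop :=
| dcoef_cst c : dcoef (fun=> c)
| dcoef_l i : i \in A -> dcoef (lder (u i))
| dcoefD f g : dcoef f -> dcoef g -> dcoef (fun z => f z + g z)
| dcoefM f g : dcoef f -> dcoef g -> dcoef (fun z => f z * g z)
| dcoef_der f : dcoef f -> dcoef (cder f).

Lemma dcoef_entire f : dcoef f -> entire f.
Proof.
elim=> [c|i _|g h _ ge _ he|g h _ ge _ he|g _ ge].
- exact: entire_cst.
- exact: entire_lder.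
- exact: entireD.
- exact: entireM.
- exact: entire_der.
Qed.

Lemma dcoefZ c f : dcoef f -> dcoef (fun z => c * f z).
Proof. exact/dcoefM/dcoef_cst. Qed.

Lemma dcoefB f g : dcoef f -> dcoef g -> dcoef (fun z => f z - g z).
Proof.
move=> fd gd; rewrite (_ : (fun z => _) = (fun z => f z + -1 * g z)).
  exact/dcoefD/dcoefZ.
by apply/funext => z; rewrite mulN1r.
Qed.

Lemma dcoef_sum (p : pred I) (F : I -> C -> C) : (forall i, p i -> dcoef (F i)) ->
  dcoef (fun z => \sum_(i | p i) F i z).
Proof.
move=> H; elim: (index_enum I) => [|i s IH].
  rewrite (_ : (fun z => _) = (fun=> 0)); first exact: dcoef_cst.
  by apply/funext => z; rewrite big_nil.
case pi : (p i); last first.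
  by move: IH; congr dcoef; apply/funext => z; rewrite big_cons pi.
move: (dcoefD (H _ pi) IH); congr dcoef; by apply/funext => z; rewrite big_cons pi.
Qed.

Lemma dcoef_prod (p : pred I) (F : I -> C -> C) : (forall i, p i -> dcoef (F i)) ->
  dcoef (fun z => \prod_(i | p i) F i z).
Proof.
move=> H; elim: (index_enum I) => [|i s IH].
  rewrite (_ : (fun z => _) = (fun=> 1)); first exact: dcoef_cst.
  by apply/funext => z; rewrite big_nil.
case pi : (p i); last first.
  by move: IH; congr dcoef; apply/funext => z; rewrite big_cons pi.
move: (dcoefM (H _ pi) IH); congr dcoef; by apply/funext => z; rewrite big_cons pi.
Qed.

Definition comm i j := exists P Q, [/\ dcoef P, dcoef Q, nz P, nz Q &
  forall z, Q z * u i z = P z * u j z].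

(** Dividing a relation by one of its terms and differentiating shortens it. *)
Lemma dcoef_elim n (b : I -> C -> C) :
  (#|[set i in A | `[< nz (b i) >]]| <= n)%N -> (forall i, i \in A -> dcoef (b i)) ->
  (forall z, \sum_(i in A) b i z * u i z = 0) -> (exists2 i, i \in A & nz (b i)) ->
  exists i j, [/\ i \in A, j \in A, i != j, comm i j & nz (b i) /\ nz (b j)].
Proof.
elim: n b => [|n IH] b bn bd bS [r rA br].
  move: bn; rewrite leqn0 cards_eq0 => /eqP /setP /(_ r).
  by rewrite !inE rA /=; move/negbT/asboolPn.
pose bs i z := cder (b i) z * b r z - b i z * cder (b r) z +
  b i z * b r z * (lder (u i) z - lder (u r) z).
have be i : i \in A -> entire (b i) by move/bd/dcoef_entire.
have bsd i : i \in A -> dcoef (bs i).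
  move=> iA; apply: dcoefD.
    by apply: dcoefB; apply: dcoefM; try (apply: dcoef_der); exact: bd.
  by apply: dcoefM; [apply: dcoefM; exact: bd|apply: dcoefB; exact: dcoef_l].
have lu i z : lder (u i) z * u i z = cder (u i) z by rewrite /lder divfK.
have dS z : \sum_(i in A) (cder (b i) z * u i z + b i z * cder (u i) z) = 0.
  have := @cderiv_sum _ (index_enum I) (mem A) (fun i z => b i z * u i z)
    (fun i z => cder (b i) z * u i z + b i z * cder (u i) z) z.
  move=> H; apply: (cderiv_uniq (H _)) => [i iA|].
    by apply: cderivM; apply: entire_cder; [exact: be|exact: ue].
  by apply: cderiv_ext (cderiv_cst 0 z) => w; rewrite bS.
have bsS z : \sum_(i in A) bs i z * u i z = 0.
  transitivity (b r z * \sum_(i in A) (cder (b i) z * u i z + b i z * cder (u i) z) -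
    (cder (b r) z + b r z * lder (u r) z) * \sum_(i in A) b i z * u i z).
    rewrite !mulr_sumr -sumrB; apply: eq_bigr => i _; rewrite -(lu i) /bs.
    move: (cder _ z) (cder _ z) (lder _ z) (lder _ z) (b _ z) (b _ z) (u i z).
    by move=> *; ring.
  by rewrite dS bS !mulr0 subrr.
have bs0 i z : ~ nz (b i) -> bs i z = 0.
  move=> bi; have b0 := nzN bi.
  have c0 : cder (b i) z = 0.
    by apply/cder_eq/(cderiv_ext _ (cderiv_cst 0 z)) => w; rewrite b0.
  by rewrite /bs b0 c0; ring.
have bsr z : bs r z = 0 by rewrite /bs; ring.
have [[i iA bi]|no] := pselect (exists2 i, i \in A & nz (bs i)).
  have [||i1 [j1 [H1 H2 H3 H4 [H5 H6]]]] := IH bs _ bsd bsS; last first.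
  - exists i1, j1; split=> //; split; apply: contrapT => h.
      by case: H5 => z; rewrite bs0 ?eqxx.
    by case: H6 => z; rewrite bs0 ?eqxx.
  - by exists i.
  rewrite -ltnS; apply: leq_trans bn; apply: proper_card; apply/properP; split.
    apply/fintype.subsetP => j; rewrite !inE => /andP[-> /asboolP [z jz]] /=.
    apply/asboolP; apply: contrapT => h; by rewrite (bs0 _ z h) eqxx in jz.
  exists r; rewrite !inE rA /=; first exact/asboolP.
  by apply/asboolPn => -[z]; rewrite bsr eqxx.
have [i [iA ir bi]] : exists i, [/\ i \in A, i != r & nz (b i)].
  apply: contrapT => /forallNP H; case: br => z /eqP; apply.
  have := bS z; rewrite (bigD1 r)//= big1 ?addr0.
    by move/eqP; rewrite mulf_eq0 (negPf (u0 r z)) orbF => /eqP.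
  move=> i /andP[iA ir]; have /nzN -> : ~ nz (b i) by move=> bi; apply: (H i).
  by rewrite mul0r.
exists i, r; split=> //.
have [||||c cE] := @wronskian2 (fun z => b i z * u i z) (fun z => b r z * u r z).
- exact/entireM/ue/be.
- exact/entireM/ue/be.
- by case: br => z bz; exists z; rewrite mulf_neq0.
- move=> z; rewrite !cder_prod; try exact: ue; try exact: be.
  have /nzN/(_ z) : ~ nz (bs i) by move=> H; apply: no; exists i.
  rewrite /bs -!lu.
  move: (cder (b i) z) (cder (b r) z) (lder (u i) z) (lder (u r) z) (b i z) (b r z) (u i z) (u r z).
  move=> b1 b2 l1 l2 x y s t E.
  apply/eqP; rewrite -subr_eq0; apply/eqP.
  transitivity ((b1 * y - x * b2 + x * y * (l1 - l2)) * (s * t)); first by ring.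
  by rewrite E mul0r.
have c0 : c != 0.
  by apply/eqP => c0; case: bi => z /eqP; apply; apply/eqP;
     rewrite -(mulIr_eq0 _ (mulIf (u0 i z))) cE c0 mul0r.
exists (fun z => c * b r z), (b i); split=> //.
- by apply: dcoefZ; exact: bd.
- exact: bd.
- by case: br => z bz; exists z; rewrite mulf_neq0.
- by move=> z; rewrite cE mulrA.
Qed.

Lemma comm_refl i : comm i i.
Proof.
by exists (fun=> 1), (fun=> 1); split=> //; try exact: dcoef_cst; exists 0; exact: oner_neq0.
Qed.
Lemma comm_sym i j : comm i j -> comm j i.
Proof. by move=> [P [Q [Pd Qd P0 Q0 E]]]; exists Q, P; split. Qed.
Lemma comm_trans i j k : comm i j -> comm j k -> comm i k.
Proof.
move=> [P [Q [Pd Qd P0 Q0 E]]] [P' [Q' [Pd' Qd' P0' Q0' E']]].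
exists (fun z => P z * P' z), (fun z => Q' z * Q z); split; try exact: dcoefM.
- by apply: nzM => //; exact: dcoef_entire.
- by apply: nzM => //; exact: dcoef_entire.
by move=> z; rewrite -mulrA E mulrCA E' mulrA.
Qed.

(** In a minimal linear relation all terms are commensurable: otherwise collect
    the terms of each class into one and shorten. *)
Lemma minimal_comm (c : I -> C) : (forall i, i \in A -> c i != 0) ->
  (forall z, \sum_(i in A) c i * u i z = 0) ->
  (forall d : I -> C, (forall z, \sum_(i in A) d i * u i z = 0) ->
     (exists2 i, i \in A & d i = 0) -> forall i, i \in A -> d i = 0) ->
  forall i j, i \in A -> j \in A -> comm i j.
Proof.
move=> c0 cS cmin; pose rho i := odflt i [pick j in A | `[< comm j i >]].
have rhoA i : i \in A -> rho i \in A.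
  by move=> iA; rewrite /rho; case: pickP => [j /andP[]|].
have rhoC i : comm i (rho i).
  rewrite /rho; case: pickP => [j /andP[_ /asboolP]|_] /=; first exact: comm_sym.
  exact: comm_refl.
have rhoE i j : i \in A -> comm i j -> rho i = rho j.
  move=> iA ij; rewrite /rho (eq_pick (Q := fun k => (k \in A) && `[< comm k j >])).
    by case: pickP => //= /(_ i); rewrite iA /=; move/asboolP: ij => ->.
  move=> k /=; congr (_ && _); apply/asboolP/asboolP => h; first exact: comm_trans h ij.
  exact: comm_trans h (comm_sym ij).
have /choice [PQ HPQ] : forall i, exists pq : (C -> C) * (C -> C),
    [/\ dcoef pq.1, dcoef pq.2, nz pq.1, nz pq.2 & forall z, pq.2 z * u i z = pq.1 z * u (rho i) z].
  by move=> i; have [P [Q H]] := rhoC i; exists (P, Q).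
pose D z := \prod_(i in A) (PQ i).2 z.
pose b x z := \sum_(i in A | rho i == x) c i * ((PQ i).1 z * \prod_(j in A | j != i) (PQ j).2 z).
have bd x : dcoef (b x).
  apply: dcoef_sum => i _; apply: dcoefZ; apply: dcoefM; first by case: (HPQ i).
  by apply: dcoef_prod => j _; case: (HPQ j).
have bE x z : b x z * u x z = D z * \sum_(i in A | rho i == x) c i * u i z.
  rewrite mulr_sumr mulr_suml; apply: eq_bigr => i /andP[iA /eqP ix].
  have [_ _ _ _ /(_ z) E] := HPQ i.
  have -> : D z = (PQ i).2 z * \prod_(j in A | j != i) (PQ j).2 z by rewrite /D (bigD1 i).
  move: (\prod_(j in A | j != i) (PQ j).2 z) => p; rewrite -ix.
  move: E; move: (u (rho i) z) (u i z) (c i) ((PQ i).1 z) ((PQ i).2 z) => s t d p1 p2 E.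
  by transitivity (d * p * (p1 * s)); [ring|rewrite -E; ring].
have bS z : \sum_(x in A) b x z * u x z = 0.
  under eq_bigr do rewrite bE.
  by rewrite -mulr_sumr -(partition_big rho)// cS mulr0.
have bN x : x \in A -> ~ nz (b x).
  move=> xA bx.
  have [i [j [iA jA ij /(rhoE _ _ iA) rij [bi bj]]]] :=
    dcoef_elim (leqnn _) (fun i _ => bd i) bS (ex_intro2 _ _ x xA bx).
  have rhoR y : nz (b y) -> rho y = y.
    move=> [z]; rewrite /b; have [k /andP[kA /eqP <-] _|no] := pickP (fun k => (k \in A) && (rho k == y)).
      by apply: esym; apply: rhoE => //.
    by rewrite big_pred0 ?eqxx.
  by move: ij; rewrite -(rhoR _ bi) -(rhoR _ bj) rij eqxx.
move=> i j iA jA; suff ij : rho j = rho i.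
  by apply: comm_trans (rhoC i) _; rewrite -ij; exact/comm_sym.
have De : entire D by apply: entire_prod => k _; apply: dcoef_entire; case: (HPQ k).
have D0 : nz D.
  rewrite /nz /D; have [||z H] := @entire_prod_neq0 R I (enum A) (fun i => (PQ i).2).
  - by move=> k _; apply: dcoef_entire; case: (HPQ k).
  - by move=> k _; case: (HPQ k).
  by exists z; rewrite big_enum in H.
apply: contrapT => ji.
pose d k := if rho k == rho i then c k else 0.
have dS z : \sum_(k in A) d k * u k z = 0.
  have se : entire (fun z => \sum_(k in A | rho k == rho i) c k * u k z).
    by apply: entire_sum => k _; exact: entireZ.
  have [w|H|H] := entire_domain De se.
  - by rewrite -bE (nzN (bN _ (rhoA _ iA))) mul0r.
  - by case: D0 => w; rewrite H eqxx.
  rewrite -[RHS](H z) [RHS]big_mkcondr; apply: eq_bigr => k _.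
  by rewrite /d; case: ifP; rewrite ?mul0r.
have dj : d j = 0 by rewrite /d (negPf (introN eqP ji)).
have := cmin d dS (ex_intro2 _ _ j jA dj) i iA; rewrite /d eqxx => h.
by have := c0 _ iA; rewrite h eqxx.
Qed.
End Relation.
End Borel1.

(** * Growth lemmas *)

Section Growth.
Variable R : realType.
Local Notation C := R[i].
Implicit Types (f g P Q F : C -> C) (a b c z w : C) (r s rho e : R).

Definition fourth_root (x : R) := Num.sqrt (Num.sqrt x).

Lemma fourth_rootK (x : R) : 0 <= x -> fourth_root x ^+ 4 = x.
Proof. by move=> x0; rewrite (exprM _ 2 2) !sqr_sqrtr// sqrtr_ge0. Qed.

Lemma fourth_root_ge (x y : R) : 0 <= y -> y ^+ 4 <= x -> y <= fourth_root x.
Proof.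
move=> y0 yx; have x0 : 0 <= x by apply: le_trans yx; rewrite exprn_ge0.
rewrite -(@ler_pXn2r _ 4) ?nnegrE ?sqrtr_ge0//; by rewrite fourth_rootK.
Qed.

(** If doubling-type inequalities failed from some radius on, the radii
    [r (1 + 1/q)] would stay bounded while [Th] grows geometrically. *)
Lemma growth_lemma (Th : R -> R) (R0 : R) : 1 <= R0 ->
  (forall r s, 0 <= r -> r <= s -> Th r <= Th s) -> (forall r, 0 <= r -> 1 <= Th r) ->
  exists2 r, R0 <= r & Th (r + r / fourth_root (Th r)) <= 16 * Th r.
Proof.
move=> R1 mono Th1; apply: contrapT => /forall2NP no.
have no' r : R0 <= r -> 16 * Th r < Th (r + r / fourth_root (Th r)).
  by move=> Rr; case: (no r) => // /negP; rewrite -ltNge.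
pose rn n := iter n (fun r => r + r / fourth_root (Th r)) R0.
have H n : [/\ R0 <= rn n, 16 ^+ n <= Th (rn n) & rn n <= R0 * expR (2 * (1 - 2^-1 ^+ n))].
  elim: n => [|n [h1 h2 h3]].
    have E0 x : x ^+ 0 = 1 :> R by [].
    by rewrite !E0 subrr mulr0 expR0 mulr1 /= lexx; split=> //; apply: Th1; lra.
  have r0 : 0 <= rn n by lra.
  have q2 : 2 ^+ n <= fourth_root (Th (rn n)).
    apply: fourth_root_ge; first by rewrite exprn_ge0.
    by rewrite -exprM mulnC exprM (_ : 2 ^+ 4 = 16)//; ring.
  have p2 : 0 < (2 : R) ^+ n by rewrite exprn_gt0.
  have q0 : 0 < fourth_root (Th (rn n)) by lra.
  have E : rn n.+1 = rn n + rn n / fourth_root (Th (rn n)) by [].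
  have k0 : 0 <= rn n / fourth_root (Th (rn n)) by rewrite divr_ge0// ltW.
  rewrite E; split; first by lra.
    by apply: ltW; apply: le_lt_trans (no' _ h1); rewrite exprS ler_wpM2l.
  have iq : (fourth_root (Th (rn n)))^-1 <= 2^-1 ^+ n by rewrite exprVn lef_pV2 ?posrE.
  have -> : 2 * (1 - 2^-1 ^+ n.+1) = 2 * (1 - 2^-1 ^+ n) + (2^-1 : R) ^+ n.
    by rewrite exprS; field.
  rewrite expRD mulrA; apply: le_trans (_ : rn n * expR (2^-1 ^+ n) <= _).
    rewrite -[X in X + _]mulr1 -mulrDr ler_wpM2l//.
    by apply: le_trans (expR_ge1Dx _); rewrite lerD2l.
  by apply: ler_wpM2r => //; exact: expR_ge0.
have B n : 16 ^+ n <= Th (R0 * expR 2).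
  have [h1 h2 h3] := H n; apply: le_trans h2 _; apply: mono; first by lra.
  apply: le_trans h3 _; rewrite ler_wpM2l ?ler_expR//; first by lra.
  have h4 : 0 <= (2^-1 : R) ^+ n by rewrite exprn_ge0.
  lra.
have [n nP] := half_small (Th (R0 * expR 2)) (@ltr01 R).
have := B n; rewrite leNgt; case/negP.
rewrite exprVn ltr_pdivrMr ?exprn_gt0// mul1r in nP; apply: lt_le_trans nP _.
by apply: lerXn2r; rewrite ?nnegrE//; lra.
Qed.

Definition maxRe f r := sup [set `|Re (f z)| | z in [set z | nm z <= r]].

Lemma ReM_ge f r z : entire f -> nm z <= r -> `|Re (f z)| <= maxRe f r.
Proof.
move=> fe zr; apply: ub_le_sup; last by exists z.
have [M _ fM] := entire_bounded r fe.
by exists M => _ [w wr <-]; apply: le_trans (nm_Re _) (fM _ wr).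
Qed.

Lemma ReM_le f r (M : R) : 0 <= r -> (forall z, nm z <= r -> `|Re (f z)| <= M) -> maxRe f r <= M.
Proof.
move=> r0 fM; apply: ge_sup; first by exists `|Re (f 0)|, 0 => //=; rewrite nm0.
by move=> _ [w wr <-]; exact: fM.
Qed.

Lemma nm_blaschke (s : R) b z : nm z = s -> nm ((s ^+ 2)%:C - conjc b * z) = s * nm (z - b).
Proof.
move=> zs; have -> : (s ^+ 2)%:C - conjc b * z = z * conjc (z - b).
  by rewrite rmorphB /= mulrBr mulcJ zs; ring.
by rewrite nmM nmJ zs.
Qed.

(** Reflecting the zeros of [Q] out of the disc of radius [s] changes neither
    [nm Q] on the circle nor [F]. *)
Lemma blaschke (s Y : R) Q F : 0 < s -> entire Q -> Q 0 != 0 -> entire F ->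
  (forall z, nm z = s -> nm (Q z) <= expR Y /\ nm (Q z * F z) <= expR Y) ->
  exists B, [/\ entire B, forall z, nm z < s -> B z != 0,
    forall z, nm z < s -> nm (B z) <= expR Y /\ nm (B z * F z) <= expR Y & nm (Q 0) <= nm (B 0)].
Proof.
move=> s0 Qe Q0 Fe QY; have [l [g [ge gE ls g0]]] := extract_zeros s0 Qe Q0.
pose B z := \prod_(b <- l) ((s^-1)%:C * ((s ^+ 2)%:C - conjc b * z)) * g z.
have Be : entire B.
  apply: entireM => //; apply: entire_prod => b _; apply: entireZ; apply: entireB.
    exact: entire_cst.
  exact/entireZ/entire_id.
have BQ z : nm z = s -> nm (B z) = nm (Q z).
  move=> zs; rewrite gE !nmM !nm_prod; congr (_ * _); apply: eq_bigr => b _.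
  by rewrite nmM nm_blaschke// nmC_ge0 ?invr_ge0 ?(ltW s0)// mulKf// gt_eqF.
have s1 : s < s + 1 by rewrite ltrDl.
exists B; split=> //.
- move=> z zs; rewrite /B mulf_neq0 ?g0// prodf_seq_neq0; apply/allP => b /ls bs /=.
  rewrite -nm_gt0 nmM nmC_ge0 ?invr_ge0 ?(ltW s0)// mulr_gt0 ?invr_gt0//.
  have := nm_sub (s ^+ 2)%:C (conjc b * z); rewrite nmC_ge0 ?exprn_ge0 ?(ltW s0)// nmM nmJ.
  have := nm_ge0 z; have := nm_ge0 b; rewrite expr2; nra.
- move=> z zs; split.
    apply: (@max_principle R (s + 1) s (expR Y) B s0 s1 (entire_hol Be)); last exact: ltW.
    by move=> w ws; rewrite BQ//; case: (QY _ ws).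
  apply: (@max_principle R (s + 1) s (expR Y) (fun z => B z * F z) s0 s1); last exact: ltW.
    exact/entire_hol/entireM.
  by move=> w ws; rewrite nmM BQ// -nmM; case: (QY _ ws).
- rewrite gE /B !nmM ler_wpM2r// !nm_prod.
  elim: l ls {gE B Be BQ} => [|b l IH] ls; first by rewrite !big_nil.
  rewrite !big_cons; apply: ler_pM; rewrite ?prodr_ge0//; last first.
    by apply: IH => c cl; apply: ls; rewrite inE cl orbT.
  rewrite mulr0 subr0 sub0r nmN -rmorphM /= expr2 mulKf ?gt_eqF// nmC_ge0 ?(ltW s0)//.
  by apply/ltW/ls/mem_head.
Qed.

Lemma log_ratio_le (r d Y : R) Q F : 0 <= r -> 0 < d -> entire Q -> Q 0 != 0 ->
  entire F -> (forall z, F z != 0) ->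
  (forall z, nm z = r + d -> nm (Q z) <= expR Y /\ nm (Q z * F z) <= expR Y) ->
  forall z, nm z <= r -> ln (nm (F z)) <= (Y + `|ln (nm (Q 0))| + 1) * (1 + 4 * r / d).
Proof.
move=> r0 d0 Qe Q0 Fe F0 QY z zr; have s0 : 0 < r + d by lra.
have [B [Be B0 BY QB]] := blaschke s0 Qe Q0 Fe QY.
have h0 : 0 < r + d / 2 by lra.
have hs : r + d / 2 < r + d by lra.
have zs : nm z < r + d by lra.
have zh : nm z < r + d / 2 by lra.
have n0 : nm (0 : C) < r + d by rewrite nm0.
have BYs w : nm w < r + d -> nm (B w) <= expR Y by move/BY => [].
have := harnack h0 hs (entire_hol Be) B0 BYs zh.
have q0 : 0 < nm (Q 0) by rewrite nm_gt0.
have b0 : 0 < nm (B 0) by rewrite nm_gt0 B0.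
have bz : 0 < nm (B z) by rewrite nm_gt0 B0.
have fz : 0 < nm (F z) by rewrite nm_gt0.
have lB : ln (nm (Q 0)) <= ln (nm (B 0)) by rewrite ler_ln ?posrE.
have lY : ln (nm (B 0)) <= Y.
  by rewrite -[Y]expRK ler_ln ?posrE ?expR_gt0 ?BYs.
have : ln (nm (B z * F z)) <= Y.
  by rewrite -[Y]expRK ler_ln ?posrE ?expR_gt0 ?nmM ?mulr_gt0// -nmM; case: (BY _ zs).
rewrite nmM lnM ?posrE//.
have a1 : - ln (nm (Q 0)) <= `|ln (nm (Q 0))| by rewrite -normrN ler_norm.
have [t tE] : exists t, t = r / d by eexists.
have rE : r = t * d by rewrite tE divfK// gt_eqF.
have -> : 4 * r / d = 4 * t by rewrite rE; field; rewrite gt_eqF.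
have t0 : 0 <= t by rewrite tE divr_ge0// ltW.
move: (ln (nm (Q 0))) (ln (nm (B 0))) (ln (nm (B z))) a1 lB lY => lq lb lbz; move: `|lq| => K a1 lB lY.
move: (ln _) => lf h1 h2.
have nz0 := nm_ge0 z; move: (nm z) nz0 zr h2 => x x0 xr h2.
have W0 : 0 <= Y - lb + 1 by lra.
have h3 : (lb - lbz) * (d / 2) <= 2 * (Y - lb + 1) * r.
  have [h|h] := leP (lb - lbz) 0.
    by apply: le_trans (_ : 0 <= _); [nra|rewrite !mulr_ge0].
  have p1 : 0 <= (lb - lbz) * (r - x) by apply: mulr_ge0; lra.
  have p2 : 0 <= (Y - lb + 1) * (r - x) by apply: mulr_ge0; lra.
  have -> : (lb - lbz) * (d / 2) = (lb - lbz) * (r + d / 2 - x) - (lb - lbz) * (r - x) by ring.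
  have E : 2 * (Y - lb + 1) * x = 2 * (Y - lb + 1) * r - 2 * ((Y - lb + 1) * (r - x)) by ring.
  by rewrite E in h2; lra.
have h4 : lb - lbz <= 4 * (Y - lb + 1) * t.
  rewrite -(ler_pM2r (_ : 0 < d / 2)); last by lra.
  by apply: le_trans h3 _; rewrite rE; nra.
have h5 : 4 * (Y - lb + 1) * t <= 4 * (Y + K + 1) * t by rewrite ler_wpM2r//; lra.
nra.
Qed.

(** The exponent of a commensurable unit [c cexp h] is controlled by the growth
    of the two coefficients. *)
Lemma exponent_bound P Q h c : entire P -> entire Q -> nz Q -> entire h -> c != 0 ->
  (forall z, Q z * (c * cexp (h z)) = P z) ->
  exists2 K : R, 0 <= K & forall r d Y : R, 1 <= r -> 0 < d -> 0 <= Y ->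
    (forall z, nm z = r + d -> nm (P z) <= expR Y /\ nm (Q z) <= expR Y) ->
    forall z, nm z <= r -> `|Re (h z)| <= (Y + K) * (1 + 4 * r / d).
Proof.
move=> Pe Qe [z1 Qz1] he c0 QP; have [m [q [qe q0 qE]]] := entire_ord 0 Qe Qz1.
pose F z := c * cexp (h z).
have Fe : entire F.
  apply: entireZ => z; have [d D] := he z; exists (cexp (h z) * d).
  exact: cderiv_comp D (cderiv_cexp _).
have F0 z : F z != 0 by rewrite mulf_neq0// cexp_neq0.
have Pq : forall z, P z = z ^+ m * (q z * F z) by move=> z; rewrite -QP qE subr0 -mulrA.
pose p z := q z * F z.
have pe : entire p by exact: entireM.
have p0 : p 0 != 0 by rewrite mulf_neq0.
exists (`|ln (nm (q 0))| + `|ln (nm (p 0))| + 1 + `|ln (nm c)|); first by rewrite !addr_ge0.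
move=> r d Y r1 d0 Y0 PQY z zr.
have r0 : 0 <= r by lra.
have C1 w : nm w = r + d -> nm (q w) <= expR Y /\ nm (p w) <= expR Y.
  move=> wr; have w1 : 1 <= nm w ^+ m by rewrite exprn_ege1// wr; lra.
  have [PY QY'] := PQY _ wr.
  split.
    apply: le_trans QY'; rewrite qE subr0 nmM nmX ler_peMl//.
  by apply: le_trans PY; rewrite Pq nmM nmX ler_peMl.
have L1 := log_ratio_le r0 d0 qe q0 Fe F0 C1 zr.
have Fi : entire (fun w => (F w)^-1) by exact: entireV.
have Fi0 w : (F w)^-1 != 0 by rewrite invr_neq0.
have C2 w : nm w = r + d -> nm (p w) <= expR Y /\ nm (p w * (F w)^-1) <= expR Y.
  by move=> /C1 []; rewrite /p mulfK.
have L2 := log_ratio_le r0 d0 pe p0 Fi Fi0 C2 zr.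
have lF : ln (nm (F z)) = ln (nm c) + Re (h z).
  by rewrite nmM nm_cexp lnM ?posrE ?expR_gt0 ?nm_gt0// expRK.
move: L2; rewrite nmV lnV ?posrE ?nm_gt0// lF; move: L1; rewrite lF.
have t0 : 0 <= 4 * r / d by rewrite divr_ge0 ?mulr_ge0// ltW.
have := ler_norm (ln (nm c)); have := ler_norm (- ln (nm c)); rewrite normrN.
have := normr_ge0 (ln (nm c)).
have := normr_ge0 (ln (nm (q 0))); have := normr_ge0 (ln (nm (p 0))).
move: `|ln (nm (q 0))| `|ln (nm (p 0))| `|ln (nm c)| (ln (nm c)) (4 * r / d) t0 (Re (h z)).
move=> x y k lc t t0 H y0 x0 k0 k1 k2 h1 h2.
have kt := mulr_ge0 k0 t0.
have xt := mulr_ge0 x0 t0.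
have yt := mulr_ge0 y0 t0.
rewrite ler_norml; apply/andP; split; nra.
Qed.
End Growth.

(** * Borel's theorem *)

Section BorelTheorem.
Variable R : realType.
Local Notation C := R[i].
Implicit Types (f P Q F : C -> C) (a b c z w : C).

Definition proportional f F := exists c, forall z, f z = c * F z.

Section Minimal.
Variables (I : finType) (A : {set I}) (u : I -> C -> C) (g : I -> C -> C).
Hypothesis ue : forall i, entire (u i).
Hypothesis u0 : forall i z, u i z != 0.
Hypothesis ge : forall i, entire (g i).
Hypothesis g0 : forall i, g i 0 = 0.
Hypothesis gl : forall i, cder (g i) = lder (u i).
Hypothesis gE : forall i z, u i z = u i 0 * cexp (g i z).

Definition Theta (r : R) := \sum_(i in A) maxRe (g i) r + r + 2.

Lemma ReM_ge0 i (r : R) : 0 <= r -> 0 <= maxRe (g i) r.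
Proof.
by move=> r0; apply: le_trans (ReM_ge (ge i) (_ : nm 0 <= r)); rewrite ?nm0.
Qed.

Lemma Theta_ge (r : R) : 0 <= r -> r + 2 <= Theta r.
Proof.
move=> r0; rewrite /Theta -addrA lerDr sumr_ge0// => i _; exact: ReM_ge0.
Qed.

Lemma Theta_ReM i (r : R) : i \in A -> 0 <= r -> maxRe (g i) r + 2 <= Theta r.
Proof.
move=> iA r0; rewrite /Theta (bigD1 i)//=.
have : 0 <= \sum_(j in A | j != i) maxRe (g j) r by apply: sumr_ge0 => j _; exact: ReM_ge0.
by move: (\sum_(j in A | j != i) maxRe (g j) r) => x x0; lra.
Qed.

Lemma Theta_mono (r s : R) : 0 <= r -> r <= s -> Theta r <= Theta s.
Proof.
move=> r0 rs; rewrite /Theta -!addrA lerD ?lerD2r//; apply: ler_sum => i _.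
by apply: ReM_le => // z zr; apply: ReM_ge => //; apply: le_trans rs.
Qed.

Definition grw f := exists (k : nat) (c : R), 0 <= c /\ forall (s rho : R) z, 1 <= s -> s < rho ->
  nm z <= s -> nm (f z) <= c * (Theta rho * (1 + (rho - s)^-1)) ^+ k.

Lemma grwX (s rho : R) : 1 <= s -> s < rho ->
  [/\ 1 <= Theta rho * (1 + (rho - s)^-1), (rho - s)^-1 <= Theta rho * (1 + (rho - s)^-1) &
   Theta rho <= Theta rho * (1 + (rho - s)^-1)].
Proof.
move=> s1 sr; have r0 : 0 <= rho by lra.
have := Theta_ge r0; have : 0 < (rho - s)^-1 by rewrite invr_gt0 subr_gt0.
by move: (Theta rho) (rho - s)^-1 => x y y0 xr; split; nra.
Qed.

Lemma grw_cst c : grw (fun=> c).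
Proof. by exists 0%N, (nm c); split=> // s rho z _ _ _; rewrite mulr1. Qed.

Lemma grwD f F : grw f -> grw F -> grw (fun z => f z + F z).
Proof.
move=> [k [c [c0 H]]] [l [d [d0 H']]]; exists (k + l)%N, (c + d); split; first exact: addr_ge0.
move=> s rho z s1 sr zs; have [x1 _ _] := grwX s1 sr.
apply: le_trans (nmD _ _) _; rewrite mulrDl lerD//.
  by apply: le_trans (H _ _ _ s1 sr zs) _; rewrite ler_wpM2l// ler_weXn2l// leq_addr.
by apply: le_trans (H' _ _ _ s1 sr zs) _; rewrite ler_wpM2l// ler_weXn2l// leq_addl.
Qed.

Lemma grwM f F : grw f -> grw F -> grw (fun z => f z * F z).
Proof.
move=> [k [c [c0 H]]] [l [d [d0 H']]]; exists (k + l)%N, (c * d); split; first exact: mulr_ge0.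
move=> s rho z s1 sr zs; rewrite exprD mulrACA; apply: nm_prod_le2; [exact: H|exact: H'].
Qed.

Lemma grw_der f : entire f -> grw f -> grw (cder f).
Proof.
move=> fe [k [c [c0 H]]]; exists k.+1, (4 * c * 2 ^+ k); split.
  by rewrite !mulr_ge0// exprn_ge0.
move=> s rho z s1 sr zs; have [x1 x2 x3] := grwX s1 sr.
have [d dE] : exists d, d = rho - s by eexists.
have d0 : 0 < d by lra.
have h0 : 0 < d / 2 by lra.
have h1 : d / 2 < d by lra.
have E : cder (fun w => f (z + w)) 0 = cder f z.
  by apply/cder_eq/cder_line; rewrite addr0; exact: entire_cder.
have fse : entire (fun w => f (z + w)).
  by apply: entire_ext (entire_line z 1 fe) => w; rewrite mulr1.
move: x1 x2 x3; set X := Theta rho * _ => x1 x2 x3.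
have X0 : 0 <= X by lra.
rewrite -E; apply: le_trans (@cauchy_est R d (d / 2) (c * (2 * X) ^+ k) _ h0 h1 (entire_hol fse) _) _.
  move=> w wd; have s2 : 1 <= s + d / 2 by lra.
  have s3 : s + d / 2 < rho by lra.
  apply: le_trans (H _ _ _ s2 s3 _) _; first by have := nmD z w; lra.
  rewrite ler_wpM2l//; apply: lerXn2r; rewrite ?nnegrE.
  - by have [+ _ _] := grwX s2 s3; apply: le_trans.
  - by rewrite mulr_ge0.
  have Tr := Theta_ge (_ : 0 <= rho).
  rewrite /X mulrCA ler_wpM2l; [by []|by have := Tr ltac:(lra); lra|].
  have -> : rho - (s + d / 2) = d / 2 by rewrite dE; field.
  rewrite -dE invf_div mulrDr mulr1; lra.
have -> : 2 * (c * (2 * X) ^+ k) / (d / 2) = 4 * c * 2 ^+ k * X ^+ k * d^-1.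
  by rewrite exprMn; field; rewrite gt_eqF.
rewrite exprSr mulrA ler_wpM2l -?dE//.
  by rewrite !mulr_ge0// exprn_ge0.
by rewrite dE.
Qed.

Lemma grw_g i : i \in A -> grw (g i).
Proof.
move=> iA; exists 2%N, 4; split=> // s rho z s1 sr zs; have [x1 x2 x3] := grwX s1 sr.
have r0 : 0 <= rho by lra.
have T1 := Theta_ReM iA r0; have T2 := Theta_ge r0; have T0 := ReM_ge0 i r0.
have [d dE] : exists d, d = rho - s by eexists.
have [h hE] : exists h, h = s + d / 2 by eexists.
have h0 : 0 < h by lra.
have h1 : h < rho by lra.
have A0 : 0 < Theta rho by lra.
have gA w : nm w < rho -> Re (g i w) <= Theta rho.
  move=> /ltW/(ReM_ge (ge i)) H; have := ler_norm (Re (g i w)); lra.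
have := borel_caratheodory h0 h1 (entire_hol (ge i)) (g0 i) A0 gA (_ : nm z < h).
move/(_ ltac:(lra)) => H.
have d0 : 0 < d by lra.
have gz := nm_ge0 (g i z); have nz := nm_ge0 z.
have H1 : nm (g i z) * (d / 2) <= 2 * Theta rho * Theta rho.
  apply: le_trans (_ : nm (g i z) * (h - nm z) <= _); first by rewrite ler_wpM2l//; lra.
  by apply: le_trans H _; rewrite ler_wpM2l//; lra.
have H2 : nm (g i z) <= 4 * (Theta rho * (Theta rho * d^-1)).
  rewrite -(ler_pM2r (_ : 0 < d / 2)); last by lra.
  apply: le_trans H1 _; rewrite (_ : _ * (d / 2) = 2 * Theta rho * Theta rho)//.
  by field; rewrite gt_eqF.
apply: le_trans H2 _; rewrite ler_wpM2l// expr2.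
apply: ler_pM => //; first exact: ltW.
  by apply: mulr_ge0; rewrite ?invr_ge0 ltW.
by rewrite -dE mulrDr mulr1 lerDr ltW.
Qed.

Lemma dcoef_grw f : dcoef A u f -> grw f.
Proof.
elim=> [c|i iA|f1 f2 _ H1 _ H2|f1 f2 _ H1 _ H2|f1 d1 H1].
- exact: grw_cst.
- by rewrite -gl; apply: grw_der => //; exact: grw_g.
- exact: grwD.
- exact: grwM.
- by apply: grw_der => //; exact: (dcoef_entire ue u0 d1).
Qed.

(** All exponents are [O(sqrt r)] on some radii tending to infinity. *)
Lemma comm_const i0 : i0 \in A -> (forall z, u i0 z = 1) ->
  (forall i, i \in A -> comm A u i i0) -> forall i, i \in A -> forall z, u i z = u i 0.
Proof.
move=> i0A ui0 cm.
have K_ex i : exists (K : R) (k : nat), 0 <= K /\ (i \in A -> forall (r : R) z,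
    let q : R := fourth_root (Theta r) in
    1 <= r -> Theta (r + r / q) <= 16 * Theta r -> nm z <= r ->
    `|Re (g i z)| <= K * q ^+ 2).
  case iA : (i \in A); last by exists 0, 0%N; split.
  have [P [Q [Pd Qd P0 Q0 E]]] := cm i iA.
  have [k1 [c1 [c10 H1]]] := dcoef_grw Pd; have [k2 [c2 [c20 H2]]] := dcoef_grw Qd.
  have [|K K0 HK] := exponent_bound (dcoef_entire ue u0 Pd) (dcoef_entire ue u0 Qd) Q0 (ge i) (u0 i 0).
    by move=> z; rewrite -gE E ui0 mulr1.
  pose k := (k1 + k2)%N; pose c := c1 + c2.
  exists ((c + k%:R * 53 + K) * 9), 0%N; split.
    by rewrite mulr_ge0// !addr_ge0// mulr_ge0.
  move=> _ r z q r1 rq zr.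
  have r0 : 0 <= r by lra.
  have T2 := Theta_ge r0.
  have q1 : 1 <= q by apply: fourth_root_ge => //; rewrite expr1n; lra.
  have qT : q ^+ 4 = Theta r by apply: fourth_rootK; lra.
  have [d dE] : exists d, d = r / (2 * q) by eexists.
  have d0 : 0 < d by rewrite dE divr_gt0//; lra.
  have dd : r / q = d + d by rewrite dE; field; rewrite gt_eqF//; lra.
  have dV : r / d = 2 * q by rewrite dE; field; rewrite !gt_eqF//; lra.
  have [Y YE] : exists Y, Y = c + k%:R * (48 + 5 * q) by eexists.
  have Y0 : 0 <= Y by rewrite YE addr_ge0 ?addr_ge0// mulr_ge0//; lra.
  have B f (c' : R) (k' : nat) : 0 <= c' -> c' <= c -> (k' <= k)%N ->
      (forall (s rho : R) z, 1 <= s -> s < rho -> nm z <= s ->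
      nm (f z) <= c' * (Theta rho * (1 + (rho - s)^-1)) ^+ k') ->
      forall w, nm w = r + d -> nm (f w) <= expR Y.
    move=> c'0 c'c k'k Hf w wr.
    have s1 : 1 <= r + d by lra.
    have s2 : r + d < r + r / q by lra.
    apply: le_trans (Hf _ _ w s1 s2 _) _; first by rewrite wr.
    have [X1 _ _] := grwX s1 s2.
    rewrite YE expRD; apply: ler_pM => //; first by rewrite exprn_ge0//; lra.
      by have := expR_ge1Dx c; lra.
    apply: le_trans (ler_weXn2l X1 k'k) _; rewrite [k%:R * _]mulrC expRM_natr.
    apply: lerXn2r; rewrite ?nnegrE ?expR_ge0//; first by lra.
    rewrite expRD; apply: le_trans (_ : 48 * q ^+ 5 <= _); last first.
      apply: ler_pM => //; first by rewrite exprn_ge0//; lra.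
        by have := expR_ge1Dx (48 : R); lra.
      rewrite [5 * q]mulrC expRM_natr; apply: lerXn2r; rewrite ?nnegrE ?expR_ge0//; first by lra.
      by have := expR_ge1Dx q; lra.
    have -> : r + r / q - (r + d) = d by rewrite dd; ring.
    have dq : 1 + d^-1 <= 3 * q.
      have : d^-1 <= 2 * q by rewrite -dV ler_peMl// invr_ge0 ltW.
      by lra.
    have -> : 48 * q ^+ 5 = (16 * Theta r) * (3 * q) by rewrite -qT; ring.
    apply: ler_pM => //; first by have := @Theta_ge (r + r / q) ltac:(lra); lra.
    by have : 0 < d^-1; [rewrite invr_gt0|lra].
  have := HK r d Y r1 d0 Y0 _ z zr; move/(_ _) => H.
  apply: le_trans (H _) _.
    move=> w wr; split.
      by apply: (B P c1 k1) => //; rewrite ?lerDl ?leq_addr.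
    by apply: (B Q c2 k2) => //; rewrite ?lerDr ?leq_addl.
  have -> : 4 * r / d = 8 * q by rewrite -mulrA dV; ring.
  have k0 : 0 <= k%:R :> R by [].
  have c0 : 0 <= c by rewrite addr_ge0.
  rewrite expr2 [X in _ <= X](_ : _ = ((c + k%:R * 53 + K) * q) * (9 * q)); last by ring.
  apply: ler_pM; [by rewrite addr_ge0|by lra| |by lra].
  rewrite YE; move: (k%:R : R) k0 => x x0.
  have := mulr_ge0 x0 (_ : 0 <= q - 1); move/(_ ltac:(lra)).
  have := mulr_ge0 c0 (_ : 0 <= q - 1); move/(_ ltac:(lra)).
  have := mulr_ge0 K0 (_ : 0 <= q - 1); move/(_ ltac:(lra)).
  lra.
have /choice [K HK] : forall i, exists K : R, 0 <= K /\ (i \in A -> forall (r : R) z,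
    let q : R := fourth_root (Theta r) in
    1 <= r -> Theta (r + r / q) <= 16 * Theta r -> nm z <= r ->
    `|Re (g i z)| <= K * q ^+ 2) by move=> i; have [K' [_ H]] := K_ex i; exists K'.
move=> i iA z; rewrite gE.
suff -> : g i z = 0 by rewrite cexp0 mulr1.
apply: contrapT => /eqP; rewrite -nm_eq0 => gz0.
have gam : 0 < nm (g i z) by rewrite lt_def gz0 nm_ge0.
pose S := \sum_(j in A) K j.
have S0 : 0 <= S by apply: sumr_ge0 => j _; case: (HK j).
have [Ki0 _] := HK i.
have [D DE] : exists D, D = 128 * nm z ^+ 2 * (K i ^+ 2 * (S ^+ 2 + 4 + 2) + 1) by eexists.
have D0 : 0 <= D.
  by rewrite DE mulr_ge0 ?mulr_ge0 ?exprn_ge0// addr_ge0// mulr_ge0 ?exprn_ge0// !addr_ge0// exprn_ge0.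
have [R0 R0E] : exists R0, R0 = 1 + 4 * nm z + D / nm (g i z) ^+ 2 by eexists.
have g2 : 0 < nm (g i z) ^+ 2 by rewrite exprn_gt0.
have R01 : 1 <= R0.
  have : 0 <= D / nm (g i z) ^+ 2 by rewrite divr_ge0// ltW.
  by have := nm_ge0 z; lra.
have [//|r Rr rq] := growth_lemma R01 Theta_mono.
  by move=> r r0; have := Theta_ge r0; lra.
have r0 : 0 <= r by lra.
have r1 : 1 <= r by lra.
have T2 := Theta_ge r0.
have [p pE] : exists p, p = fourth_root (Theta r) ^+ 2 by eexists.
have p0 : 0 <= p by rewrite pE exprn_ge0 ?sqrtr_ge0.
have p2 : p ^+ 2 = Theta r by rewrite pE -exprM fourth_rootK//; lra.
have RK j : j \in A -> maxRe (g j) r <= K j * p.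
  by move=> jA; apply: ReM_le => // w wr; rewrite pE; have [_] := HK j; apply.
have TS : Theta r <= S * p + r + 2.
  by rewrite /Theta !lerD2r mulr_suml; apply: ler_sum.
have pS : p ^+ 2 <= S ^+ 2 + 2 * r + 4.
  rewrite p2; have : 0 <= (S - p) ^+ 2 by apply: sqr_ge0.
  have -> : (S - p) ^+ 2 = S ^+ 2 - 2 * (S * p) + p ^+ 2 by ring.
  by rewrite p2; lra.
have Kp := RK i iA.
have Kp0 : 0 <= K i * p by rewrite mulr_ge0.
have gA w : nm w < r -> Re (g i w) <= K i * p + 1.
  by move=> /ltW/(ReM_ge (ge i)) H; have := ler_norm (Re (g i w)); lra.
have zD : 0 <= D / nm (g i z) ^+ 2 by rewrite divr_ge0// ltW.
have n0 := nm_ge0 z.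
have := @borel_caratheodory R r (r / 2) (K i * p + 1) (g i) ltac:(lra) ltac:(lra) (entire_hol (ge i)) (g0 i) ltac:(lra) gA z ltac:(lra).
move=> H.
have H1 : nm (g i z) * r <= 8 * nm z * (K i * p + 1).
  have : nm (g i z) * (r / 4) <= nm (g i z) * (r / 2 - nm z) by rewrite ler_wpM2l//; lra.
  by move: H; move: (nm (g i z)) (K i * p + 1) (nm z) => x y t h1 h2; lra.
have H2 : (nm (g i z) * r) ^+ 2 <= (8 * nm z * (K i * p + 1)) ^+ 2.
  by apply: lerXn2r; rewrite ?nnegrE ?mulr_ge0//; lra.
have H3 : (K i * p + 1) ^+ 2 <= 2 * (K i ^+ 2 * p ^+ 2 + 1).
  have : 0 <= (K i * p - 1) ^+ 2 by apply: sqr_ge0.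
  by move: (K i) => x; rewrite !expr2; lra.
have H4 : K i ^+ 2 * p ^+ 2 + 1 <= (K i ^+ 2 * (S ^+ 2 + 4 + 2) + 1) * r.
  rewrite mulrDl mul1r lerD// -mulrA ler_wpM2l ?exprn_ge0//; apply: le_trans pS _.
  have : 0 <= (S ^+ 2 + 4) * (r - 1) by rewrite mulr_ge0 ?subr_ge0// addr_ge0// exprn_ge0.
  by move: (S ^+ 2) => x; lra.
have H5 : (8 * nm z * (K i * p + 1)) ^+ 2 <= D * r.
  rewrite exprMn; apply: le_trans (_ : (8 * nm z) ^+ 2 * (2 * ((K i ^+ 2 * (S ^+ 2 + 4 + 2) + 1) * r)) <= _).
    rewrite ler_wpM2l ?exprn_ge0 ?mulr_ge0//; apply: le_trans H3 _.
    by rewrite ler_wpM2l.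
  by rewrite DE; move: (K i ^+ 2 * _ + 1) => x; rewrite le_eqVlt; apply/orP; left; apply/eqP; ring.
have : nm (g i z) ^+ 2 * r ^+ 2 <= D * r by rewrite -exprMn; apply: le_trans H5.
have rp : 0 < r by lra.
rewrite expr2 [r ^+ 2]expr2 mulrA ler_pM2r// -expr2 leNgt => /negP; apply.
rewrite -ltr_pdivrMl//; apply: lt_le_trans Rr; rewrite R0E mulrC; lra.
Qed.
End Minimal.

(** The growth estimate makes the exponents of the quotients constant. *)
Lemma minimal_proportional (I : finType) (A : {set I}) (u : I -> C -> C) (c : I -> C) :
  (forall i, entire (u i)) -> (forall i z, u i z != 0) ->
  (forall i, i \in A -> c i != 0) -> (forall z, \sum_(i in A) c i * u i z = 0) ->
  (forall d : I -> C, (forall z, \sum_(i in A) d i * u i z = 0) ->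
     (exists2 i, i \in A & d i = 0) -> forall i, i \in A -> d i = 0) ->
  forall i j, i \in A -> j \in A -> proportional (u i) (u j).
Proof.
move=> ue u0 c0 cS cmin i j iA jA.
pose v k z := u k z * (u j z)^-1.
have ve k : entire (v k) by apply: entireM => //; exact: entireV.
have v0 k z : v k z != 0 by rewrite mulf_neq0 ?invr_neq0.
have vS (d : I -> C) z : \sum_(k in A) d k * v k z = (\sum_(k in A) d k * u k z) * (u j z)^-1.
  by rewrite mulr_suml; apply: eq_bigr => k _; rewrite mulrA.
have vcS z : \sum_(k in A) c k * v k z = 0 by rewrite vS cS mul0r.
have vmin (d : I -> C) : (forall z, \sum_(i in A) d i * v i z = 0) ->
     (exists2 i, i \in A & d i = 0) -> forall i, i \in A -> d i = 0.
  move=> H; apply: cmin => z; have := H z; rewrite vS => /eqP.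
  by rewrite mulf_eq0 invr_eq0 (negPf (u0 j z)) orbF => /eqP.
have /choice [g Hg] : forall k, exists g, [/\ entire g, g 0 = 0, cder g = lder (v k) &
    forall z, v k z = v k 0 * cexp (g z)] by move=> k; exact: entire_log.
have vc := minimal_comm ve v0 c0 vcS vmin.
have := @comm_const I A v g ve v0 _ _ _ _ j jA _ (fun k kA => vc k j kA jA) i iA.
move=> H; exists (v i 0) => z; rewrite -(H _ _ _ _ _ z) /v ?mulfVK//.
- by move=> k; case: (Hg k).
- by move=> k; case: (Hg k).
- by move=> k; case: (Hg k).
- by move=> k; case: (Hg k).
- by move=> w; rewrite /v divff.
Qed.

(** Borel: a shortest nontrivial relation would consist of proportional terms. *)
Lemma borel_indep (I : finType) (A : {set I}) (u : I -> C -> C) (c : I -> C) :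
  (forall i, entire (u i)) -> (forall i z, u i z != 0) ->
  (forall i j, i \in A -> j \in A -> proportional (u i) (u j) -> i = j) ->
  (forall z, \sum_(i in A) c i * u i z = 0) -> forall i, i \in A -> c i = 0.
Proof.
move=> ue u0 np; elim: {A}#|A| {-2}A (leqnn #|A|) np c => [|n IH] A An np c cS i iA.
  by move: An; rewrite leqn0 cards_eq0 => /eqP A0; rewrite A0 inE in iA.
have small (d : I -> C) : (forall z, \sum_(i in A) d i * u i z = 0) ->
    (exists2 i, i \in A & d i = 0) -> forall i, i \in A -> d i = 0.
  move=> dS [k kA dk] l lA; have [->//|lk] := eqVneq l k.
  apply: (IH (A :\ k) _ _ d) => [||z|].
  - by rewrite (cardsD1 k) kA in An.
  - by move=> x y; rewrite !inE => /andP[_ xA] /andP[_ yA]; exact: np.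
  - rewrite -[RHS](dS z) (bigD1 k kA) /= dk mul0r add0r; apply: eq_bigl => x.
    by rewrite !inE andbC.
  - by rewrite !inE lk.
apply: contrapT => ci.
have c0 k : k \in A -> c k != 0.
  by move=> kA; apply/eqP => ck; apply: ci; apply: (small c) => //; exists k.
have pr := minimal_proportional ue u0 c0 cS small.
have AE k : (k \in A) = (k == i).
   by apply/idP/eqP => [kA|->//]; apply: np => //; exact: pr.
have := cS 0; rewrite (eq_bigl _ _ AE) big_pred1_eq => /eqP.
by rewrite mulf_eq0 (negPf (u0 i 0)) orbF => /eqP.
Qed.

Lemma proportional_sym f F : (forall z, f z != 0) -> proportional f F -> proportional F f.
Proof.
move=> f0 [c H]; have c0 : c != 0.
  by apply/eqP => c0; have := f0 0; rewrite H c0 mul0r eqxx.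
by exists c^-1 => z; rewrite H mulKf.
Qed.

Lemma proportional_trans f F P : proportional f F -> proportional F P -> proportional f P.
Proof. by move=> [c H] [d H']; exists (c * d) => z; rewrite H H' mulrA. Qed.

(** Collecting each class into a multiple of one of its members leaves a relation
    between functions no two of which are proportional. *)
Theorem borel (I : finType) (u : I -> C -> C) (c : I -> C) :
  (forall i, entire (u i)) -> (forall i z, u i z != 0) ->
  (forall z, \sum_i c i * u i z = 0) ->
  forall i z, \sum_(j | `[< proportional (u j) (u i) >]) c j * u j z = 0.
Proof.
move=> ue u0 cS.
have prr k : proportional (u k) (u k) by exists 1 => z; rewrite mul1r.
pose rho i := odflt i [pick j | `[< proportional (u i) (u j) >]].
have rhoP i : proportional (u i) (u (rho i)).
  by rewrite /rho; case: pickP => [j /asboolP|].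
have rhoE i j : proportional (u i) (u j) -> rho i = rho j.
  move=> ij; rewrite /rho (eq_pick (Q := fun k => `[< proportional (u j) (u k) >])).
    by case: pickP => //= /(_ j); case/asboolPn; exact: prr.
  move=> k /=; apply/asboolP/asboolP => h; last exact: proportional_trans ij h.
  exact: proportional_trans (proportional_sym (u0 i) ij) h.
have /choice [k Hk] : forall i, exists k, forall z, u i z = k * u (rho i) z by [].
pose A := [set i | rho i == i]%SET.
have rhoA i : rho i \in A by rewrite inE -(rhoE _ _ (rhoP i)).
pose d x := \sum_(i | rho i == x) c i * k i.
have dE x z : \sum_(i | rho i == x) c i * u i z = d x * u x z.
  by rewrite mulr_suml; apply: eq_bigr => i /eqP ix; rewrite (Hk i z) ix mulrA.
have d0 x : x \in A -> d x = 0.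
  apply: (borel_indep ue u0) => [i j|z].
    by rewrite !inE => /eqP iA /eqP jA /rhoE; rewrite iA jA.
  transitivity (\sum_(y in A) \sum_(i | rho i == y) c i * u i z).
    by apply: eq_bigr => y _; rewrite dE.
  rewrite -[RHS](cS z) [RHS](partition_big rho (mem A)) => [|j _]; last exact: rhoA.
  exact: eq_bigr.
move=> i z; transitivity (d (rho i) * u (rho i) z); last by rewrite d0 ?mul0r.
rewrite -dE.
apply: eq_bigl => j; apply/asboolP/eqP => [/rhoE//|ji].
apply: proportional_trans (rhoP j) _; rewrite ji; apply: proportional_sym => //.
Qed.
End BorelTheorem.

(** * Holomorphic functions of several variables *)

Section HolLimit.
Variable R : realType.
Local Notation C := R[i].
Implicit Types (f g F : C -> C) (a b c z w : C).

Lemma hol_limit (r : R) f :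
  (forall e : R, 0 < e -> exists2 g, hol r g & forall z, nm z < r -> nm (f z - g z) <= e) ->
  hol r f.
Proof.
move=> lim.
have fc z : nm z < r -> ccont f z.
  move=> zr e e0; have e4 : 0 < e / 4 by lra.
  have [g gh fg] := lim _ e4; have [d d0 H] := hol_cont gh zr e4.
  exists (Num.min d (r - nm z)) => [|w]; first by rewrite lt_min d0 subr_gt0.
  rewrite lt_min => /andP[/H h wr].
  have wr' : nm w < r by have := nmD (w - z) z; rewrite subrK; lra.
  have := fg _ zr; have := fg _ wr'; rewrite -(nmBC (g z)).
  have -> : f w - f z = (f w - g w) + ((g w - g z) + (g z - f z)) by ring.
  have := nmD (f w - g w) ((g w - g z) + (g z - f z)).
  have := nmD (g w - g z) (g z - f z).
  by move: (nm _) (nm _) (nm _) (nm _) (nm _) h => x1 x2 x3 x4 x5 h; lra.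
have Dj z : nm z < r -> cderiv (J f 0) z (f z).
  apply: morera => // a b c ar br cr.
  have sg x y : nm x < r -> nm y < r -> forall t : R, 0 <= t <= 1 -> nm (seg x y t) < r.
    move=> xr yr t t01; apply: le_lt_trans (_ : Num.max (nm x) (nm y) < r); last by rewrite gt_max xr.
    by apply: nm_seg; rewrite // le_max lexx ?orbT.
  have cs x y : nm x < r -> nm y < r -> cseg f x y.
    by move=> xr yr t t01; apply/fc/sg.
  apply: eq0_le_eps => e e0.
  have [L LE] : exists L, L = nm (b - a) + nm (c - b) + nm (a - c) + 1 by eexists.
  have L0 : 0 < L.
    by have := nm_ge0 (b - a); have := nm_ge0 (c - b); have := nm_ge0 (a - c); lra.
  have [g gh fg] := lim (e / L) ltac:(by rewrite divr_gt0).
  have Jd x y : nm x < r -> nm y < r -> nm (J f x y - J g x y) <= nm (y - x) * (e / L).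
    move=> xr yr; have cg : cseg g x y by move=> t t01; apply/(hol_cont gh)/sg.
    have -> : J f x y - J g x y = J (fun z => f z + -1 * g z) x y.
      by rewrite JD ?JZ ?mulN1r//; [exact: cs|exact: csegZ].
    apply: J_bound; first by apply: csegD; [exact: cs|exact: csegZ].
    by move=> t t01; rewrite mulN1r; apply/fg/sg.
  have Tg : T g a b c = 0.
    apply: (@goursat R r (Num.max (nm a) (Num.max (nm b) (nm c)))) => //.
    - by rewrite !gt_max ar br.
    - by rewrite le_max lexx.
    - by rewrite !le_max lexx orbT.
    - by rewrite !le_max lexx !orbT.
  rewrite -[T f a b c]subr0 -Tg /T.
  have -> : J f a b + J f b c + J f c a - (J g a b + J g b c + J g c a) =
    (J f a b - J g a b) + ((J f b c - J g b c) + (J f c a - J g c a)) by ring.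
  apply: le_trans (nmD _ _) _.
  apply: le_trans (_ : (nm (b - a) + nm (c - b) + nm (a - c)) * (e / L) <= _).
    rewrite !mulrDl -[X in _ <= X]addrA lerD ?Jd//; apply: le_trans (nmD _ _) _.
    by rewrite lerD ?Jd//.
  rewrite mulrA ler_pdivrMr// mulrC ler_wpM2l ?(ltW e0)//; lra.
have Fh : hol r (J f 0) by move=> z /Dj D; exists (f z).
move=> z zr; have [d D] := hol_der Fh zr; exists d.
have z0 : 0 < r - nm z by rewrite subr_gt0.
apply: cderiv_near z0 _ D => w wz; apply/cder_eq/Dj.
by have := nmD (w - z) z; rewrite subrK; lra.
Qed.
End HolLimit.

Section LineHol.
Variables (R : realType) (m : nat).
Local Notation C := R[i].
Local Notation V := 'rV[R[i]]_m.
Implicit Types (F G : V -> C) (p q v h : V) (z t : C).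

Definition nv p : R := \sum_j nm (p 0 j).

Lemma nv_ge0 p : 0 <= nv p. Proof. exact: sumr_ge0. Qed.
Lemma nv0 : nv 0 = 0. Proof. by rewrite /nv big1// => j _; rewrite mxE nm0. Qed.
Lemma nvD p q : nv (p + q) <= nv p + nv q.
Proof. by rewrite /nv -big_split ler_sum// => j _; rewrite mxE nmD. Qed.
Lemma nvZ z p : nv (z *: p) = nm z * nv p.
Proof. by rewrite /nv mulr_sumr; apply: eq_bigr => j _; rewrite mxE nmM. Qed.
Lemma nvN p : nv (- p) = nv p.
Proof. by rewrite -scaleN1r nvZ nmN nm1 mul1r. Qed.
Lemma nvBC p q : nv (p - q) = nv (q - p).
Proof. by rewrite -nvN opprB. Qed.
Lemma nv_eq0 p : nv p = 0 -> p = 0.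
Proof.
move=> p0; apply/rowP => j; rewrite mxE; apply/eqP; rewrite -nm_eq0 eq_le nm_ge0 andbT.
by rewrite -p0 /nv (bigD1 j)//= lerDl sumr_ge0.
Qed.

(** Entire on every complex line and locally bounded: this weak form of
    holomorphy is stable under the operations needed and suffices throughout. *)
Definition lhol F := (forall p v, entire (fun t => F (p + t *: v))) /\
  (forall p, exists r M : R, 0 < r /\ forall q, nv (q - p) < r -> nm (F q) <= M).

Lemma lhol_lip F p : lhol F -> exists r M K : R, [/\ 0 < r, 0 <= M, 0 <= K,
  forall q, nv (q - p) < r -> nm (F q) <= M &
  forall q q', nv (q - p) < r -> nv (q' - p) < r -> nm (F q' - F q) <= K * nv (q' - q)].
Proof.
move=> [Fe /(_ p) [r [M [r0 FM]]]].
have M0 : 0 <= M by apply: le_trans (FM p _); rewrite ?subrr ?nv0.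
exists (r / 4), M, (4 * M / r); split=> //; first lra.
- by rewrite divr_ge0 ?mulr_ge0// ltW.
- by move=> q qr; apply: FM; lra.
move=> q q' qr qr'; have [/nv_eq0/eqP|n0] := eqVneq (nv (q' - q)) 0.
  by rewrite subr_eq0 => /eqP ->; rewrite !subrr nm0 nv0 mulr0.
have n1 : 0 < nv (q' - q) by rewrite lt_def n0 nv_ge0.
have [s sE] : exists s, s = r / (2 * nv (q' - q)) by eexists.
have sn : s * nv (q' - q) = r / 2 by rewrite sE; field.
have s0 : 0 < s by rewrite sE divr_gt0// mulr_gt0.
have n2 : nv (q' - q) <= r / 2.
  have := nvD (q' - p) (p - q); rewrite subrKA (nvBC p); lra.
have s1 : 1 <= s by rewrite -(ler_pM2r n1) mul1r sn.
pose f t := F (q + t *: (q' - q)) - F q.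
have fe : entire f by apply: entireB; [exact: Fe|exact: entire_cst].
have f0 : f 0 = 0 by rewrite /f scale0r addr0 subrr.
have ss : s < s + 1 by rewrite ltrDl.
have fM w : nm w = s -> nm (f w) <= 2 * M.
  move=> ws; have h1 : nm (F (q + w *: (q' - q))) <= M.
    apply: FM; rewrite addrAC; apply: le_lt_trans (nvD _ _) _; rewrite nvZ ws sn; lra.
  have h2 : nm (F q) <= M by apply: FM; lra.
  by have := nmB (F (q + w *: (q' - q))) (F q); rewrite -/(f w); lra.
have := schwarz s0 ss (entire_hol fe) f0 fM (z := 1).
rewrite nm1 mulr1 => /(_ s1); rewrite /f scale1r [q + _]addrC subrK.
by rewrite (_ : 2 * M / s = 4 * M / r * nv (q' - q))// sE; field; rewrite !gt_eqF.
Qed.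

Lemma line_shift p v a t : p + (a + t) *: v = (p + a *: v) + t *: v.
Proof. by rewrite scalerDl addrA. Qed.

Lemma lholD F G : lhol F -> lhol G -> lhol (fun q => F q + G q).
Proof.
move=> [Fe Fb] [Ge Gb]; split=> [p v|p]; first exact: entireD.
have [r [M [r0 FM]]] := Fb p; have [s [N [s0 GN]]] := Gb p.
exists (Num.min r s), (M + N); split; first by rewrite lt_min r0.
by move=> q; rewrite lt_min => /andP[/FM h /GN h']; apply: le_trans (nmD _ _) _; exact: lerD.
Qed.
Lemma lhol_cst z : lhol (fun=> z).
Proof. by split=> [p v|p]; [exact: entire_cst|exists 1, (nm z)]. Qed.
Lemma lholM F G : lhol F -> lhol G -> lhol (fun q => F q * G q).
Proof.
move=> [Fe Fb] [Ge Gb]; split=> [p v|p]; first exact: entireM.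
have [r [M [r0 FM]]] := Fb p; have [s [N [s0 GN]]] := Gb p.
exists (Num.min r s), (M * N); split; first by rewrite lt_min r0.
by move=> q; rewrite lt_min => /andP[/FM h /GN h']; exact: nm_prod_le2.
Qed.

Lemma lhol_domain F G : lhol F -> lhol G -> (exists p, F p != 0) -> (exists p, G p != 0) ->
  exists p, F p * G p != 0.
Proof.
move=> [Fe _] [Ge _] [p Fp] [q Gq]; apply: contrapT => /forallNP no.
have [t|/(_ 0)|/(_ 1)] := entire_domain (Fe p (q - p)) (Ge p (q - p)).
- by have /negP := no (p + t *: (q - p)); rewrite negbK => /eqP.
- by rewrite scale0r addr0 => E; rewrite E eqxx in Fp.
- by rewrite scale1r addrC subrK => E; rewrite E eqxx in Gq.
Qed.

Definition D v F q := cder (fun t => F (q + t *: v)) 0.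

Lemma D_line F p v t : lhol F -> cderiv (fun s => F (p + s *: v)) t (D v F (p + t *: v)).
Proof.
move=> [Fe _]; rewrite -[X in cderiv _ X _]addr0; apply: cderiv_shift.
have := entire_cder 0 (Fe (p + t *: v) v).
by apply: cderiv_ext => s; rewrite -line_shift.
Qed.

(** Cauchy's estimate along the line in direction [v]. *)
Lemma D_bound F q v (s M : R) : 0 < s -> lhol F ->
  (forall h, nv h <= s * nv v -> nm (F (q + h)) <= M) -> nm (D v F q) <= 2 * M / s.
Proof.
move=> s0 [Fe _] FM; have ss : s < s + 1 by rewrite ltrDl.
apply: (cauchy_est s0 ss (entire_hol (Fe q v))) => t ts.
by apply: FM; rewrite nvZ ler_wpM2r ?nv_ge0.
Qed.

Lemma lhol_D v F : lhol F -> lhol (D v F).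
Proof.
move=> Fl; have [Fe _] := Fl.
have n0 := nv_ge0 v.
split=> [p u|p]; last first.
  have [r [M [K [r0 M0 K0 FM _]]]] := lhol_lip p Fl.
  have [s sE] : exists s, s = r / (2 * (nv v + 1)) by eexists.
  have s0 : 0 < s by rewrite sE divr_gt0//; lra.
  have sv : s * nv v <= r / 2.
    have -> : r / 2 = s * (nv v + 1) by rewrite sE; field; rewrite gt_eqF//; lra.
    by rewrite ler_pM2l//; lra.
  exists (r / 2), (2 * M / s); split; first lra.
  move=> q qr; apply: D_bound => // h hs; apply: FM.
  by rewrite addrAC; apply: le_lt_trans (nvD _ _) _; lra.
suff H q : exists d, cderiv (fun t => D v F (q + t *: u)) 0 d.
  move=> t; have [d H'] := H (p + t *: u); exists d.
  rewrite -[X in cderiv _ X _]addr0; apply: cderiv_shift.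
  by apply: cderiv_ext H' => s; rewrite line_shift.
have [r [M [K [r0 M0 K0 FM _]]]] := lhol_lip q Fl.
have u0 := nv_ge0 u.
have [s sE] : exists s, s = r / (2 * (nv v + nv u + 1)) by eexists.
have s0 : 0 < s by rewrite sE divr_gt0//; lra.
have suv : s * nv v + s * nv u < r.
  have -> : r = 2 * (s * nv v + s * nv u + s) by rewrite sE; field; rewrite gt_eqF//; lra.
  have : 0 <= s * nv v by rewrite mulr_ge0// ltW.
  have : 0 <= s * nv u by rewrite mulr_ge0// ltW.
  lra.
suff Hh : hol s (fun t => D v F (q + t *: u)) by apply: Hh; rewrite nm0.
apply: hol_limit => e e0.
have [k kE] : exists k, k = 4 * M / s ^+ 2 + 1 by eexists.
have k0 : 0 < k.
  have : 0 <= 4 * M / s ^+ 2 by apply: divr_ge0; [apply: mulr_ge0|exact/exprn_ge0/ltW].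
  by lra.
have [a aE] : exists a, a = Num.min s (e / k) by eexists.
have a0 : 0 < a by rewrite aE lt_min s0 divr_gt0.
have as_ : a <= s by rewrite aE ge_min lexx.
have ae : k * a <= e by rewrite mulrC -ler_pdivlMr// aE ge_min lexx orbT.
exists (fun t => (a%:C)^-1 * (F ((q + a%:C *: v) + t *: u) - F (q + t *: u))).
  by apply/entire_hol/entireZ/entireB; exact: Fe.
move=> t ts; have ss : s < s + 1 by rewrite ltrDl.
have aC : a%:C != 0 :> C by rewrite -nm_gt0 nmC_ge0// ltW.
have aa : nm (a%:C : C) = a by rewrite nmC_ge0// ltW.
have := @taylor2 R (s + 1) s M (fun x => F ((q + t *: u) + x *: v)) s0 ss (entire_hol (Fe _ _)).
move/(_ _ a%:C) => H.
have {}H : nm (F (q + t *: u + a%:C *: v) - F (q + t *: u + 0 *: v) - a%:C * D v F (q + t *: u))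
    <= 4 * M / s ^+ 2 * a ^+ 2.
  rewrite -[X in _ <= _ * X ^+ 2]aa; apply: H; last by rewrite aa.
  move=> x xs; apply: FM; rewrite -(addrA q) [_ - q]addrC addKr.
  apply: le_lt_trans (nvD _ _) _; rewrite !nvZ.
  have : nm t * nv u <= s * nv u by rewrite ler_wpM2r// ltW.
  have : nm x * nv v <= s * nv v by rewrite ler_wpM2r.
  lra.
rewrite scale0r addr0 [q + _ + a%:C *: v]addrAC in H.
have -> : D v F (q + t *: u) - (a%:C)^-1 * (F (q + a%:C *: v + t *: u) - F (q + t *: u)) =
  - (a%:C)^-1 * (F (q + a%:C *: v + t *: u) - F (q + t *: u) - a%:C * D v F (q + t *: u)).
  by field.
rewrite nmM nmN nmV aa; apply: le_trans ae; rewrite ler_pdivrMl//.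
apply: le_trans H _; have -> : a * (k * a) = k * a ^+ 2 by ring.
by apply: ler_wpM2r; [exact/exprn_ge0/ltW|lra].
Qed.
End LineHol.

(** * Orders of vanishing *)

Section LineOrder.
Variable R : realType.
Local Notation C := R[i].
Implicit Types (f g : C -> C) (a b c z t : C).

Definition ordat f a l := exists g, [/\ entire g, g a != 0 & forall z, f z = (z - a) ^+ l * g z].

Lemma ordat0 f a : entire f -> f a != 0 -> ordat f a 0.
Proof. by move=> fe fa; exists f; split=> // z; rewrite expr0 mul1r. Qed.

Lemma ordat_zero f a l : ordat f a l -> (f a == 0) = (0 < l)%N.
Proof.
move=> [g [_ ga ->]]; rewrite subrr mulf_eq0 (negPf ga) orbF.
by case: l => [|l]; rewrite ?expr0 ?oner_eq0// exprS mul0r eqxx.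
Qed.

Lemma ordat_der l f a : ordat f a l.+1 -> ordat (cder f) a l.
Proof.
move=> [g [ge ga gE]].
have e1 n : entire (fun z => (z - a) ^+ n).
  by apply: entireX; apply: entireB; [exact: entire_id|exact: entire_cst].
exists (fun z => l.+1%:R * g z + (z - a) * cder g z); split.
- by apply: entireD; [exact: entireZ|apply: entireM (entire_der ge); exact: e1 1%N].
- by rewrite subrr mul0r addr0 mulf_neq0 ?pnatr_eq0.
have Dx n z : cderiv (fun z => (z - a) ^+ n.+1) z (n.+1%:R * (z - a) ^+ n).
  elim: n => [|n IH].
    rewrite expr0 mulr1 -[1%:R]subr0; apply: cderiv_ext (cderivB (cderiv_id z) (cderiv_cst a z)) => w.
    by rewrite expr1.
  have := cderivM (cderivB (cderiv_id z) (cderiv_cst a z)) IH.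
  move/cderiv_ext => /(_ (fun z => (z - a) ^+ n.+2)) H.
  have {H} := H (fun w => esym (exprS _ _)); congr cderiv.
  by rewrite subr0 mul1r [in LHS]exprS -[n.+2]addn1 natrD exprS; ring.
move=> z; apply/cder_eq/(cderiv_ext (fun w => esym (gE w))).
have := cderivM (Dx l z) (entire_cder z ge); congr cderiv.
by rewrite exprS; ring.
Qed.

Lemma ordat_iter l f a : ordat f a l ->
  (forall j, (j < l)%N -> iter j (@cder R) f a = 0) /\ iter l (@cder R) f a != 0.
Proof.
elim: l f => [|l IH] f fo.
  by split=> //; have := ordat_zero fo; rewrite /= => ->.
have [H1 H2] := IH _ (ordat_der fo); split=> [[|j] jl|].
- by apply/eqP; rewrite (ordat_zero fo).
- by rewrite iterSr; apply: H1.
- by rewrite iterSr.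
Qed.

Lemma ordat_uniq f a k l : ordat f a k -> ordat f a l -> k = l.
Proof.
move=> /ordat_iter [H1 H2] /ordat_iter [H3 H4].
by case: (ltngtP k l) => // h; [rewrite H3 ?eqxx// in H2|rewrite H1 ?eqxx// in H4].
Qed.

Lemma ordat_mulX f a b k : ordat f a k -> ordat (fun z => (z - b) * f z) a (k + (a == b)).
Proof.
have e1 : entire (fun z => z - b) by apply: entireB; [exact: entire_id|exact: entire_cst].
move=> [g [ge ga gE]]; have [<-|ab] := eqVneq a b.
  exists g; split=> // z; rewrite gE addn1 exprS; ring.
exists (fun z => (z - b) * g z); split; first exact: entireM.
  by rewrite mulf_neq0// subr_eq0.
by move=> z; rewrite gE addn0; ring.
Qed.

Lemma ordat_shift f a b l : ordat (fun t => f (a + t)) b l <-> ordat f (a + b) l.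
Proof.
have sh g c : entire g -> entire (fun t => g (c + t)).
  by move=> ge; apply: entire_ext (entire_line c 1 ge) => t; rewrite mulr1.
split=> [] [g [ge ga gE]].
  exists (fun t => g (- a + t)); split; [exact: sh|by rewrite addKr|move=> z].
  rewrite -{1}(addKr (- a) z) opprK gE; congr (_ ^+ _ * _); ring.
exists (fun t => g (a + t)); split; [exact: sh|by []|move=> z].
rewrite gE; congr (_ ^+ _ * _); ring.
Qed.

(** If [f] and [g] have the same zeros with multiplicity in a disc then a
    comparison on a circle propagates to the centre. *)
Lemma compare_disc (n : nat) f g (r1 r2 M : R) : 0 < r1 -> r1 < r2 -> entire f -> entire g ->
  (forall a k k', nm a < r2 -> ordat f a k -> ordat g a k' -> k = k') ->
  (exists2 l : seq C, size l = n & exists2 f1, entire f1 &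
     (forall z, f z = \prod_(b <- l) (z - b) * f1 z) /\ (forall b, b \in l -> nm b < r1) /\
     forall z, nm z < r2 -> f1 z != 0) ->
  (exists z, f z != 0) -> (exists z, g z != 0) ->
  (forall z, nm z = r1 -> nm (f z) <= M * nm (g z)) -> nm (f 0) <= M * nm (g 0).
Proof.
move=> r10 r12; elim: n f g => [|n IH] f g fe ge fg [l ln [f1 f1e [fE [lr f10]]]] fz gz fM.
  case: l ln fE lr => // _ fE _.
  have f0 a : nm a < r2 -> f a != 0 by move=> ar; rewrite fE big_nil mul1r f10.
  have g0 a : nm a < r2 -> g a != 0.
    case: gz => w gw ar; have [k' [h hP]] := entire_ord a ge gw.
    have hk : ordat g a k' by exists h.
    have := fg a 0%N k' ar (ordat0 fe (f0 a ar)) hk => k0.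
    by have := ordat_zero hk; rewrite -k0 => ->.
  have uh : hol r2 (fun z => f z * (g z)^-1).
    move=> z zr; have [d Dd] := fe z; have [d' D'] := ge z.
    by exists (d * (g z)^-1 + f z * (- d' / g z ^+ 2)); apply: cderivM => //; apply: cderivV => //; exact: g0.
  have := @max_principle R r2 r1 M _ r10 r12 uh _ 0; rewrite nm0 nmM nmV.
  have n0 : nm (0 : C) < r2 by rewrite nm0; lra.
  rewrite ler_pdivrMr ?nm_gt0 ?g0//; apply; last exact: ltW.
  move=> z zr; have zr2 : nm z < r2 by rewrite zr.
  by rewrite nmM nmV ler_pdivrMr ?nm_gt0 ?g0//; exact: fM.
case: l ln fE lr => // b l [ln] fE lr.
have br : nm b < r1 by apply: lr; rewrite mem_head.
have br2 : nm b < r2 by lra.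
have fb : f b = 0 by rewrite fE big_cons subrr !mul0r.
case: fz => z1 fz1; case: gz => z2 gz2.
have gb : g b = 0.
  have [k [h hP]] := entire_ord b fe fz1; have hk : ordat f b k by exists h.
  have [k' [h' hP']] := entire_ord b ge gz2; have hk' : ordat g b k' by exists h'.
  apply/eqP; rewrite (ordat_zero hk') -(fg _ _ _ br2 hk hk') -(ordat_zero hk).
  exact/eqP.
have [g' ge' gE'] := entire_quot ge gb.
pose f' z := \prod_(c <- l) (z - c) * f1 z.
have fE' z : f z = (z - b) * f' z by rewrite fE big_cons mulrA.
have fe' : entire f'.
  apply: entireM => //; apply: entire_prod => c _; apply: entireB; [exact: entire_id|exact: entire_cst].
have [b0|b0] := eqVneq b 0; last first.
  have H : nm (f' 0) <= M * nm (g' 0).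
    apply: (IH f' g') => //.
    - move=> a k k' ar fk gk; apply: (@addIn (a == b)); apply: (fg a) => //.
        have := ordat_mulX b fk; rewrite [X in ordat X](_ : _ = f)//.
        by apply/funext => z; rewrite fE'.
      have := ordat_mulX b gk; rewrite [X in ordat X](_ : _ = g)//.
      by apply/funext => z; rewrite gE'.
    - exists l => //; exists f1 => //; split=> //; split=> // c cl.
      by apply: lr; rewrite inE cl orbT.
    - by exists z1; move: fz1; rewrite fE' mulf_eq0 negb_or => /andP[].
    - by exists z2; move: gz2; rewrite gE' mulf_eq0 negb_or => /andP[].
    - move=> z zr; have := fM z zr; rewrite fE' gE' (nmM _ (f' _)) (nmM _ (g' _)) mulrCA ler_pM2l// nm_gt0 subr_eq0.
      by apply/eqP => zb; rewrite -zb zr ltxx in br.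
  by rewrite fE' gE' (nmM _ (f' _)) (nmM _ (g' _)) mulrCA ler_wpM2l.
by move: fb gb; rewrite b0 => -> ->; rewrite nm0 mulr0.
Qed.
End LineOrder.

Section Orders.
Variables (R : realType) (m : nat).
Local Notation C := R[i].
Local Notation V := 'rV[R[i]]_m.
Implicit Types (F G : V -> C) (p q v h x : V) (z t : C).

Definition dlt (j : 'I_m) : V := delta_mx 0 j.

Lemma nv_dlt j : nv (dlt j) = 1.
Proof.
rewrite /nv (bigD1 j)//= big1 => [|k kj]; rewrite !mxE eqxx/=; first by rewrite eqxx nm1 addr0.
by rewrite (negPf kj) nm0.
Qed.

Definition iterD (s : seq 'I_m) F := foldr (fun j G => D (dlt j) G) F s.

Lemma lhol_iterD s F : lhol F -> lhol (iterD s F).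
Proof. by move=> Fl; elim: s => //= j s; exact: lhol_D. Qed.

Definition ordO F p k := exists r K : R, [/\ 0 < r, 0 <= K & forall (rho : R) h,
  0 < rho -> rho < r -> nv h <= rho -> nm (F (p + h)) <= K * rho ^+ k].

Lemma ordO_zero F p k : ordO F p k.+1 -> F p = 0.
Proof.
move=> [r [K [r0 K0 H]]]; apply: eq0_le_eps => e e0.
have [s sE] : exists s, s = Num.min (r / 2) (Num.min 1 (e / (K + 1))) by eexists.
have s0 : 0 < s by rewrite sE !lt_min !divr_gt0//; lra.
have sr : s < r by have : s <= r / 2; [rewrite sE ge_min lexx|lra].
have s1 : s <= 1 by rewrite sE !ge_min lexx !orbT.
have se : s * (K + 1) <= e by rewrite -ler_pdivlMr ?sE ?ge_min ?lexx ?orbT//; lra.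
have := H s 0 s0 sr; rewrite nv0 addr0 => /(_ (ltW s0)) /le_trans; apply.
apply: le_trans se; rewrite mulrC; apply: ler_pM; rewrite ?exprn_ge0 ?(ltW s0)//; last lra.
by rewrite exprS ler_piMr ?(ltW s0)// exprn_ile1// ltW.
Qed.

Lemma ordO_D F p k j : lhol F -> ordO F p k.+1 -> ordO (D (dlt j) F) p k.
Proof.
move=> Fl [r [K [r0 K0 H]]]; exists (r / 2), (4 * K * 2 ^+ k); split; first lra.
  by rewrite mulr_ge0 ?exprn_ge0// mulr_ge0.
move=> rho h h0 hr hh; apply: le_trans (D_bound (s := rho) (M := K * (2 * rho) ^+ k.+1) h0 Fl _) _.
  move=> h'; rewrite nv_dlt mulr1 => hh'; rewrite -addrA; apply: H; [lra|lra|].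
  by apply: le_trans (nvD _ _) _; lra.
rewrite le_eqVlt; apply/orP; left; apply/eqP; rewrite exprMn !exprS; field; exact: lt0r_neq0.
Qed.

Lemma ordO_iterD F p s k : lhol F -> ordO F p (size s + k) -> ordO (iterD s F) p k.
Proof.
move=> Fl; elim: s k => //= j s IH k Fo; apply: ordO_D; first exact: lhol_iterD.
by apply: IH; rewrite addnS.
Qed.

Lemma ordO_vanish F p k s : lhol F -> ordO F p k -> (size s < k)%N -> iterD s F p = 0.
Proof.
move=> Fl Fo sk; apply: (@ordO_zero _ _ (k - size s).-1); apply: ordO_iterD => //.
by rewrite prednK ?subn_gt0// subnKC// ltnW.
Qed.

(** Moving from [p] to [p + h] one coordinate at a time. *)
Lemma ordO_step F p k : lhol F -> F p = 0 -> (forall j, ordO (D (dlt j) F) p k) -> ordO F p k.+1.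
Proof.
move=> Fl F0 DF.
have [r [K [r0 K0 H]]] : exists r K : R, [/\ 0 < r, 0 <= K & forall j (rho : R) h,
    0 < rho -> rho < r -> nv h <= rho -> nm (D (dlt j) F (p + h)) <= K * rho ^+ k].
  suff : forall l : seq 'I_m, exists r K : R, [/\ 0 < r, 0 <= K & forall j, j \in l -> forall (rho : R) h,
    0 < rho -> rho < r -> nv h <= rho -> nm (D (dlt j) F (p + h)) <= K * rho ^+ k].
    by move=> /(_ (enum 'I_m)) [r [K [r0 K0 H]]]; exists r, K; split=> // j; apply: H; rewrite mem_enum.
  elim=> [|j l [r [K [r0 K0 H]]]]; first by exists 1, 0.
  have [r' [K' [r'0 K'0 H']]] := DF j; exists (Num.min r r'), (K + K'); split.
  - by rewrite lt_min r0.
  - exact: addr_ge0.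
  move=> i il rho h h0; rewrite lt_min => /andP[hr hr'] hh.
  have X0 : 0 <= rho ^+ k by rewrite exprn_ge0// ltW.
  move: il; rewrite inE => /predU1P[->|il].
    by apply: le_trans (H' _ _ h0 hr' hh) _; rewrite ler_wpM2r// lerDr.
  by apply: le_trans (H _ il _ _ h0 hr hh) _; rewrite ler_wpM2r// lerDl.
exists r, (m%:R * K); split=> //; first exact: mulr_ge0.
move=> rho h h0 hr hh.
pose hc (c : nat) : V := \row_i (if (i < c)%N then h 0 i else 0).
have hcm : hc m = h by apply/rowP => i; rewrite mxE ltn_ord.
have hc0 : hc 0%N = 0 by apply/rowP => i; rewrite !mxE.
suff S c : (c <= m)%N -> nm (F (p + hc c)) <= c%:R * (K * rho ^+ k * rho).
  by have := S m (leqnn m); rewrite hcm exprSr !mulrA.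
elim: c => [|c IH] cm; first by rewrite hc0 addr0 F0 nm0 mul0r.
pose j := Ordinal cm.
have hS : hc c.+1 = hc c + h 0 j *: dlt j.
  apply/rowP => i; rewrite !mxE eqxx /= ltnS leq_eqVlt -(inj_eq val_inj) /= eq_sym.
  have [->|ij] := eqVneq i j; first by rewrite /= eqxx ltnn/= mulr1 add0r.
  have -> : (c == i) = false by apply/eqP => ci; case/eqP: ij; apply/val_inj.
  by rewrite mulr0 addr0.
have nh : nv (hc c) + nm (h 0 j) <= rho.
  apply: le_trans hh; rewrite /nv (bigD1 j)//= [X in _ <= X](bigD1 j)//= mxE ltnn nm0 add0r addrC.
  by rewrite lerD2r ler_sum// => i _; rewrite mxE; case: ifP; rewrite ?nm0.
have E : nm (F (p + hc c.+1) - F (p + hc c)) <= K * rho ^+ k * nm (h 0 j - 0).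
  have := @cmv R (fun t => F (p + hc c + t *: dlt j)) (fun t => D (dlt j) F (p + hc c + t *: dlt j)) 0 (h 0 j) (K * rho ^+ k).
  rewrite scale0r addr0 -addrA -hS; apply=> t t01; first exact: D_line.
  rewrite -addrA; apply: H => //; apply: le_trans (nvD _ _) _.
  rewrite nvZ nv_dlt mulr1; apply: le_trans nh; rewrite lerD2l.
  by apply: nm_seg; rewrite ?nm0.
rewrite -(subrK (F (p + hc c)) (F (p + hc c.+1))); apply: le_trans (nmD _ _) _.
rewrite -natr1 mulrDl mul1r addrC lerD ?IH ?(ltnW cm)//; apply: le_trans E _.
rewrite subr0 ler_wpM2l ?mulr_ge0 ?exprn_ge0 ?(ltW h0)//.
by have := nv_ge0 (hc c); lra.
Qed.

Lemma ordO_of_iterD k F p : lhol F -> (forall s, (size s < k)%N -> iterD s F p = 0) -> ordO F p k.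
Proof.
elim: k F => [|k IH] F Fl H.
  have [r [M [K [r0 M0 _ FM _]]]] := lhol_lip p Fl; exists r, M; split=> // rho h _ hr hh.
  by rewrite mulr1; apply: FM; rewrite addrC addKr; apply: le_lt_trans hr.
apply: ordO_step => //; first exact: (H [::]).
move=> j; apply: IH; first exact: lhol_D.
by move=> s sk; have := H (rcons s j); rewrite size_rcons /iterD foldr_rcons; apply.
Qed.

Definition vorder F p k := (forall s, (size s < k)%N -> iterD s F p = 0) /\
  exists2 s, size s = k & iterD s F p <> 0.

Lemma vorder_uniq F p k l : vorder F p k -> vorder F p l -> k = l.
Proof.
move=> [H1 [s sk s0]] [H2 [s' sl s'0]]; case: (ltngtP k l) => // h.
  by case: s0; apply: H2; rewrite sk.
by case: s'0; apply: H1; rewrite sl.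
Qed.

Definition lineF F p v t := F (p + t *: v).

Lemma Dn_iter F p v l t : lhol F -> iter l (D v) F (p + t *: v) = iter l (@cder R) (lineF F p v) t.
Proof.
move=> Fl; elim: l t => // l IH t /=.
have Il : lhol (iter l (D v) F) by elim: l {IH} => //= l; exact: lhol_D.
have := D_line p v t Il => H; rewrite -(cder_eq H).
by congr (cder _ t); apply/funext => s; rewrite IH.
Qed.

(** When the order along some line is attained by the full order of vanishing
    estimate, it is the vanishing order. *)
Lemma vorder_line F p v k : lhol F -> ordat (lineF F p v) 0 k -> ordO F p k -> vorder F p k.
Proof.
move=> Fl fo Fo; split=> [s|]; first exact: ordO_vanish.
apply: contrapT => /forall2NP no.
have [r [K [r0 K0 H]]] : ordO F p k.+1.
  apply: ordO_of_iterD => // s; rewrite ltnS leq_eqVlt => /orP[/eqP sk|]; last exact: ordO_vanish.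
  by apply: contrapT => h; case: (no s).
have [g [ge g0 gE]] := fo; case/eqP: g0; apply: eq0_le_eps => e e0.
have e2 : 0 < e / 2 by lra.
have [d d0 dP] := entire_cont 0 ge e2.
have n1 : 0 < nv v + 1 by have := nv_ge0 v; lra.
have [L LE] : exists L, L = K * (nv v + 1) ^+ k.+1 by eexists.
have L0 : 0 <= L by rewrite LE mulr_ge0// exprn_ge0// ltW.
have [s sE] : exists s, s = Num.min (d / 2) (Num.min (r / (2 * (nv v + 1))) (e / (2 * (L + 1)))) by eexists.
have s0 : 0 < s by rewrite sE !lt_min !divr_gt0// ?mulr_gt0//; lra.
have sd : s < d by have : s <= d / 2; [rewrite sE ge_min lexx|lra].
have sr : s * (nv v + 1) < r.
  have : s <= r / (2 * (nv v + 1)) by rewrite sE !ge_min lexx !orbT.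
  by rewrite ler_pdivlMr ?mulr_gt0//; lra.
have sL : s * (2 * (L + 1)) <= e.
  by rewrite -ler_pdivlMr ?sE ?ge_min ?lexx ?orbT// mulr_gt0//; lra.
have as_ : nm (s%:C : C) = s by rewrite nmC_ge0// ltW.
have := dP s%:C; rewrite subr0 as_ => /(_ sd).
have := H (s * (nv v + 1)) (s%:C *: v) ltac:(by rewrite mulr_gt0) sr.
rewrite nvZ as_ ler_wpM2l ?(ltW s0) ?lerDl// => /(_ isT).
have := gE s%:C; rewrite /lineF => ->; rewrite subr0 nmM nmX as_ exprMn mulrCA -LE exprSr -mulrA.
rewrite ler_pM2l ?exprn_gt0// => h1 h2.
have := nmD (g s%:C) (g 0 - g s%:C); rewrite addrC subrK nmBC.
have : s * L <= e / 2 by have := ltW s0; move: sL; rewrite mulrDr mulrDr; lra.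
lra.
Qed.
End Orders.

(** * Persistence of zeros *)

Section Generic.
Variables (R : realType) (m : nat).
Local Notation C := R[i].
Local Notation V := 'rV[R[i]]_m.
Implicit Types (F G : V -> C) (p q v h x : V) (z t : C).

Lemma seq_common (T : eqType) (l : seq T) (P : T -> R -> Prop) :
  (forall b (e e' : R), e' <= e -> P b e -> P b e') ->
  (forall b, b \in l -> exists2 e : R, 0 < e & P b e) ->
  exists2 e : R, 0 < e & forall b, b \in l -> P b e.
Proof.
move=> mono; elim: l => [|b l IH] H; first by exists 1.
have [|e e0 He] := IH; first by move=> c cl; apply: H; rewrite inE cl orbT.
have [e' e'0 He'] := H b (mem_head _ _).
exists (Num.min e e') => [|c]; first by rewrite lt_min e0.
rewrite inE => /predU1P[->|/He]; first by apply: mono He'; rewrite ge_min lexx orbT.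
by apply: mono; rewrite ge_min lexx.
Qed.

Lemma lhol_Dn l v F : lhol F -> lhol (iter l (D v) F).
Proof. by move=> Fl; elim: l => //= l; exact: lhol_D. Qed.

Lemma lhol_cont F p (e : R) : lhol F -> 0 < e ->
  exists2 d : R, 0 < d & forall q, nv (q - p) < d -> nm (F q - F p) <= e.
Proof.
move=> Fl e0; have [r [M [K [r0 M0 K0 _ FK]]]] := lhol_lip p Fl.
exists (Num.min r (e / (K + 1))) => [|q]; first by rewrite lt_min r0 divr_gt0//; lra.
rewrite lt_min ltr_pdivlMr => [/andP[qr qe]|]; last lra.
apply: le_trans (FK p q _ qr) _; first by rewrite subrr nv0.
by have := nv_ge0 (q - p); move: qe; rewrite mulrDr; lra.
Qed.

Lemma lhol_neq0 F p : lhol F -> F p != 0 ->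
  exists2 d : R, 0 < d & forall q, nv (q - p) < d -> nm (F p) / 2 <= nm (F q).
Proof.
rewrite -nm_gt0 => Fl f0; have h0 : 0 < nm (F p) / 2 by lra.
have [d d0 H] := lhol_cont p Fl h0; exists d => // q /H.
by have := nm_sub (F p) (F p - F q); rewrite subKr (nmBC (F p)); lra.
Qed.

Lemma lineF_entire F p v : lhol F -> entire (lineF F p v).
Proof. by case=> + _; apply. Qed.

Lemma lineF_shift F p v a : lineF F (p + a *: v) v = (fun t => lineF F p v (a + t)).
Proof. by apply/funext => t; rewrite /lineF line_shift. Qed.

Lemma ordat_ex (f : C -> C) z1 a : entire f -> f z1 != 0 -> exists l, ordat f a l.
Proof. by move=> fe /(entire_ord a fe) [l [g H]]; exists l, g. Qed.

Lemma Dn_ord F x v l : lhol F -> ordat (lineF F x v) 0 l ->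
  (forall j, (j < l)%N -> iter j (D v) F x = 0) /\ iter l (D v) F x != 0.
Proof.
move=> Fl /ordat_iter []; have E j : iter j (D v) F x = iter j (@cder R) (lineF F x v) 0.
  by have := Dn_iter x v j 0 Fl; rewrite scale0r addr0.
by rewrite -E => H1 H2; split=> // j /H1; rewrite E.
Qed.

Lemma ord_semicont F x v l : lhol F -> ordat (lineF F x v) 0 l ->
  exists2 e : R, 0 < e & forall x' l', nv (x' - x) < e -> ordat (lineF F x' v) 0 l' -> (l' <= l)%N.
Proof.
move=> Fl /(Dn_ord Fl) [_ H]; have [d d0 dP] := lhol_neq0 (lhol_Dn l v Fl) H.
exists d => // x' l' /dP hx /(Dn_ord Fl) [H' _]; rewrite leqNgt; apply/negP => /H' E.
move: hx; rewrite E nm0; rewrite -nm_gt0 in H; lra.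
Qed.

(** Zeros persist: otherwise [1 / F] on nearby lines violates the maximum
    principle. *)
Lemma hurwitz F x v l (eta : R) : lhol F -> F x = 0 -> ordat (lineF F x v) 0 l -> 0 < eta ->
  exists2 e : R, 0 < e & forall x', nv (x' - x) < e -> exists2 t, nm t < eta & F (x' + t *: v) = 0.
Proof.
move=> Fl Fx [g [ge g0 gE]] eta0.
have [d d0 dP] := ccont_neq0 (entire_cont 0 ge) g0.
have [r [M [K [r0 M0 K0 FM FK]]]] := lhol_lip x Fl.
have nv0' := nv_ge0 v; have g1 : 0 < nm (g 0) by rewrite nm_gt0.
have [s sE] : exists s, s = Num.min (eta / 2) (Num.min (d / 2) (r / (2 * (nv v + 1)))) by eexists.
have s0 : 0 < s by rewrite sE !lt_min !divr_gt0//; lra.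
have se : s < eta by have : s <= eta / 2; [rewrite sE ge_min lexx|lra].
have sd : s < d by have : s <= d / 2; [rewrite sE !ge_min lexx orbT|lra].
have sr : s * nv v <= r / 2.
  have : s <= r / (2 * (nv v + 1)) by rewrite sE !ge_min lexx !orbT.
  by rewrite ler_pdivlMr; [lra|lra].
have [c cE] : exists c, c = s ^+ l * (nm (g 0) / 2) by eexists.
have c0 : 0 < c by rewrite cE mulr_gt0 ?exprn_gt0// divr_gt0.
have Fc t : nm t = s -> c <= nm (F (x + t *: v)).
  move=> ts; have := gE t; rewrite /lineF subr0 => ->; rewrite nmM nmX ts cE.
  by rewrite ler_wpM2l ?exprn_ge0 ?(ltW s0)//; apply/ltW/dP; rewrite subr0 ts.
exists (Num.min (r / 4) (c / (4 * (K + 1)))) => [|x'].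
  by rewrite lt_min !divr_gt0//; lra.
rewrite lt_min => /andP[xr xc].
have Kc : K * nv (x' - x) <= c / 4.
  move: xc; rewrite ltr_pdivlMr; last by lra.
  by have := nv_ge0 (x' - x); lra.
apply: contrapT => /forall2NP no.
have n0 t : nm t < eta -> F (x' + t *: v) != 0.
  by move=> te; apply/eqP => E; case: (no t).
have diff t : nm t <= s -> nm (F (x' + t *: v) - F (x + t *: v)) <= c / 4.
  move=> ts; apply: le_trans Kc; have tv : nm t * nv v <= s * nv v by rewrite ler_wpM2r.
  have -> : x' - x = (x' + t *: v) - (x + t *: v) by rewrite opprD addrACA subrr addr0.
  apply: FK; rewrite addrAC; apply: le_lt_trans (nvD _ _) _; rewrite nvZ; last by lra.
  by rewrite subrr nv0; lra.
have uh : hol eta (fun t => (lineF F x' v t)^-1).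
  move=> t te; have [d' D'] := lineF_entire x' v Fl t.
  by exists (- d' / lineF F x' v t ^+ 2); apply: cderivV => //; exact: n0.
have := @max_principle R eta s (2 / c) _ s0 se uh _ 0; rewrite nm0 nmV.
move=> H; have := H _ (ltW s0); rewrite /lineF scale0r addr0 => {}H.
have F0 : F x' != 0 by have := n0 0; rewrite nm0 scale0r addr0; apply.
have : (nm (F x'))^-1 <= 2 / c.
  apply: H => t ts; rewrite nmV -[2 / c]invrK lef_pV2 ?posrE ?invr_gt0 ?divr_gt0//; last first.
    by rewrite nm_gt0 n0// ts.
  rewrite invf_div; have := Fc t ts; have := diff t; rewrite ts lexx => /(_ isT).
  have := nm_sub (F (x + t *: v)) (F (x + t *: v) - F (x' + t *: v)).
  by rewrite subKr (nmBC (F (x' + _))); lra.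
rewrite -[2 / c]invrK lef_pV2 ?posrE ?invr_gt0 ?divr_gt0 ?nm_gt0// invf_div.
have := diff 0; rewrite nm0 !scale0r !addr0 Fx subr0 => /(_ (ltW s0)); lra.
Qed.

Lemma leq_sum_seq_eq (T : eqType) (l : seq T) (f g : T -> nat) :
  (forall b, b \in l -> (f b <= g b)%N) -> (\sum_(b <- l) g b <= \sum_(b <- l) f b)%N ->
  forall b, b \in l -> f b = g b.
Proof.
elim: l => // b l IH H; rewrite !big_cons => S c.
have h1 := H b (mem_head _ _).
have hl c' : c' \in l -> (f c' <= g c')%N by move=> cl; apply: H; rewrite inE cl orbT.
have h2 : (\sum_(b <- l) f b <= \sum_(b <- l) g b)%N.
  by rewrite big_seq [leqRHS]big_seq; apply: leq_sum.
have e1 : f b = g b.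
  apply/eqP; rewrite eqn_leq h1 /= -(leq_add2r (\sum_(b <- l) g b)%N).
  by apply: leq_trans S _; rewrite leq_add2l.
rewrite inE => /predU1P[->//|cl]; apply: IH => //.
by move: S; rewrite e1 leq_add2l.
Qed.

(** Where, locally, the zeros along lines in direction [v] have constant
    multiplicity, the order along the line is the full order: the zero moves
    Lipschitz-continuously with the line. *)
Lemma ordO_const F q v l (w : V -> C) (e : R) : lhol F -> 0 < e -> (0 < l)%N ->
  (forall q', nv (q' - q) < e -> ordat (lineF F (q' + w q' *: v) v) 0 l) ->
  (forall eta : R, 0 < eta -> exists2 d : R, 0 < d & forall q', nv (q' - q) < d -> nm (w q' - w q) < eta) ->
  ordO F (q + w q *: v) l.
Proof.
move=> Fl e0 l0 Ho wc; set x := q + w q *: v.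
have qq : nv (q - q) < e by rewrite subrr nv0.
pose P := iter l.-1 (D v) F.
have Pl : lhol P by exact: lhol_Dn.
have [H1 H2] := Dn_ord Fl (Ho q qq).
have Px : P x = 0 by apply: H1; rewrite prednK.
have Px0 : lineF P x v 0 = 0 by rewrite /lineF scale0r addr0.
have [g ge gE] := entire_quot (lineF_entire x v Pl) Px0.
have g0 : g 0 != 0.
  move: H2; rewrite -(prednK l0) /= -/P -/x; congr (_ != 0).
  have := D_line x v 0 Pl; rewrite scale0r addr0 => /cderiv_uniq; apply.
  have := cderivM (cderivB (cderiv_id 0) (cderiv_cst 0 0)) (entire_cder 0 ge).
  by rewrite subrr mul0r addr0 subr0 mul1r; apply: cderiv_ext => t; rewrite -gE.
have [d d0 dP] := ccont_neq0 (entire_cont 0 ge) g0.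
have [r [M [K [r0 M0 K0 FM _]]]] := lhol_lip x Fl.
have [r' [M' [K' [r'0 M'0 K'0 _ PK]]]] := lhol_lip x Pl.
have nvv := nv_ge0 v.
have g1 : 0 < nm (g 0) / 2 by rewrite divr_gt0// nm_gt0.
have [a aE] : exists a, a = Num.min d (Num.min (r' / (2 * (nv v + 1))) (r / (4 * (nv v + 1)))) by eexists.
have a0 : 0 < a by rewrite aE !lt_min d0 !divr_gt0//; lra.
have ad : a <= d by rewrite aE ge_min lexx.
have ar' : a * (nv v + 1) <= r' / 2.
  have : a <= r' / (2 * (nv v + 1)) by rewrite aE !ge_min lexx !orbT.
  by rewrite ler_pdivlMr; lra.
have ar : a * (nv v + 1) <= r / 4.
  have : a <= r / (4 * (nv v + 1)) by rewrite aE !ge_min lexx !orbT.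
  by rewrite ler_pdivlMr; lra.
have [c c0 cP] := wc a a0.
have [L LE] : exists L, L = K' / (nm (g 0) / 2) by eexists.
have L0 : 0 <= L by rewrite LE divr_ge0// ltW.
exists (Num.min c (Num.min e (Num.min (r' / 2) (r / 4)))), (M / a ^+ l * L ^+ l); split.
- by rewrite !lt_min c0 e0 !divr_gt0.
- by rewrite mulr_ge0 ?divr_ge0 ?exprn_ge0// ltW.
move=> rho h h0; rewrite !lt_min => /and4P[hc he hr' hr] hh.
pose q' := q + h.
have qE : q' - q = h by rewrite /q' addrC addKr.
have wq : nm (w q' - w q) < a by apply: cP; rewrite qE; lra.
have ho : ordat (lineF F (q' + w q' *: v) v) 0 l by apply: Ho; rewrite qE; lra.
have [t tE] : exists t, t = w q' - w q by eexists.
have wt : w q' = w q + t by rewrite tE addrC subrK.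
rewrite -tE in wq.
have tv : nm t * nv v <= a * (nv v + 1).
  by apply: ler_pM => //; [exact: ltW|lra].
have xt : q' + w q' *: v = x + h + t *: v by rewrite wt scalerDl /x /q' addrA (addrAC q).
have tL : nm t <= L * rho.
  have [H3 _] := Dn_ord Fl ho.
  have P0 : P (x + h + t *: v) = 0 by rewrite -xt; apply: H3; rewrite prednK.
  have := PK (x + h + t *: v) (x + t *: v).
  rewrite P0 subr0 -/(lineF P x v t) gE subr0 nmM.
  have -> : x + t *: v - (x + h + t *: v) = - h.
    by rewrite opprD addrACA subrr addr0 opprD addrA subrr add0r.
  have -> : x + h + t *: v - x = h + t *: v by rewrite -(addrA x) [_ - x]addrC addKr.
  have -> : x + t *: v - x = t *: v by rewrite addrC addKr.
  rewrite nvN nvZ => H.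
  have {}H : nm t * nm (g t) <= K' * nv h.
    by apply: H; [apply: le_lt_trans (nvD _ _) _; rewrite nvZ|]; lra.
  have gt : nm (g 0) / 2 <= nm (g t) by apply/ltW/dP; rewrite subr0; lra.
  rewrite LE mulrAC ler_pdivlMr//.
  apply: le_trans (ler_wpM2l (nm_ge0 t) gt) _; apply: le_trans H _.
  by rewrite ler_wpM2l.
have [k [ke k0 kE]] := ho.
have -> : x + h = (q' + w q' *: v) + (- t) *: v by rewrite xt scaleNr addrK.
rewrite -/(lineF F _ v (- t)) kE subr0 nmM nmX nmN.
have kM : nm (k (- t)) <= M / a ^+ l.
  have a1 : a < a + 1 by rewrite ltrDl.
  apply: (max_principle a0 a1 (entire_hol ke)); last by rewrite nmN ltW.
  move=> z za; rewrite ler_pdivlMr ?exprn_gt0// -za -nmX -nmM mulrC.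
  have := kE z; rewrite subr0 => <-; rewrite /lineF xt; apply: FM.
  have -> : x + h + t *: v + z *: v - x = h + (t *: v + z *: v).
    by rewrite -!(addrA x) [x + _]addrC subrK -addrA.
  apply: le_lt_trans (nvD _ _) _; apply: le_lt_trans (_ : rho + (nm t * nv v + nm z * nv v) < _).
    by rewrite lerD// -!nvZ nvD.
  by rewrite za; have : a * nv v <= a * (nv v + 1); [rewrite ler_wpM2l ?(ltW a0)// lerDl|lra].
have -> : M / a ^+ l * L ^+ l * rho ^+ l = M / a ^+ l * (L * rho) ^+ l by rewrite exprMn mulrA.
rewrite mulrC; apply: ler_pM => //; first exact: exprn_ge0.
by apply: lerXn2r; rewrite ?nnegrE ?mulr_ge0 ?(ltW h0).
Qed.
End Generic.

(** * Generic lines *)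

Section Compare.
Variables (R : realType) (m : nat).
Local Notation C := R[i].
Local Notation V := 'rV[R[i]]_m.
Implicit Types (F G : V -> C) (p q v h x : V) (z t : C).

Lemma separate (l : seq C) (r : R) : uniq l -> (forall b, b \in l -> nm b < r) ->
  exists2 eta : R, 0 < eta & forall b, b \in l -> nm b + eta <= r /\
    forall c, c \in l -> c != b -> 2 * eta <= nm (b - c).
Proof.
move=> ul lr; apply: seq_common => [b e e' ee [h1 h2]|b bl].
  by split=> [|c cl cb]; [|have := h2 c cl cb]; lra.
have [|c cl|e e0 He] := @seq_common R C l (fun c e => c != b -> 2 * e <= nm (b - c)).
- by move=> c e e' ee h cb; have := h cb; lra.
- have [->|cb] := eqVneq c b; first by exists 1.
  exists (nm (b - c) / 2) => [|_]; last by lra.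
  by rewrite divr_gt0// nm_gt0 subr_eq0 eq_sym.
exists (Num.min e (r - nm b)); first by rewrite lt_min e0 subr_gt0 lr.
have h1 : Num.min e (r - nm b) <= e by rewrite ge_min lexx.
have h2 : Num.min e (r - nm b) <= r - nm b by rewrite ge_min lexx orbT.
by split=> [|c cl cb]; [lra|have := He c cl cb; lra].
Qed.

(** Maximising the number of distinct zeros on the lines, and then minimising
    their total multiplicity, gives lines along which the order of [F] at each
    zero is its vanishing order. *)
Lemma generic_lines F v q0 (dl r1 : R) (K : nat) : lhol F -> 0 < dl ->
  (forall q, nv (q - q0) < dl -> exists t, lineF F q v t != 0) ->
  (forall q l, nv (q - q0) < dl -> uniq l ->
     (forall b, b \in l -> nm b < r1 /\ lineF F q v b = 0) -> (size l <= K)%N) ->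
  exists q1 (e : R), [/\ 0 < e, forall q, nv (q - q1) < e -> nv (q - q0) < dl &
    forall q t k, nv (q - q1) < e -> nm t < r1 -> ordat (lineF F q v) t k -> vorder F (q + t *: v) k].
Proof.
move=> Fl dl0 Hne Hcnt.
pose P k := `[< exists q l, [/\ nv (q - q0) < dl, uniq l,
   forall b, b \in l -> nm b < r1 /\ lineF F q v b = 0 & size l = k] >].
have exP : exists k, P k.
  by exists 0%N; apply/asboolP; exists q0, [::]; rewrite subrr nv0.
have ubP k : P k -> (k <= K)%N by move=> /asboolP [q [l [h1 h2 h3 <-]]]; exact: Hcnt h1 h2 h3.
case: (ex_maxnP exP ubP) => k /asboolP [q1 [l1 [q1d ul1 l1z sl1]]] kmax.
have [eta eta0 Heta] := separate ul1 (fun b bl => proj1 (l1z b bl)).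
have nesh q a : nv (q - q0) < dl -> exists k, ordat (lineF F (q + a *: v) v) 0 k.
  move=> /Hne [t ht]; apply: (@ordat_ex _ _ (t - a)); first exact: lineF_entire.
  by rewrite lineF_shift addrC subrK.
have [e1' e1'0 He1'] : exists2 e : R, 0 < e & forall b, b \in l1 ->
    forall q, nv (q - q1) < e -> exists2 t, nm (t - b) < eta & F (q + t *: v) = 0.
  apply: seq_common => [b e e' ee H q qe|b bl]; first by apply: H; apply: lt_le_trans ee.
  have [k' ho] := nesh q1 b q1d; have [_ Fb] := l1z b bl.
  have [e e0 H] := hurwitz Fl Fb ho eta0; exists e => // q qe.
  have [|t te Ft] := H (q + b *: v).
    by rewrite opprD addrACA subrr addr0.
  by exists (b + t); rewrite ?line_shift// addrC addKr.
have [e1 e1E] : exists e1, e1 = Num.min e1' (dl - nv (q1 - q0)) by eexists.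
have e10 : 0 < e1 by rewrite e1E lt_min e1'0 subr_gt0.
have in0 q : nv (q - q1) < e1 -> nv (q - q0) < dl.
  rewrite e1E lt_min => /andP[_ h]; have := nvD (q - q1) (q1 - q0); rewrite subrKA; lra.
have /choice [w' Hw'] : forall qb : V * C, exists t, nv (qb.1 - q1) < e1 -> qb.2 \in l1 ->
    nm (t - qb.2) < eta /\ F (qb.1 + t *: v) = 0.
  move=> [q b] /=; have [[h1 h2]|no] := pselect (nv (q - q1) < e1 /\ b \in l1).
    have [|t t1 t2] := He1' b h2 q; last by exists t.
    by move: h1; rewrite e1E lt_min => /andP[].
  by exists 0 => h1 h2; case: no.
pose w q b := w' (q, b).
have Hw q b : nv (q - q1) < e1 -> b \in l1 -> nm (w q b - b) < eta /\ F (q + w q b *: v) = 0.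
  exact: (Hw' (q, b)).
have wr q b : nv (q - q1) < e1 -> b \in l1 -> nm (w q b) < r1.
  move=> h1 h2; have [h3 _] := Hw q b h1 h2; have [h4 _] := Heta b h2.
  by have := nmD (w q b - b) b; rewrite subrK; lra.
have U q t : nv (q - q1) < e1 -> nm t < r1 -> F (q + t *: v) = 0 -> exists2 b, b \in l1 & t = w q b.
  move=> h1 tr Ft; apply: contrapT => /forall2NP no.
  have : (k.+1 <= k)%N; last by rewrite ltnn.
  apply: kmax; apply/asboolP; exists q, (t :: map (w q) l1); split.
  - exact: in0.
  - rewrite /= map_inj_in_uniq ?ul1 ?andbT.
      by apply/mapP => -[b bl tb]; case: (no b).
    move=> b c bl cl wbc; apply/eqP; apply: contraT => bc.
    have [_ /(_ b bl bc) H] := Heta c cl.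
    have [h3 _] := Hw q b h1 bl; have [h4 _] := Hw q c h1 cl.
    rewrite -wbc in h4; have := nmD (c - w q b) (w q b - b); rewrite subrKA (nmBC c (w q b)); lra.
  - move=> b; rewrite inE => /predU1P[->//|/mapP [c cl ->]].
    by split; [exact: wr|case: (Hw q c h1 cl)].
  - by rewrite /= size_map sl1.
have U1 q t b : nv (q - q1) < e1 -> b \in l1 -> nm (t - b) < eta -> F (q + t *: v) = 0 -> t = w q b.
  move=> h1 bl tb Ft; have [h4 H] := Heta b bl.
  have tr : nm t < r1 by have := nmD (t - b) b; rewrite subrK; lra.
  have [c cl tc] := U q t h1 tr Ft; have [h3 _] := Hw q c h1 cl.
  suff -> : b = c by [].
  apply/eqP; apply: contraT => bc; have {}H := H c cl; rewrite eq_sym in bc.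
  rewrite -tc in h3; have := H bc; have := nmD (b - t) (t - c); rewrite subrKA (nmBC b t); lra.
have wcont q' b (eta' : R) : nv (q' - q1) < e1 -> b \in l1 -> 0 < eta' ->
    exists2 d : R, 0 < d & forall q, nv (q - q') < d -> nv (q - q1) < e1 /\ nm (w q b - w q' b) < eta'.
  move=> h1 bl eta'0; have [h3 Fw] := Hw q' b h1 bl.
  have [k' ho] := nesh q' (w q' b) (in0 _ h1).
  have [s sE] : exists s, s = Num.min eta' (eta - nm (w q' b - b)) by eexists.
  have s0 : 0 < s by rewrite sE lt_min eta'0 subr_gt0.
  have [d d0 H] := hurwitz Fl Fw ho s0.
  exists (Num.min d (e1 - nv (q' - q1))) => [|q]; first by rewrite lt_min d0 subr_gt0.
  rewrite lt_min => /andP[qd qe].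
  have q1e : nv (q - q1) < e1 by have := nvD (q - q') (q' - q1); rewrite subrKA; lra.
  split=> //; have [|t ts Ft] := H (q + w q' b *: v).
    by rewrite opprD addrACA subrr addr0.
  move: ts; rewrite sE lt_min => /andP[t1 t2].
  have <- : w q' b + t = w q b.
    apply: U1 => //; last by rewrite line_shift.
    by have := nmD (w q' b - b) t; rewrite addrAC; lra.
  by rewrite addrC addKr.
have /choice [mu' Hmu'] : forall qb : V * C, exists k, nv (qb.1 - q1) < e1 ->
    ordat (lineF F (qb.1 + w qb.1 qb.2 *: v) v) 0 k.
  move=> [q b] /=; have [h1|no] := pselect (nv (q - q1) < e1); last by exists 0%N.
  by have [k' H] := nesh q (w q b) (in0 _ h1); exists k'.
pose mu q b := mu' (q, b).
have Hmu q b : nv (q - q1) < e1 -> ordat (lineF F (q + w q b *: v) v) 0 (mu q b).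
  exact: (Hmu' (q, b)).
pose S n := `[< exists q, nv (q - q1) < e1 /\ (\sum_(b <- l1) mu q b)%N = n >].
have exS : exists n, S n.
  by exists (\sum_(b <- l1) mu q1 b)%N; apply/asboolP; exists q1; rewrite subrr nv0.
case: (ex_minnP exS) => n /asboolP [q2 [q2e q2n]] nmin.
have [e2' e2'0 He2'] : exists2 e : R, 0 < e & forall b, b \in l1 ->
    forall q, nv (q - q2) < e -> nv (q - q1) < e1 -> (mu q b <= mu q2 b)%N.
  apply: seq_common => [b e e' ee H q qe|b bl]; first by apply: H; apply: lt_le_trans ee.
  have [a a0 Ha] := ord_semicont Fl (Hmu q2 b q2e).
  have v0 : 0 < nv v + 1 by have := nv_ge0 v; lra.
  have [d d0 Hd] := wcont q2 b (a / (2 * (nv v + 1))) q2e bl ltac:(by rewrite divr_gt0// mulr_gt0).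
  exists (Num.min d (a / 2)) => [|q]; first by rewrite lt_min d0 divr_gt0.
  rewrite lt_min => /andP[qd qa] qe; apply: Ha (Hmu q b qe).
  have -> : q + w q b *: v - (q2 + w q2 b *: v) = (q - q2) + (w q b - w q2 b) *: v.
    by rewrite opprD addrACA scalerBl.
  apply: le_lt_trans (nvD _ _) _; rewrite nvZ.
  have [_ wq] := Hd q qd.
  have : nm (w q b - w q2 b) * nv v <= a / (2 * (nv v + 1)) * (nv v + 1).
    by apply: ler_pM; rewrite ?nv_ge0 ?(ltW wq)//; lra.
  have -> : a / (2 * (nv v + 1)) * (nv v + 1) = a / 2 by field; rewrite gt_eqF.
  lra.
have [e2 e2E] : exists e2, e2 = Num.min e2' (e1 - nv (q2 - q1)) by eexists.
have in1 q : nv (q - q2) < e2 -> nv (q - q1) < e1.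
  rewrite e2E lt_min => /andP[_ h]; have := nvD (q - q2) (q2 - q1); rewrite subrKA; lra.
have muE q b : nv (q - q2) < e2 -> b \in l1 -> mu q b = mu q2 b.
  move=> h; apply: leq_sum_seq_eq.
    move=> c cl; apply: He2' => //; last exact: in1.
    by move: h; rewrite e2E lt_min => /andP[].
  by rewrite q2n; apply: nmin; apply/asboolP; exists q; split=> //; exact: in1.
exists q2, e2; split.
- by rewrite e2E lt_min e2'0 subr_gt0.
- by move=> q /in1/in0.
move=> q t k' qe tr ho.
have hox : ordat (lineF F (q + t *: v) v) 0 k'.
  by rewrite lineF_shift; apply/ordat_shift; rewrite addr0.
case: k' ho hox => [|k'] ho hox.
  apply: (vorder_line Fl hox); apply: ordO_of_iterD => // s; by rewrite ltn0.
have Fx : F (q + t *: v) = 0.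
  by have := ordat_zero ho => /eqP.
have [b bl tE] := U q t (in1 _ qe) tr Fx.
apply: (vorder_line Fl hox).
have mk : mu q2 b = k'.+1.
  by rewrite -(muE q)//; apply: ordat_uniq (Hmu q b (in1 _ qe)) _; rewrite -tE.
rewrite tE; apply: (@ordO_const R m F q v k'.+1 (fun q => w q b) (e2 - nv (q - q2))) => //.
- by rewrite subr_gt0.
- move=> q' hq'; have q'e : nv (q' - q2) < e2.
    by have := nvD (q' - q) (q - q2); rewrite subrKA; lra.
  by rewrite -mk -(muE q')//; exact: Hmu (in1 _ q'e).
- move=> s s0; have [d d0 Hd] := wcont q b s (in1 _ qe) bl s0.
  by exists d => // q' /Hd [].
Qed.

Lemma ord_le (f g : C -> C) a k k' (r M : R) : 0 < r ->
  (forall t, nm (t - a) < r -> nm (f t) <= M * nm (g t)) ->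
  ordat f a k -> ordat g a k' -> (k' <= k)%N.
Proof.
move=> r0 fg [f1 [f1e f10 fE]] [g1 [g1e g10 gE]]; rewrite leqNgt; apply/negP => kk.
have [d d0 dP] := ccont_neq0 (entire_cont a f1e) f10.
have [B B0 gB] := entire_bounded (nm a + 1) g1e.
have c0 : 0 < nm (f1 a) / 2 by rewrite divr_gt0// nm_gt0.
have M0 := normr_ge0 M.
have [s sE] : exists s, s = Num.min (Num.min 1 (r / 2)) (Num.min (d / 2) (nm (f1 a) / 2 / (`|M| * B + 1))) by eexists.
have D0 : 0 < `|M| * B + 1 by have := mulr_ge0 M0 (ltW B0); lra.
have s0 : 0 < s by rewrite sE !lt_min ltr01 !divr_gt0// nm_gt0.
have s1 : s <= 1 by rewrite sE !ge_min lexx.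
have sr : s < r by have : s <= r / 2; [rewrite sE !ge_min lexx orbT|lra].
have sd : s < d by have : s <= d / 2; [rewrite sE !ge_min lexx !orbT|lra].
have sc : s * (`|M| * B + 1) <= nm (f1 a) / 2.
  by rewrite -ler_pdivlMr// sE !ge_min lexx !orbT.
have as_ : nm (s%:C : C) = s by rewrite nmC_ge0// ltW.
have E : a + s%:C - a = s%:C by rewrite addrC addKr.
have := fg (a + s%:C); rewrite E as_ => /(_ sr); rewrite fE gE E !nmM !nmX as_.
have h1 := dP (a + s%:C); rewrite E as_ in h1; have {}h1 := h1 sd.
have h2 := gB (a + s%:C); have {}h2 := h2 ltac:(by have := nmD a s%:C; rewrite as_; lra).
rewrite -(subnK kk); set n := (k' - k.+1)%N => H.
have sk : 0 < s ^+ k by rewrite exprn_gt0.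
have sn : s ^+ n <= 1 by rewrite exprn_ile1// ltW.
have sn0 : 0 <= s ^+ n by rewrite exprn_ge0// ltW.
have {}H : nm (f1 (a + s%:C)) <= M * (s ^+ n * s * nm (g1 (a + s%:C))).
  rewrite -(ler_pM2l sk); apply: le_trans H _; rewrite exprD exprS.
  by rewrite le_eqVlt; apply/orP; left; apply/eqP; ring.
have g0 := nm_ge0 (g1 (a + s%:C)).
move: H h1 h2 g0; move: (nm (f1 (a + s%:C))) (nm (g1 (a + s%:C))) => x y H h1 h2 y0.
have : M * (s ^+ n * s * y) <= `|M| * (1 * s * B).
  apply: le_trans (_ : `|M| * (s ^+ n * s * y) <= _).
    by rewrite ler_wpM2r ?ler_norm// !mulr_ge0// ltW.
  rewrite ler_wpM2l//; apply: ler_pM => //; first by rewrite mulr_ge0// ltW.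
  by rewrite ler_wpM2r// ltW.
by move: sc; rewrite mul1r mulrDr mulr1 mulrCA; lra.
Qed.

(** If each of two functions is locally dominated by the other, their quotient
    on a line is a zero-free entire function. *)
Lemma line_unit (f g : C -> C) : entire f -> entire g -> (exists t, f t != 0) ->
  (forall a, exists r M : R, 0 < r /\ forall t, nm (t - a) < r ->
     nm (f t) <= M * nm (g t) /\ nm (g t) <= M * nm (f t)) ->
  exists u, [/\ entire u, forall t, u t != 0 & forall t, f t = u t * g t].
Proof.
move=> fe ge [t1 ft1] dom.
have gt1 : g t1 != 0.
  have [r [M [r0 /(_ t1)]]] := dom t1; rewrite subrr nm0 => /(_ r0) [h _].
  apply/eqP => E; move: h; rewrite E nm0 mulr0 => h.
  by move: ft1; rewrite -nm_eq0 eq_le h nm_ge0.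
have /choice [h Hh] : forall a, exists fg : (C -> C) * (C -> C) * nat,
   [/\ entire fg.1.1, entire fg.1.2, fg.1.1 a != 0, fg.1.2 a != 0 &
     forall t, f t = (t - a) ^+ fg.2 * fg.1.1 t /\ g t = (t - a) ^+ fg.2 * fg.1.2 t].
  move=> a; have [k [f1 hf]] := entire_ord a fe ft1; have [k' [g1 hg]] := entire_ord a ge gt1.
  have [r [M [r0 H]]] := dom a.
  have h1 := ord_le r0 (fun t tr => proj1 (H t tr)) (ex_intro _ _ hf) (ex_intro _ _ hg).
  have h2 := ord_le r0 (fun t tr => proj2 (H t tr)) (ex_intro _ _ hg) (ex_intro _ _ hf).
  have kk : k' = k by apply/eqP; rewrite eqn_leq h1.
  move: hf hg; rewrite kk => -[fe1 f0 fE] [ge1 g0 gE].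
  by exists (f1, g1, k); split.
pose u a := (h a).1.1 a / (h a).1.2 a.
have uE t : f t = u t * g t.
  have [_ _ _ g0 /(_ t) [-> ->]] := Hh t; rewrite /u.
  by move: (_ ^+ _) => z; field.
exists u; split=> // [a|t]; last first.
  by have [_ _ f0 g0 _] := Hh t; rewrite mulf_neq0 ?invr_neq0.
have [fe1 ge1 f0 g0 H] := Hh a.
have [d d0 dP] := ccont_neq0 (entire_cont a ge1) g0.
have [s s0 sP] := entire_isolated a ge gt1.
have [d1 D1] := fe1 a; have [d2 D2] := ge1 a.
exists (d1 * ((h a).1.2 a)^-1 + (h a).1.1 a * (- d2 / (h a).1.2 a ^+ 2)).
have m0 : 0 < Num.min d s by rewrite lt_min d0.
apply: cderiv_near m0 _ (cderivM D1 (cderivV D2 g0)) => t.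
rewrite lt_min => /andP[td ts]; have [->//|ta] := eqVneq t a.
have gt := sP t ts ta; have [E1 E2] := H t.
have g2 : (h a).1.2 t != 0.
  by rewrite -nm_gt0; apply: le_lt_trans (dP t td); rewrite divr_ge0.
apply: (mulIf gt); rewrite -uE E1 E2.
by move: (_ ^+ _) => z; field.
Qed.

Lemma zeros_size (f : C -> C) (l : seq C) (r1 A B : R) n : 0 < r1 -> entire f ->
  A * 2^-1 ^+ n < B -> uniq l -> (forall b, b \in l -> nm b < r1 /\ f b = 0) ->
  (forall t, nm t <= 5 * r1 -> nm (f t) <= A) ->
  (forall t, nm t = r1 -> B <= nm (f t)) -> (size l <= n)%N.
Proof.
move=> r10 fe nP us sP fA fB.
have rr1 : nm (r1%:C : C) = r1 by rewrite nmC_ge0// ltW.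
have [k ke kE] := extract_uniq fe us (fun b bs => proj2 (sP b bs)).
rewrite leqNgt; apply/negP => ns.
have r1r : nm (r1%:C : C) <= r1 by rewrite rr1.
have h2 := zeros_count r10 ke kE (fun b bs => proj1 (sP b bs)) r1r fA.
have h1 := fB _ rr1.
have p2 : 0 < (2 : R) ^+ n by rewrite exprn_gt0.
have B0 : 0 <= nm (f r1%:C) by [].
have h3 : (2 : R) ^+ n <= 2 ^+ size l by apply: ler_weXn2l; [rewrite ler1n|exact: ltnW].
have h4 : (2 : R) ^+ n * nm (f r1%:C) <= A by apply: le_trans h2; exact: ler_wpM2r.
have h5 : (2 : R) ^+ n * B <= (2 : R) ^+ n * nm (f r1%:C) by apply: ler_wpM2l => //; exact: ltW.
by move: nP; rewrite exprVn ltr_pdivrMr// [B * _]mulrC; lra.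
Qed.

End Compare.

(** * Functions with equal divisors *)

Section Compare.
Variables (R : realType) (m : nat).
Local Notation C := R[i].
Local Notation V := 'rV[R[i]]_m.
Implicit Types (F G : V -> C) (p q v h x : V) (z t : C).

(** On generic lines the two functions have the same zeros with the same
    multiplicities, so that a comparison on a circle propagates inwards. *)
Lemma compare F G : lhol F -> lhol G -> (exists p, F p != 0) -> (exists p, G p != 0) ->
  (forall x k k', vorder F x k -> vorder G x k' -> k = k') ->
  forall p, exists r M : R, 0 < r /\ forall q, nv (q - p) < r -> nm (F q) <= M * nm (G q).
Proof.
move=> Fl Gl Fnz Gnz FG p; have Hl := lholM Fl Gl.
have [z Hz] := lhol_domain Fl Gl Fnz Gnz.
pose v := z - p; pose phi := lineF (fun q => F q * G q) p v.
have phi1 : phi 1 != 0 by rewrite /phi /lineF scale1r addrC subrK.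
have [l [g [ge g0 gE]]] := entire_ord 0 (lineF_entire p v Hl) phi1.
have [d d0 dP] := ccont_neq0 (entire_cont 0 ge) g0.
have [rF [MF [KF [rF0 MF0 KF0 FM _]]]] := lhol_lip p Fl.
have [rG [MG [KG [rG0 MG0 KG0 GM _]]]] := lhol_lip p Gl.
have [rH [MH [KH [rH0 MH0 KH0 _ HK]]]] := lhol_lip p Hl.
have nvv := nv_ge0 v.
have [r [r0 rF' rG' rH']] : exists r, [/\ 0 < r, r <= rF, r <= rG & r <= rH].
  by exists (Num.min rF (Num.min rG rH)); rewrite !lt_min !ge_min !lexx !orbT rF0 rG0 rH0.
have [r2 r2E] : exists r2, r2 = Num.min (d / 2) (r / (20 * (nv v + 1))) by eexists.
have r20 : 0 < r2 by rewrite r2E lt_min !divr_gt0// mulr_gt0//; lra.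
have r2d : r2 < d by have : r2 <= d / 2; [rewrite r2E ge_min lexx|lra].
have r2r : r2 * nv v <= r / 20.
  have : r2 <= r / (20 * (nv v + 1)) by rewrite r2E ge_min lexx orbT.
  by rewrite ler_pdivlMr; lra.
have [r1 r1E] : exists r1, r1 = r2 / 2 by eexists.
have r10 : 0 < r1 by lra.
have r12 : r1 < r2 by lra.
have [c cE] : exists c, c = r1 ^+ l * (nm (g 0) / 2) by eexists.
have c0 : 0 < c by rewrite cE mulr_gt0 ?exprn_gt0// divr_gt0// nm_gt0.
have phic t : r1 <= nm t -> nm t <= r2 -> c <= nm (phi t).
  move=> t1 t2; rewrite /phi gE subr0 nmM nmX cE; apply: ler_pM.
  - by rewrite exprn_ge0// ltW.
  - by rewrite divr_ge0.
  - by apply: lerXn2r; rewrite ?nnegrE ?(ltW r10).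
  - by apply/ltW/dP; rewrite subr0; lra.
have [dl dlE] : exists dl, dl = Num.min (r / 4) (c / (2 * (KH + 1))) by eexists.
have dl0 : 0 < dl by rewrite dlE lt_min !divr_gt0// mulr_gt0//; lra.
have dlr : dl <= r / 4 by rewrite dlE ge_min lexx.
have dlc : dl * (KH + 1) <= c / 2.
  have : dl <= c / (2 * (KH + 1)) by rewrite dlE ge_min lexx orbT.
  by rewrite ler_pdivlMr; lra.
have near q t : nv (q - p) < dl -> nm t <= 5 * r1 -> nv (q + t *: v - p) < r.
  move=> qd t2; rewrite addrAC; apply: le_lt_trans (nvD _ _) _; rewrite nvZ.
  have E : 5 * r1 * nv v = 5 / 2 * (r2 * nv v) by rewrite r1E; field.
  by have : nm t * nv v <= 5 * r1 * nv v; [rewrite ler_wpM2r|lra].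
have Hc q t : nv (q - p) < dl -> r1 <= nm t -> nm t <= r2 ->
    c / 2 <= nm (lineF F q v t) * nm (lineF G q v t).
  move=> qd t1 t2; rewrite -nmM.
  have t3 : nm t <= 5 * r1 by lra.
  have pd : nv (p - p) < dl by rewrite subrr nv0.
  have := HK _ _ (lt_le_trans (near q t qd t3) rH') (lt_le_trans (near p t pd t3) rH').
  rewrite -/(lineF F p v t) -/(lineF G p v t) -/(lineF F q v t) -/(lineF G q v t).
  have -> : p + t *: v - (q + t *: v) = p - q by rewrite opprD addrACA subrr addr0.
  have := phic t t1 t2; rewrite /phi.
  change (lineF (fun q => F q * G q) p v t) with (lineF F p v t * lineF G p v t).
  have : KH * nv (p - q) <= c / 2.
    apply: le_trans dlc; rewrite mulrC nvBC; have := nv_ge0 (q - p) => h.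
    by apply: ler_pM => //; lra.
  have := nm_sub (lineF F p v t * lineF G p v t) (lineF F p v t * lineF G p v t - lineF F q v t * lineF G q v t).
  by rewrite subKr; lra.
have Fb q t : nv (q - p) < dl -> nm t <= 5 * r1 -> nm (lineF F q v t) <= MF + 1.
  by move=> h1 h2; have := FM _ (lt_le_trans (near q t h1 h2) rF'); rewrite /lineF; lra.
have Gb q t : nv (q - p) < dl -> nm t <= 5 * r1 -> nm (lineF G q v t) <= MG + 1.
  by move=> h1 h2; have := GM _ (lt_le_trans (near q t h1 h2) rG'); rewrite /lineF; lra.
have low (x y A : R) : 0 < A -> y <= A -> 0 <= x -> 0 <= y -> c / 2 <= x * y -> c / (2 * A) <= x.
  move=> A0 yA x0 y0 h; rewrite invfM mulrA ler_pdivrMr//; apply: le_trans h _.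
  by rewrite ler_wpM2l.
have Fc q t : nv (q - p) < dl -> r1 <= nm t -> nm t <= r2 -> c / (2 * (MG + 1)) <= nm (lineF F q v t).
  move=> h1 h2 h3; apply: low (Hc q t h1 h2 h3) => //; first by lra.
  by apply: Gb => //; lra.
have Gc q t : nv (q - p) < dl -> r1 <= nm t -> nm t <= r2 -> c / (2 * (MF + 1)) <= nm (lineF G q v t).
  move=> h1 h2 h3; have := Hc q t h1 h2 h3; rewrite [nm (lineF F _ _ _) * _]mulrC => h4.
  apply: low h4 => //; first by lra.
  by apply: Fb => //; lra.
have cF : 0 < c / (2 * (MG + 1)) by rewrite divr_gt0// mulr_gt0//; lra.
have cG : 0 < c / (2 * (MF + 1)) by rewrite divr_gt0// mulr_gt0//; lra.
have rr1 : nm (r1%:C : C) = r1 by rewrite nmC_ge0// ltW.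
have cnt E (A B : R) : lhol E -> 0 < B -> (forall q t, nv (q - p) < dl -> nm t <= 5 * r1 -> nm (lineF E q v t) <= A) ->
    (forall q t, nv (q - p) < dl -> r1 <= nm t -> nm t <= r2 -> B <= nm (lineF E q v t)) ->
    exists K : nat, forall q l, nv (q - p) < dl -> uniq l ->
     (forall b, b \in l -> nm b < r1 /\ lineF E q v b = 0) -> (size l <= K)%N.
  move=> El B0 EA EB; have [n nP] := half_small A B0; exists n => q s qd us sP.
  apply: (zeros_size r10 (lineF_entire q v El) nP us sP (fun t => EA q t qd)).
  by move=> t tr; apply: EB; rewrite // tr// ltW.
have [KF' HKF] := cnt F _ _ Fl cF Fb Fc.
have [KG' HKG] := cnt G _ _ Gl cG Gb Gc.
have [M ME] : exists M, M = (MF + 1) * (2 * (MF + 1) / c) by eexists.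
have MF1 : 0 <= MF + 1 by lra.
have M0 : 0 <= M.
  rewrite ME; apply: mulr_ge0 => //; apply: divr_ge0; last exact: ltW.
  exact: mulr_ge0.
have nF q : nv (q - p) < dl -> exists t, lineF F q v t != 0.
  by move=> qd; exists r1%:C; rewrite -nm_gt0; apply: lt_le_trans cF (Fc q _ qd _ _); rewrite rr1// ltW.
have nG q : nv (q - p) < dl -> exists t, lineF G q v t != 0.
  by move=> qd; exists r1%:C; rewrite -nm_gt0; apply: lt_le_trans cG (Gc q _ qd _ _); rewrite rr1// ltW.
have dense q0 (e : R) : nv (q0 - p) < dl -> 0 < e -> exists2 q, nv (q - q0) < e & nm (F q) <= M * nm (G q).
  move=> q0d e0; have [a [a0 ae ad]] : exists a, [/\ 0 < a, a <= e & a <= dl - nv (q0 - p)].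
    by exists (Num.min e (dl - nv (q0 - p))); rewrite lt_min !ge_min !lexx !orbT e0 subr_gt0.
  have ina q : nv (q - q0) < a -> nv (q - p) < dl.
    by move=> h; have := nvD (q - q0) (q0 - p); rewrite subrKA; lra.
  have nFa q : nv (q - q0) < a -> exists t, lineF F q v t != 0 by move=> /ina; exact: nF.
  have cFa q s : nv (q - q0) < a -> uniq s ->
      (forall b, b \in s -> nm b < r1 /\ lineF F q v b = 0) -> (size s <= KF')%N.
    by move=> /ina; exact: HKF.
  have [q1 [e1 [e10 in1 G1]]] := @generic_lines R m F v q0 a r1 KF' Fl a0 nFa cFa.
  have nGa q : nv (q - q1) < e1 -> exists t, lineF G q v t != 0 by move=> /in1/ina; exact: nG.
  have cGa q s : nv (q - q1) < e1 -> uniq s ->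
      (forall b, b \in s -> nm b < r1 /\ lineF G q v b = 0) -> (size s <= KG')%N.
    by move=> /in1/ina; exact: HKG.
  have [q2 [e2 [e20 in2 G2]]] := @generic_lines R m G v q1 e1 r1 KG' Gl e10 nGa cGa.
  have q22 : nv (q2 - q2) < e2 by rewrite subrr nv0.
  have q2d := ina _ (in1 _ (in2 _ q22)).
  exists q2; first by apply: lt_le_trans (in1 _ (in2 _ q22)) ae.
  have f0 b : r1 <= nm b -> nm b <= r2 -> lineF F q2 v b != 0.
    by move=> h1 h2; rewrite -nm_gt0; apply: lt_le_trans cF (Fc _ _ _ _ _).
  have g0' b : r1 <= nm b -> nm b <= r2 -> lineF G q2 v b != 0.
    by move=> h1 h2; rewrite -nm_gt0; apply: lt_le_trans cG (Gc _ _ _ _ _).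
  have [t ft] := nF _ q2d; have [s [f1 [f1e f1E sr f10]]] := extract_zeros r20 (lineF_entire q2 v Fl) ft.
  have lE E : lineF E q2 v 0 = E q2 by rewrite /lineF scale0r addr0.
  rewrite -(lE F) -(lE G); apply: (@compare_disc R (size s) (lineF F q2 v) (lineF G q2 v) r1 r2 M r10 r12
    (lineF_entire q2 v Fl) (lineF_entire q2 v Gl)).
  - move=> b k k' br hk hk'; have [b1|b1] := ltP (nm b) r1.
      by apply: FG (G1 _ _ _ (in2 _ q22) b1 hk) (G2 _ _ _ q22 b1 hk').
    have := ordat_zero hk; have := ordat_zero hk'.
    rewrite (negPf (f0 b b1 (ltW br))) (negPf (g0' b b1 (ltW br))).
    by case: k {hk} => //; case: k' {hk'}.
  - exists s => //; exists f1 => //; split=> //; split=> // b bs.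
    rewrite ltNge; apply/negP => b1; have := f0 b b1 (ltW (sr b bs)).
    rewrite f1E (big_rem b bs) /= subrr !mul0r eqxx //.
  - exact: nF.
  - exact: nG.
  - move=> b br; have b1 : r1 <= nm b by rewrite br.
    have b2 : nm b <= r2 by lra.
    have b3 : nm b <= 5 * r1 by lra.
    have := Gc q2 b q2d b1 b2; have := Fb q2 b q2d b3.
    move: (nm (lineF F _ _ _)) (nm (lineF G _ _ _)) => x y h1 h2.
    apply: le_trans h1 _; rewrite ME -mulrA -[X in X <= _]mulr1 ler_wpM2l//.
    have -> : 2 * (MF + 1) / c = (c / (2 * (MF + 1)))^-1 by rewrite invf_div.
    by rewrite ler_pdivlMl// mulr1.
exists dl, M; split=> // q qd; apply/ler_addgt0Pr => e e0.
have e1 : 0 < e / (M + 1) by rewrite divr_gt0//; lra.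
have [d1 d10 H1] := lhol_cont q Fl e1.
have [d2 d20 H2] := lhol_cont q Gl e1.
have m0 : 0 < Num.min d1 d2 by rewrite lt_min d10.
have [q' + H3] := dense q _ qd m0; rewrite lt_min => /andP[/H1 h1 /H2 h2].
have h3 := nm_sub (F q) (F q - F q'); have h4 := nmD (G q) (G q' - G q).
rewrite subKr (nmBC (F q)) in h3; rewrite [G q + _]addrC subrK in h4.
have h5 : M * nm (G q') <= M * (nm (G q) + e / (M + 1)) by rewrite ler_wpM2l//; lra.
have h6 : M * (nm (G q) + e / (M + 1)) + e / (M + 1) = M * nm (G q) + e.
  by field; rewrite gt_eqF//; lra.
lra.
Qed.
End Compare.

(** * Partial derivatives and divisors *)

Section Bridge.
Variables (R : realType) (m : nat).
Local Notation C := R[i].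
Implicit Types (F G : Cn R m -> R[i]^o) (p q v z : Cn R m) (d : C).

Lemma gt0_cplx (d : C) : 0 < d -> exists2 e : R, 0 < e & d = e%:C.
Proof. by case: d => a b; rewrite ltcE /= => /andP[/eqP -> a0]; exists a. Qed.

Lemma cvg_cderiv F z v d :
  (fun h : R[i]^o => h^-1 *: (F (h *: v + z) - F z)) @ (0 : R[i]^o)^' --> (d : R[i]^o) <->
  cderiv (fun t => F (z + t *: v)) 0 d.
Proof.
split=> [|/cderivP H].
  move/cvgrPdist_le => H; apply/cderivP => e e0.
  have eC : 0 < e%:C :> C by rewrite ltcR.
  have := H _ eC; rewrite near_withinE => /nbhs_ballP [dl' /gt0_cplx [dl dl0 ->] {}H].
  exists dl => // w; rewrite subr0 => wd; have [->|w0] := eqVneq w 0.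
    by rewrite !scale0r !addr0 subrr mulr0 subrr nm0 mulr0.
  have := H w; rewrite /ball /= sub0r normrN nmE ltcR => /(_ wd w0).
  rewrite nmE lecR scale0r addr0 [w *: v + z]addrC => {}H.
  have -> : F (z + w *: v) - F z - d * w = - w * (d - w^-1 *: (F (z + w *: v) - F z)).
    by rewrite /GRing.scale /=; field.
  by rewrite nmM nmN mulrC ler_wpM2r.
apply/cvgrPdist_le => e' /gt0_cplx [e e0 ->]; have [dl dl0 {}H] := H e e0.
rewrite near_withinE; apply/nbhs_ballP; exists dl%:C; first by rewrite /= ltcR.
move=> w; rewrite /ball /= sub0r normrN nmE ltcR => wd w0.
have := H w; rewrite subr0 => /(_ wd); rewrite scale0r addr0 [w *: v + z]addrC => {}H.
rewrite nmE lecR.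
have -> : d - w^-1 *: (F (z + w *: v) - F z) = - (w^-1 * (F (z + w *: v) - F z - d * w)).
  by rewrite /GRing.scale /=; field.
by rewrite nmN nmM nmV mulrC ler_pdivrMr ?nm_gt0.
Qed.

Lemma derive_D F v : lhol F -> 'D_v F = D v F :> (Cn R m -> C).
Proof.
move=> Fl; apply/funext => z.
have /cvg_cderiv H : cderiv (fun t => F (z + t *: v)) 0 (D v F z).
  by have := D_line z v 0 Fl; rewrite scale0r addr0.
exact: (cvg_lim (@norm_hausdorff _ R[i]^o) H).
Qed.

Lemma holomorphic_lhol F : holomorphic F -> lhol F.
Proof.
move=> Fd; split=> [p v t|p].
  have /(_ v) H := diff_derivable (Fd (p + t *: v)).
  have [d] : exists d, cderiv (fun s => F (p + t *: v + s *: v)) 0 d.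
    exists (lim ((fun h : R[i]^o => h^-1 *: (F (h *: v + (p + t *: v)) - F (p + t *: v))) @ (0 : R[i]^o)^')).
    by apply/cvg_cderiv; exact: H.
  move=> D1; exists d; rewrite -[X in cderiv _ X _]addr0; apply: cderiv_shift.
  by apply: cderiv_ext D1 => s; rewrite scalerDl addrA.
have /cvgrPdist_lt/(_ 1 ltr01)/nbhs_ballP [d' /gt0_cplx [d d0 ->] H] := differentiable_continuous (Fd p).
exists d, (nm (F p) + 1); split=> // q qd.
have := H q; rewrite /= nmE -[1]/(1%:C) ltcR => h.
have {}h : nm (F p - F q) < 1.
  apply: h; split; [by rewrite ltcR|move=> i j]; rewrite /ball /= nmE ltcR; apply: le_lt_trans qd.
  rewrite nmBC !ord1 /nv (bigD1 j)//= !mxE lerDl; exact: sumr_ge0.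
by have := nm_sub (F q) (F q - F p); rewrite subKr (nmBC (F q)); lra.
Qed.

Lemma iter_partial_iterD F (s : seq 'I_m) : lhol F -> iter_partial s F = iterD s F :> (Cn R m -> C).
Proof.
move=> Fl; elim: s => // j s IH.
have -> : iter_partial (j :: s) F = 'D_(dlt R j) (iter_partial s F) by [].
by rewrite IH derive_D//; exact: (lhol_iterD s Fl).
Qed.

Lemma vorder_divisor F z k : lhol F -> vorder F z k -> zero_divisor F z = k.
Proof.
move=> Fl Vk; have [H1 [s sk s0]] := Vk.
have V : vanishing_order F z k.
  split=> [s' s'k|]; first by rewrite iter_partial_iterD// H1.
  by exists s => //; rewrite iter_partial_iterD.
rewrite /zero_divisor; case: xgetP => [l _ [L1 [s' s'l L2]]|/(_ k) //].
have Vl : vorder F z l.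
  split=> [s2 h|]; first by have := L1 _ h; rewrite iter_partial_iterD.
  by exists s' => // E; apply: L2; rewrite iter_partial_iterD.
exact: vorder_uniq Vl Vk.
Qed.

Lemma divisor_vorder F G : lhol F -> lhol G -> zero_divisor F = zero_divisor G ->
  forall x k k', vorder F x k -> vorder G x k' -> k = k'.
Proof. by move=> Fl Gl E x k k' /(vorder_divisor Fl) <- /(vorder_divisor Gl) <-; rewrite E. Qed.
End Bridge.

(** * Products of quotients of functions with equal divisors *)

Section Units.
Variables (R : realType) (m : nat) (I : finType).
Local Notation C := R[i].
Local Notation V := 'rV[R[i]]_m.
Variables (F G : I -> V -> C).
Hypotheses (Fl : forall j, lhol (F j)) (Gl : forall j, lhol (G j)).
Hypotheses (Fz : forall j, exists p, F j p != 0) (Gz : forall j, exists p, G j p != 0).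
Hypothesis FG : forall j x k k', vorder (F j) x k -> vorder (G j) x k' -> k = k'.
Implicit Types (z w v : V) (t : C) (S U : {set I}).

Definition FGprod z := \prod_j (F j z * G j z).
Definition hq j z := F j z / G j z.
Definition hS S z := \prod_(j in S) hq j z.

Lemma lhol_prod (J : Type) (s : seq J) (P : pred J) (E : J -> V -> C) :
  (forall i, lhol (E i)) -> lhol (fun q => \prod_(i <- s | P i) E i q).
Proof.
move=> H; elim: s => [|i s IH].
  rewrite (_ : (fun q => _) = (fun=> 1)); first exact: lhol_cst.
  by apply/funext => q; rewrite big_nil.
case Pi : (P i).
  by move: (lholM (H i) IH); congr lhol; apply/funext => q; rewrite big_cons Pi.
by move: IH; congr lhol; apply/funext => q; rewrite big_cons Pi.
Qed.

Lemma lhol_prod_neq0 (J : eqType) (s : seq J) (E : J -> V -> C) : (forall i, lhol (E i)) ->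
  (forall i, i \in s -> exists p, E i p != 0) -> exists p, \prod_(i <- s) E i p != 0.
Proof.
move=> El; elim: s => [|i s IH] H; first by exists 0; rewrite big_nil oner_neq0.
have [|p pH] := @lhol_domain R m (E i) _ (El i) (lhol_prod s predT El) (H i (mem_head _ _)).
  by apply: IH => k ks; apply: H; rewrite inE ks orbT.
by exists p; rewrite big_cons.
Qed.

Lemma lhol_FGprod : lhol FGprod.
Proof. by apply: lhol_prod => j; exact: lholM. Qed.

Lemma FGprod_ex : exists z, FGprod z != 0.
Proof.
apply: lhol_prod_neq0 => j; first exact: lholM.
by move=> _; exact: lhol_domain.
Qed.

Lemma FGprod_neq0 z j : FGprod z != 0 -> F j z != 0 /\ G j z != 0.
Proof.
by move=> /prodf_neq0 /(_ j isT); rewrite mulf_eq0 negb_or => /andP[].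
Qed.

Lemma hq_neq0 z j : FGprod z != 0 -> hq j z != 0.
Proof. by move=> /(@FGprod_neq0 z j) [f0 g0]; rewrite mulf_neq0 ?invr_neq0. Qed.

(** Equality of the divisors makes each function locally dominated by the other. *)
Lemma line_units z v j : FGprod z != 0 -> exists u : C -> C, [/\ entire u, forall t, u t != 0 &
  forall t, F j (z + t *: v) = u t * G j (z + t *: v)].
Proof.
move=> zO; have [f0 g0] := FGprod_neq0 j zO.
apply: (@line_unit R (lineF (F j) z v) (lineF (G j) z v)).
- exact: lineF_entire.
- exact: lineF_entire.
- by exists 0; rewrite /lineF scale0r addr0.
move=> a.
have GF x k k' (h : vorder (G j) x k) (h' : vorder (F j) x k') : k = k' by rewrite (FG h' h).
have [r [M [r0 H]]] := compare (Fl j) (Gl j) (Fz j) (Gz j) (@FG j) (z + a *: v).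
have [r' [M' [r'0 H']]] := compare (Gl j) (Fl j) (Gz j) (Fz j) GF (z + a *: v).
have n1 : 0 < nv v + 1 by have := nv_ge0 v; lra.
exists (Num.min r r' / (nv v + 1)), (Num.max M M'); split.
  by rewrite divr_gt0// lt_min r0.
move=> t; rewrite ltr_pdivlMr// lt_min => /andP[tr tr'].
have E : nv (z + t *: v - (z + a *: v)) <= nm (t - a) * (nv v + 1).
  rewrite opprD addrACA subrr add0r -scalerBl nvZ ler_wpM2l// lerDl//.
split; [apply: le_trans (H _ (le_lt_trans E tr)) _|apply: le_trans (H' _ (le_lt_trans E tr')) _];
  by rewrite ler_wpM2r// le_max lexx ?orbT.
Qed.

Definition sim S U := forall z w, FGprod z != 0 -> FGprod w != 0 -> hS S z * hS U w = hS S w * hS U z.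

Lemma line_ext z v (f : C -> C) : FGprod z != 0 -> entire f ->
  (forall t, FGprod (z + t *: v) != 0 -> f t = 0) -> forall t, f t = 0.
Proof.
move=> zO fe f0.
have Pe : entire (fun t => FGprod (z + t *: v)) by have [+ _] := lhol_FGprod; apply.
have [t||H] := entire_domain fe Pe; last first.
- by have := H 0; rewrite scale0r addr0 => E; rewrite E eqxx in zO.
- by [].
by have [->|/f0 ->] := eqVneq (FGprod (z + t *: v)) 0; rewrite ?mulr0 ?mul0r.
Qed.

(** Along lines the products become zero-free entire functions. *)
Lemma borel_sets (c : {set I} -> C) : (forall z, FGprod z != 0 -> \sum_S c S * hS S z = 0) ->
  forall U z, FGprod z != 0 -> \sum_(S | `[< sim S U >]) c S * hS S z = 0.
Proof.
move=> cS U z0 z0O.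
have hS0 S z : FGprod z != 0 -> hS S z != 0.
  by move=> zO; apply/prodf_neq0 => j _; exact: hq_neq0.
pose FS S z := \prod_(j in S) F j z. pose GS S z := \prod_(j in S) G j z.
have hE S z : hS S z = FS S z / GS S z by rewrite /hS prodf_div.
have GS0 S z : FGprod z != 0 -> GS S z != 0.
  by move=> zO; apply/prodf_neq0 => j _; case: (FGprod_neq0 j zO).
pose E S z := FS S z * GS U z * hS U z0 - hS S z0 * (FS U z * GS S z).
have EE S z : FGprod z != 0 -> E S z = GS S z * GS U z * (hS S z * hS U z0 - hS S z0 * hS U z).
  by move=> zO; rewrite /E (hE S z) (hE U z); have := GS0 S _ zO; have := GS0 U _ zO => h1 h2; field; rewrite h1 h2.
have El S : lhol (E S).
  have -> : E S = (fun z => FS S z * GS U z * hS U z0 + (- hS S z0) * (FS U z * GS S z)).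
    by apply/funext => z; rewrite /E mulNr.
  apply: lholD; apply: lholM; try exact: lhol_cst; apply: lholM; exact: lhol_prod.
have simE S : (forall z, FGprod z != 0 -> E S z = 0) -> sim S U.
  have H z : FGprod z != 0 -> E S z = 0 -> hS S z * hS U z0 = hS S z0 * hS U z.
    move=> zO; rewrite EE// => /eqP; rewrite !mulf_eq0 (negPf (GS0 S z zO)) (negPf (GS0 U z zO)) /=.
    by rewrite subr_eq0 => /eqP.
  move=> H0 z w zO wO; have h1 := H z zO (H0 z zO); have h2 := H w wO (H0 w wO).
  apply: (mulIf (hS0 U z0 z0O)); apply: (mulIf (hS0 S z0 z0O)).
  transitivity ((hS S z * hS U z0) * (hS U w * hS S z0)); first by ring.
  by rewrite h1 [hS U w * _]mulrC -h2; ring.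
pose N := [set S | ~~ `[< sim S U >]]%SET.
have [z1 z1P] : exists z, \prod_(S <- enum N) E S z * FGprod z != 0.
  apply: lhol_domain; [exact: lhol_prod|exact: lhol_FGprod| |exact: FGprod_ex].
  apply: lhol_prod_neq0 => // S; rewrite mem_enum inE => /asboolPn nS.
  apply: contrapT => /forallNP no; apply: nS; apply: simE => z _; apply/eqP.
  by have /negP := no z; rewrite negbK.
move: z1P; rewrite mulf_eq0 negb_or => /andP[E1 z1O].
pose v := z1 - z0.
have /choice [u Hu] := fun j => line_units v j z0O.
pose uS S t := \prod_(j in S) u j t.
have uSe S : entire (uS S) by apply: entire_prod => j _; case: (Hu j).
have uS0 S t : uS S t != 0 by apply/prodf_neq0 => j _; case: (Hu j).
have uh S t : FGprod (z0 + t *: v) != 0 -> uS S t = hS S (z0 + t *: v).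
  move=> tO; apply: eq_bigr => j _; have [_ _ HE] := Hu j.
  by rewrite /hq HE mulfK//; case: (FGprod_neq0 j tO).
have uh0 S : uS S 0 = hS S z0 by rewrite uh scale0r addr0.
have uh1 S : uS S 1 = hS S z1 by rewrite uh scale1r addrC subrK.
have rel t : \sum_S c S * uS S t = 0.
  apply: (@line_ext z0 v (fun t => \sum_S c S * uS S t) z0O) => [|{}t tO].
    by apply: entire_sum => S _; exact: entireZ.
  by rewrite -[RHS](cS _ tO); apply: eq_bigr => S _; rewrite uh.
have := borel uSe uS0 rel U 0 => H; rewrite -[RHS]H.
apply: eq_big => [S|S _]; last by rewrite uh0.
apply/asboolP/asboolP => [sSU|[k Hk]].
  exists (hS S z0 / hS U z0) => t.
  apply/eqP; rewrite -subr_eq0; apply/eqP.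
  apply: (@line_ext z0 v (fun t => uS S t - hS S z0 / hS U z0 * uS U t) z0O) => [|{}t tO].
    by apply: entireB => //; exact: entireZ.
  rewrite !uh// mulrAC -(sSU _ _ tO z0O) mulfK ?subrr//; exact: hS0.
apply: contrapT => nS.
have : E S z1 != 0.
  have := E1; rewrite big_seq prodf_seq_neq0 => /allP /(_ S).
  by rewrite mem_enum inE; move/asboolPn: (nS) => ->; move=> /(_ isT).
rewrite EE// -!uh0 -!uh1 !Hk; case/eqP.
by rewrite [k * uS U 1 * _]mulrAC subrr mulr0.
Qed.
End Units.

(** * The determinant relation *)

Section Det.
Variables (K : fieldType) (n : nat).
Local Notation N := (n.+1 + n.+1)%N.
Implicit Types (a : 'M[K]_(N, n.+1)) (S T U : {set 'I_N}) (x y : 'I_N -> K).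

Lemma few_eq (p : nat) (a : 'M[K]_(p, n.+1)) (T : {set 'I_p}) : (#|T| < n.+1)%N ->
  exists2 y : 'cV[K]_n.+1, y != 0 & forall i, i \in T -> \sum_j a i j * y j 0 = 0.
Proof.
move=> Tn; pose A0 := rowsub (fun i : 'I_#|T| => enum_val i) a.
have : kermx A0^T != 0.
  rewrite kermx_eq0 /row_free mxrank_tr; apply/eqP => E.
  by have := rank_leq_row A0; rewrite E leqNgt Tn.
case/rowV0Pn => v /sub_kermxP vA v0; exists v^T; first by rewrite trmx_eq0.
move=> i iT; have /rowP /(_ (enum_rank_in iT i)) := vA.
rewrite !mxE => E; rewrite -[RHS]E; apply: eq_bigr => j _.
by rewrite !mxE enum_rankK_in// mulrC.
Qed.

Lemma det_ker (p : nat) (M : 'M[K]_p) (w : 'cV[K]_p) : w != 0 -> M *m w = 0 -> \det M = 0.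
Proof.
move=> w0 Mw; apply/eqP; apply: contraTT w0 => d0; rewrite negbK.
have Mu : M \in unitmx by rewrite unitmxE unitfE.
by rewrite -(mulKmx Mu w) Mw mulmx0.
Qed.

(** On a pair [(u, v)] row [i] takes the value [x_i a_i u + y_i a_i v], so that the
    pair [(f, - g)] is in the kernel for [x = 1] and [y_i = F_i / G_i]. *)
Definition mrow a x y : 'M[K]_N :=
  \matrix_(i, j) (x i * row_mx a 0 i j + y i * row_mx 0 a i j).
Definition mdet a x y := \det (mrow a x y).
Definition chi S i : K := (i \in S)%:R.
Definition cS a S := mdet a (chi (~: S)) (chi S).

Lemma mrow_mul a x y (u v : 'cV[K]_n.+1) i :
  (mrow a x y *m col_mx u v) i 0 = x i * (\sum_j a i j * u j 0) + y i * (\sum_j a i j * v j 0).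
Proof.
rewrite mxE big_split_ord /= !mulr_sumr; congr (_ + _); apply: eq_bigr => j _.
  by rewrite !mxE !(unsplitK (inl _)) !mxE mulr0 addr0 mulrA.
by rewrite !mxE !(unsplitK (inr _)) !mxE mulr0 add0r mulrA.
Qed.

Lemma det_expand a x y :
  mdet a x y = \sum_(S : {set 'I_N}) (\prod_(i in S) y i) * (\prod_(i in ~: S) x i) * cS a S.
Proof.
rewrite /mdet /cS /mdet /determinant.
under eq_bigr => s _.
  under eq_bigr => i _ do rewrite mxE addrC.
  rewrite bigA_distr mulr_sumr.
over.
rewrite exchange_big /=; apply: eq_bigr => S _; rewrite mulr_sumr; apply: eq_bigr => s _.
rewrite [RHS]mulrCA; congr (_ * _).
have -> : \prod_(i in ~: S) x i = \prod_i (if i \in S then 1 else x i).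
  by rewrite big_mkcond; apply: eq_bigr => i _; rewrite inE; case: (i \in S).
rewrite [\prod_(i in S) y i]big_mkcond -!big_split /=; apply: eq_bigr => i _.
rewrite !mxE /chi inE; case: (i \in S) => /=; rewrite ?mul1r ?mul0r ?mulr1 ?add0r ?addr0//.
Qed.

Lemma cS_card a S : #|S| != n.+1 -> cS a S = 0.
Proof.
have cc := cardsC S; rewrite card_ord in cc.
case: ltngtP => // h _.
  have [y y0 yT] := few_eq a h.
  apply: (@det_ker _ _ (col_mx 0 y)).
    by apply: contraNneq y0 => E; have := congr1 dsubmx E; rewrite col_mxKd linear0 => ->.
  apply/colP => i; rewrite mrow_mul [RHS]mxE; under eq_bigr do rewrite mxE mulr0.
  rewrite big1// mulr0 add0r /chi; have [iS|_] := boolP (i \in S); last by rewrite mul0r.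
  by rewrite yT// mulr0.
have hc : (#|~: S| < n.+1)%N by rewrite -(ltn_add2l #|S|) cc ltn_add2r.
have [y y0 yT] := few_eq a hc.
apply: (@det_ker _ _ (col_mx y 0)).
  by apply: contraNneq y0 => E; have := congr1 usubmx E; rewrite col_mxKu linear0 => ->.
apply/colP => i; rewrite mrow_mul [RHS]mxE [X in _ + _ * X]big1 => [|j _]; last by rewrite mxE mulr0.
rewrite mulr0 addr0 /chi; have [iS|_] := boolP (i \in ~: S); last by rewrite mul0r.
by rewrite yT// mulr0.
Qed.

Lemma class_sum0 (T : finType) (r : T -> T -> Prop) (f : T -> K) (P : pred T) :
  (forall s, r s s) -> (forall s t, r s t -> r t s) -> (forall s t u, r s t -> r t u -> r s u) ->
  (forall u, \sum_(s | `[< r s u >]) f s = 0) -> (forall s u, r s u -> P s = P u) ->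
  \sum_(s | P s) f s = 0.
Proof.
move=> rr rs rt f0 Pr; pose rho s := odflt s [pick u | `[< r s u >]].
have rhoP s : r s (rho s) by rewrite /rho; case: pickP => [u /asboolP|].
have rhoE s u : r s u -> rho s = rho u.
  move=> su; rewrite /rho (eq_pick (Q := fun k => `[< r u k >])).
    by case: pickP => //= /(_ u); case/asboolPn.
  by move=> k /=; apply/asboolP/asboolP => h; [exact: rt (rs _ _ su) h|exact: rt su h].
rewrite (partition_big rho P) => [|s Ps]; last by rewrite -(Pr _ _ (rhoP s)).
apply: big1 => u Pu; have [[s /eqP su]|no] := pselect (exists s, rho s == u); last first.
  by apply: big1 => s /andP[_ su]; case: no; exists s.
rewrite -[RHS](f0 u); apply: eq_bigl => t; apply/andP/asboolP => [[_ /eqP <-]|tu]; first exact: rhoP.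
split; first by rewrite (Pr _ _ tu).
by rewrite (rhoE _ _ tu) -su -(rhoE _ _ (rhoP s)).
Qed.

(** Replacing an element by one of larger value increases the sum. *)
Lemma weight_max (R : realDomainType) (lam : 'I_N -> R) (v : R) S :
  let Q := [set i | v < lam i]%SET in let P := [set i | lam i < v]%SET in
  #|S| = n.+1 ->
  (\sum_(i in S) lam i == \sum_(i in Q) (lam i - v) + v *+ n.+1) =
  (Q \subset S) && (S \subset ~: P).
Proof.
move=> Q P Sn.
have E : \sum_(i in S) lam i = \sum_(i in S) (lam i - v) + v *+ n.+1.
  by rewrite sumrB sumr_const Sn subrK.
rewrite E (inj_eq (addIr _)).
have ES : \sum_(i in S) (lam i - v) = \sum_(i in S :&: Q) (lam i - v) + \sum_(i in S :\: Q) (lam i - v).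
  by rewrite (big_setID Q).
have EQ : \sum_(i in Q) (lam i - v) = \sum_(i in S :&: Q) (lam i - v) + \sum_(i in Q :\: S) (lam i - v).
  by rewrite (big_setID S) finset.setIC.
rewrite ES EQ (inj_eq (addrI _)).
have p1 : \sum_(i in S :\: Q) (lam i - v) <= 0.
  by apply: sumr_le0 => i; rewrite !inE -leNgt subr_le0 => /andP[].
have p2 : 0 <= \sum_(i in Q :\: S) (lam i - v).
  by apply: sumr_ge0 => i; rewrite !inE subr_ge0 => /andP[_ /ltW].
apply/idP/idP => [/eqP e|/andP[QS SP]].
  have e1 : \sum_(i in S :\: Q) (lam i - v) = 0 by apply/eqP; rewrite eq_le p1 e p2.
  have e2 : \sum_(i in Q :\: S) (lam i - v) = 0 by rewrite -e.
  apply/andP; split; apply/fintype.subsetP => i iA.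
    apply: contraT => iS; have iQ : v < lam i by move: iA; rewrite inE.
    have /eqP := e2; rewrite psumr_eq0 => [/allP /(_ i)|j].
      rewrite mem_index_enum => /(_ isT) /implyP; rewrite !inE iS iQ => /(_ isT).
      by rewrite subr_eq0 gt_eqF.
    by rewrite !inE subr_ge0 => /andP[_ /ltW].
  rewrite !inE; apply/negP => iv; have /eqP := e1; rewrite -oppr_eq0 -sumrN psumr_eq0 => [/allP /(_ i)|j].
    rewrite mem_index_enum => /(_ isT) /implyP; rewrite !inE iA -leNgt (ltW iv) => /(_ isT).
    by rewrite oppr_eq0 subr_eq0 lt_eqF.
  by rewrite !inE oppr_ge0 subr_le0 -leNgt => /andP[].
have -> : \sum_(i in Q :\: S) (lam i - v) = 0.
  by apply: big1 => i; rewrite inE => /andP[/negP iS /(fintype.subsetP QS)].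
apply/eqP; apply: big1 => i; rewrite !inE -leNgt => /andP[iv /(fintype.subsetP SP)].
rewrite !inE -leNgt => vi; apply/eqP; rewrite subr_eq0 eq_le iv vi //.
Qed.

(** By [weight_max] the sets of largest weight are those selected by the two
    thresholds, and they form a union of classes. *)
Lemma lam_det (R : realDomainType) a (h : 'I_N -> K) (r : {set 'I_N} -> {set 'I_N} -> Prop)
    (lam : 'I_N -> R) (v : R) :
  (forall s, r s s) -> (forall s t, r s t -> r t s) -> (forall s t u, r s t -> r t u -> r s u) ->
  (forall U, \sum_(S | `[< r S U >]) cS a S * (\prod_(i in S) h i) = 0) ->
  (forall S U, #|S| = n.+1 -> #|U| = n.+1 -> r S U -> \sum_(i in S) lam i = \sum_(i in U) lam i) ->
  mdet a (fun i => if v < lam i then 0 else 1) (fun i => if lam i < v then 0 else h i) = 0.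
Proof.
move=> rr rs rt H Hlam; pose Q := [set i | v < lam i]%SET; pose P := [set i | lam i < v]%SET.
pose mu := \sum_(i in Q) (lam i - v) + v *+ n.+1.
pose good S := `[< exists U, [/\ #|U| = n.+1, \sum_(i in U) lam i = mu & r S U] >].
have G0 : \sum_(S | good S) cS a S * (\prod_(i in S) h i) = 0.
  apply: (class_sum0 rr rs rt H) => S U SU; apply/asboolP/asboolP => -[T [h1 h2 h3]]; exists T; split=> //.
    exact: rt (rs _ _ SU) h3.
  exact: rt SU h3.
rewrite det_expand -[RHS]G0 [RHS]big_mkcond; apply: eq_bigr => S _.
have [Sn|Sn] := eqVneq #|S| n.+1; last by rewrite cS_card// !(mul0r, mulr0) if_same.
have gS : good S = (Q \subset S) && (S \subset ~: P).
  rewrite -(weight_max lam v Sn); apply/asboolP/eqP => [[U [h1 h2 h3]]|e]; last by exists S.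
  by rewrite (Hlam _ _ Sn h1 h3).
rewrite gS; case: ifP => [/andP[QS SP]|/negbT]; last first.
  rewrite negb_and => /orP[] /subsetPn [i iA iB].
    rewrite [X in _ * X * _](bigD1 i) ?inE//=; move: iA; rewrite inE => ->.
    by rewrite !(mul0r, mulr0).
  rewrite [X in X * _ * _](bigD1 i)//=; move: iB; rewrite !inE negbK => ->.
  by rewrite !mul0r.
rewrite mulrC; congr (_ * _); rewrite [X in _ * X]big1 ?mulr1 => [|i].
  apply: eq_bigr => i iS; case: ifP => // iP; have := fintype.subsetP SP i iS.
  by rewrite !inE iP.
rewrite inE => iS; case: ifP => // iQ; have := fintype.subsetP QS i.
by rewrite inE iQ (negPf iS) => /(_ isT).
Qed.
End Det.

(** * Balanced vectors in subspaces *)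

From mathcomp Require Import zify.
Section Signs.

(** Positive integers with an even sum smaller than twice their number can be
    signed to sum to zero: an integer larger than 1 absorbs a 1. *)
Lemma signing (I : finType) (k : nat) (A : {set I}) (f : I -> nat) : (#|A| <= k)%N ->
  (\sum_(i in A) (if f i == 0 then 2 else f i) + 2 <= 2 * #|A|)%N \/
    (forall i, i \in A -> f i = 1%N) -> ~~ odd (\sum_(i in A) f i)%N ->
  exists e : I -> bool, \sum_(i in A) (-1) ^+ e i * (f i)%:Z = 0 :> int.
Proof.
elim: k A f => [|k IH] A f Ak.
  have -> : A = finset.set0 by apply/eqP; rewrite -cards_eq0 -leqn0.
  by exists (fun=> false); rewrite big_set0.
have cD (B : {set I}) i : i \in B -> #|B| = #|B :\ i|.+1 by move=> iB; rewrite (cardsD1 i) iB.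
have ones (B : {set I}) : (#|B| <= k.+1)%N -> (forall i, i \in B -> f i = 1%N) ->
    ~~ odd (\sum_(i in B) f i)%N -> exists e : I -> bool, \sum_(i in B) (-1) ^+ e i * (f i)%:Z = 0 :> int.
  move=> Bk B1 ev; have [B0|[i1 i1B]] := finset.set_0Vmem B.
    by exists (fun=> false); rewrite B0 big_set0.
  have [B0|[i2 i2B]] := finset.set_0Vmem (B :\ i1).
    by move: ev; rewrite (big_setD1 i1)//= B0 big_set0 B1.
  have i2B' : i2 \in B by move: i2B; rewrite !inE => /andP[].
  have i21 : i2 != i1 by move: i2B; rewrite !inE => /andP[].
  have [|||e eS] := IH (B :\ i1 :\ i2) f.
  - by rewrite (cD _ _ i1B) (cD _ _ i2B) in Bk; lia.
  - by right=> i; rewrite !inE => /and3P[_ _]; exact: B1.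
  - move: ev; rewrite (big_setD1 i1)//= (big_setD1 i2)//= (B1 i1)// (B1 i2)//.
    by move: (\sum_(i in _) _)%N => q; lia.
  exists (fun i => if i == i1 then false else if i == i2 then true else e i).
  rewrite (big_setD1 i1)//= (big_setD1 i2)//= !eqxx (negPf i21) !B1//.
  rewrite (eq_bigr (fun i => (-1) ^+ e i * (f i)%:Z)) => [|i].
    by rewrite eS addr0.
  by rewrite !inE => /and3P[/negPf -> /negPf -> _].
case=> [H|A1] ev; last exact: ones.
have [[i0 i0A f0]|pos] := pselect (exists2 i, i \in A & f i = 0%N).
  have [|||e eS] := IH (A :\ i0) f.
  - by rewrite (cD _ _ i0A) in Ak.
  - by left; move: H; rewrite (big_setD1 i0)//= f0 (cD _ _ i0A) /=; lia.
  - by move: ev; rewrite (big_setD1 i0)//= f0.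
  by exists e; rewrite (big_setD1 i0)//= f0 eS mulr0.
have f1 i : i \in A -> (0 < f i)%N.
  by move=> iA; rewrite lt0n; apply/eqP => fi; apply: pos; exists i.
have sE : (\sum_(i in A) (if f i == 0 then 2 else f i) = \sum_(i in A) f i)%N.
  by apply: eq_bigr => i /f1; case: (f i).
rewrite sE in H.
have [[i1 i1A f2]|no1] := pselect (exists2 i, i \in A & (1 < f i)%N); last first.
  apply: ones => // i iA; apply/eqP; rewrite eqn_leq f1// andbT leqNgt.
  by apply/negP => h; apply: no1; exists i.
have [[i2 i2A fi2]|no2] := pselect (exists2 i, i \in A & f i = 1%N); last first.
  have : (\sum_(i in A) 2 <= \sum_(i in A) f i)%N.
    apply: leq_sum => i iA; have := f1 i iA; have : f i <> 1%N by move=> h; apply: no2; exists i.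
    lia.
  by rewrite sum_nat_const; lia.
have i12 : i1 != i2 by apply/eqP => E; rewrite E fi2 in f2.
have i1A' : i1 \in A :\ i2 by rewrite !inE i12.
pose f' i := if i == i1 then (f i).-1 else f i.
have fE : forall i, i \in A :\ i2 :\ i1 -> f' i = f i.
  by move=> i; rewrite !inE /f' => /andP[/negPf -> _].
have S1 : (\sum_(i in A) f i = 1 + (f i1 + \sum_(i in A :\ i2 :\ i1) f i))%N.
  by rewrite (big_setD1 i2)//= fi2 (big_setD1 i1).
have S2 : (\sum_(i in A :\ i2) f' i = (f i1).-1 + \sum_(i in A :\ i2 :\ i1) f i)%N.
  by rewrite (big_setD1 i1)//= {1}/f' eqxx; congr addn; exact: eq_bigr.
have [|||e eS] := IH (A :\ i2) f'.
- by rewrite (cD _ _ i2A) in Ak.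
- left; have -> : (\sum_(i in A :\ i2) (if f' i == 0 then 2 else f' i) = \sum_(i in A :\ i2) f' i)%N.
    apply: eq_bigr => i; rewrite inE => /andP[_ /f1]; rewrite /f'; have [->|_] := eqVneq i i1.
      by move=> _; move: f2; case: (f i1) => [|[|p]].
    by case: (f i).
  by rewrite S2; move: H; rewrite S1 (cD _ _ i2A); lia.
- by rewrite S2; move: ev; rewrite S1; case: (f i1) f2 => [|[|p]] //= _; rewrite !oddD /= negbK.
exists (fun i => if i == i2 then ~~ e i1 else e i).
rewrite (big_setD1 i2)//= eqxx fi2 (big_setD1 i1)//= (negPf i12).
move: eS; rewrite (big_setD1 i1)//= {1}/f' eqxx.
rewrite (eq_bigr (fun i => (-1) ^+ e i * (f i)%:Z)) => [|i iA]; last by rewrite fE.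
rewrite [in X in _ -> X](eq_bigr (fun i => (-1) ^+ e i * (f i)%:Z)) => [|i]; last first.
  by rewrite !inE => /and3P[_ /negPf -> _].
move: (\sum_(i in A :\ i2 :\ i1) _) => s.
case: (f i1) f2 => [|p] // _; rewrite /= signrN (intS p) => E; rewrite -[RHS]E.
by move: ((-1) ^+ e i1) (p%:Z) => y z; ring.
Qed.

Lemma sum_signs (I : finType) (P : pred I) (b : I -> bool) :
  \sum_(j | P j) (-1) ^+ b j = (#|P|)%:Z - 2 * (#|[pred j | P j && b j]|)%:Z :> int.
Proof.
have E (Q : pred I) : (#|Q|)%:Z = \sum_(j | Q j) 1 :> int by rewrite sumr_const natz.
rewrite !E mulr_sumr big_mkcondr /= -sumrB; apply: eq_bigr => j _.
by case: (b j).
Qed.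

(** A subspace of dimension greater than [n+1] of a space of dimension [2n+2]
    that lies in no coordinate hyperplane has a vector without zero coordinates
    and with as many positive as negative ones.  In coordinates for which it is
    a graph, take [x_k = +- T^(d-k)] with [T] large: the sign of a coordinate is
    decided by its first nonzero coefficient. *)
Lemma balanced (R : realFieldType) (n d : nat) (W : 'M[R]_(d, n.+1 + n.+1)) : row_free W ->
  (forall j, exists k, W k j != 0) -> (n.+1 < d)%N ->
  exists x : 'rV_d, #|[set j | 0 < (x *m W) 0 j]%SET| = n.+1 /\ #|[set j | (x *m W) 0 j < 0]%SET| = n.+1.
Proof.
move=> Wf Wn dn.
have Bf : row_full W^T by rewrite /row_full mxrank_tr.
pose g := fullrankfun Bf.
have Uu : rowsub g W^T \in unitmx by exact: fullrowsub_unit.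
pose U := rowsub g W^T; pose B := W^T *m invmx U.
have gB k l : B (g k) l = (k == l)%:R.
  have : rowsub g B = 1%:M by rewrite /B -mul_rowsub_mx mulmxV.
  by move/matrixP => /(_ k l); rewrite !mxE.
have BU : B *m U = W^T by rewrite mulmxKV.
have Bn j : exists k, B j k != 0.
  apply: contrapT => /forallNP no; have [k /eqP] := Wn j; apply.
  have /matrixP /(_ j k) := BU; rewrite !mxE => <-; rewrite big1// => l _.
  by have /negP := no l; rewrite negbK => /eqP ->; rewrite mul0r.
have /choice [kap Hkap] : forall j, exists k, B j k != 0 /\ forall l : 'I_d, (l < k)%N -> B j l = 0.
  move=> j; have [k0 hk0] := Bn j.
  case: (@arg_minnP _ k0 (fun k => B j k != 0) (fun k => k : nat) hk0) => k hk hm.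
  exists k; split=> // l lk; apply/eqP; apply: contraLR lk => h; rewrite -leqNgt; exact: hm.
have kapg k : kap (g k) = k.
  have [h _] := Hkap (g k); apply/eqP; rewrite eq_sym; move: h; rewrite gB.
  by case: (k == _); rewrite ?eqxx.
pose sg j := B j (kap j) < 0.
pose w k : int := \sum_(j | kap j == k) (-1) ^+ sg j.
pose s k := #|[pred j | kap j == k]|.
pose t k := #|[pred j | (kap j == k) && sg j]|.
have wE k : w k = (s k)%:Z - 2 * (t k)%:Z by exact: sum_signs.
have ts k : (t k <= s k)%N by apply: subset_leq_card; apply/fintype.subsetP => j; rewrite !inE => /andP[].
have s1 k : (0 < s k)%N by apply/card_gt0P; exists (g k); rewrite inE kapg.
have sN : (\sum_k s k = n.+1 + n.+1)%N.
  rewrite -[RHS]card_ord -sum1_card (partition_big kap predT)//=.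
  by apply: eq_bigr => k _; rewrite sum1_card.
have [|||e eS] := @signing _ d [set: 'I_d]%SET (fun k => `|w k|%N).
- by rewrite cardsT card_ord.
- left; rewrite cardsT card_ord.
  have : (\sum_(k in [set: 'I_d]%SET) (if `|w k|%N == 0%N then 2 else `|w k|) <= \sum_k s k)%N.
    rewrite [leqRHS](eq_bigl (fun k => k \in [set: 'I_d]%SET)) => [|k]; last by rewrite finset.in_setT.
    apply: leq_sum => k _; have := wE k; have := ts k; have := s1 k.
    move: (w k) (s k) (t k) => x y z h1 h2 h3; case: eqP => h4; lia.
  by rewrite sN; lia.
- have -> : odd (\sum_(k in [set: 'I_d]%SET) `|w k|%N) = odd (\sum_k s k).
    rewrite (eq_bigl predT) => [|k]; last by rewrite finset.in_setT.
    rewrite !(big_morph odd oddD (erefl _)); apply: eq_bigr => k _.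
    by have := wE k; have := ts k; move: (w k) (s k) (t k) => x y z h1 h2; lia.
  by rewrite sN addnn odd_double.
pose eta k := e k (+) (w k < 0).
have etaw k : (-1) ^+ eta k * w k = (-1) ^+ e k * (`|w k|%N)%:Z.
  by rewrite /eta signr_addb -mulrA abszE normrEsign.
pose T : R := 1 + \sum_j \sum_k `|B j k| / `|B j (kap j)|.
have T1 : 1 <= T by rewrite lerDl; apply: sumr_ge0 => j _; apply: sumr_ge0 => k _; rewrite divr_ge0.
have TB j : \sum_k `|B j k| < T * `|B j (kap j)|.
  have [h _] := Hkap j; have h0 : 0 < `|B j (kap j)| by rewrite normr_gt0.
  rewrite -ltr_pdivrMr// mulr_suml; apply: lt_le_trans (_ : 1 + \sum_k `|B j k| / `|B j (kap j)| <= _).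
    by rewrite ltrDr.
  rewrite lerD2l [leRHS](bigD1 j)//= lerDl; apply: sumr_ge0 => i _; apply: sumr_ge0 => k _.
  by rewrite divr_ge0.
pose xc : 'cV[R]_d := \col_k ((-1) ^+ eta k * T ^+ (d - k)).
pose x := (invmx U *m xc)^T.
have xW j : (x *m W) 0 j = \sum_k B j k * xc k 0.
  have : (x *m W)^T = B *m xc by rewrite trmx_mul /x trmxK mulmxA.
  by move/colP => /(_ j); rewrite !mxE.
pose b j := eta (kap j) (+) sg j.
have T0 : 0 < T by lra.
have pos j : 0 < (-1) ^+ b j * (x *m W) 0 j.
  have [hk hl] := Hkap j; rewrite xW (bigD1 (kap j))//= mulrDr.
  set rest := \sum_(k | k != kap j) _.
  have m1 : (-1) ^+ b j * (B j (kap j) * xc (kap j) 0) = `|B j (kap j)| * T ^+ (d - kap j).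
    have e2 : (-1) ^+ eta (kap j) * (-1) ^+ eta (kap j) = 1 :> R by rewrite -expr2 sqrr_sign.
    have e3 : (-1) ^+ sg j * B j (kap j) = `|B j (kap j)| by rewrite /sg -normrEsign.
    rewrite [xc _ _]mxE /b signr_addb -e3; move: e2.
    move: ((-1) ^+ eta (kap j)) ((-1) ^+ sg j) (B j (kap j)) (T ^+ (d - kap j)) => p q r t1 e2.
    by transitivity ((p * p) * (q * r) * t1); [ring|rewrite e2 mul1r].
  have r1 : `|rest| < `|B j (kap j)| * T ^+ (d - kap j).
    apply: le_lt_trans (ler_norm_sum _ _ _) _.
    apply: le_lt_trans (_ : \sum_(k | k != kap j) `|B j k| * T ^+ (d - kap j).-1 < _).
      apply: ler_sum => k kk; rewrite normrM [xc _ _]mxE normrM normr_sign mul1r normrX (gtr0_norm T0).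
      have [lt|gt] := ltnP k (kap j); first by rewrite hl// normr0 !mul0r.
      rewrite ler_wpM2l// ler_weXn2l//.
      have : (kap j < k)%N by rewrite ltn_neqAle gt andbT eq_sym.
      by have := ltn_ord k; lia.
    have E : T ^+ (d - kap j) = T * T ^+ (d - kap j).-1.
      by rewrite -exprS prednK// subn_gt0 ltn_ord.
    rewrite E -mulr_suml mulrA ltr_pM2r ?exprn_gt0// [ltRHS]mulrC.
    by apply: le_lt_trans (TB j); rewrite [leRHS](bigD1 (kap j))//= lerDr.
  have h : - ((-1) ^+ b j * rest) <= `|rest|.
    by apply: le_trans (ler_norm _) _; rewrite normrN normrM normr_sign mul1r.
  rewrite m1 -ltrBlDr sub0r; exact: le_lt_trans h r1.
have bsum : \sum_j (-1) ^+ b j = 0 :> int.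
  rewrite (partition_big kap predT)//= -[RHS]eS; apply: eq_big => [k|k _]; first by rewrite finset.in_setT.
  rewrite -etaw mulr_sumr; apply: eq_bigr => j /eqP <-.
  by rewrite /b signr_addb.
have cb : #|[pred j | b j]| = n.+1.
  have cE : #|[pred j | predT j && b j]| = #|[pred j | b j]| by apply: eq_card => j; rewrite !inE.
  have cN : #|(predT : pred 'I_(n.+1 + n.+1))| = (n.+1 + n.+1)%N by rewrite card_ord.
  have := sum_signs predT b; rewrite bsum cE cN.
  by move: #|[pred j | b j]| => c; clear; lia.
have cb' : #|[pred j | ~~ b j]| = n.+1.
  have := cardC [pred j | b j]; rewrite card_ord cb.
  by move/eqP; rewrite eqn_add2l => /eqP H; rewrite -[RHS]H; apply: eq_card => j; rewrite !inE.
exists x; split.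
  rewrite -[RHS]cb'; apply: eq_card => j; rewrite !inE; have := pos j.
  by case: (b j) => /=; rewrite ?mulN1r ?mul1r ?oppr_gt0 => h; [rewrite lt_gtF|].
rewrite -[RHS]cb; apply: eq_card => j; rewrite !inE; have := pos j.
by case: (b j) => /=; rewrite ?mulN1r ?mul1r ?oppr_gt0 => h; [|rewrite lt_gtF].
Qed.
End Signs.

(** * Polynomial functions and elimination *)

From mathcomp Require Import closed_field.
From mathcomp Require mpoly.
Import -(notations) mpoly.
Section PolynomialFunctions.
Variable K : closedFieldType.
Hypothesis K_infinite : forall s : seq K, exists a, a \notin s.

(** An inductive encoding, for arguments by induction on the expression. *)
Inductive PF k : (('I_k -> K) -> K) -> Prop :=
| PF_cst c : PF (fun=> c)
| PF_var i : PF (fun x => x i)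
| PF_add P Q : PF P -> PF Q -> PF (fun x => P x + Q x)
| PF_mul P Q : PF P -> PF Q -> PF (fun x => P x * Q x).

Lemma PF_line k P (x y : 'I_k -> K) : PF P ->
  exists p : {poly K}, forall t, P (fun i => x i + t * y i) = p.[t].
Proof.
elim=> [c|i|P1 P2 _ [p pE] _ [q qE]|P1 P2 _ [p pE] _ [q qE]].
- by exists c%:P => t; rewrite hornerC.
- by exists ((x i)%:P + 'X * (y i)%:P) => t; rewrite !hornerE.
- by exists (p + q) => t; rewrite hornerD pE qE.
- by exists (p * q) => t; rewrite hornerM pE qE.
Qed.

Lemma poly_roots (p : {poly K}) : p != 0 -> exists s : seq K, forall t, t \notin s -> p.[t] != 0.
Proof.
move=> p0; have [rs pE] := closed_field_poly_normal p; exists rs => t ts.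
rewrite pE hornerZ mulf_neq0 ?lead_coef_eq0// horner_prod prodf_seq_neq0.
apply/allP => z zs /=; rewrite hornerXsubC subr_eq0; apply: contraNneq ts => ->.
exact: zs.
Qed.

Lemma PF_neq0M k (P Q : ('I_k -> K) -> K) : PF P -> PF Q -> (exists x, P x != 0) ->
  (exists x, Q x != 0) -> exists x, P x * Q x != 0.
Proof.
move=> PP PQ [x Px] [y Qy].
have [p pE] := PF_line x (fun i => y i - x i) PP; have [q qE] := PF_line x (fun i => y i - x i) PQ.
have E0 : (fun i => x i + 0 * (y i - x i)) = x by apply/funext => i; rewrite mul0r addr0.
have E1 : (fun i => x i + 1 * (y i - x i)) = y by apply/funext => i; rewrite mul1r addrC subrK.
have p0 : p != 0 by apply: contraNneq Px => p0; rewrite -E0 pE p0 horner0.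
have q0 : q != 0 by apply: contraNneq Qy => q0; rewrite -E1 qE q0 horner0.
have [s sP] := poly_roots (mulf_neq0 p0 q0); have [t ts] := K_infinite s.
by exists (fun i => x i + t * (y i - x i)); rewrite pE qE -hornerM; exact: sP.
Qed.

(** A nonzero polynomial function does not vanish identically on a product of
    infinite sets: move the coordinates into the sets one at a time. *)
Lemma PF_torus k (P : ('I_k -> K) -> K) (A : 'I_k -> K -> Prop) : PF P ->
  (forall i (s : seq K), exists2 a, A i a & a \notin s) -> (exists x, P x != 0) ->
  exists2 x, (forall i, A i (x i)) & P x != 0.
Proof.
move=> PP Ainf [x0 Px0].
suff H (l : seq 'I_k) : exists2 x, (forall i, i \in l -> A i (x i)) & P x != 0.
  by have [x xA Px] := H (enum 'I_k); exists x => // i; apply: xA; rewrite mem_enum.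
elim: l => [|i l [x xA Px]]; first by exists x0.
have [p pE] := PF_line x (fun j => (j == i)%:R) PP.
have E0 : (fun j => x j + 0 * (j == i)%:R) = x by apply/funext => j; rewrite mul0r addr0.
have p0 : p != 0 by apply: contraNneq Px => p0; rewrite -E0 pE p0 horner0.
have [s sP] := poly_roots p0.
have [a aA as_] := Ainf i [seq x i + t | t <- s].
exists (fun j => x j + (a - x i) * (j == i)%:R); last first.
  rewrite pE; apply: sP; apply: contra as_ => h; apply/mapP; exists (a - x i) => //.
  by rewrite addrC subrK.
move=> j; have [->|ji] := eqVneq j i; first by rewrite mulr1 addrC subrK.
by rewrite mulr0 addr0 inE (negPf ji); exact: xA.
Qed.

Lemma PF_meval k (P : ('I_k -> K) -> K) : PF P -> exists p : mpoly.mpoly k K, forall x, P x = mpoly.meval x p.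
Proof.
elim=> [c|i|P1 P2 _ [p pE] _ [q qE]|P1 P2 _ [p pE] _ [q qE]].
- by exists (mpoly.mpolyC k c) => x; rewrite mevalC.
- by exists (mpoly.mpolyX K (mpoly.mnm1 i)) => x; rewrite mevalXU.
- by exists (p + q) => x; rewrite mevalD pE qE.
- by exists (p * q) => x; rewrite mevalM pE qE.
Qed.

Definition env k (x : 'I_k -> K) : seq K := [seq x i | i <- enum 'I_k].

Lemma size_env k (x : 'I_k -> K) : size (env x) = k.
Proof. by rewrite size_map size_enum_ord. Qed.

Lemma nth_env k (x : 'I_k -> K) (i : 'I_k) : (env x)`_i = x i.
Proof. by rewrite (nth_map i) ?size_enum_ord// nth_ord_enum. Qed.

Lemma PF_term k (t : GRing.term K) : GRing.rterm t -> PF (fun x : 'I_k -> K => GRing.eval (env x) t).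
Proof.
elim: t => //=.
- move=> i _; have [ik|ki] := ltnP i k.
    have := PF_var (Ordinal ik); congr PF; apply/funext => x.
    by rewrite -nth_env.
  have := @PF_cst k 0; congr PF; apply/funext => x.
  by rewrite nth_default// size_env.
- by move=> c _; exact: PF_cst.
- by move=> n _; exact: PF_cst.
- by move=> t1 H1 t2 H2 /andP[/H1 h1 /H2 h2]; exact: PF_add.
- move=> t1 H1 /H1 h1; have := PF_mul (PF_cst _ (-1)) h1; congr PF.
  by apply/funext => x; rewrite mulN1r.
- move=> t1 H1 n /H1 h1; have := PF_mul (PF_cst _ n%:R) h1; congr PF.
  by apply/funext => x; rewrite mulr_natl.
- by move=> t1 H1 t2 H2 /andP[/H1 h1 /H2 h2]; exact: PF_mul.
- move=> t1 H1 n /H1 h1; elim: n => [|n IH].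
    by have := @PF_cst k 1; congr PF; apply/funext => x; rewrite expr0.
  by have := PF_mul h1 IH; congr PF; apply/funext => x; rewrite exprS.
Qed.

(** An equation that is not an identity is generically false. *)
Lemma qf_generic k (f : GRing.formula K) : GRing.qf_form f && GRing.rformula f ->
  exists D, [/\ @PF k D, exists x, D x != 0 & exists b, forall x, D x != 0 -> GRing.qf_eval (env x) f = b].
Proof.
have one : exists x : 'I_k -> K, (fun=> 1 : K) x != 0 by exists (fun=> 0); exact: oner_neq0.
have two f1 f2 (op : bool -> bool -> bool) (g : ('I_k -> K) -> bool) :
  (forall x, g x = op (GRing.qf_eval (env x) f1) (GRing.qf_eval (env x) f2)) ->
  (exists D, [/\ @PF k D, exists x, D x != 0 & exists b, forall x, D x != 0 -> GRing.qf_eval (env x) f1 = b]) ->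
  (exists D, [/\ @PF k D, exists x, D x != 0 & exists b, forall x, D x != 0 -> GRing.qf_eval (env x) f2 = b]) ->
  exists D, [/\ @PF k D, exists x, D x != 0 & exists b, forall x, D x != 0 -> g x = b].
  move=> gE [D1 [P1 n1 [b1 H1]]] [D2 [P2 n2 [b2 H2]]].
  exists (fun x => D1 x * D2 x); split; [exact: PF_mul|exact: PF_neq0M|].
  exists (op b1 b2) => x; rewrite mulf_eq0 negb_or => /andP[/H1 <- /H2 <-]; exact: gE.
elim: f => //=.
- by move=> b _; exists (fun=> 1); split=> //; [exact: PF_cst|exists b].
- move=> t1 t2 /andP[r1 r2].
  pose D (x : 'I_k -> K) := GRing.eval (env x) t1 - GRing.eval (env x) t2.
  have DP : PF D.
    have := PF_add (PF_term k r1) (PF_mul (PF_cst _ (-1)) (PF_term k r2)); congr PF.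
    by apply/funext => x; rewrite mulN1r.
  have [[x Dx]|no] := pselect (exists x, D x != 0).
    by exists D; split=> //; [exists x|exists false => y; rewrite subr_eq0 => /negPf].
  exists (fun=> 1); split=> //; first exact: PF_cst.
  exists true => y _; rewrite -subr_eq0; apply/negPn/negP => h; apply: no; by exists y.
- move=> f1 H1 f2 H2 /andP[/andP[q1 q2] /andP[r1 r2]].
  by apply: (two f1 f2 andb) => //; [apply: H1|apply: H2]; apply/andP.
- move=> f1 H1 f2 H2 /andP[/andP[q1 q2] /andP[r1 r2]].
  by apply: (two f1 f2 orb) => //; [apply: H1|apply: H2]; apply/andP.
- move=> f1 H1 f2 H2 /andP[/andP[q1 q2] /andP[r1 r2]].
  by apply: (two f1 f2 implb) => //; [apply: H1|apply: H2]; apply/andP.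
- move=> f1 H1 /H1 [D [DP D0 [b Hb]]]; exists D; split=> //.
  by exists (~~ b) => x /Hb ->.
Qed.

(** Lets systems of equations be written as functions of the environment rather
    than as syntactic terms. *)
Definition termfun (phi : (nat -> K) -> K) := exists2 t, GRing.rterm t &
  forall e : seq K, GRing.eval e t = phi (nth 0 e).

Lemma termfun_var i : termfun (fun v => v i). Proof. by exists ('X_i)%T. Qed.
Lemma termfun_cst c : termfun (fun=> c). Proof. by exists (c%:T)%T. Qed.
Lemma termfunD p q : termfun p -> termfun q -> termfun (fun v => p v + q v).
Proof. by move=> [t rt E] [u ru E']; exists (t + u)%T => [|e]; rewrite /= ?rt ?ru ?E ?E'. Qed.
Lemma termfunM p q : termfun p -> termfun q -> termfun (fun v => p v * q v).
Proof. by move=> [t rt E] [u ru E']; exists (t * u)%T => [|e]; rewrite /= ?rt ?ru ?E ?E'. Qed.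
Lemma termfunB p q : termfun p -> termfun q -> termfun (fun v => p v - q v).
Proof. by move=> [t rt E] [u ru E']; exists (t - u)%T => [|e]; rewrite /= ?rt ?ru ?E ?E'. Qed.
Lemma termfunX p n : termfun p -> termfun (fun v => p v ^+ n).
Proof. by move=> [t rt E]; exists (t ^+ n)%T => [|e]; rewrite /= ?rt ?E. Qed.
Lemma termfun_sum (J : Type) (s : seq J) (F : J -> (nat -> K) -> K) : (forall j, termfun (F j)) ->
  termfun (fun v => \sum_(j <- s) F j v).
Proof.
move=> H; elim: s => [|j s IH].
  by have := termfun_cst 0; congr termfun; apply/funext => v; rewrite big_nil.
by have := termfunD (H j) IH; congr termfun; apply/funext => v; rewrite big_cons.
Qed.
Lemma termfun_prod (J : Type) (s : seq J) (F : J -> (nat -> K) -> K) : (forall j, termfun (F j)) ->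
  termfun (fun v => \prod_(j <- s) F j v).
Proof.
move=> H; elim: s => [|j s IH].
  by have := termfun_cst 1; congr termfun; apply/funext => v; rewrite big_nil.
by have := termfunM (H j) IH; congr termfun; apply/funext => v; rewrite big_cons.
Qed.

Lemma holds_exists (p : nat) (e : seq K) f :
  GRing.holds e (foldr (fun i g => GRing.Exists i g) f (iota (size e) p)) <->
  exists2 y : seq K, size y = p & GRing.holds (e ++ y) f.
Proof.
have S x : forall l : seq K, set_nth 0 l (size l) x = rcons l x by elim=> //= y l ->.
elim: p e => [|p IH] e /=.
  split=> [H|[[|//] _]]; last by rewrite cats0.
  by exists [::]; rewrite ?cats0.
split=> [[x]|[[|x y]//= [yp] H]].
  rewrite S; have := IH (rcons e x); rewrite size_rcons => -> [y yp H].
  by exists (x :: y); rewrite /= ?yp// -cat_rcons.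
exists x; rewrite S; have := IH (rcons e x); rewrite size_rcons => ->.
by exists y; rewrite // cat_rcons.
Qed.

(** Chevalley: whether a polynomial system with parameters is solvable does not
    depend on the parameters, for generic parameters. *)
Lemma solvable_generic (k p : nat) (J : finType) (phi : J -> (nat -> K) -> K) psi :
  (forall j, termfun (phi j)) -> termfun psi ->
  let Sat (x : 'I_k -> K) := exists2 y : seq K, size y = p &
    (forall j, phi j (nth 0 (env x ++ y)) = 0) /\ psi (nth 0 (env x ++ y)) != 0 in
  exists D, [/\ @PF k D, exists x, D x != 0 &
    (forall x, D x != 0 -> Sat x) \/ (forall x, D x != 0 -> ~ Sat x)].
Proof.
move=> tf [u ru uE] Sat.
have /choice [t Ht] : forall j, exists t, GRing.rterm t /\ forall e : seq K, GRing.eval e t = phi j (nth 0 e).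
  by move=> j; have [t rt E] := tf j; exists t.
pose body := (foldr GRing.And (GRing.Bool true) [seq (t j == 0)%T | j <- enum J] /\ ~ (u == 0))%T.
pose f := foldr (fun i g => GRing.Exists i g) body (iota k p).
have rf : GRing.rformula f.
  rewrite /f; elim: (iota k p) => //=; rewrite ru ?andbT; elim: (enum J) => //= j s.
  by have [-> _] := Ht j.
have bodyP (e : seq K) : GRing.holds e body <-> (forall j, phi j (nth 0 e) = 0) /\ psi (nth 0 e) != 0.
  rewrite /body /= uE; split=> -[H1 H2]; split; try exact/eqP.
    move=> j; have : j \in enum J by rewrite mem_enum.
    elim: (enum J) H1 => //= j' s IH [h1 h2]; rewrite inE => /predU1P[->|]; last exact: IH.
    by have [_ <-] := Ht j'.
  elim: (enum J) => //= j s IH; split=> //; by have [_ ->] := Ht j.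
have SatP x : GRing.holds (env x) f <-> Sat x.
  rewrite /f -[in iota k p](size_env x) holds_exists; split=> -[y yp /bodyP H]; by exists y.
have cl : GRing.closed_field_axiom K by exact: solve_monicpoly.
have wf := @ClosedFieldQE.wf_ex_elim K; have ok := ClosedFieldQE.holds_ex_elim cl.
have [D [DP D0 [b Hb]]] := qf_generic k (GRing.quantifier_elim_wf wf rf).
exists D; split=> //; case: b Hb => Hb; [left|right] => x /Hb.
  by move/(GRing.quantifier_elim_rformP wf ok _ rf)/SatP.
by move=> E /SatP /(GRing.quantifier_elim_rformP wf ok _ rf); rewrite E.
Qed.

(** On a line through the origin the polynomial becomes a polynomial in the
    scaling factor with infinitely many zeros, so its coefficients vanish. *)
Lemma homogeneous_component k (p : mpoly.mpoly k K) (X : ('I_k -> K) -> Prop) : p != 0 ->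
  (forall x t, X x -> t != 0 -> mpoly.meval (fun i => t * x i) p = 0) ->
  exists d (q : mpoly.mpoly k K), [/\ q != 0, q \is mpoly.ishomog1 d mpoly.mdeg &
    forall x, X x -> mpoly.meval x q = 0].
Proof.
move=> p0 pX; have : msupp p != [::] by rewrite msupp_eq0.
case E : (msupp p) => [//|mon s] _; pose d := mdeg mon.
exists d, (pihomog mpoly.mdeg d p); split; [|exact: pihomogP|].
- have ms : mon \in msupp p by rewrite E mem_head.
  apply/eqP => E0; have := congr1 (mcoeff mon) E0; rewrite mcoeff0 /pihomog raddf_sum /= big_mkcond.
  rewrite (bigD1_seq mon) ?msupp_uniq//= eqxx mcoeffZ mcoeffX eqxx mulr1 big1 ?addr0 => [/eqP|m /negPf mm].
    by rewrite mcoeff_eq0 ms.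
  by case: ifP => // _; rewrite mcoeffZ mcoeffX mm mulr0.
- move=> x Xx; pose Q : {poly K} := \sum_(m <- msupp p) (mcoeff m p * \prod_i x i ^+ m i) *: 'X^(mdeg m).
  have Q0 : Q = 0.
    apply/eqP; apply: contraT => /poly_roots [rs Hrs].
    have [t] := K_infinite (0 :: rs); rewrite inE negb_or => /andP[t0 /Hrs].
    case/eqP; rewrite /Q horner_sum -[RHS](pX x t Xx t0) mevalE; apply: eq_bigr => m _; rewrite hornerZ hornerXn -mulrA; congr (_ * _).
    rewrite mulrC mdegE -prodrXr -big_split /=; apply: eq_bigr => i _.
    by rewrite exprMn.
  transitivity (Q`_d); last by rewrite Q0 coef0.
  rewrite /Q coef_sum /pihomog raddf_sum /= big_mkcond.
  apply: eq_bigr => m _; rewrite coefZ coefXn eq_sym; case: eqP => _; last by rewrite mulr0.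
  by rewrite mevalZ mevalX mulr1.
Qed.
End PolynomialFunctions.

(** * Spanning sets of coordinates *)

Section TwoSets.
Variables (R : realFieldType) (N d : nat) (W : 'M[R]_(d, N)).
Hypothesis Wf : row_free W.
Implicit Types (Y T : {set 'I_N}) (x : 'rV[R]_d).
Local Notation lam x j := ((x *m W) 0 j).

Definition spans Y := forall x, (forall j, j \in Y -> lam x j = 0) -> x = 0.

Lemma spansS Y T : Y \subset T -> spans Y -> spans T.
Proof. by move=> /fintype.subsetP YT sY x xT; apply: sY => j /YT; exact: xT. Qed.

Lemma spansT : spans [set: 'I_N]%SET.
Proof.
move=> x x0; apply: (row_free_inj Wf); rewrite mul0mx; apply/rowP => j.
by rewrite (x0 j (finset.in_setT _)) [RHS]mxE.
Qed.

(** If dropping any element of [T] other than [i] loses information then the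
    other coordinates in [T] can be prescribed. *)
Lemma dual_vec T (j : 'I_N) : spans T -> ~ spans (T :\ j) -> exists2 x : 'rV[R]_d, lam x j = 1 & forall l, l \in T :\ j -> lam x l = 0.
Proof.
move=> sT /existsNP [x /not_implyP [x0 xn]].
have xj : lam x j != 0.
  apply/eqP => h; apply: xn; apply: sT => l lT; have [->//|lj] := eqVneq l j.
  by apply: x0; rewrite !inE lj.
exists ((lam x j)^-1 *: x) => [|l lT]; rewrite -scalemxAl [LHS]mxE; first by rewrite mulVf.
by rewrite (x0 l lT) mulr0.
Qed.

Lemma indep_card T (D : {set 'I_N}) : D \subset T -> spans T -> (forall j, j \in D -> ~ spans (T :\ j)) -> (#|D| <= d)%N.
Proof.
move=> DT sT H.
have /choice [x Hx] : forall j, exists x : 'rV[R]_d, j \in D -> lam x j = 1 /\ forall l, l \in T :\ j -> lam x l = 0.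
  move=> j; have [jD|_] := boolP (j \in D); last by exists 0.
  by have [x h1 h2] := dual_vec sT (H j jD); exists x.
pose M : 'M[R]_(#|D|, d) := \matrix_(r, k) x (enum_val r) 0 k.
pose W' : 'M[R]_(d, #|D|) := \matrix_(k, r) W k (enum_val r).
have MW : M *m W' = 1%:M.
  apply/matrixP => r s; rewrite !mxE.
  have -> : \sum_j M r j * W' j s = lam (x (enum_val r)) (enum_val s).
    by rewrite mxE; apply: eq_bigr => k _; rewrite !mxE.
  have [h1 h2] := Hx _ (enum_valP r); have [->|rs] := eqVneq r s; first by have [-> _] := Hx _ (enum_valP s).
  apply: h2; rewrite !inE (fintype.subsetP DT) ?enum_valP// andbT.
  by apply: contraNneq rs => /enum_val_inj ->.
have := mxrank1 R #|D|; rewrite -MW => <-.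
apply: leq_trans (mxrankM_maxl _ _) (rank_leq_col _).
Qed.

Lemma minimal_spanning T (i : 'I_N) : spans T -> i \in T -> exists T', [/\ T' \subset T, spans T', i \in T' &
  forall j, j \in T' -> j != i -> ~ spans (T' :\ j)].
Proof.
elim: {T}#|T| {-2}T (leqnn #|T|) => [|k IH] T Tk sT iT.
  by move: Tk; rewrite leqn0 cards_eq0 => /eqP T0; rewrite T0 inE in iT.
have [[j [jT ji sj]]|no] := pselect (exists j, [/\ j \in T, j != i & spans (T :\ j)]); last first.
  by exists T; split=> // j jT ji sj; apply: no; exists j.
have [||T' [h1 h2 h3 h4]] := IH (T :\ j) _ sj.
- by rewrite (cardsD1 j) jT in Tk.
- by rewrite !inE eq_sym ji.
by exists T'; split=> //; apply: fintype.subset_trans h1 _; exact: finset.subsetDl.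
Qed.

Lemma superset_card T k : (#|T| <= k)%N -> (k <= N)%N -> exists2 Y : {set 'I_N}, T \subset Y & #|Y| = k.
Proof.
move=> Tk kN; elim: k kN Tk => [|k IH] kN Tk.
  by exists T => //; apply/eqP; rewrite -leqn0.
have [Tk1|] := leqP #|T| k; last first.
  by move=> kT; exists T => //; apply/eqP; rewrite eqn_leq Tk.
have [Y TY Yk] := IH (ltnW kN) Tk1.
have [j jY] : exists j, j \notin Y.
  apply: contrapT => /forallNP no; have : (N <= #|Y|)%N; last by rewrite Yk leqNgt kN.
  rewrite -{1}(card_ord N) -cardsT; apply: subset_leq_card; apply/fintype.subsetP => j _.
  by have /negP := no j; rewrite negbK.
exists (j |: Y); last by rewrite cardsU1 jY Yk.
by apply: fintype.subset_trans TY _; exact: finset.subsetUr.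
Qed.
End TwoSets.

Section TwoSets2.
Variables (R : realFieldType) (n d : nat) (W : 'M[R]_(d, n.+1 + n.+1)).
Local Notation N := (n.+1 + n.+1)%N.
Hypothesis Wf : row_free W.
Local Notation lam x j := ((x *m W) 0 j).

(** If the class of [i] has at most [n+1] elements then at least two sets of
    [n+2] coordinates containing [i] and [k] determine everything. *)
Lemma two_sets (i k : 'I_N) : (0 < n)%N -> (d <= n.+1)%N -> (exists x : 'rV[R]_d, forall j, lam x j = 1) -> i != k ->
  (forall x : 'rV[R]_d, lam x i = lam x k) ->
  (#|[set j | `[< forall x : 'rV[R]_d, lam x j = lam x i >]]%SET| <= n.+1)%N ->
  exists Y1 Y2 : {set 'I_N}, [/\ Y1 != Y2, spans W Y1 /\ spans W Y2, #|Y1| = n.+2 /\ #|Y2| = n.+2,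
    i \in Y1 /\ i \in Y2 & k \in Y1 /\ k \in Y2].
Proof.
move=> n0 dn [x1 hx1] ik eik; set S := [set j | _]%SET => Sn.
have [T [_ sT iT Tmin]] := minimal_spanning (spansT Wf) (finset.in_setT i).
have outS j : j \in T -> j != i -> j \notin S.
  move=> jT ji; rewrite inE; apply/asboolPn => e; apply: (Tmin j jT ji) => x xT.
  apply: sT => l lT; have [->|lj] := eqVneq l j; last by apply: xT; rewrite !inE lj.
  by rewrite e; apply: xT; rewrite !inE eq_sym ji.
have iS : i \in S by rewrite inE; apply/asboolP.
have kS : k \in S by rewrite inE; apply/asboolP.
have kT : k \notin T by apply/negP => /outS; rewrite eq_sym ik => /(_ isT); rewrite kS.
have lamD (x y : 'rV[R]_d) j : lam (x + y) j = lam x j + lam y j by rewrite mulmxDl [LHS]mxE.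
have lamZ (c : R) (x : 'rV[R]_d) j : lam (c *: x) j = c * lam x j by rewrite -scalemxAl [LHS]mxE.
have lamN (x : 'rV[R]_d) j : lam (- x) j = - lam x j by rewrite mulNmx [LHS]mxE.
have lam_sum (A : {set 'I_N}) (F : 'I_N -> 'rV[R]_d) j : lam (\sum_(t in A) F t) j = \sum_(t in A) lam (F t) j.
  by rewrite mulmx_suml summxE.
have dual' (P : pred 'I_N) : (forall j, P j -> j \in T /\ ~ spans W (T :\ j)) -> exists x : 'I_N -> 'rV[R]_d,
    forall j, P j -> lam (x j) j = 1 /\ forall l, l \in T :\ j -> lam (x j) l = 0.
  move=> H; have /choice [f Hf] : forall j, exists x : 'rV[R]_d, P j -> lam x j = 1 /\ forall l, l \in T :\ j -> lam x l = 0.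
    move=> j; case Pj : (P j); last by exists 0.
    by have [jT js] := H j Pj; have [x h1 h2] := dual_vec sT js; exists x.
  by exists f.
have Tall j : j \in T -> ~ spans W (T :\ j).
  have [->|ji] := eqVneq j i; last by move=> jT; exact: Tmin.
  move=> _ si; have [|x Hx] := dual' (fun t => t \in T :\ i).
    by move=> t; rewrite !inE => /andP[ti tT]; split=> //; exact: Tmin.
  have y0 : x1 - \sum_(t in T :\ i) x t = 0.
    apply: si => l lT; rewrite lamD lamN lam_sum (bigD1 l)//= big1 => [|t /andP[tT tl]].
      by have [-> _] := Hx l lT; rewrite hx1 addr0 subrr.
    by have [_ h] := Hx t tT; apply: h; rewrite !inE eq_sym tl; move: lT; rewrite !inE => /andP[].
  have := hx1 i; rewrite -[x1](subrK (\sum_(t in T :\ i) x t)) y0 add0r lam_sum big1 => [/esym/eqP|t tT].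
    by rewrite oner_eq0.
  have [_ h] := Hx t tT; apply: h; rewrite !inE iT andbT eq_sym; by move: tT; rewrite !inE => /andP[].
have Td : (#|T| <= d)%N by apply: (indep_card (fintype.subxx T) sT).
have Tn : (#|T| <= n.+1)%N by apply: leq_trans dn.
pose T1 := k |: T.
have TT1 : T \subset T1 by exact: finset.subsetUr.
have iT1 : i \in T1 by rewrite !inE iT orbT.
have kT1 : k \in T1 by rewrite !inE eqxx.
have T1c : #|T1| = #|T|.+1 by rewrite cardsU1 kT.
have [lt|gt] := ltnP #|T1| n.+2.
  have [Y1 TY1 Y1n] := @superset_card N T1 n.+2 (ltnW lt) ltac:(by clear; lia).
  have [j jY jT] : exists2 j, j \in Y1 & j \notin T1.
    apply/subsetPn; apply/negP => /subset_leq_card; rewrite Y1n; by rewrite leqNgt lt.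
  have [j' j'Y] : exists j', j' \notin Y1.
    apply: contrapT => /forallNP no; have : (N <= #|Y1|)%N.
      rewrite -{1}(card_ord N) -cardsT; apply: subset_leq_card; apply/fintype.subsetP => l _.
      by have /negP := no l; rewrite negbK.
    by rewrite Y1n; clear -n0; lia.
  have T1Y2 : T1 \subset j' |: (Y1 :\ j).
    apply/fintype.subsetP => l lT; rewrite !inE (fintype.subsetP TY1 l lT) andbT.
    by apply/orP; right; apply: contraNneq jT => <-.
  exists Y1, (j' |: (Y1 :\ j)); split.
  - by apply: contraNneq j'Y => ->; rewrite !inE eqxx.
  - by split; apply: spansS sT; apply: fintype.subset_trans TT1 _.
  - split=> //; rewrite cardsU1 !inE (negPf j'Y) andbF /=.
    by move: Y1n; rewrite (cardsD1 j) jY.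
  - by split; [exact: (fintype.subsetP TY1)|exact: (fintype.subsetP T1Y2)].
  - by split; [exact: (fintype.subsetP TY1)|exact: (fintype.subsetP T1Y2)].
have Tn1 : #|T| = n.+1 by apply/eqP; rewrite eqn_leq Tn -ltnS -T1c.
have [x Hx] := dual' (fun t => t \in T) (fun j jT => conj jT (Tall j jT)).
have [u uS uT] : exists2 u, u \notin S & u \notin T.
  have : (#|S :|: T| < N)%N.
    have := cardsUI S T; have : (0 < #|S :&: T|)%N by apply/card_gt0P; exists i; rewrite finset.in_setI iS iT.
    rewrite Tn1; move: #|S :|: T| #|S :&: T| => p q q0 E.
    clear -q0 E Sn; lia.
  rewrite ltnNge => /negP h; apply: contrapT => /forall2NP no; apply: h.
  rewrite -{1}(card_ord N) -cardsT; apply: subset_leq_card; apply/fintype.subsetP => l _.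
  by rewrite finset.in_setU; case: (no l) => /negP; rewrite negbK => ->; rewrite ?orbT.
have [t [tT ti ux]] : exists t, [/\ t \in T, t != i & lam (x t) u != 0].
  apply: contrapT => /forallNP no; move/negP: uS; apply; rewrite inE; apply/asboolP => y.
  have E (z : 'rV[R]_d) : z = \sum_(t in T) lam z t *: x t.
    apply/eqP; rewrite -subr_eq0; apply/eqP; apply: sT => l lT.
    rewrite lamD lamN lam_sum (bigD1 l)//= big1 => [|t /andP[tT tl]].
      by rewrite lamZ; have [-> _] := Hx l lT; rewrite mulr1 addr0 subrr.
    by rewrite lamZ; have [_ ->] := Hx t tT; rewrite ?mulr0// !inE eq_sym tl lT.
  have Eu (z : 'rV[R]_d) : lam z u = lam z i * lam (x i) u.
    transitivity (lam (\sum_(t in T) lam z t *: x t) u); first exact: (congr1 (fun v : 'rV[R]_d => (v *m W) 0 u) (E z)).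
    rewrite lam_sum (bigD1 i)//= big1 => [|t /andP[tT ti]]; first by rewrite lamZ addr0.
    rewrite lamZ; have [->|h] := eqVneq (lam (x t) u) 0; first by rewrite mulr0.
    by case: (no t).
  by rewrite Eu; have := Eu x1; rewrite !hx1 mul1r => <-; rewrite mulr1.
have uk : u != k by apply: contraNneq uS => ->.
have ut : u != t by apply: contraNneq uT => ->.
have kt : k != t by apply: contraNneq kT => ->.
exists T1, (u |: (T1 :\ t)); split.
- have uT1 : u \notin T1 by rewrite !inE negb_or uk.
  by apply: contraNneq uT1 => ->; rewrite !inE eqxx.
- split; first exact: spansS sT.
  apply: (@spansS _ _ _ _ (u |: (T :\ t))).
    by apply: finset.setUS; apply: finset.setSD.
  move=> y yT; have E : y = lam y t *: x t.
    apply/eqP; rewrite -subr_eq0; apply/eqP; apply: sT => l lT; rewrite lamD lamN lamZ.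
    have [->|lt] := eqVneq l t; first by have [-> _] := Hx t tT; rewrite mulr1 subrr.
    have [_ ->] := Hx t tT; last by rewrite !inE lt.
    by rewrite mulr0 subr0; apply: yT; rewrite !inE lt lT orbT.
  have := yT u; rewrite !inE eqxx /= => /(_ isT); rewrite E lamZ => /eqP.
  by rewrite mulf_eq0 (negPf ux) orbF => /eqP ->; rewrite scale0r.
- split; first by rewrite T1c Tn1.
  have uY : u \notin T1 :\ t by rewrite !inE negb_and negb_or uk uT orbT.
  have tT1 : t \in T1 by rewrite !inE tT orbT.
  rewrite (cardsU1 u) uY; have := cardsD1 t T1; rewrite tT1 T1c Tn1; move: #|T1 :\ t| => q; clear; lia.
- by split=> //; rewrite !inE [i == t]eq_sym (negPf ti) iT !orbT.
- by split=> //; rewrite !inE kt eqxx orbT.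
Qed.
End TwoSets2.

(** * Linear forms in general position *)

Section Eta.
Variables (R : realFieldType) (N d n : nat) (W : 'M[R]_(d, N)).
Implicit Types (A J M U : {set 'I_N}) (x : 'rV[R]_d).
Local Notation lam x j := ((x *m W) 0 j).

Definition colsel (A : {set 'I_N}) : 'M[R]_(N, d) := \matrix_(j, k) (if j \in A then W k j else 0).

Lemma row_colsel A j : j \in A -> row j (colsel A) = row j W^T.
Proof. by move=> jA; apply/rowP => k; rewrite !mxE jA. Qed.

Lemma colsel_rank A : (\rank (colsel A) <= #|A|)%N.
Proof.
have : (colsel A <= rowsub (fun r : 'I_#|A| => enum_val r) (colsel A))%MS.
  apply/row_subP => j; have [jA|jA] := boolP (j \in A).
    have -> : row j (colsel A) = row (enum_rank_in jA j) (rowsub (fun r : 'I_#|A| => enum_val r) (colsel A)).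
      by apply/rowP => k; rewrite !mxE enum_rankK_in.
    exact: row_sub.
  have -> : row j (colsel A) = 0 by apply/rowP => k; rewrite !mxE (negPf jA).
  exact: sub0mx.
by move/mxrankS/leq_trans; apply; exact: rank_leq_row.
Qed.

Lemma spans_rank A : spans W A -> \rank (colsel A) = d.
Proof.
move=> sA; apply/eqP; rewrite -mxrank_tr; apply: inj_row_free => x xA; apply: sA => j jA.
have /rowP /(_ j) := xA; rewrite !mxE => E; rewrite -[RHS]E; apply: eq_bigr => k _.
by rewrite !mxE jA.
Qed.

(** If fewer functionals than [#|J :\: M|] are lost, then some combination of
    the coordinates in [J :\: M] is controlled by those outside [J :|: M]. *)
Lemma eta_lemma J M U : spans W (~: J) ->
  (forall j, j \in ~: J -> j \notin U -> (row j W^T <= colsel (~: (J :|: M)) + colsel U)%MS) ->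
  (#|U| < #|J :\: M|)%N ->
  exists eta beta : 'I_N -> R, [/\ exists2 j, j \in J :\: M & eta j != 0,
    forall j, j \notin J :\: M -> eta j = 0, forall j, j \in J :|: M -> beta j = 0 &
    forall x, \sum_j eta j * lam x j = \sum_j beta j * lam x j].
Proof.
move=> sJ HU cU; pose E1 := colsel (~: (J :|: M)).
have r1 : (d <= \rank E1 + #|U|)%N.
  rewrite -[X in (X <= _)%N](spans_rank sJ); apply: leq_trans (mxrankS (_ : colsel (~: J) <= E1 + colsel U)%MS) _.
    apply/row_subP => j; have [jJ|jJ] := boolP (j \in ~: J); last first.
      have -> : row j (colsel (~: J)) = 0 by apply/rowP => k; rewrite !mxE (negPf jJ).
      exact: sub0mx.
    rewrite row_colsel//; have [jU|jU] := boolP (j \in U); last exact: HU.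
    by rewrite -(row_colsel jU); apply: submx_trans (addsmxSr _ _); exact: row_sub.
  by apply: leq_trans (mxrank_adds_leqif _ _) _; rewrite leq_add2l colsel_rank.
pose Q := rowsub (fun r : 'I_#|J :\: M| => enum_val r) (W^T *m cokermx E1).
have rQ : (\rank Q < #|J :\: M|)%N.
  apply: leq_ltn_trans cU; apply: leq_trans (_ : \rank (cokermx E1) <= _)%N.
    by rewrite /Q -mul_rowsub_mx mxrankM_maxr.
  by rewrite mxrank_coker leq_subLR.
have : kermx Q != 0.
  by rewrite kermx_eq0 /row_free; apply/eqP => E; rewrite E ltnn in rQ.
case/rowV0Pn => v /sub_kermxP vQ v0.
pose eta j := if boolP (j \in J :\: M) is AltTrue h then v 0 (enum_rank_in h j) else 0.
have etaE r : eta (enum_val r) = v 0 r.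
  rewrite /eta; case: {-}_ / boolP => [h|]; last by rewrite enum_valP.
  by rewrite enum_valK_in.
have eta0 j : j \notin J :\: M -> eta j = 0.
  by move=> jn; rewrite /eta; case: {-}_ / boolP => // h; rewrite h in jn.
have eS (x : 'rV_d) : \sum_j eta j * lam x j = (v *m rowsub (fun r : 'I_#|J :\: M| => enum_val r) W^T *m x^T) 0 0.
  rewrite (bigID (mem (J :\: M))) /= [X in _ + X]big1 ?addr0 => [|j jn]; last by rewrite eta0// mul0r.
  rewrite big_enum_val /= -mulmxA mxE; apply: eq_bigr => r _; rewrite etaE; congr (_ * _).
  by rewrite !mxE; apply: eq_bigr => k _; rewrite !mxE mulrC.
have : (v *m rowsub (fun r : 'I_#|(J :\: M)%SET| => enum_val r) W^T <= E1)%MS.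
  by rewrite submxE -mulmxA mul_rowsub_mx -/Q vQ.
case/submxP => b bE; pose beta (j : 'I_N) := if j \in J :|: M then 0 else b 0 j.
exists eta, beta; split=> //.
- have [r vr] : exists r, v 0 r != 0.
    apply: contrapT => /forallNP no; case/eqP: v0; apply/rowP => r; rewrite [RHS]mxE; apply/eqP.
    by have /negP := no r; rewrite negbK.
  by exists (enum_val r); [exact: enum_valP|rewrite etaE].
- by move=> j jJ; rewrite /beta jJ.
- move=> x; rewrite eS bE -mulmxA mxE; apply: eq_bigr => j _; rewrite /beta.
  rewrite !mxE; case: ifP => jJ.
    rewrite mul0r big1 ?mulr0// => k _; by rewrite !mxE inE jJ mul0r.
  congr (_ * _); apply: eq_bigr => k _; by rewrite !mxE inE jJ mulrC.
Qed.
End Eta.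

Section Forms.
Variables (K : fieldType) (n : nat) (N : nat) (a : 'M[K]_(N, n.+1)).
Definition fo j (x : 'I_n.+1 -> K) := \sum_l a j l * x l.
(** General position, expressed through common zeros. *)
Definition good := forall T : {set 'I_N}, #|T| = n.+1 -> forall x, (forall j, j \in T -> fo j x = 0) -> forall l, x l = 0.
Hypothesis ga : good.

Lemma good_rank (T : {set 'I_N}) : #|T| = n.+1 ->
  \rank (rowsub (fun r : 'I_#|T| => enum_val r) a) = n.+1.
Proof.
move=> Tn; apply/eqP; rewrite -mxrank_tr; apply: inj_row_free => v vA.
apply/rowP => l; rewrite mxE; apply: (ga Tn (x := fun l => v 0 l)) => j jT.
have /rowP /(_ (enum_rank_in jT j)) := vA; rewrite !mxE => E; rewrite -[RHS]E; apply: eq_bigr => k _.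
by rewrite !mxE enum_rankK_in// mulrC.
Qed.

Lemma good_expand (T : {set 'I_N}) j : #|T| = n.+1 ->
  exists beta : 'I_N -> K, forall x, fo j x = \sum_(t in T) beta t * fo t x.
Proof.
move=> Tn; have rf : row_full (rowsub (fun r : 'I_#|T| => enum_val r) a) by rewrite /row_full good_rank.
have /submxP [u uE] := submx_full (row j a) rf.
have [t0 t0T] : exists t, t \in T by apply/card_gt0P; rewrite Tn.
exists (fun t => u 0 (enum_rank_in t0T t)) => x; rewrite big_enum_val /=.
transitivity (\sum_l (u *m rowsub (fun r : 'I_#|T| => enum_val r) a) 0 l * x l).
  by rewrite -uE; apply: eq_bigr => l _; rewrite mxE.
under [LHS]eq_bigr => l _ do rewrite mxE mulr_suml.
rewrite exchange_big /=; apply: eq_bigr => r _; rewrite enum_valK_in /fo mulr_sumr.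
by apply: eq_bigr => l _; rewrite !mxE mulrA.
Qed.

Lemma good_solve (T : {set 'I_N}) : #|T| = n.+1 ->
  exists B : 'I_n.+1 -> 'I_N -> K, forall (g : 'I_N -> K) j, j \in T -> fo j (fun l => \sum_(t in T) B l t * g t) = g j.
Proof.
move=> Tn; have rf : row_free (rowsub (fun r : 'I_#|T| => enum_val r) a) by rewrite /row_free good_rank// Tn.
have [B BE] := row_freeP rf.
have [t0 t0T] : exists t, t \in T by apply/card_gt0P; rewrite Tn.
exists (fun l t => B l (enum_rank_in t0T t)) => g j jT.
transitivity (\sum_(s < #|T|) (1%:M : 'M[K]_#|T|) (enum_rank_in jT j) s * g (enum_val s)).
  rewrite -BE; under [RHS]eq_bigr => s _ do rewrite mxE mulr_suml.
  rewrite exchange_big /=; apply: eq_bigr => l _; rewrite big_enum_val /= mulr_sumr.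
  by apply: eq_bigr => s _; rewrite enum_valK_in !mxE enum_rankK_in// mulrA.
rewrite (bigD1 (enum_rank_in jT j))//= big1 => [|s sj]; last by rewrite mxE eq_sym (negPf sj) mul0r.
by rewrite mxE eqxx mul1r addr0 enum_rankK_in.
Qed.
End Forms.

(** * Generic families of linear forms *)

Section GenericDefs.
Variables (K : fieldType) (n : nat).

(** Geometrically, [al] is the ratio of the forms [i] and [k] at the common zero of
    the forms in [T]. *)
Definition expands (N : nat) (a : 'M[K]_(N, n.+1)) (T : {set 'I_N}) i k al :=
  exists b : 'I_N -> K, forall x, fo a i x = al * fo a k x + \sum_(t in T) b t * fo a t x.

Local Notation N := (n.+1 + n.+1)%N.

(** The numbers [al], [al'], [be], [be'] are ratios of minors, and the equation
    between them is an identity in the matrix only when the products of minors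
    match up; as [J] differs from [J'] this leaves the case in the conclusion. *)
Definition generic_ratios (a : 'M[K]_(N, n.+1)) := forall (J J' U U' : {set 'I_N}) i k al al' be be',
  [/\ #|J| = n, #|J'| = n, #|U| = n & #|U'| = n] ->
  [/\ i \notin J, i \notin J', i \notin U & i \notin U'] ->
  [/\ k \notin J, k \notin J', k \notin U & k \notin U'] ->
  i != k -> J != J' -> expands a U i k al -> expands a J i k al' -> expands a U' i k be ->
  expands a J' i k be' -> al * be' = be * al' -> U = J /\ U' = J'.

(** The determinant of the relation between the two maps when some rows have lost
    one of their blocks. *)
Definition generic_blocks (a : 'M[K]_(N, n.+1)) := forall P Q : {set 'I_N}, P :&: Q = finset.set0 ->
  (#|P| <= n.+1)%N -> (#|Q| <= n.+1)%N -> (n.+1 <= #|P :|: Q|)%N ->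
  mdet a (fun i => if i \in Q then 0 else 1) (fun i => if i \in P then 0 else 1) != 0.
End GenericDefs.

Lemma subset_card (N : nat) (U : {set 'I_N}) q : (q <= #|U|)%N -> exists2 T : {set 'I_N}, T \subset U & #|T| = q.
Proof.
move=> qU; have cU := cardsC U; rewrite card_ord in cU.
have [|Y UY Yq] := @superset_card N (~: U) (N - q) _ (leq_subr _ _).
  by rewrite leq_subRL; lia.
exists (~: Y); first by rewrite finset.subCset.
have := cardsC Y; rewrite card_ord Yq; lia.
Qed.

(** * Degeneration of the parameter *)

Section Rho.
Variables (R : realType) (n d p : nat).
Local Notation C := R[i].
Local Notation N := (n.+1 + n.+1)%N.
Variables (a : 'M[C]_(N, n.+1)) (W : 'M[R]_(d, N)) (M : 'I_p -> 'I_N -> int) (h0 : 'I_N -> C).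
Local Notation lam x j := ((x *m W) 0 j).
Local Notation fm := (fo a).
Hypothesis ga : good a.
Hypothesis h00 : forall j, h0 j != 0.
Hypothesis Msum : forall r, \sum_j M r j = 0.
Hypothesis LW : forall l : 'I_N -> R, (forall r, \sum_j (M r j)%:~R * l j = 0) ->
  exists x : 'rV[R]_d, forall j, l j = lam x j.

Lemma C_infinite (s : seq C) : exists c, c \notin s.
Proof.
pose t := [seq (k%:R : C) | k <- iota 0 (size s).+1].
have ut : uniq t by rewrite map_inj_uniq ?iota_uniq// => x y /eqP; rewrite eqr_nat => /eqP.
have : ~~ all (mem s) t.
  apply/negP => /allP h; have := uniq_leq_size ut h; by rewrite size_map size_iota ltnn.
by move=> /allPn [c _ cs]; exists c.
Qed.

Lemma circle_infinite (r : R) : 0 < r -> forall s : seq C, exists2 c, nm c = r & c \notin s.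
Proof.
move=> r0 s; pose u (k : nat) : C := let t : R := k%:R in (1 + 'i%C * t%:C) / (1 - 'i%C * t%:C).
have den (k : nat) : (1 - 'i%C * (k%:R : R)%:C : C) != 0.
  rewrite -nm_gt0; apply: lt_le_trans (Re_le_nm _); rewrite ReD ReN ReM /= .
  by rewrite !mul0r !mul1r subrr subr0 ltr01.
have nu k : nm (u k) = 1.
  rewrite /u nmM nmV; have -> : nm (1 + 'i%C * (k%:R : R)%:C) = nm (1 - 'i%C * (k%:R : R)%:C).
    rewrite -nmJ; congr nm; apply: eqC; rewrite ?ReD ?ImD ?ReN ?ImN ?ReM ?ImM /=; ring.
  by rewrite divff// nm_eq0.
have inju : injective (fun k => r%:C * u k).
  move=> k l /(mulfI (_ : r%:C != 0)) E; have {E} : u k = u l.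
    by apply: E; rewrite -nm_gt0 nmC_ge0// ltW.
  rewrite /u => /eqP; rewrite eqr_div ?den// => /eqP E.
  have E2 : 'i%C * ((k%:R : R)%:C - (l%:R : R)%:C) = 0 :> C.
    apply: (mulfI (_ : 2%:R != 0 :> C)); first by rewrite pnatr_eq0.
    rewrite mulr0; move/eqP: E; rewrite -subr_eq0 => /eqP <-.
    by move: (k%:R%:C) (l%:R%:C) => x y; ring.
  move/eqP: E2; rewrite mulf_eq0 => /orP[/eqP i0|].
    by have := @sqr_i R; rewrite i0 expr0n /= => /eqP; rewrite eq_sym oppr_eq0 oner_eq0.
  by rewrite subr_eq0 => /eqP /(congr1 (@complex.Re R)) /= /eqP; rewrite eqr_nat => /eqP.
pose t := [seq r%:C * u k | k <- iota 0 (size s).+1].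
have ut : uniq t by rewrite (map_inj_uniq inju) iota_uniq.
have : ~~ all (mem s) t.
  apply/negP => /allP h; have := uniq_leq_size ut h; by rewrite size_map size_iota ltnn.
by move=> /allPn [c /mapP [k _ ->] cs]; exists (r%:C * u k); rewrite // nmM nu mulr1 nmC_ge0// ltW.
Qed.

(** There are only finitely many bases to expand in. *)
Lemma form_bound : exists2 B : R, 1 <= B & forall (T : {set 'I_N}) j x (e : R), #|T| = n.+1 ->
  0 <= e -> (forall t, t \in T -> nm (fm t x) <= e) -> nm (fm j x) <= B * e.
Proof.
have /choice [b Hb] : forall Tj : {set 'I_N} * 'I_N, exists b : 'I_N -> C, #|Tj.1| = n.+1 ->
    forall x, fm Tj.2 x = \sum_(t in Tj.1) b t * fm t x.
  move=> [T j] /=; have [Tn|Tn] := eqVneq #|T| n.+1; last by exists (fun=> 0) => E; rewrite E eqxx in Tn.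
  by have [b Hb] := good_expand ga j Tn; exists b.
exists (1 + \sum_Tj \sum_t nm (b Tj t)) => [|T j x e Tn e0 H].
  by rewrite lerDl; apply: sumr_ge0 => Tj _; apply: sumr_ge0.
rewrite (Hb (T, j) Tn) /=; apply: le_trans (nm_sum _ _ _) _.
apply: le_trans (_ : \sum_(t in T) nm (b (T, j) t) * e <= _).
  by apply: ler_sum => t tT; rewrite nmM ler_wpM2l// H.
rewrite -mulr_suml ler_wpM2r//; apply: le_trans (_ : \sum_t nm (b (T, j) t) <= _).
  by rewrite [leRHS](bigID (mem T)) /= lerDl sumr_ge0.
rewrite [X in _ <= 1 + X](bigD1 (T, j))//= addrCA lerDl addr_ge0// ?sumr_ge0// => Tj _.
exact: sumr_ge0.
Qed.

Lemma norm_sum_le (I : finType) (f g : I -> R) (k : R) : (forall i, f i != 0 -> `|g i| <= k) ->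
  `|\sum_i f i * g i| <= (\sum_i `|f i|) * k.
Proof.
move=> H; apply: le_trans (ler_norm_sum _ _ _) _; rewrite mulr_suml; apply: ler_sum => i _.
rewrite normrM; have [->|fi] := eqVneq (f i) 0; first by rewrite normr0 !mul0r.
by rewrite ler_wpM2l// H.
Qed.

Local Notation expands := (expands a).

Lemma expands_ex (T : {set 'I_N}) i k : #|T| = n -> k \notin T -> exists al, expands T i k al.
Proof.
move=> Tn kT; have Tk : #|k |: T| = n.+1 by rewrite cardsU1 kT Tn.
have [b Hb] := good_expand ga i Tk; exists (b k), b => x.
by rewrite Hb big_setU1.
Qed.

Lemma expands_bound (T : {set 'I_N}) i k al : expands T i k al -> exists2 B : R, 0 <= B &
  forall x (e : R), 0 <= e -> (forall t, t \in T -> nm (fm t x) <= e) -> nm (fm i x - al * fm k x) <= B * e.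
Proof.
move=> [b Hb]; exists (\sum_(t in T) nm (b t)) => [|x e e0 H]; first exact: sumr_ge0.
rewrite Hb addrAC subrr add0r; apply: le_trans (nm_sum _ _ _) _; rewrite mulr_suml.
by apply: ler_sum => t tT; rewrite nmM ler_wpM2l// H.
Qed.

Variables (J : {set 'I_N}) (i k : 'I_N) (c : C) (D : ('I_n.+1 -> C) -> C).
Hypotheses (Jn : #|J| = n) (iJ : i \notin J) (kJ : k \notin J) (ik : i != k).
Hypothesis eik : forall x : 'rV[R]_d, lam x i = lam x k.
Hypothesis sJ : spans W (~: J).
Hypotheses (DP : PF D) (D0 : exists x, D x != 0).
Hypothesis sol : forall x, D x != 0 -> (forall j, fm j x != 0) -> exists y, [/\ forall j, fm j y != 0,
  forall r, \prod_j (fm j y / fm j x) ^ M r j = \prod_j h0 j ^ M r j & fm i y * fm k x = c * (fm k y * fm i x)].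

Definition bad (U : {set 'I_N}) := (#|U| < n)%N || (#|U| == n) && ((i \in U) || (k \in U)).

(** A dimension count: as the coordinates [i] and [k] agree, the coordinates in [U]
    outside [J] contribute fewer functionals than [J :\: U] has elements. *)
Lemma eta_bad U : bad U -> exists eb : ('I_N -> R) * ('I_N -> R), [/\ exists2 j, j \in J :\: U & eb.1 j != 0,
    forall j, j \notin J :\: U -> eb.1 j = 0, forall j, j \in J :|: U -> eb.2 j = 0 &
    forall x : 'rV[R]_d, \sum_j eb.1 j * lam x j = \sum_j eb.2 j * lam x j].
Proof.
move=> bU.
have rik : row i W^T = row k W^T.
  apply/rowP => l; rewrite !mxE; have := eik (delta_mx 0 l).
  by rewrite -rowE !mxE.
have cJ := cardsID U J; have cU := cardsID J U; rewrite Jn in cJ.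
have cI : #|U :&: J| = #|J :&: U| by rewrite finset.setIC.
pose V := if i \in U then (U :\: J) :\ i else (if k \in U then (U :\: J) :\ k else U :\: J).
have Vn : (#|V| < #|J :\: U|)%N.
  have h1 : (#|U :\: J| < #|J :\: U|)%N \/ (i \in U \/ k \in U) /\ #|U| = n.
    by move: bU => /orP[h|/andP[/eqP h1 /orP h2]]; [left; lia|right].
  have di : i \in U -> #|U :\: J| = #|(U :\: J) :\ i|.+1.
    by move=> iU; rewrite (cardsD1 i (U :\: J)) !inE iJ iU.
  have dk : k \in U -> #|U :\: J| = #|(U :\: J) :\ k|.+1.
    by move=> kU; rewrite (cardsD1 k (U :\: J)) !inE kJ kU.
  rewrite /V; case: ifP => iU; first by have := di iU; case: h1; lia.
  case: ifP => kU; first by have := dk kU; case: h1; lia.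
  by case: h1 => // -[[]]; rewrite ?iU ?kU.
have [|eta [beta H]] := eta_lemma sJ _ Vn; last by exists (eta, beta).
have inE1 j : j \notin J -> j \notin U -> (row j W^T <= colsel W (~: (J :|: U)) + colsel W V)%MS.
  move=> jJ jU; apply: submx_trans (addsmxSl _ _).
  by rewrite -(@row_colsel _ _ _ W (~: (J :|: U))) ?row_sub// !inE negb_or jJ.
have inV j : j \in V -> (row j W^T <= colsel W (~: (J :|: U)) + colsel W V)%MS.
  by move=> jV; apply: submx_trans (addsmxSr _ _); rewrite -(row_colsel W jV) row_sub.
move=> j; rewrite inE => jJ jV; have [jU|jU] := boolP (j \in U); last exact: inE1.
have jV' := jV; rewrite /V in jV'; move: jV'; case iU : (i \in U).
  rewrite !inE jJ jU !andbT negbK => /eqP ->; rewrite rik.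
  have [kU|kU] := boolP (k \in U); last exact: inE1.
  by apply: inV; rewrite /V iU !inE eq_sym ik kJ kU.
case kU : (k \in U); last by rewrite !inE jJ jU.
by rewrite !inE jJ jU !andbT negbK => /eqP ->; rewrite -rik; apply: inE1 => //; rewrite iU.
Qed.

Lemma ln_bound (x lo hi : R) : 0 < lo -> lo <= x -> x <= hi -> `|ln x| <= `|ln lo| + `|ln hi|.
Proof.
move=> l0 lx xh; have x0 : 0 < x by lra.
have h1 : ln lo <= ln x by rewrite ler_ln ?posrE.
have h2 : ln x <= ln hi by rewrite ler_ln ?posrE//; lra.
have := ler_norm (ln hi); have := ler_norm (- ln lo); rewrite normrN.
have := normr_ge0 (ln hi); have := normr_ge0 (ln lo).
by rewrite ler_norml; move=> *; apply/andP; split; lra.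
Qed.

Lemma norm_sub3 (x y z u v w : R) : `|x| <= u -> `|y| <= v -> `|z| <= w -> `|x - y - z| <= u + v + w.
Proof.
by rewrite !ler_norml => /andP[? ?] /andP[? ?] /andP[? ?]; apply/andP; split; lra.
Qed.

Lemma norm_between (x y e : R) : x <= y -> e + y <= x -> `|x - y| <= `|e|.
Proof.
move=> h1 h2; have := ler_norm (- e); rewrite normrN => h3; have := normr_ge0 e => h4.
by rewrite ler_norml; apply/andP; split; lra.
Qed.

Lemma ln_prod_exp (f : 'I_N -> C) r : (forall j, f j != 0) ->
  ln (nm (\prod_j f j ^ M r j)) = \sum_j (M r j)%:~R * ln (nm (f j)).
Proof.
move=> f0; have nmz (z : C) (m : int) : nm (z ^ m) = nm z ^ m.
  by case: m => m; rewrite -?pmulrn ?NegzE -?exprnN /= ?nmX// /exprz /= nmV nmX.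
rewrite nm_prod; elim: (index_enum _) => [|j s IH]; first by rewrite !big_nil ln1.
rewrite !big_cons lnM ?posrE; last first.
- by apply: prodr_gt0 => l _; rewrite nm_gt0 expfz_neq0.
- by rewrite nm_gt0 expfz_neq0.
rewrite IH; congr (_ + _); rewrite nmz; have p0 : 0 < nm (f j) by rewrite nm_gt0.
case: (M r j) => m; first by rewrite -exprnP lnXn// -mulr_natl.
by rewrite NegzE -exprnN lnV ?posrE ?exprn_gt0// lnXn// mulrNz mulNr -mulr_natl.
Qed.

Lemma PF_subst (k' : nat) (P : ('I_n.+1 -> C) -> C) (B : 'I_n.+1 -> 'I_k' -> C) (T : {set 'I_k'}) : PF P ->
  PF (fun g => P (fun l => \sum_(t in T) B l t * g t)).
Proof.
elim=> [c'|l|P1 P2 _ H1 _ H2|P1 P2 _ H1 _ H2]; [exact: PF_cst| |exact: PF_add|exact: PF_mul].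
have : forall s : seq 'I_k', PF (fun g : 'I_k' -> C => \sum_(t <- s | t \in T) B l t * g t).
  elim=> [|t s IH].
    by have := PF_cst k' (0 : C); congr PF; apply/funext => g; rewrite big_nil.
  case tT : (t \in T).
    have := PF_add (PF_mul (PF_cst k' (B l t)) (PF_var _ t)) IH; congr PF; apply/funext => g.
    by rewrite big_cons tT.
  by move: IH; congr PF; apply/funext => g; rewrite big_cons tT.
exact.
Qed.

Lemma PF_prod (k' : nat) (I : Type) (s : seq I) (P : I -> ('I_k' -> C) -> C) : (forall u, PF (P u)) ->
  (forall u, exists x, P u x != 0) ->
  PF (fun x => \prod_(u <- s) P u x) /\ exists x, \prod_(u <- s) P u x != 0.
Proof.
move=> PP P0; elim: s => [|u s [IH1 IH2]].
  split; last by exists (fun=> 0); rewrite big_nil oner_neq0.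
  by have := PF_cst k' (1 : C); congr PF; apply/funext => g; rewrite big_nil.
split; first by have := PF_mul (PP u) IH1; congr PF; apply/funext => g; rewrite big_cons.
have [x hx] := PF_neq0M C_infinite (PP u) IH1 (P0 u) IH2.
by exists x; rewrite big_cons.
Qed.

(** Such a vector prescribes rates of decay that satisfy none of finitely many
    linear conditions. *)
Lemma generic_weight (I : finType) (eta : I -> 'I_N -> R) : (forall u, exists j, eta u j != 0) ->
  exists2 w : 'I_N -> R, (forall j, 1 <= w j) & forall u, \sum_j eta u j * w j != 0.
Proof.
move=> eta0; pose P u (x : 'I_N -> C) := \sum_(t in [set: 'I_N]%SET) (eta u t)%:C * x t.
have PP u : PF (P u).
  have : forall s : seq 'I_N, PF (fun g : 'I_N -> C => \sum_(t <- s | t \in [set: 'I_N]%SET) (eta u t)%:C * g t).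
    elim=> [|t s IH].
      by have := PF_cst N (0 : C); congr PF; apply/funext => g; rewrite big_nil.
    have := PF_add (PF_mul (PF_cst N ((eta u t)%:C : C)) (PF_var _ t)) IH; congr PF; apply/funext => g.
    by rewrite big_cons finset.in_setT.
  exact.
have P0 u : exists x, P u x != 0.
  have [j ej] := eta0 u; exists (fun t => (t == j)%:R); rewrite /P (bigD1 j) ?finset.in_setT//= eqxx mulr1.
  rewrite big1 => [|t /andP[_ /negPf ->]]; last by rewrite mulr0.
  by rewrite addr0 -nm_gt0 nmR normr_gt0.
have [PPF PP0] := PF_prod (index_enum I) PP P0.
have inf j (s : seq C) : exists2 c, (fun (_ : 'I_N) c => exists2 r : R, 1 <= r & c = r%:C) j c & c \notin s.
  pose t := [seq (k%:R : C) | k <- iota 1 (size s).+1].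
  have ut : uniq t by rewrite map_inj_uniq ?iota_uniq// => x y /eqP; rewrite eqr_nat => /eqP.
  have : ~~ all (mem s) t.
    apply/negP => /allP h; have := uniq_leq_size ut h; by rewrite size_map size_iota ltnn.
  move=> /allPn [_ /mapP [q + ->] cs]; rewrite mem_iota => /andP[q1 _]; exists (q%:R) => //.
  by exists q%:R; [rewrite ler1n|rewrite rmorph_nat].
have [x xA Px] := PF_torus PPF inf PP0.
have /choice [w Hw] : forall j, exists r : R, 1 <= r /\ x j = r%:C by move=> j; have [r r1 rE] := xA j; exists r.
exists w => [j|u]; first by case: (Hw j).
move: Px => /prodf_neq0 /(_ u isT); apply: contraNneq => E.
rewrite /P (eq_bigr (fun t => (eta u t * w t)%:C)) => [|t _]; last by have [_ ->] := Hw t; rewrite rmorphM.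
rewrite -rmorph_sum (eq_bigl predT) => [|t]; last by rewrite finset.in_setT.
by rewrite E.
Qed.

(** Let the parameter approach the point where the forms in [J] vanish, the
    forms tending to zero at generic rates.  Comparing growth rates shows that
    exactly [n] forms of the solution tend to zero, and neither of the forms
    [i], [k]. *)
Theorem degeneration : exists (U : {set 'I_N}) (al al' : C), [/\ #|U| = n, i \notin U, k \notin U, expands U i k al &
  expands J i k al' /\ al = c * al'].
Proof.
apply: contrapT => no.
have [B B1 HB] := form_bound.
have [al' Hal'] := expands_ex i Jn kJ; have [B' B'0 HB'] := expands_bound Hal'.
have /choice [aB HaB] : forall U : {set 'I_N}, exists aB : C * R, 0 <= aB.2 /\ (#|U| = n -> k \notin U ->
    expands U i k aB.1 /\ forall x (e : R), 0 <= e -> (forall t, t \in U -> nm (fm t x) <= e) ->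
      nm (fm i x - aB.1 * fm k x) <= aB.2 * e).
  move=> U; have [[Un kU]|h] := pselect (#|U| = n /\ k \notin U); last by exists (0, 0); split=> // h1 h2; case: h.
  by have [al Hal] := expands_ex i Un kU; have [b b0 Hb] := expands_bound Hal; exists (al, b).
pose q (U : {set 'I_N}) := (nm ((aB U).1 - c * al'))^-1.
(* If the conclusion fails, [gam] bounds from below the finitely many numbers
   that would have to vanish. *)
pose gam := (1 + \sum_U q U)^-1.
have q0 (U : {set 'I_N}) : 0 <= q U by rewrite invr_ge0.
have S0 : 0 <= \sum_U q U by exact: sumr_ge0.
have gam0 : 0 < gam by rewrite invr_gt0; lra.
have Hgam (U : {set 'I_N}) : #|U| = n -> i \notin U -> k \notin U -> gam <= nm ((aB U).1 - c * al').
  move=> Un iU kU; have [_ /(_ Un kU) [h1 _]] := HaB U.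
  have p0 : 0 < nm ((aB U).1 - c * al').
    rewrite nm_gt0 subr_eq0; apply/eqP => E; apply: no; exists U, (aB U).1, al'; split=> //.
  rewrite -[leRHS]invrK lef_pV2 ?posrE ?invr_gt0//; last by lra.
  have : q U <= \sum_U q U by rewrite [leRHS](bigD1 U)//= lerDl sumr_ge0.
  by rewrite /q; lra.
pose Bt := \sum_U (aB U).2.
have Bt0 : 0 <= Bt by apply: sumr_ge0 => U _; case: (HaB U).
have HBt (U : {set 'I_N}) : (aB U).2 <= Bt.
  by rewrite /Bt [leRHS](bigD1 U)//= lerDl sumr_ge0// => V _; case: (HaB V).
(* Below [de] times the largest form of the solution a form counts as small.
   The two bounds ensure that at most [n] forms are small, and that [gam] is
   not reached. *)
have [de deE] : exists de, de = Num.min (1 / (2 * B)) (gam / (2 * B * (nm c * B' + Bt + 1))) by eexists.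
have cB0 : 0 <= nm c * B' by rewrite mulr_ge0.
have de0 : 0 < de by rewrite deE lt_min !divr_gt0// ?mulr_gt0//; lra.
have deB : B * de < 1.
  have : de <= 1 / (2 * B) by rewrite deE ge_min lexx.
  by rewrite ler_pdivlMr; lra.
have deg : de * (nm c * B' + Bt) < gam / B.
  have : de <= gam / (2 * B * (nm c * B' + Bt + 1)) by rewrite deE ge_min lexx orbT.
  rewrite ler_pdivlMr ?mulr_gt0//; [|lra|lra] => h; rewrite ltr_pdivlMr; last lra.
  have : 0 <= de * B by rewrite mulr_ge0//; lra.
  have : 0 <= de * (nm c * B' + Bt) * B by rewrite !mulr_ge0//; lra.
  by move: h; move: (nm c * B' + Bt) => z h h1 h2; lra.
pose H := \sum_j `|ln (nm (h0 j))|.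
have HH j : `|ln (nm (h0 j))| <= H by rewrite /H [leRHS](bigD1 j)//= lerDl sumr_ge0.
have [K1 K1E] : exists K1, K1 = `|ln de| + (`|ln B^-1| + `|ln B|) + H by eexists.
have K10 : 0 <= K1 by rewrite K1E !addr_ge0// sumr_ge0.
have /choice [eb Heb] : forall U : {U : {set 'I_N} | `[< bad U >]}, exists eb : ('I_N -> R) * ('I_N -> R),
    [/\ exists2 j, j \in J :\: sval U & eb.1 j != 0,
    forall j, j \notin J :\: sval U -> eb.1 j = 0, forall j, j \in J :|: sval U -> eb.2 j = 0 &
    forall x : 'rV[R]_d, \sum_j eb.1 j * lam x j = \sum_j eb.2 j * lam x j].
  by move=> [U bU]; apply: eta_bad; exact/asboolP.
have [|w0 w01 w0P] := generic_weight (eta := fun U => (eb U).1).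
  by move=> U; have [[j _ h] _ _ _] := Heb U; exists j.
pose nb U := (\sum_j `|(eb U).1 j|) + (\sum_j `|(eb U).2 j|).
have nb0 U : 0 <= nb U by rewrite addr_ge0// sumr_ge0.
pose v U := `|\sum_j (eb U).1 j * w0 j|.
have v0 U : 0 < v U by rewrite normr_gt0.
(* The forms in [J] of the parameter will have modulus [exp (- t w0)]; [t] beats
   the error terms in each of the linear conditions found above. *)
pose t := 1 + `|ln de| + \sum_U nb U * K1 / v U.
have tU U : nb U * K1 < t * v U.
  have : nb U * K1 / v U <= \sum_U nb U * K1 / v U.
    by rewrite [leRHS](bigD1 U)//= lerDl sumr_ge0// => V _; rewrite divr_ge0 ?mulr_ge0// ltW.
  rewrite -ltr_pdivrMr// /t; have := normr_ge0 (ln de); lra.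
have t0 : 0 < t.
  by rewrite /t -addrA ltr_pwDl// addr_ge0// sumr_ge0// => V _; rewrite divr_ge0 ?mulr_ge0// ltW.
have tde : `|ln de| <= t.
  rewrite /t addrAC lerDr addr_ge0// sumr_ge0// => V _; rewrite divr_ge0 ?mulr_ge0// ltW//.
pose rj j := expR (- (t * w0 j)).
have rj0 j : 0 < rj j by exact: expR_gt0.
have rjd j : rj j <= de.
  rewrite -[leRHS]lnK ?posrE// ler_expR.
  have : t <= t * w0 j by rewrite ler_peMr// ltW.
  by have := ler_norm (- ln de); rewrite normrN; lra.
pose T := k |: J.
have Tn : #|T| = n.+1 by rewrite cardsU1 kJ Jn.
have [Bs HBs] := good_solve ga Tn.
have DsP := PF_subst Bs T DP.
have Ds0 : exists g : 'I_N -> C, D (fun l => \sum_(t in T) Bs l t * g t) != 0.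
  have [x Dx] := D0; exists (fun t => fm t x); congr (D _ != 0): Dx; apply/funext => l.
  pose z l := x l - \sum_(t in T) Bs l t * fm t x.
  have := ga Tn (x := z) => Hz; apply/eqP; rewrite -subr_eq0; apply/eqP; apply: (Hz _ l) => j jT.
  rewrite -(subrr (fm j x)) -[X in _ = _ - X](HBs (fun t => fm t x) j jT) /fo -sumrB.
  by apply: eq_bigr => l' _; rewrite /z mulrBr.
have gpos j : 0 < (if j \in J then rj j else 1) by case: ifP.
(* The phases are used to avoid the zeros of [D]. *)
have [g gA Dg] := PF_torus DsP (A := fun j z => nm z = if j \in J then rj j else 1)
  (fun j => circle_infinite (gpos j)) Ds0.

pose G l := \sum_(u in T) Bs l u * g u.
have foG j : j \in T -> fm j G = g j by exact: HBs.
have Gk : nm (fm k G) = 1 by rewrite foG ?gA ?(negPf kJ)// finset.setU11.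
have GJ j : j \in J -> nm (fm j G) = rj j.
  by move=> jJ; rewrite foG ?gA ?jJ// finset.in_setU1 jJ orbT.
have B0 : 0 < B by lra.
have de1 : de <= 1.
  by apply: le_trans (ltW deB); rewrite ler_peMl// ltW.
have Gle j : nm (fm j G) <= B.
  rewrite -[leRHS]mulr1; apply: (HB T j G 1 Tn ler01) => u; rewrite finset.in_setU1 => /orP[/eqP ->|uJ].
    by rewrite Gk.
  by rewrite GJ//; exact: le_trans (rjd u) de1.
have Gge y : y \notin J -> B^-1 <= nm (fm y G).
  move=> yJ; have yn : #|y |: J| = n.+1 by rewrite cardsU1 yJ Jn.
  have h := HB (y |: J) k G (Num.max (nm (fm y G)) de) yn.
  have {h} : 1 <= B * Num.max (nm (fm y G)) de.
    rewrite -Gk; apply: h => [|u]; first by rewrite le_max (ltW de0) orbT.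
    rewrite finset.in_setU1 le_max => /orP[/eqP ->|uJ]; first by rewrite lexx.
    by rewrite GJ// rjd orbT.
  rewrite maxEle; case: ifP => _ h; first by move: deB; rewrite ltNge h.
  by rewrite -[leLHS]mulr1 ler_pdivrMl.
have G0 j : fm j G != 0.
  rewrite -nm_gt0; have [jJ|jJ] := boolP (j \in J); first by rewrite GJ.
  by apply: lt_le_trans (Gge _ jJ); rewrite invr_gt0.
have [y [y0 Hy Hc]] := sol Dg G0.
(* The largest form of the solution takes the place of a normalisation. *)
have [jm jmP] : exists jm, forall j, nm (fm j y) <= nm (fm jm y).
  by case: (arg_maxP (fun j => nm (fm j y)) (isT : xpredT k)) => jm _ jmP; exists jm => j; exact: jmP.
pose s := nm (fm jm y); have s0 : 0 < s by rewrite nm_gt0.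
have ds0 : 0 < de * s by rewrite mulr_gt0.
pose U := [set j | nm (fm j y) < de * s]%SET.
have UP j : (j \in U) = (nm (fm j y) < de * s) by rewrite inE.
have yU j : j \in U -> nm (fm j y) <= de * s by rewrite UP => /ltW.
have bs : B * (de * s) < s by rewrite mulrA -[ltRHS]mul1r ltr_pM2r.
have Un : (#|U| <= n)%N.
  rewrite leqNgt; apply/negP => /subset_card [T' /fintype.subsetP T'U T'n].
  have := HB T' jm y (de * s) T'n (ltW ds0) (fun u uT => yU u (T'U u uT)).
  by rewrite leNgt bs.
(* If the small forms are as claimed, the equation between the forms [i] and [k]
   gives a number below [gam]. *)
have [bU|nbU] := boolP (bad U); last first.
  have [UnE iU kU] : [/\ #|U| = n, i \notin U & k \notin U].
    move: nbU; rewrite /bad negb_or negb_and negb_or -leqNgt => /andP[h1 h2].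
    have e : #|U| = n by apply/eqP; rewrite eqn_leq Un.
    by move: h2; rewrite e eqxx /= => /andP[].
  have [_ /(_ UnE kU) [_ h1]] := HaB U.
  have {}h1 := h1 y (de * s) (ltW ds0) yU.
  pose X := nm c * B' + Bt.
  have e1 : gam * nm (fm k y) <= de * X * s.
    apply: le_trans (_ : nm (((aB U).1 - c * al') * fm k y * fm k G) <= _).
      by rewrite nmM Gk mulr1 nmM ler_wpM2r// Hgam.
    have -> : ((aB U).1 - c * al') * fm k y * fm k G =
        c * fm k y * (fm i G - al' * fm k G) - (fm i y - (aB U).1 * fm k y) * fm k G.
      have E (Fi Fk Gi Gk' A : C) : (A - c * al') * Fk * Gk' - (c * Fk * (Gi - al' * Gk') - (Fi - A * Fk) * Gk') =
        Fi * Gk' - c * (Fk * Gi) by ring.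
      by apply/eqP; rewrite -subr_eq0 E Hc subrr.
    apply: le_trans (nmB _ _) _; rewrite !nmM Gk mulr1.
    have h3 : nm c * nm (fm k y) * nm (fm i G - al' * fm k G) <= nm c * s * (B' * de).
      apply: ler_pM; rewrite ?mulr_ge0//; first by rewrite ler_wpM2l.
      by apply: HB' => [|u uJ]; [exact: ltW|rewrite GJ].
    have h4 : nm (fm i y - (aB U).1 * fm k y) <= Bt * (de * s).
      by apply: le_trans h1 _; rewrite ler_wpM2r// ltW.
    have -> : de * X * s = nm c * s * (B' * de) + Bt * (de * s) by rewrite /X; ring.
    exact: lerD.
  have e2 : s <= B * nm (fm k y).
    have kUn : #|k |: U| = n.+1 by rewrite cardsU1 kU UnE.
    have := HB (k |: U) jm y (Num.max (nm (fm k y)) (de * s)) kUn; rewrite maxEle; case: ifP => hm h.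
      have hs : s <= B * (de * s).
        by apply: h => [|u]; [exact: ltW|rewrite finset.in_setU1 => /orP[/eqP ->|/yU]].
      by move: hs; rewrite leNgt bs.
    apply: h => // u; move/negbT: hm; rewrite -ltNge => /ltW hm.
    by rewrite finset.in_setU1 => /orP[/eqP ->|/yU h'] //; exact: le_trans h' hm.
  have d1 : de * X * B < gam by rewrite -ltr_pdivlMr.
  have f1 : gam * s <= gam * (B * nm (fm k y)) by rewrite ler_wpM2l// ltW.
  have f2 : B * (gam * nm (fm k y)) <= B * (de * X * s) by rewrite ler_wpM2l// ltW.
  have f3 : de * X * B * s < gam * s by rewrite ltr_pM2r.
  have f4 : B * (de * X * s) = de * X * B * s by ring.
  rewrite mulrCA in f1; rewrite f4 in f2.
  by have := le_lt_trans (le_trans f1 f2) f3; rewrite ltxx.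
(* Otherwise the logarithms form a vector of the row space of [W] that is bounded
   outside [J] and [U] and close to [t w0] on the rest of [J]. *)
pose la j := ln (nm (fm j y)) - ln s - ln (nm (fm j G)) - ln (nm (h0 j)).
have laM r : \sum_j (M r j)%:~R * la j = 0.
  have /(congr1 (fun z => ln (nm z))) := Hy r; rewrite !ln_prod_exp//; last first.
    by move=> j; rewrite mulf_neq0 ?invr_eq0.
  move/eqP; rewrite -subr_eq0 => /eqP E.
  have Ms0 : \sum_j ((M r j)%:~R : R) = 0.
    by have := congr1 (fun z : int => z%:~R : R) (Msum r); rewrite /= rmorph_sum /= => ->.
  transitivity ((\sum_j (M r j)%:~R * ln (nm (fm j y / fm j G)) - \sum_j (M r j)%:~R * ln (nm (h0 j)))
    - \sum_j (M r j)%:~R * ln s); last by rewrite E -mulr_suml Ms0 mul0r subrr.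
  rewrite -!sumrB; apply: eq_bigr => j _; rewrite nmM nmV lnM ?posrE ?invr_gt0 ?nm_gt0//.
  by rewrite lnV ?posrE ?nm_gt0// /la; ring.
have [x Hx] := LW laM.
have lF j : j \notin U -> `|ln (nm (fm j y)) - ln s| <= `|ln de|.
  rewrite UP -leNgt => dF; have F0 : 0 < nm (fm j y) by rewrite nm_gt0.
  have h1 : ln (nm (fm j y)) <= ln s by rewrite ler_ln ?posrE.
  have h2 : ln de + ln s <= ln (nm (fm j y)) by rewrite -lnM ?posrE// ler_ln ?posrE.
  exact: norm_between.
have lB j : j \notin J -> `|ln (nm (fm j G))| <= `|ln B^-1| + `|ln B|.
  by move=> jJ; apply: (ln_bound _ (Gge _ jJ) (Gle j)); rewrite invr_gt0.
have la1 j : j \notin J -> j \notin U -> `|la j| <= K1.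
  by move=> jJ jU; rewrite /la K1E; exact: norm_sub3 (lF j jU) (lB j jJ) (HH j).
have la2 j : j \in J -> j \notin U -> `|la j - t * w0 j| <= K1.
  move=> jJ jU; rewrite /la K1E GJ// expRK.
  have -> : ln (nm (fm j y)) - ln s - - (t * w0 j) - ln (nm (h0 j)) - t * w0 j =
    (ln (nm (fm j y)) - ln s) - 0 - ln (nm (h0 j)) by ring.
  apply: norm_sub3 (lF j jU) _ (HH j); by rewrite normr0 addr_ge0.
have bU' : `[< bad U >] by apply/asboolP.
set Us : {U : {set 'I_N} | `[< bad U >]} := exist _ U bU'.
have [_ e1z e2z eE] := Heb Us.
have := tU Us; rewrite ltNge => /negP; apply.
have E : t * (\sum_j (eb Us).1 j * w0 j) = \sum_j (eb Us).1 j * (t * w0 j - la j) + \sum_j (eb Us).2 j * la j.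
  have -> : \sum_j (eb Us).2 j * la j = \sum_j (eb Us).1 j * la j.
    transitivity (\sum_j (eb Us).2 j * lam x j); first by apply: eq_bigr => j _; rewrite Hx.
    by rewrite -eE; apply: eq_bigr => j _; rewrite Hx.
  by rewrite -big_split /= mulr_sumr; apply: eq_bigr => j _; ring.
have -> : t * v Us = `|t * (\sum_j (eb Us).1 j * w0 j)| by rewrite normrM (gtr0_norm t0).
rewrite E; apply: le_trans (ler_normD _ _) _; rewrite /nb mulrDl; apply: lerD; apply: norm_sum_le => j nz.
  have : j \in J :\: U by apply: contraLR nz => /e1z ->; rewrite eqxx.
  by rewrite finset.in_setD => /andP[jU jJ]; rewrite distrC; exact: la2.
have : j \notin J :|: U by apply: contraL nz => /e2z ->; rewrite eqxx.
by rewrite finset.in_setU negb_or => /andP[jJ jU]; exact: la1.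
Qed.
End Rho.

Section PFmore.
Variable R : realType.
Local Notation C := R[i].
Lemma PF_bigsum k (I : Type) (s : seq I) (P : I -> ('I_k -> C) -> C) : (forall u, PF (P u)) ->
  PF (fun x => \sum_(u <- s) P u x).
Proof.
move=> H; elim: s => [|u s IH].
  by have := PF_cst k (0 : C); congr PF; apply/funext => x; rewrite big_nil.
by have := PF_add (H u) IH; congr PF; apply/funext => x; rewrite big_cons.
Qed.

Lemma PF_bigprod k (I : Type) (s : seq I) (P : I -> ('I_k -> C) -> C) : (forall u, PF (P u)) ->
  PF (fun x => \prod_(u <- s) P u x).
Proof.
move=> H; elim: s => [|u s IH].
  by have := PF_cst k (1 : C); congr PF; apply/funext => x; rewrite big_nil.
by have := PF_mul (H u) IH; congr PF; apply/funext => x; rewrite big_cons.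
Qed.

Lemma PF_mpoly k (p : mpoly.mpoly k C) : PF (fun x => meval x p).
Proof.
have : PF (fun x : 'I_k -> C => \sum_(m <- msupp p) mcoeff m p * \prod_i x i ^+ m i).
  apply: PF_bigsum => m; apply: PF_mul; first exact: PF_cst.
  apply: PF_bigprod => i; elim: (m i) => [|e IH].
    by have := PF_cst k (1 : C); congr PF; apply/funext => x; rewrite expr0.
  by have := PF_mul (PF_var _ i) IH; congr PF; apply/funext => x; rewrite exprS.
by congr PF; apply/funext => x; rewrite mevalE.
Qed.

End PFmore.

(** * Multihomogeneous conditions on hyperplanes *)

Section Genericity.
Variables (R : realType) (n : nat).
Local Notation C := R[i].
Local Notation N := (n.+1 + n.+1)%N.
Local Notation MP := (mpoly.mpoly (N * n.+1) R[i]).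
Implicit Types (A : 'M[R[i]]_(N, n.+1)) (p q : MP) (d : 'I_N -> nat).

(** Multihomogeneity with a prescribed multidegree, which unlike mere
    multihomogeneity is stable under addition. *)
Definition mh d p := forall mon, mon \in msupp p ->
  forall j : 'I_N, (\sum_(i < n.+1) mon (mxvec_index j i))%N = d j.

Lemma mh_ext d d' p : d =1 d' -> mh d p -> mh d' p.
Proof. by move=> E h mon /h H j; rewrite H E. Qed.

Lemma mh0 d : mh d 0. Proof. by move=> mon; rewrite msupp0. Qed.

Lemma mhD d p q : mh d p -> mh d q -> mh d (p + q).
Proof. by move=> h1 h2 mon /msuppD_le; rewrite mem_cat => /orP[/h1|/h2]. Qed.

Lemma mhN d p : mh d p -> mh d (- p).
Proof. by move=> h mon; rewrite (perm_mem (msuppN _)) => /h. Qed.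

Lemma mhM d d' p q : mh d p -> mh d' q -> mh (fun j => d j + d' j)%N (p * q).
Proof.
move=> h1 h2 mon /msuppM_le /allpairsP [[m1 m2] /= [i1 i2 ->]] j.
by rewrite (eq_bigr _ (fun i _ => mnmDE _ m1 m2)) big_split /= h1// h2.
Qed.

Lemma mhC (c : C) : mh (fun=> 0%N) (mpolyC _ c).
Proof.
move=> mon; rewrite msuppC; case: eqP => // _; rewrite inE => /eqP -> j.
by apply: big1 => i _; rewrite mnm0E.
Qed.

Lemma mh1 : mh (fun=> 0%N) 1. Proof. exact: mhC. Qed.

Lemma mhprod (I : Type) (s : seq I) (d : I -> 'I_N -> nat) (F : I -> MP) : (forall u, mh (d u) (F u)) ->
  mh (fun j => \sum_(u <- s) d u j)%N (\prod_(u <- s) F u).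
Proof.
move=> H; elim: s => [|u s IH].
  by rewrite big_nil; apply: mh_ext mh1 => j; rewrite big_nil.
by rewrite big_cons; apply: mh_ext (mhM (H u) IH) => j; rewrite big_cons.
Qed.

Lemma mhdet k (Y : 'M[MP]_k) (d : 'I_k -> 'I_N -> nat) : (forall r s, mh (d r) (Y r s)) ->
  mh (fun j => \sum_r d r j)%N (\det Y).
Proof.
move=> H; rewrite /determinant; apply: big_ind => [|p q|s _]; [exact: mh0|exact: mhD|].
by rewrite mulr_sign; case: ifP => _; [apply: mhN|]; apply: mhprod.
Qed.

Definition Xmx : 'M[MP]_(N, n.+1) := \matrix_(j, i) mpolyX C (mnm1 (mxvec_index j i)).

Definition ev A p := meval (fun k => mxvec A 0 k) p.

Lemma mhX j0 i : mh (fun j => (j0 == j) : nat) (Xmx j0 i).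
Proof.
move=> mon; rewrite mxE msuppX inE => /eqP -> j.
have inj j1 i1 : (mxvec_index j0 i == mxvec_index j1 i1) = (j0 == j1) && (i == i1).
  by rewrite (inj_eq (@cast_ord_inj _ _ _)) (inj_eq enum_rank_inj) xpair_eqE.
rewrite (eq_bigr (fun i1 => (j0 == j) && (i == i1) : nat)) => [|i1 _]; last by rewrite mnm1E inj.
case: (j0 == j); last by rewrite big1.
by rewrite (bigD1 i)//= eqxx big1// => i1 /negPf; rewrite eq_sym => ->.
Qed.

Lemma evX A j i : ev A (Xmx j i) = A j i.
Proof. by rewrite mxE /ev mevalXU mxvecE. Qed.

Lemma evdet k A (Y : 'M[MP]_k) : ev A (\det Y) = \det (map_mx (ev A) Y).
Proof. by rewrite /ev -det_map_mx. Qed.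

Lemma evM A p q : ev A (p * q) = ev A p * ev A q. Proof. exact: mevalM. Qed.
Lemma evB A p q : ev A (p - q) = ev A p - ev A q. Proof. exact: mevalB. Qed.
Lemma evD A p q : ev A (p + q) = ev A p + ev A q. Proof. exact: mevalD. Qed.

Lemma ev_diff A p1 p2 p3 p4 q1 q2 q3 q4 : ev A (p1 * p2 * (p3 * p4) - q1 * q2 * (q3 * q4)) =
  ev A p1 * ev A p2 * (ev A p3 * ev A p4) - ev A q1 * ev A q2 * (ev A q3 * ev A q4).
Proof. by rewrite evB !evM. Qed.

Definition mn (f : 'I_n.+1 -> 'I_N) : MP := \det (rowsub f Xmx).

Lemma ev_mn A f : ev A (mn f) = \det (rowsub f A).
Proof. by rewrite evdet; congr (\det _); apply/matrixP => r s; rewrite mxE [rowsub _ _ _ _]mxE evX [RHS]mxE. Qed.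

Lemma mh_mn f : mh (fun j => \sum_r (f r == j))%N (mn f).
Proof. by apply: mhdet => r s; rewrite mxE; exact: mhX. Qed.

(** Finitely many conditions that can be satisfied separately hold together
    outside a proper algebraic set. *)
Lemma generic_point (L : seq MP) : (forall p, p \in L -> exists d, mh d p) ->
  (forall p, p \in L -> exists A, ev A p != 0) ->
  exists V : set ('I_N -> projspace R n), [/\ algebraic_subset V, V <> setT &
    forall H, ~ V H -> exists A, (forall j, hcoord (row j A) (H j)) /\ forall p, p \in L -> ev A p != 0].
Proof.
move=> Lmh Lex; pose L' := L ++ [seq Xmx j ord0 | j <- enum 'I_N].
have mh' p : p \in L' -> exists d, mh d p.
  by rewrite mem_cat => /orP[/Lmh //|/mapP [j _ ->]]; eexists; exact: mhX.
have ex' p : p \in L' -> exists A, ev A p != 0.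
  rewrite mem_cat => /orP[/Lex //|/mapP [j _ ->]]; exists (const_mx 1).
  by rewrite evX mxE oner_neq0.
pose T := seq_sub L'; pose P := \prod_(u : T) ssval u.
have evP A : ev A P = \prod_(u : T) ev A (ssval u) by rewrite /ev /P rmorph_prod.
exists [set H | forall Q, Q \in [:: P] -> forall A, (forall j, hcoord (row j A) (H j)) -> ev A Q = 0].
have rows A : ev A P != 0 -> forall j, row j A != 0.
  move=> h j; have jL : Xmx j ord0 \in L' by rewrite mem_cat; apply/orP; right; apply/mapP; exists j; rewrite ?mem_enum.
  move: h; rewrite evP => /prodf_neq0 /(_ (SeqSub jL) isT); rewrite evX; apply: contraNneq => E.
  by have /rowP /(_ ord0) := E; rewrite !mxE => ->.
split.
- exists [:: P]; split=> // Q; rewrite inE => /eqP ->.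
  have /choice [d Hd] : forall u : T, exists d, mh d (ssval u) by move=> [u uL]; exact: mh'.
  by exists (fun j => \sum_(u : T) d u j)%N; exact: mhprod.
- have [_ [x Hx]] := @PF_prod R (N * n.+1) T (index_enum T) (fun u x => meval x (ssval u)) (fun u => @PF_mpoly R _ _)
    (fun u => let: SeqSub u uL := u in let: ex_intro A HA := ex' u uL in ex_intro _ (fun k => mxvec A 0 k) HA).
  pose A := vec_mx (\row_k x k) : 'M[C]_(N, n.+1).
  have HA : ev A P != 0.
    rewrite evP /ev /A vec_mxK; congr (_ != 0): Hx; apply: eq_bigr => u _; congr meval.
    by apply/funext => k; rewrite mxE.
  have H0 j : exists H : projspace R n, hcoord (row j A) H.
    have d1 : \dim <[row j A]>%VS == 1%N by rewrite dim_vline rows.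
    by exists (exist _ <[row j A]>%VS d1).
  have [H HH] := choice H0; move=> VT; have : [set: 'I_N -> projspace R n] H by [].
  by rewrite -VT => /(_ P (mem_head _ _) A HH) /eqP; apply/negP.
- move=> H /existsNP [Q /not_implyP [QP /existsNP [A /not_implyP [HA /eqP AQ]]]].
  move: QP AQ; rewrite inE => /eqP -> h; exists A; split=> // p pL.
  have pL' : p \in L' by rewrite mem_cat pL.
  by move: h; rewrite evP => /prodf_neq0 /(_ (SeqSub pL') isT).
Qed.

Definition ext (m : 'I_n -> 'I_N) i (r : 'I_n.+1) := if unlift ord_max r is Some r' then m r' else i.
Lemma ext_max m i : ext m i ord_max = i. Proof. by rewrite /ext unlift_none. Qed.
Lemma ext_lift m i r : ext m i (lift ord_max r) = m r. Proof. by rewrite /ext liftK. Qed.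

Definition im (m : {ffun 'I_n -> 'I_N}) : {set 'I_N} := [set m r | r in [set: 'I_n]%SET]%SET.

Lemma imP (m : {ffun 'I_n -> 'I_N}) r : m r \in im m. Proof. by apply: imset_f; rewrite finset.in_setT. Qed.

Lemma ext_inj (m : {ffun 'I_n -> 'I_N}) i : injective m -> i \notin im m -> injective (ext m i).
Proof.
move=> mi im' r s; case: (unliftP ord_max r) => [r'|] ->; case: (unliftP ord_max s) => [s'|] ->; rewrite ?ext_lift ?ext_max//.
- by move=> /mi ->.
- by move=> E; rewrite -E imP in im'.
- by move=> E; rewrite E imP in im'.
Qed.

Lemma set_enum (U : {set 'I_N}) : #|U| = n -> exists2 m : {ffun 'I_n -> 'I_N}, injective m & im m = U.
Proof.
move=> Un; exists [ffun r => enum_val (cast_ord (esym Un) r)].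
  by move=> r s; rewrite !ffunE => /enum_val_inj /cast_ord_inj.
apply/setP => j; apply/imsetP/idP => [[r _ ->]|jU]; first by rewrite ffunE enum_valP.
by exists (cast_ord Un (enum_rank_in jU j)); rewrite ?finset.in_setT// ffunE cast_ordK enum_rankK_in.
Qed.

Definition cofs A (m : 'I_n -> 'I_N) (l : 'I_n.+1) : C :=
  (-1) ^+ (n + l) * \det (\matrix_(r < n, s < n) A (m r) (lift l s)).

(** Expansion along the last row, whose cofactors do not involve that row. *)
Lemma minor_fo A m i : \det (rowsub (ext m i) A) = fo A i (cofs A m).
Proof.
rewrite (expand_det_row _ ord_max); apply: eq_bigr => l _; rewrite mxE ext_max; congr (_ * _).
rewrite /cofactor; congr (_ * \det _); apply/matrixP => r s.
by rewrite !mxE ext_lift.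
Qed.

Lemma minor_expands A (m : {ffun 'I_n -> 'I_N}) i k al : expands A (im m) i k al ->
  \det (rowsub (ext m i) A) = al * \det (rowsub (ext m k) A).
Proof.
move=> [b Hb]; rewrite !minor_fo Hb big1 ?addr0// => t /imsetP [r _ ->].
rewrite -minor_fo (@determinant_alternate _ _ _ (lift ord_max r) ord_max) ?mulr0//.
  by rewrite eq_sym neq_lift.
by move=> l; rewrite !mxE ext_lift ext_max.
Qed.

Lemma minor_cofs_eq A A' m i : (forall r l, A (m r) l = A' (m r) l) ->
  fo A i (cofs A m) = fo A i (cofs A' m).
Proof.
move=> H; apply: eq_bigr => l _; congr (_ * (_ * \det _)); apply/matrixP => r s.
by rewrite !mxE H.
Qed.

Definition vdm : 'M[C]_(N, n.+1) := \matrix_(j, l) (j : nat)%:R ^+ l.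

Lemma vdm_minor f : injective f -> \det (rowsub f vdm) != 0.
Proof.
move=> fi; have -> : rowsub f vdm = (Vandermonde n.+1 (\row_r (f r : nat)%:R : 'rV[C]_n.+1))^T.
  by apply/matrixP => r s; rewrite !mxE.
rewrite det_tr det_Vandermonde; apply/prodf_neq0 => r _; apply/prodf_neq0 => s rs.
rewrite !mxE subr_eq0 eqr_nat; apply: contraTneq rs => /val_inj /fi ->.
by rewrite ltnn.
Qed.

(** A matrix with just one vanishing minor among those considered: the row [i]
    is a generic combination of the rows in the given set. *)
Lemma one_minor (mX m1 m2 m3 m4 : {ffun 'I_n -> 'I_N}) i k : i != k -> injective mX -> i \notin im mX ->
  (forall m, m \in [:: m1; m2] -> [/\ injective m, i \notin im m & im m != im mX]) ->
  (forall m, m \in [:: m3; m4] -> [/\ injective m, i \notin im m & k \notin im m]) ->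
  exists A, [/\ \det (rowsub (ext mX i) A) = 0,
    forall m, m \in [:: m1; m2] -> \det (rowsub (ext m i) A) != 0 &
    forall m, m \in [:: m3; m4] -> \det (rowsub (ext m k) A) != 0].
Proof.
move=> ik mXi iX H1 H2.
pose A (be : 'I_n -> C) : 'M[C]_(N, n.+1) := \matrix_(j, l) if j == i then \sum_r be r * vdm (mX r) l else vdm j l.
have AE be (m : {ffun 'I_n -> 'I_N}) r l : i \notin im m -> A be (m r) l = vdm (m r) l.
  by move=> h; rewrite mxE ifN//; apply: contraNneq h => <-; exact: imP.
have Ai be (m : {ffun 'I_n -> 'I_N}) : i \notin im m ->
    \det (rowsub (ext m i) (A be)) = \sum_r be r * \det (rowsub (ext m (mX r)) vdm).
  move=> h; rewrite minor_fo (minor_cofs_eq (A' := vdm)) => [|r l]; last exact: AE.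
  rewrite /fo; under eq_bigr => l _ do rewrite mxE eqxx mulr_suml.
  rewrite exchange_big /=; apply: eq_bigr => r _; rewrite minor_fo /fo mulr_sumr.
  by apply: eq_bigr => l _; rewrite -mulrA.
have c0 (m : {ffun 'I_n -> 'I_N}) : m \in [:: m1; m2] -> exists r, \det (rowsub (ext m (mX r)) vdm) != 0.
  move=> /H1 [mi im' mX']; have : ~~ (im mX \subset im m).
    apply: contra mX' => h; rewrite eq_sym eqEcard h /=.
    by rewrite /im !card_imset.
  by move=> /subsetPn [_ /imsetP [r _ ->] h]; exists r; apply: vdm_minor; exact: ext_inj.
pose P (m : {ffun 'I_n -> 'I_N}) (be : 'I_n -> C) := \sum_r be r * \det (rowsub (ext m (mX r)) vdm).
have PP m : PF (P m).
  apply: PF_bigsum => r; exact: PF_mul (PF_var _ r) (PF_cst _ _).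
have P0 m : m \in [:: m1; m2] -> exists be, P m be != 0.
  move=> /c0 [r Hr]; exists (fun s => (s == r)%:R); rewrite /P (bigD1 r)//= eqxx mul1r big1 ?addr0//.
  by move=> s /negPf ->; rewrite mul0r.
have [be] := PF_neq0M (@C_infinite R) (PP m1) (PP m2) (P0 m1 (mem_head _ _)) (P0 m2 ltac:(by rewrite !inE eqxx orbT)).
rewrite mulf_eq0 negb_or => /andP[h1 h2]; exists (A be); split.
- rewrite Ai// big1// => r _; rewrite (@determinant_alternate _ _ _ (lift ord_max r) ord_max) ?mulr0//.
    by rewrite eq_sym neq_lift.
  by move=> l; rewrite !mxE ext_lift ext_max.
- by move=> m mm; have [_ im' _] := H1 m mm; rewrite Ai//; move: mm; rewrite !inE => /orP[/eqP ->|/eqP ->].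
- move=> m /H2 [mi im' km].
  have -> : rowsub (ext m k) (A be) = rowsub (ext m k) vdm.
    apply/matrixP => r l; rewrite !mxE; case: (unliftP ord_max r) => [r'|] ->.
      rewrite ext_lift ifN ?mxE//; apply: contraNneq im' => <-; exact: imP.
    by rewrite ext_max eq_sym (negPf ik).
  by apply: vdm_minor; exact: ext_inj.
Qed.

Definition ratio_poly (u : ({ffun 'I_n -> 'I_N} * {ffun 'I_n -> 'I_N}) * ({ffun 'I_n -> 'I_N} * {ffun 'I_n -> 'I_N}) * ('I_N * 'I_N)) : MP :=
  let: (((mJ, mJ'), (mU, mU')), (i, k)) := u in
  mn (ext mU i) * mn (ext mJ k) * (mn (ext mU' k) * mn (ext mJ' i)) -
  mn (ext mU k) * mn (ext mJ i) * (mn (ext mU' i) * mn (ext mJ' k)).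

Definition ratio_cond (u : ({ffun 'I_n -> 'I_N} * {ffun 'I_n -> 'I_N}) * ({ffun 'I_n -> 'I_N} * {ffun 'I_n -> 'I_N}) * ('I_N * 'I_N)) : bool :=
  let: (((mJ, mJ'), (mU, mU')), (i, k)) := u in
  [&& i != k, im mJ != im mJ', ~~ ((im mU == im mJ) && (im mU' == im mJ')) &
    all (fun m : {ffun 'I_n -> 'I_N} => [&& injectiveb m, i \notin im m & k \notin im m]) [:: mJ; mJ'; mU; mU']].

Lemma mh_ratio u : exists d, mh d (ratio_poly u).
Proof.
case: u => [[[mJ mJ'] [mU mU']] [i k]].
have E (m : {ffun 'I_n -> 'I_N}) (l j : 'I_N) : (\sum_r (ext m l r == j) = (l == j) + \sum_r (m r == j))%N.
  rewrite (bigD1_ord ord_max)//= ext_max; congr (_ + _)%N.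
  by apply: eq_bigr => r _; rewrite ext_lift.
eexists; apply: mhD; first by do 2?apply: mhM; exact: mh_mn.
apply: mhN; apply: mh_ext; last by do 2?apply: mhM; exact: mh_mn.
by move=> j /=; rewrite !E; lia.
Qed.

Lemma ev_ratio A mJ mJ' mU mU' i k : ev A (ratio_poly (((mJ, mJ'), (mU, mU')), (i, k))) =
  \det (rowsub (ext mU i) A) * \det (rowsub (ext mJ k) A) * (\det (rowsub (ext mU' k) A) * \det (rowsub (ext mJ' i) A)) -
  \det (rowsub (ext mU k) A) * \det (rowsub (ext mJ i) A) * (\det (rowsub (ext mU' i) A) * \det (rowsub (ext mJ' k) A)).
Proof. by rewrite /ratio_poly ev_diff -!ev_mn. Qed.

(** Some set occurs together with [i] on one side only; a matrix for which just
    this minor vanishes separates the two sides. *)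
Lemma ratio_ex u : ratio_cond u -> exists A, ev A (ratio_poly u) != 0.
Proof.
case: u => [[[mJ mJ'] [mU mU']] [i k]]; rewrite /ratio_cond => /and4P[ik JJ' nU].
rewrite /= andbT => /and4P[/and3P[/injectiveP i1 i2 i3] /and3P[/injectiveP j1 j2 j3] /and3P[/injectiveP u1 u2 u3] /and3P[/injectiveP v1 v2 v3]].
have two (x y : {ffun 'I_n -> 'I_N}) (Q : {ffun 'I_n -> 'I_N} -> Prop) : Q x -> Q y -> forall m, m \in [:: x; y] -> Q m.
  by move=> Qx Qy m; rewrite !inE => /orP[/eqP ->|/eqP ->].
have [xX xY mx my] : [/\ mU \in [:: mU; mJ'], mJ' \in [:: mU; mJ'], mJ \in [:: mJ; mU'] & mU' \in [:: mJ; mU']].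
  by rewrite !inE !eqxx !orbT.
have [[x xm]|[x xm]] : (exists2 x : {ffun 'I_n -> 'I_N}, x \in [:: mU; mJ'] & im x != im mJ /\ im x != im mU') \/
    (exists2 x : {ffun 'I_n -> 'I_N}, x \in [:: mJ; mU'] & im x != im mU /\ im x != im mJ').
  apply: contrapT => /not_orP [/forall2NP no1 /forall2NP no2].
  case: (no1 mJ') => // /not_andP [/negP|/negP]; rewrite negbK => /eqP e1; first by rewrite e1 eqxx in JJ'.
  case: (no2 mJ) => // /not_andP [/negP|/negP]; rewrite negbK => /eqP e2; last by rewrite e2 eqxx in JJ'.
  by rewrite e1 e2 !eqxx in nU.
- move=> [/eqP xJ /eqP xU']; have [A [A0 A1 A2]] := @one_minor x mJ mU' mU mJ' i k ik
    (two _ _ (fun m : {ffun 'I_n -> 'I_N} => injective m) u1 j1 x xm) (two _ _ (fun m => i \notin im m) u2 j2 x xm)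
    (two _ _ (fun m : {ffun 'I_n -> 'I_N} => [/\ injective m, i \notin im m & im m != im x])
      (And3 i1 i2 (introN eqP (fun e => xJ (esym e)))) (And3 v1 v2 (introN eqP (fun e => xU' (esym e)))))
    (two _ _ (fun m : {ffun 'I_n -> 'I_N} => [/\ injective m, i \notin im m & k \notin im m]) (And3 u1 u2 u3) (And3 j1 j2 j3)).
  have z0 : \det (rowsub (ext mU i) A) = 0 \/ \det (rowsub (ext mJ' i) A) = 0.
    by move: xm A0; rewrite !inE => /orP[] /eqP -> ->; [left|right].
  exists A; rewrite ev_ratio; move: z0 (A1 _ mx) (A1 _ my) (A2 _ xX) (A2 _ xY); clear.
  move: (\det _) (\det _) (\det _) (\det _) (\det _) (\det _) (\det _) (\det _) => ? ? ? ? ? ? ? ? [->|->] ? ? ? ?;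
    by rewrite !(mul0r, mulr0) sub0r oppr_eq0 !mulf_neq0.
- move=> [/eqP xU /eqP xJ']; have [A [A0 A1 A2]] := @one_minor x mU mJ' mJ mU' i k ik
    (two _ _ (fun m : {ffun 'I_n -> 'I_N} => injective m) i1 v1 x xm) (two _ _ (fun m => i \notin im m) i2 v2 x xm)
    (two _ _ (fun m : {ffun 'I_n -> 'I_N} => [/\ injective m, i \notin im m & im m != im x])
      (And3 u1 u2 (introN eqP (fun e => xU (esym e)))) (And3 j1 j2 (introN eqP (fun e => xJ' (esym e)))))
    (two _ _ (fun m : {ffun 'I_n -> 'I_N} => [/\ injective m, i \notin im m & k \notin im m]) (And3 i1 i2 i3) (And3 v1 v2 v3)).
  have z0 : \det (rowsub (ext mJ i) A) = 0 \/ \det (rowsub (ext mU' i) A) = 0.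
    by move: xm A0; rewrite !inE => /orP[] /eqP -> ->; [left|right].
  exists A; rewrite ev_ratio; move: z0 (A1 _ xX) (A1 _ xY) (A2 _ mx) (A2 _ my); clear.
  move: (\det _) (\det _) (\det _) (\det _) (\det _) (\det _) (\det _) (\det _) => ? ? ? ? ? ? ? ? [->|->] ? ? ? ?;
    by rewrite !(mul0r, mulr0) subr0 !mulf_neq0.
Qed.

Definition block_poly (P Q : {set 'I_N}) : MP := \det (\matrix_(i, j)
  ((if i \in Q then 0 else 1) * row_mx Xmx 0 i j + (if i \in P then 0 else 1) * row_mx 0 Xmx i j)).

Lemma mh_block P Q : exists d, mh d (block_poly P Q).
Proof.
eexists; apply: (mhdet (d := fun i j => (i == j) : nat)) => i j; rewrite mxE.
have c01 (b : bool) : mh (fun=> 0%N) (if b then 0 else 1) by case: b; [exact: mh0|exact: mh1].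
apply: mhD; apply: (@mh_ext (fun j => 0 + (i == j))%N) => //; apply: mhM => //;
  rewrite mxE; case: (fintype.split j) => l; rewrite ?mxE; first [exact: mhX | exact: mh0 | (by have := @mhX i l; rewrite mxE)].
Qed.

Lemma ev_block A P Q : ev A (block_poly P Q) =
  mdet A (fun i => if i \in Q then 0 else 1) (fun i => if i \in P then 0 else 1).
Proof.
rewrite evdet /mdet; congr (\det _); apply/matrixP => i j.
rewrite mxE [X in ev A X]mxE [RHS]mxE evD !evM.
have c01 (b : bool) : ev A (if b then 0 else 1) = (if b then 0 else 1).
  by case: b; rewrite /ev ?meval0 ?meval1.
rewrite !c01; congr (_ * _ + _ * _); rewrite [in LHS]mxE [in RHS]mxE; case: (fintype.split j) => l; rewrite ?evX// !mxE /ev meval0//.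
Qed.

(** With rows that are suitable unit vectors the kernel of the block matrix is
    trivial coordinate by coordinate. *)
Lemma block_ex (P Q : {set 'I_N}) : P :&: Q = finset.set0 -> (#|P| <= n.+1)%N -> (#|Q| <= n.+1)%N ->
  (n.+1 <= #|P :|: Q|)%N -> exists A, ev A (block_poly P Q) != 0.
Proof.
move=> PQ Pn Qn PQn; pose S := ~: (P :|: Q).
have Sc : (#|P| + #|Q| + #|S| = N)%N.
  by have := cardsC (P :|: Q); rewrite card_ord cardsU PQ cards0 subn0.
have PQc : (#|P :|: Q| = #|P| + #|Q|)%N by rewrite cardsU PQ cards0 subn0.
pose kk := (n.+1 - #|P|)%N.
have kS : (kk <= #|S|)%N by rewrite /kk; clear -Sc Qn Pn; lia.
pose s1 := take kk (enum S) ++ enum P; pose s2 := enum Q ++ drop kk (enum S).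
have z1 : size s1 = n.+1.
  by rewrite size_cat size_take -!cardE; case: ltnP => h; rewrite /kk in h kS *; clear -Sc Qn Pn h kS; lia.
have z2 : size s2 = n.+1 by rewrite size_cat size_drop -!cardE /kk; clear -Sc Qn Pn; lia.
have kQ : (kk <= #|Q|)%N by rewrite /kk; rewrite PQc in PQn; clear -PQn; lia.
have u12 : uniq (s1 ++ s2).
  have : perm_eq (s1 ++ s2) ((enum P ++ enum Q) ++ enum S).
    rewrite -[enum S in X in perm_eq _ X](cat_take_drop kk) /s1 /s2.
    by apply/permP => f; rewrite !count_cat; lia.
  move/perm_uniq ->; rewrite !cat_uniq !enum_uniq /= !andbT; apply/andP; split.
    by apply/hasPn => x; rewrite !mem_enum => xQ; apply/negP => xP; move/setP: PQ => /(_ x); rewrite finset.in_setI xP xQ finset.in_set0.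
  by apply/hasPn => x; rewrite /= mem_cat !mem_enum finset.in_setC finset.in_setU.
pose A : 'M[C]_(N, n.+1) := \matrix_(i, l) ((nth i s1 l == i) || (nth i s2 l == i))%:R.
have := u12; rewrite cat_uniq => /and3P[us1 dis us2].
have in1 (l : 'I_n.+1) i : nth i s1 l \in s1 by rewrite mem_nth// z1.
have in2 (l : 'I_n.+1) i : nth i s2 l \in s2 by rewrite mem_nth// z2.
have d12 x : x \in s1 -> x \in s2 -> False by move=> x1 x2; move/hasPn: dis => /(_ x x2); rewrite /= x1.
have A1 (l : 'I_n.+1) i0 x : fo A (nth i0 s1 l) x = x l.
  rewrite /fo (bigD1 l)//= big1 => [|l' l'l].
    by rewrite mxE (set_nth_default i0) ?z1// eqxx mul1r addr0.
  rewrite mxE; case: eqP => [E|_] /=.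
    have E1 : nth i0 s1 l' = nth i0 s1 l by rewrite -[RHS]E; apply: set_nth_default; rewrite z1.
    have h := @nth_uniq _ i0 s1 l' l; rewrite z1 in h; have {}h := h (ltn_ord _) (ltn_ord _) us1.
    move: h; rewrite E1 eqxx => /esym /eqP /val_inj h.
    by rewrite h eqxx in l'l.
  case: eqP => [E|_]; last by rewrite mul0r.
  by case: (d12 (nth i0 s1 l)) => //; rewrite -E.
have A2 (l : 'I_n.+1) i0 x : fo A (nth i0 s2 l) x = x l.
  rewrite /fo (bigD1 l)//= big1 => [|l' l'l].
    have E0 : nth (nth i0 s2 l) s2 l = nth i0 s2 l by apply: set_nth_default; rewrite z2.
    by rewrite mxE E0 eqxx orbT mul1r addr0.
  rewrite mxE; case: eqP => [E|_] /=.
    by case: (d12 (nth i0 s2 l)) => //; rewrite -E.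
  case: eqP => [E|_]; last by rewrite mul0r.
  have E1 : nth i0 s2 l' = nth i0 s2 l by rewrite -[RHS]E; apply: set_nth_default; rewrite z2.
  have h := @nth_uniq _ i0 s2 l' l; rewrite z2 in h; have {}h := h (ltn_ord _) (ltn_ord _) us2.
  move: h; rewrite E1 eqxx => /esym /eqP /val_inj h.
  by rewrite h eqxx in l'l.
exists A; rewrite ev_block /mdet -det_tr; apply/det0P => -[v v0 vM].
pose u l := v 0 (lshift n.+1 l); pose w l := v 0 (rshift n.+1 l).
have row0 i : (if i \in Q then 0 else 1) * fo A i u + (if i \in P then 0 else 1) * fo A i w = 0.
  have := mrow_mul A (fun i => if i \in Q then 0 else 1) (fun i => if i \in P then 0 else 1) (\col_l u l) (\col_l w l) i.
  have -> : col_mx (\col_l u l) (\col_l w l) = v^T.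
    apply/colP => j; rewrite !mxE; case: (splitP j) => l E; rewrite mxE; congr (v 0 _); exact: val_inj.
  have -> : mrow A (fun i => if i \in Q then 0 else 1) (fun i => if i \in P then 0 else 1) *m v^T = 0.
    by apply: trmx_inj; rewrite trmx_mul trmxK trmx0.
  rewrite mxE => /esym E; rewrite -[RHS]E; congr (_ * _ + _ * _); apply: eq_bigr => l _; congr (_ * _); by rewrite mxE.
have inP x : x \in P -> x \notin Q by move=> xP; apply/negP => xQ; move/setP: PQ => /(_ x); rewrite finset.in_setI xP xQ finset.in_set0.
have inQ x : x \in Q -> x \notin P by move=> xQ; apply/negP => /inP; rewrite xQ.
have zS x : x \in S -> (x \notin P) && (x \notin Q) by rewrite finset.in_setC finset.in_setU negb_or.
have sz : size (take kk (enum S)) = kk by rewrite size_takel// -cardE.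
have uw l : u l = 0 /\ w l = 0.
  have r1 := row0 (nth ord0 s1 l); have r2 := row0 (nth ord0 s2 l); rewrite !A1 in r1; rewrite !A2 in r2.
  have k1 : (kk <= l)%N -> u l = 0.
    move=> kl; have lP : nth ord0 s1 l \in P.
      rewrite nth_cat sz ltnNge kl /=; rewrite -mem_enum mem_nth//.
      have : (l < size s1)%N by rewrite z1.
      by rewrite size_cat sz -(ltn_add2l kk (l - kk)) subnKC.
    by move: r1; rewrite lP (negPf (inP _ lP)) mul1r mul0r addr0.
  have k2 : (l < kk)%N -> u l + w l = 0.
    move=> kl; have : nth ord0 s1 l \in S.
      by rewrite nth_cat sz kl; rewrite -mem_enum; apply: (mem_take (n0 := kk)); rewrite mem_nth// sz.
    by move=> /zS /andP[/negPf lP /negPf lQ]; move: r1; rewrite lP lQ !mul1r.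
  have k3 : (l < #|Q|)%N -> w l = 0.
    move=> kl; have lQ : nth ord0 s2 l \in Q.
      by rewrite nth_cat -cardE kl; rewrite -mem_enum mem_nth// -cardE.
    by move: r2; rewrite lQ (negPf (inQ _ lQ)) mul0r mul1r add0r.
  have k4 : (#|Q| <= l)%N -> u l + w l = 0.
    move=> kl; have : nth ord0 s2 l \in S.
      rewrite nth_cat -cardE ltnNge kl /=; rewrite -mem_enum; apply: (@mem_drop kk); rewrite mem_nth//.
      have : (l < size s2)%N by rewrite z2.
      by rewrite size_cat -cardE -(ltn_add2l #|Q| (l - #|Q|)) subnKC.
    by move=> /zS /andP[/negPf lP /negPf lQ]; move: r2; rewrite lP lQ !mul1r.
  have [lk|kl] := ltnP l kk.
    have w0 := k3 (leq_trans lk kQ); by have := k2 lk; rewrite w0 addr0.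
  have u0 := k1 kl; split=> //; have [lQ|Ql] := ltnP l #|Q|; first exact: k3.
  by have := k4 Ql; rewrite u0 add0r.
case/eqP: v0; apply/rowP => j; rewrite [RHS]mxE; case: (fintype.splitP j) => l E.
  have -> : j = lshift n.+1 l by exact: val_inj.
  by case: (uw l).
have -> : j = rshift n.+1 l by exact: val_inj.
by case: (uw l).
Qed.

Theorem generic_hyperplanes : exists V : set ('I_N -> projspace R n), [/\ algebraic_subset V, V <> setT &
  forall H, ~ V H -> exists A, [/\ forall j, hcoord (row j A) (H j), good A, generic_ratios A & generic_blocks A]].
Proof.
pose p0 (f : {ffun 'I_n.+1 -> 'I_N}) := if injectiveb f then mn f else 1.
pose p1 u := if ratio_cond u then ratio_poly u else 1.
pose c2 (PQ : {set 'I_N} * {set 'I_N}) := [&& PQ.1 :&: PQ.2 == finset.set0, (#|PQ.1| <= n.+1)%N, (#|PQ.2| <= n.+1)%N & (n.+1 <= #|PQ.1 :|: PQ.2|)%N].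
pose p2 PQ := if c2 PQ then block_poly PQ.1 PQ.2 else 1.
pose L := map p0 (enum predT) ++ map p1 (enum predT) ++ map p2 (enum predT).
have one : exists A, ev A 1 != 0 by exists 0; rewrite /ev meval1 oner_neq0.
have mone : exists d, mh d 1 by eexists; exact: mh1.
have [||V [V1 V2 V3]] := @generic_point L.
- move=> p; rewrite !mem_cat => /or3P[] /mapP [u _ ->].
  + by rewrite /p0; case: ifP => // _; eexists; exact: mh_mn.
  + by rewrite /p1; case: ifP => // _; exact: mh_ratio.
  + by rewrite /p2; case: ifP => // _; exact: mh_block.
- move=> p; rewrite !mem_cat => /or3P[] /mapP [u _ ->].
  + rewrite /p0; case: ifP => // /injectiveP fi; exists vdm; rewrite ev_mn; exact: vdm_minor.
  + by rewrite /p1; case: ifP => // h; exact: ratio_ex.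
  + by rewrite /p2; case: ifP => // /and4P[/eqP h1 h2 h3 h4]; exact: block_ex.
exists V; split=> // H /V3 [A [HA AL]]; exists A; split=> //.
- move=> T Tn x xT.
  pose f : {ffun 'I_n.+1 -> 'I_N} := [ffun r => enum_val (cast_ord (esym Tn) r)].
  have fi : injectiveb f by apply/injectiveP => r s; rewrite !ffunE => /enum_val_inj /cast_ord_inj.
  have := AL (p0 f); rewrite /L mem_cat map_f ?mem_enum//= /p0 fi ev_mn => /(_ isT) d0 l.
  apply: contraNeq d0 => xl; apply/eqP; apply: (@det_ker _ _ _ (\col_l x l)).
    by apply: contraNneq xl => E; have /colP /(_ l) := E; rewrite !mxE => ->.
  apply/colP => r; rewrite !mxE -[RHS](xT (f r)); last by rewrite ffunE enum_valP.
  by apply: eq_bigr => s _; rewrite !mxE.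
- move=> J J' U U' i k al al' be be' [nJ nJ' nU nU'] [i1 i2 i3 i4] [k1 k2 k3 k4] ik JJ' xU xJ xU' xJ' E.
  have [mJ mJi mJE] := set_enum nJ; have [mJ' mJi' mJE'] := set_enum nJ'.
  have [mU mUi mUE] := set_enum nU; have [mU' mUi' mUE'] := set_enum nU'; subst J J' U U'.
  apply: contrapT => no; pose u := (((mJ, mJ'), (mU, mU')), (i, k)).
  have c1 : ratio_cond u.
    rewrite /u /= ik JJ' /=; apply/andP; split; first by apply/negP => /andP[/eqP e1 /eqP e2]; exact: no.
    rewrite i1 i2 i3 i4 k1 k2 k3 k4 /= !andbT; apply/and4P; split; exact/injectiveP.
  have := AL (p1 u); rewrite /L !mem_cat map_f ?mem_enum//= orbT /p1 c1 => /(_ isT) /eqP; apply.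
  rewrite /u ev_ratio.
  rewrite (minor_expands xU) (minor_expands xJ) (minor_expands xU') (minor_expands xJ').
  move: (\det _) (\det _) (\det _) (\det _) => x y z w.
  transitivity ((al * be' - be * al') * (x * y * z * w)); first by ring.
  by rewrite E subrr mul0r.
- move=> P Q h1 h2 h3 h4; have := AL (p2 (P, Q)); rewrite /L !mem_cat map_f ?mem_enum//= !orbT.
  by rewrite /p2 /c2 /= h1 eqxx h2 h3 h4 /= ev_block; exact.
Qed.
End Genericity.

(** * Multiplicative relations and weights *)

Section Lattice.
Variables (R : realFieldType) (N : nat) (La : ('I_N -> int) -> Prop).
Local Notation mx M := (\matrix_(r, j) (M r j)%:~R : 'M[R]_(_, N)).

(** A choice of maximal rank works. *)
Lemma finite_span : exists p (M : 'I_p -> 'I_N -> int), (forall r, La (M r)) /\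
  forall M', La M' -> ((\row_j (M' j)%:~R : 'rV[R]_N) <= mx M)%MS.
Proof.
pose P r := `[< exists p (M : 'I_p -> 'I_N -> int), (forall r, La (M r)) /\ \rank (mx M) = r >].
have P0 : exists r, P r.
  by exists 0%N; apply/asboolP; exists 0%N, (fun _ _ => 0); split=> [[]//|]; apply/eqP; rewrite mxrank_eq0 -submx0; apply/row_subP => -[].
have Pb r : P r -> (r <= N)%N by move=> /asboolP [p [M [_ <-]]]; exact: rank_leq_col.
case: (ex_maxnP P0 Pb) => r /asboolP [p [M [ML rM]]] rmax.
exists p, M; split=> // M' LM'.
pose M2 (i : 'I_p.+1) := if unlift ord0 i is Some i' then M i' else M'.
have sub : (mx M <= mx M2)%MS.
  apply/row_subP => i; have -> : row i (mx M) = row (lift ord0 i) (mx M2).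
    by apply/rowP => j; rewrite !mxE /M2 liftK.
  exact: row_sub.
have : (mx M2 <= mx M)%MS.
  rewrite -(geq_leqif (mxrank_leqif_sup sub)) rM; apply: rmax; apply/asboolP.
  exists p.+1, M2; split=> // i; rewrite /M2; by case: (unliftP ord0 i).
apply: submx_trans; have -> : \row_j (M' j)%:~R = row ord0 (mx M2).
  by apply/rowP => j; rewrite !mxE /M2 unlift_none.
exact: row_sub.
Qed.

(** Finitely many equations suffice by [finite_span]; the basis is one of the
    kernel of their matrix. *)
Lemma lattice_basis : exists d (W : 'M[R]_(d, N)) p (M : 'I_p -> 'I_N -> int),
  [/\ row_free W, forall r, La (M r),
   forall l : 'I_N -> R, (forall r, \sum_j (M r j)%:~R * l j = 0) -> exists x : 'rV[R]_d, forall j, l j = (x *m W) 0 j &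
   forall M' (x : 'rV[R]_d), La M' -> \sum_j (M' j)%:~R * (x *m W) 0 j = 0].
Proof.
have [p [M [ML HM]]] := finite_span; pose K := kermx (mx M)^T.
exists (\rank K), (row_base K), p, M; split=> //; first exact: row_base_free.
- move=> l Hl; have : (\row_j l j <= row_base K)%MS.
    rewrite eq_row_base; apply/sub_kermxP; apply/rowP => r; rewrite !mxE -[RHS](Hl r).
    by apply: eq_bigr => j _; rewrite !mxE mulrC.
  by case/submxP => x E; exists x => j; rewrite -E mxE.
- move=> M' x /HM /submxP [u uE].
  have : x *m row_base K *m (mx M)^T = 0.
    by apply/sub_kermxP; apply: submx_trans (submxMl _ _) _; rewrite eq_row_base.
  move=> E; have : (u *m mx M) *m (x *m row_base K)^T = 0.
    by rewrite -mulmxA -[mx M](trmxK) -trmx_mul E trmx0 mulmx0.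
  rewrite -uE => /rowP /(_ 0); rewrite !mxE => E2; rewrite -[RHS]E2.
  by apply: eq_bigr => j _; rewrite !mxE.
Qed.
End Lattice.

Section Separation.
Variables (R : realFieldType) (N d : nat) (W : 'M[R]_(d, N)).
Local Notation lam x j := ((x *m W) 0 j).

Lemma poly_nat_neq0 (p : {poly R}) : p != 0 -> exists t : nat, p.[t%:R] != 0.
Proof.
move=> p0; apply: contrapT => /forallNP no; pose rs := [seq (k%:R : R) | k <- iota 0 (size p)].
have us : uniq rs by rewrite map_inj_uniq ?iota_uniq// => x y /eqP; rewrite eqr_nat => /eqP.
have : all (root p) rs.
  by apply/allP => _ /mapP [k _ ->]; apply/rootP; apply/eqP; have /negP := no k; rewrite negbK.
by move=> /(max_poly_roots p0) /(_ us); rewrite size_map size_iota ltnn.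
Qed.

(** The points of the moment curve avoid finitely many hyperplanes. *)
Lemma separating : exists x : 'rV[R]_d, forall i k, lam x i = lam x k -> forall y : 'rV[R]_d, lam y i = lam y k.
Proof.
pose P (u : 'I_N * 'I_N) : {poly R} := \sum_s (W s u.1 - W s u.2) *: 'X^s.
pose Q := \prod_(u | P u != 0) P u.
have Q0 : Q != 0 by apply/prodf_neq0.
have [t Qt] := poly_nat_neq0 Q0; pose x : 'rV[R]_d := \row_s t%:R ^+ s.
have xE i k : lam x i - lam x k = (P (i, k)).[t%:R].
  rewrite !mxE -sumrB horner_sum; apply: eq_bigr => s _.
  by rewrite !mxE hornerZ hornerXn -mulrBr mulrC.
exists x => i k /eqP; rewrite -subr_eq0 xE => Pt y.
have P0 : P (i, k) = 0.
  apply/eqP; apply: contraTT Pt => Pik; move: Qt; rewrite /Q horner_prod => /prodf_neq0.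
  by apply.
have col s : W s i = W s k.
  have := congr1 (fun p : {poly R} => p`_s) P0; rewrite /= coef0 /P coef_sum (bigD1 s)//= big1 => [|s' s's].
    by rewrite coefZ coefXn eqxx mulr1 addr0 => /eqP; rewrite subr_eq0 => /eqP.
  rewrite coefZ coefXn (_ : _ == _ = false) ?mulr0//; apply/negbTE; apply: contraNneq s's => /val_inj ->.
  by [].
by rewrite !mxE; apply: eq_bigr => s _; rewrite col.
Qed.
End Separation.

Lemma median (R : realFieldType) (n : nat) (l : 'I_(n.+1 + n.+1) -> R) : exists i0,
  (#|[set j | (l i0 < l j)%R]%SET| <= n.+1)%N /\ (#|[set j | (l j < l i0)%R]%SET| <= n.+1)%N.
Proof.
pose A i := [set j | (l j <= l i)%R]%SET; pose P i := (n.+1 <= #|A i|)%N.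
have [im _ imP] : exists2 im, true & forall j, l j <= l im.
  by case: (arg_maxP l (isT : xpredT (ord0 : 'I_(n.+1 + n.+1)))) => im _ H; exists im => // j; exact: H.
have Pm : P im.
  rewrite /P; have -> : A im = [set: 'I_(n.+1 + n.+1)]%SET by apply/setP => j; rewrite !inE imP.
  by rewrite cardsT card_ord leq_addr.
case: (arg_minP l Pm) => i0 Pi0 imin; exists i0; split.
  have := cardsC (A i0); rewrite card_ord.
  have -> : ~: A i0 = [set j | (l i0 < l j)%R]%SET by apply/setP => j; rewrite !inE -ltNge.
  by move: Pi0; rewrite /P; clear; lia.
rewrite leqNgt; apply/negP => h.
have [j0 j0A] : exists j0, l j0 < l i0.
  have /card_gt0P [j0] : (0 < #|[set j | (l j < l i0)%R]%SET|)%N by apply: leq_trans h.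
  by rewrite inE; exists j0.
case: (arg_maxP (P := [pred j | l j < l i0]) l j0A) => i1 /= i1A i1max.
have : P i1.
  apply: leq_trans (ltnW h) _; apply: subset_leq_card; apply/fintype.subsetP => j; rewrite !inE => jA.
  exact: i1max.
by move=> /imin; rewrite leNgt i1A.
Qed.

Lemma prod_expz (K : fieldType) (I : finType) (s : K) (M : I -> int) : s != 0 -> \prod_j s ^ M j = s ^ (\sum_j M j).
Proof.
move=> s0; elim: (index_enum I) => [|j t IH]; first by rewrite !big_nil expr0z.
by rewrite !big_cons expfzDr// IH.
Qed.

Section Blocks.
Variables (K : fieldType) (n : nat).
Local Notation N := (n.+1 + n.+1)%N.
Implicit Types (a : 'M[K]_(N, n.+1)).

Lemma mdet_rows a a' (s x y : 'I_N -> K) : (forall i l, a' i l = s i * a i l) ->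
  mdet a' x y = (\prod_i s i) * mdet a x y.
Proof.
move=> E; rewrite /mdet; have -> : mrow a' x y = diag_mx (\row_i s i) *m mrow a x y.
  rewrite mul_diag_mx; apply/matrixP => i j; rewrite !mxE; case: (fintype.split j) => l; rewrite ?mxE ?E ?mulr0 ?addr0 ?add0r;
    by rewrite mulrCA.
by rewrite det_mulmx det_diag; congr (_ * _); apply: eq_bigr => i _; rewrite mxE.
Qed.

(** Scaling the rows and the second block of columns reduces the claim to the case
    of all units equal to 1. *)
Lemma mdet_block a (P Q : {set 'I_N}) (h : 'I_N -> K) c : generic_blocks a -> c != 0 -> (forall i, h i != 0) ->
  P :&: Q = finset.set0 -> (#|P| <= n.+1)%N -> (#|Q| <= n.+1)%N -> (n.+1 <= #|P :|: Q|)%N ->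
  (forall i, i \notin P -> i \notin Q -> h i = c) ->
  mdet a (fun i => if i \in Q then 0 else 1) (fun i => if i \in P then 0 else h i) != 0.
Proof.
move=> ga c0 h0 PQ Pn Qn PQn hc; pose s i := if i \in Q then h i / c else 1.
have s0 i : s i != 0 by rewrite /s; case: ifP => _; rewrite ?mulf_neq0 ?invr_eq0 ?oner_neq0.
pose x i : K := if i \in Q then 0 else 1; pose y i : K := if i \in P then 0 else 1.
suff -> : mdet a (fun i => if i \in Q then 0 else 1) (fun i => if i \in P then 0 else h i) =
    c ^+ n.+1 * ((\prod_i s i) * mdet a x y).
  rewrite !mulf_neq0 ?expf_neq0 ?ga//; exact/prodf_neq0.
have yE : (fun i => if i \in P then 0 else h i) = (fun i => c * (s i * y i)).
  apply/funext => i; rewrite /y; case: ifPn => iP; first by rewrite !mulr0.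
  rewrite mulr1 /s; case: ifPn => iQ; first by rewrite mulrCA divff// mulr1.
  by rewrite mulr1 hc.
have xE : (fun i => if i \in Q then 0 else 1) = (fun i => s i * x i).
  by apply/funext => i; rewrite /x /s; case: ifP => _; rewrite ?mulr0 ?mulr1.
rewrite yE xE !det_expand !mulr_sumr; apply: eq_bigr => S _.
have [Sn|Sn] := eqVneq #|S| n.+1; last by rewrite cS_card// !mulr0.
have sE : \prod_i s i = (\prod_(i in S) s i) * (\prod_(i in ~: S) s i).
  by rewrite (bigID (mem S)) /=; congr (_ * _); apply: eq_bigl => i; rewrite finset.in_setC.
rewrite sE !big_split /= prodr_const Sn; ring.
Qed.
End Blocks.

Section Rescale.
Variables (K : fieldType) (n : nat).
Local Notation N := (n.+1 + n.+1)%N.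
Variables (a a' : 'M[K]_(N, n.+1)) (mu : 'I_N -> K).
Hypotheses (mu0 : forall i, mu i != 0) (E : forall i l, a' i l = mu i * a i l).

Lemma fo_scale i x : fo a' i x = mu i * fo a i x.
Proof. by rewrite /fo mulr_sumr; apply: eq_bigr => l _; rewrite E mulrA. Qed.

Lemma good_scale : good a -> good a'.
Proof.
move=> ga T Tn x xT; apply: (ga T Tn) => j jT; apply: (mulfI (mu0 j)).
by rewrite -fo_scale xT// mulr0.
Qed.

Lemma blocks_scale : generic_blocks a -> generic_blocks a'.
Proof.
move=> gb P Q h1 h2 h3 h4; rewrite (mdet_rows _ _ E) mulf_neq0 ?gb//; exact/prodf_neq0.
Qed.

Lemma expands_scale T i k al : expands a' T i k al -> expands a T i k (al * (mu k / mu i)).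
Proof.
move=> [b Hb]; exists (fun t => b t * (mu t / mu i)) => x; apply: (mulfI (mu0 i)).
rewrite -fo_scale Hb mulrDr fo_scale; congr (_ + _).
  by field; rewrite mu0.
by rewrite mulr_sumr; apply: eq_bigr => t _; rewrite fo_scale; field; rewrite mu0.
Qed.

Lemma ratios_scale : generic_ratios a -> generic_ratios a'.
Proof.
move=> gr J J' U U' i k al al' be be' h1 h2 h3 h4 h5 /expands_scale x1 /expands_scale x2 /expands_scale x3 /expands_scale x4 e.
by apply: (gr _ _ _ _ _ _ _ _ _ _ h1 h2 h3 h4 h5 x1 x2 x3 x4); rewrite mulrACA e mulrACA.
Qed.
End Rescale.

(** * Uniqueness for linear forms in generic position *)

Section Core.
Variables (R : realType) (n m : nat).
Local Notation C := R[i].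
Local Notation V := 'rV[R[i]]_m.
Local Notation N := (n.+1 + n.+1)%N.
Variables (a : 'M[R[i]]_(N, n.+1)) (f g : 'I_n.+1 -> V -> C).
Definition pull (h : 'I_n.+1 -> V -> C) (j : 'I_N) (z : V) := fo a j (fun l => h l z).
Local Notation F := (pull f).
Local Notation G := (pull g).
Local Notation Om z := (FGprod F G z != 0).
Local Notation qt := (hq F G).
Hypotheses (n0 : (0 < n)%N) (ga : good a) (gr : generic_ratios a) (gb : generic_blocks a).
Hypotheses (fl : forall l, lhol (f l)) (gl : forall l, lhol (g l)).
Hypotheses (Fz : forall j, exists p, F j p != 0) (Gz : forall j, exists p, G j p != 0).
Hypothesis FG : forall j x k k', vorder (F j) x k -> vorder (G j) x k' -> k = k'.
Hypothesis nondeg : forall d (q : mpoly.mpoly n.+1 C), (0 < d)%N -> q != 0 -> q \is mpoly.ishomog1 d mpoly.mdeg ->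
  exists z, meval (fun l => g l z) q != 0.

Lemma lhol_PF (h : 'I_n.+1 -> V -> C) P : (forall l, lhol (h l)) -> PF P -> lhol (fun z => P (fun l => h l z)).
Proof.
move=> hl; elim=> [c|i|P1 P2 _ H1 _ H2|P1 P2 _ H1 _ H2]; [exact: lhol_cst|exact: hl|exact: lholD|exact: lholM].
Qed.

Lemma PF_fo j : PF (fo a j).
Proof.
by apply: PF_bigsum => l; apply: PF_mul; [exact: PF_cst|exact: PF_var].
Qed.

Let Fl j : lhol (F j). Proof. exact: (lhol_PF fl (PF_fo j)). Qed.
Let Gl j : lhol (G j). Proof. exact: (lhol_PF gl (PF_fo j)). Qed.

Lemma identity_ext (E : V -> C) : lhol E -> (forall z, Om z -> E z = 0) -> forall z, E z = 0.
Proof.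
move=> El H z; have [z0 z0O] := FGprod_ex Fl Gl Fz Gz.
have := line_ext Fl Gl z0O (proj1 El z0 (z - z0)) (fun t h => H _ h) 1.
by rewrite scale1r addrC subrK.
Qed.

(** Nondegeneracy concerns homogeneous polynomials, whence the cone over the image. *)
Lemma zariski_dense P : PF P -> (exists x, P x != 0) -> exists z t, [/\ Om z, t != 0 & P (fun l => t * g l z) != 0].
Proof.
move=> PP [x0 Px0]; apply: contrapT => no; have [p pE] := PF_meval PP.
have p0 : p != 0 by apply: contraNneq Px0 => p0; rewrite pE p0 meval0.
have [|d [q [q0 qd qX]]] := homogeneous_component (@C_infinite R) (X := fun x => exists2 z, Om z & x = (fun l => g l z)) p0.
  move=> _ t [z zO ->] t0; rewrite -pE; apply: contrapT => /eqP h; apply: no; exists z, t; split=> //.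
pose q' := q * mpolyX C (mnm1 ord0).
have q'0 : q' != 0.
  rewrite mulf_neq0// -(@msupp_eq0 n.+1 C) msuppX //.
have [|z] := nondeg (ltn0Sn d) q'0.
  have mX : mpolyX C (mnm1 (@ord0 n)) \is mpoly.ishomog1 1 mpoly.mdeg.
    by apply/dhomogP => mon; rewrite msuppX inE => /eqP ->; rewrite /= mdeg1.
  by have h := dhomogM qd mX; rewrite addn1 in h.
rewrite mevalM mulf_eq0 negb_or => /andP[+ _]; apply/negP; rewrite negbK; apply/eqP.
apply: (identity_ext (E := fun z => meval (fun l => g l z) q)) => [|w wO].
  exact: (lhol_PF gl (PF_mpoly q)).
by apply: qX; exists w.
Qed.

(** On every line the quotient is an entire function whose modulus has a local
    maximum. *)
Lemma unit_const i k z0 : Om z0 -> (forall w, Om w -> nm (qt i w * qt k z0) = nm (qt i z0 * qt k w)) ->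
  forall w, Om w -> qt i w * qt k z0 = qt i z0 * qt k w.
Proof.
move=> z0O H w wO; pose v := w - z0.
have [u [ue u0 uE]] := line_units Fl Gl Fz Gz FG v i z0O.
have [u' [ue' u0' uE']] := line_units Fl Gl Fz Gz FG v k z0O.
have hu t : Om (z0 + t *: v) -> qt i (z0 + t *: v) = u t.
  by move=> tO; have [_ g0] := FGprod_neq0 i tO; rewrite /hq uE mulfK.
have hu' t : Om (z0 + t *: v) -> qt k (z0 + t *: v) = u' t.
  by move=> tO; have [_ g0] := FGprod_neq0 k tO; rewrite /hq uE' mulfK.
have z00 : z0 + 0 *: v = z0 by rewrite scale0r addr0.
have hi : qt i z0 = u 0 by rewrite -hu z00.
have hk : qt k z0 = u' 0 by rewrite -hu' z00.
pose ph t := u t * (u' t)^-1.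
have phe : entire ph by apply: entireM => //; exact: entireV.
have Pe : entire (fun t => FGprod F G (z0 + t *: v)) by have [+ _] := lhol_FGprod Fl Gl; apply.
have P0 : FGprod F G (z0 + 0 *: v) != 0 by rewrite z00.
have [dl dl0 Hdl] := ccont_neq0 (entire_cont 0 Pe) P0.
have near t : nm t < dl -> Om (z0 + t *: v).
  move=> td; rewrite -nm_gt0; apply: lt_trans _ (Hdl t _); last by rewrite subr0.
  by rewrite divr_gt0// nm_gt0.
have nmph t : nm t < dl -> nm (ph t) <= nm (ph 0).
  move=> /near tO; rewrite /ph !nmM !nmV; have := H _ tO; rewrite hu// hu'// hi hk !nmM => E.
  have -> : nm (u t) / nm (u' t) = nm (u 0) / nm (u' 0); last exact: lexx.
  by apply/eqP; rewrite eqr_div ?nm_eq0//; apply/eqP.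
have phh : hol dl ph by move=> z _; exact: phe.
have [s s0 Hs] := local_max_const dl0 phh nmph.
have ph1 : ph 1 = ph 0.
  apply: contrapT => /eqP ne; pose e t := ph t - ph 0.
  have ee : entire e by exact: entireB phe (entire_cst _).
  have e1 : e 1 != 0 by rewrite subr_eq0.
  have [r r0 Hr] := entire_isolated 0 ee e1.
  pose t : R := Num.min s r / 2.
  have m0 : 0 < Num.min s r by rewrite lt_min s0.
  have t0 : 0 < t by rewrite divr_gt0.
  have [ts tr] : t < s /\ t < r.
    have : Num.min s r <= s by rewrite ge_min lexx.
    have : Num.min s r <= r by rewrite ge_min lexx orbT.
    by rewrite /t; split; lra.
  have tn : nm (t%:C : C) = t by rewrite nmC_ge0// ltW.
  have := Hr t%:C; rewrite subr0 tn tr -nm_gt0 tn t0 => /(_ isT isT).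
  by rewrite /e Hs ?tn// subrr eqxx.
have w1 : w = z0 + 1 *: v by rewrite scale1r addrC subrK.
have O1 : Om (z0 + 1 *: v) by rewrite -w1.
rewrite w1 hu// hu'// hi hk; apply/eqP; rewrite -eqr_div//; exact/eqP.
Qed.

Definition relation (M : 'I_N -> int) := \sum_j M j = 0 /\
  forall z w, Om z -> Om w -> \prod_j qt j z ^ M j = \prod_j qt j w ^ M j.

Let hq0 j z : Om z -> qt j z != 0. Proof. exact: hq_neq0. Qed.

Lemma wedge_of_ratio z : (exists c, forall j, F j z = c * G j z) -> forall l l', f l z * g l' z = f l' z * g l z.
Proof.
move=> [c H]; have [T _ Tn] := @subset_card N [set: 'I_N]%SET n.+1 ltac:(by rewrite cardsT card_ord leq_addr).
have E l : f l z = c * g l z.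
  apply/eqP; rewrite -subr_eq0; apply/eqP; apply: (ga Tn (x := fun l => f l z - c * g l z)) => j _.
  rewrite -(subrr (F j z)) {2}H /pull /fo mulr_sumr -sumrB; apply: eq_bigr => l' _.
  by rewrite mulrBr mulrCA.
by move=> l l'; rewrite !E; ring.
Qed.

(** At the point where the forms in [T] vanish and the form [k] is 1 the form [i]
    takes the value [al]. *)
Lemma expands_uniq (T : {set 'I_N}) i k al al' : #|T| = n -> i \notin T -> k \notin T ->
  expands a T i k al -> expands a T i k al' -> al = al' /\ al != 0.
Proof.
move=> Tn iT kT [b Hb] [b' Hb']; have kTn : #|k |: T| = n.+1 by rewrite cardsU1 kT Tn.
have iTn : #|i |: T| = n.+1 by rewrite cardsU1 iT Tn.
have [B HB] := good_solve ga kTn; pose x l := \sum_(t in k |: T) B l t * (t == k)%:R.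
have xk : fo a k x = 1 by rewrite HB ?finset.setU11// eqxx.
have xT t : t \in T -> fo a t x = 0.
  move=> tT; rewrite HB ?finset.in_setU1 ?tT ?orbT// (_ : (t == k) = false)//.
  by apply: contraNF kT => /eqP <-.
have z0 (b0 : 'I_N -> C) : \sum_(t in T) b0 t * fo a t x = 0.
  by apply: big1 => t tT; rewrite xT// mulr0.
have e1 : fo a i x = al by rewrite Hb z0 xk mulr1 addr0.
have e2 : fo a i x = al' by rewrite Hb' z0 xk mulr1 addr0.
split; first by rewrite -e1 e2.
apply/eqP => al0; have x0 : forall l, x l = 0.
  apply: (ga iTn) => t; rewrite finset.in_setU1 => /orP[/eqP ->|/xT //].
  by rewrite e1.
have : fo a k x = 0 by apply: big1 => l _; rewrite x0 mulr0.
by rewrite xk => /eqP; rewrite oner_eq0.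
Qed.

(** If many of the units are proportional then the maps agree, because their
    relation is a linear relation between the coordinates of [g]. *)
Lemma many_proportional (S : {set 'I_N}) k (c : 'I_N -> C) : (n.+1 < #|S|)%N -> k \in S ->
  (forall j z, j \in S -> Om z -> qt j z = c j * qt k z) ->
  forall z, Om z -> forall l l', f l z * g l' z = f l' z * g l z.
Proof.
move=> Sn kS Hc; have [T TS Tn] := subset_card (ltnW Sn).
have [s sS sT] : exists2 s, s \in S & s \notin T.
  by apply/subsetPn; apply/negP => /subset_leq_card; rewrite Tn leqNgt Sn.
have [b Hb] := good_expand ga s Tn.
have b0 t : t \in T -> b t != 0.
  move=> tT; apply/eqP => bt0; have [B HB] := good_solve ga Tn.
  pose x l := \sum_(t' in T) B l t' * (t' == t)%:R.
  have xT t' : t' \in T -> fo a t' x = (t' == t)%:R by move=> h; rewrite HB.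
  have sTn : #|s |: (T :\ t)| = n.+1.
    have := cardsD1 t T; rewrite tT Tn cardsU1 finset.in_setD1 (negPf sT) andbF /=; lia.
  have x0 : forall l, x l = 0.
    apply: (ga sTn) => j; rewrite finset.in_setU1 => /orP[/eqP ->|].
      rewrite Hb (bigD1 t)//= bt0 mul0r add0r big1// => t' /andP[t'T /negPf t't].
      by rewrite xT// t't mulr0.
    by rewrite finset.in_setD1 => /andP[/negPf jt jT]; rewrite xT// jt.
  have := xT t tT; rewrite eqxx /fo big1 => [/eqP|l _]; last by rewrite x0 mulr0.
  by rewrite eq_sym oner_eq0.
have FE j z : j \in S -> Om z -> F j z = c j * qt k z * G j z.
  by move=> jS zO; rewrite -Hc// /hq divfK//; have [] := FGprod_neq0 j zO.
pose P (x : 'I_n.+1 -> C) := \sum_(t <- enum T) (b t * (c s - c t)) * fo a t x.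
have PP : PF P by apply: PF_bigsum => t; apply: PF_mul; [exact: PF_cst|exact: PF_fo].
have PE z t0 : Om z -> P (fun l => t0 * g l z) = 0.
  move=> zO; have foZ j : fo a j (fun l => t0 * g l z) = t0 * G j z.
    by rewrite /pull /fo mulr_sumr; apply: eq_bigr => l _; rewrite mulrCA.
  apply: (mulfI (hq0 k zO)); rewrite mulr0 /P big_enum /=.
  have E1 := Hb (fun l => f l z); have E2 := Hb (fun l => g l z); rewrite -!/(pull _ _ _) in E1 E2.
  have E3 : F s z = c s * qt k z * \sum_(t in T) b t * G t z by rewrite FE// E2.
  have E4 : F s z = \sum_(t in T) b t * (c t * qt k z * G t z).
    by rewrite E1; apply: eq_bigr => t tT; rewrite -FE//; exact: (fintype.subsetP TS).
  transitivity (t0 * (F s z - F s z)); last by rewrite subrr mulr0.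
  rewrite {1}E3 E4 !mulr_sumr -sumrB !mulr_sumr; apply: eq_bigr => t _.
  by rewrite foZ; ring.
have cE t : t \in T -> c t = c s.
  move=> tT; apply: contrapT => /eqP ne; have [|z [t0 [zO t00]]] := zariski_dense PP; last by rewrite PE// eqxx.
  have [B HB] := good_solve ga Tn; exists (fun l => \sum_(t' in T) B l t' * (t' == t)%:R).
  rewrite /P big_enum /= (bigD1 t)//= big1 => [|t' /andP[t'T /negPf t't]]; last by rewrite HB// t't mulr0.
  by rewrite HB// eqxx mulr1 addr0 mulf_neq0 ?b0// subr_eq0 eq_sym.
move=> z zO; apply: wedge_of_ratio; exists (c s * qt k z).
have E l : f l z - c s * qt k z * g l z = 0.
  apply: (ga Tn (x := fun l => f l z - c s * qt k z * g l z)) => t tT.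
  rewrite -(subrr (F t z)) [X in _ = _ - X]FE// ?cE//; last exact: (fintype.subsetP TS).
  rewrite /pull /fo mulr_sumr -sumrB; apply: eq_bigr => l' _; by rewrite mulrBr mulrCA.
move=> j; rewrite /pull /fo mulr_sumr; apply: eq_bigr => l _.
by have /eqP := E l; rewrite subr_eq0 => /eqP ->; rewrite mulrCA.
Qed.

Lemma det_relation z : Om z -> mdet a (fun=> 1) (fun i => qt i z) = 0.
Proof.
move=> zO; apply: (@det_ker _ _ _ (col_mx (\col_l f l z) (- \col_l g l z))).
  have [F0 _] := FGprod_neq0 (ord0 : 'I_N) zO; apply: contraNneq F0 => E.
  have := congr1 usubmx E; rewrite col_mxKu linear0 => /colP h.
  apply/eqP; apply: big1 => l _; have := h l; rewrite !mxE => ->; exact: mulr0.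
apply/colP => i; rewrite mrow_mul [RHS]mxE mul1r.
have [_ G0] := FGprod_neq0 i zO.
have -> : \sum_j a i j * (\col_l f l z) j 0 = F i z by apply: eq_bigr => l _; rewrite mxE.
have -> : \sum_j a i j * (- \col_l g l z) j 0 = - G i z.
  rewrite /pull /fo -sumrN; apply: eq_bigr => l _; by rewrite !mxE mulrN.
by rewrite /hq mulrN divfK// subrr.
Qed.

Let hS0 S z : Om z -> hS F G S z != 0.
Proof. by move=> zO; apply/prodf_neq0 => j _; exact: hq0. Qed.

(** Sets with proportional products have the same weight because the difference of
    their indicator functions is a relation. *)
Lemma threshold (l : 'I_N -> R) (v : R) z (P Q : {set 'I_N}) : (forall M, relation M -> \sum_j (M j)%:~R * l j = 0) ->
  Om z -> P = [set j | (l j < v)%R]%SET -> Q = [set j | (v < l j)%R]%SET ->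
  mdet a (fun i => if i \in Q then 0 else 1) (fun i => if i \in P then 0 else qt i z) = 0.
Proof.
move=> Hl zO -> ->.
have -> : (fun i => if i \in [set j | (v < l j)%R]%SET then 0 else 1 : C) = (fun i => if v < l i then 0 else 1).
  by apply/funext => i; rewrite inE.
have -> : (fun i => if i \in [set j | (l j < v)%R]%SET then 0 else qt i z) = (fun i => if l i < v then 0 else qt i z).
  by apply/funext => i; rewrite inE.
apply: (lam_det (r := sim F G)).
- by move=> S w w' _ _; rewrite mulrC.
- by move=> S U H w w' wO w'O; rewrite mulrC (H w' w)// mulrC.
- move=> S T U H1 H2 w w' wO w'O; apply: (mulfI (hS0 T wO)); apply: (mulfI (hS0 T w'O)).
  have E1 := H1 w w' wO w'O; have E2 := H2 w w' wO w'O.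
  transitivity ((hS F G S w * hS F G T w') * (hS F G T w * hS F G U w')); first by ring.
  by rewrite E1 E2; ring.
- move=> U; apply: (borel_sets Fl Gl Fz Gz FG (c := cS a)) => // w wO.
  transitivity (mdet a (fun=> 1) (fun i => qt i w)); last exact: det_relation.
  rewrite det_expand; apply: eq_bigr => S _.
  by rewrite [X in _ = _ * X * _]big1// mulr1 mulrC.
move=> S U Sn Un sSU; pose M j : int := (j \in S)%:Z - (j \in U)%:Z.
have sumE (T : {set 'I_N}) (e : 'I_N -> R) : \sum_j (j \in T)%:R * e j = \sum_(j in T) e j.
  by rewrite [RHS]big_mkcond; apply: eq_bigr => j _; case: (j \in T); rewrite ?mul1r ?mul0r.
have rM : relation M.
  split.
    have cE (T : {set 'I_N}) : \sum_j (j \in T)%:Z = #|T|%:Z :> int.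
      transitivity (\sum_(j in T) (1 : int)); last by rewrite sumr_const natz.
      by rewrite [RHS]big_mkcond; apply: eq_bigr => j _; case: (j \in T).
    rewrite (_ : \sum_j M j = \sum_j ((j \in S)%:Z - (j \in U)%:Z))// sumrB !cE Sn Un subrr//.
  move=> w w' wO w'O; have pE (y : V) : Om y -> \prod_j qt j y ^ M j = hS F G S y / hS F G U y.
    move=> yO; rewrite /hS ![\prod_(j in _) _]big_mkcond -prodf_div; apply: eq_bigr => j _.
    have := hq0 j yO; rewrite /M; case: (j \in S); case: (j \in U) => h0;
      by rewrite /= ?subrr ?subr0 ?sub0r ?expr0z ?expr1z ?exprN1 ?divr1 ?div1r ?divff.
  rewrite !pE//; apply/eqP; rewrite eqr_div ?hS0//; apply/eqP; exact: sSU.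
apply/eqP; rewrite -subr_eq0 -!sumE -sumrB; apply/eqP; rewrite -[RHS](Hl M rM); apply: eq_bigr => j _.
by rewrite -mulrBl /M rmorphB.
Qed.

Lemma no_block (l : 'I_N -> R) (v : R) z (P Q : {set 'I_N}) c : (forall M, relation M -> \sum_j (M j)%:~R * l j = 0) ->
  Om z -> P = [set j | (l j < v)%R]%SET -> Q = [set j | (v < l j)%R]%SET ->
  (#|P| <= n.+1)%N -> (#|Q| <= n.+1)%N -> (n.+1 <= #|(P :|: Q)%SET|)%N -> c != 0 ->
  (forall i, i \notin P -> i \notin Q -> qt i z = c) -> False.
Proof.
move=> Hl zO PE QE Pn Qn PQn c0 hc; have := threshold Hl zO PE QE; apply/eqP.
apply: (mdet_block gb c0 _ _ Pn Qn PQn hc) => [i|]; first exact: hq0.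
by apply/setP => j; rewrite PE QE !inE; case: ltgtP.
Qed.

(** The points [g z] are parameters for which [f z] is a solution, and they lie in
    no hypersurface; hence generic parameters admit solutions. *)
Lemma generic_solution p (M : 'I_p -> 'I_N -> int) i k c z0 : Om z0 -> (forall r, relation (M r)) ->
  (forall w, Om w -> qt i w = c * qt k w) ->
  exists D : ('I_n.+1 -> C) -> C, [/\ PF D, exists x, D x != 0 &
    forall x, D x != 0 -> (forall j, fo a j x != 0) -> exists y, [/\ forall j, fo a j y != 0,
      forall r, \prod_j (fo a j y / fo a j x) ^ M r j = \prod_j qt j z0 ^ M r j &
      fo a i y * fo a k x = c * (fo a k y * fo a i x)]].
Proof.
move=> z0O Mrel Hc.
pose mp (t : int) : nat := if t is Posz u then u else 0%N.
pose mm (t : int) : nat := if t is Negz u then u.+1 else 0%N.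
have zpm (z : C) t : z ^ t = z ^+ mp t / z ^+ mm t.
  by case: t => u; rewrite /mp /mm expr0 ?divr1 ?div1r.
have prodz (T : 'I_N -> int) (u w : 'I_N -> C) : \prod_j (u j / w j) ^ T j =
    (\prod_j (u j ^+ mp (T j) * w j ^+ mm (T j))) / (\prod_j (w j ^+ mp (T j) * u j ^+ mm (T j))).
  by rewrite -prodf_div; apply: eq_bigr => j _; rewrite zpm !expr_div_n invf_div mulf_div.
pose X (v : nat -> C) j := \sum_(l < n.+1) a j l * v l.
pose Y (v : nat -> C) j := \sum_(l < n.+1) a j l * v (n.+1 + l)%N.
have tX j : termfun (fun v => X v j).
  by apply: (@termfun_sum _ 'I_n.+1 (index_enum _) (fun l v => a j l * v (nat_of_ord l))) => l; apply: termfunM; [exact: termfun_cst|exact: termfun_var].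
have tY j : termfun (fun v => Y v j).
  by apply: (@termfun_sum _ 'I_n.+1 (index_enum _) (fun l v => a j l * v (n.+1 + l)%N)) => l; apply: termfunM; [exact: termfun_cst|exact: termfun_var].
pose c1 r := \prod_j qt j z0 ^+ mm (M r j); pose c2 r := \prod_j qt j z0 ^+ mp (M r j).
pose phi (o : option 'I_p) v := match o with
  | Some r => (\prod_j (Y v j ^+ mp (M r j) * X v j ^+ mm (M r j))) * c1 r -
      (\prod_j (X v j ^+ mp (M r j) * Y v j ^+ mm (M r j))) * c2 r
  | None => Y v i * X v k - c * (Y v k * X v i) end.
pose psi v := \prod_j Y v j.
have tphi o : termfun (phi o).
  case: o => [r|]; last first.
    by apply: termfunB; [exact: termfunM|apply: termfunM; [exact: termfun_cst|exact: termfunM]].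
  by apply: termfunB; apply: termfunM; (try exact: termfun_cst);
    [apply: (@termfun_prod _ 'I_N (index_enum _) (fun j v => Y v j ^+ mp (M r j) * X v j ^+ mm (M r j)))
    |apply: (@termfun_prod _ 'I_N (index_enum _) (fun j v => X v j ^+ mp (M r j) * Y v j ^+ mm (M r j)))] => j;
    apply: termfunM; exact: termfunX.
have tpsi : termfun psi by exact: (@termfun_prod _ 'I_N (index_enum _) (fun j v => Y v j)).
have XE (x : 'I_n.+1 -> C) (y : seq C) j : X (nth 0 (env x ++ y)) j = fo a j x.
  by apply: eq_bigr => l _; rewrite nth_cat size_env ltn_ord nth_env.
have YE (x : 'I_n.+1 -> C) (y : seq C) j : Y (nth 0 (env x ++ y)) j = fo a j (fun l => y`_l).
  by apply: eq_bigr => l _; rewrite nth_cat size_env ltnNge leq_addr /= addKn.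
have c20 r : c2 r / c1 r = \prod_j qt j z0 ^ M r j.
  by rewrite /c1 /c2 -prodf_div; apply: eq_bigr => j _; rewrite zpm.
have c10 r : c1 r != 0 by apply/prodf_neq0 => j _; rewrite expf_neq0// hq0.
have phiE (x : 'I_n.+1 -> C) (y : seq C) r : (forall j, fo a j x != 0) -> (forall j, fo a j (fun l => y`_l) != 0) ->
    phi (Some r) (nth 0 (env x ++ y)) = 0 <->
    \prod_j (fo a j (fun l => y`_l) / fo a j x) ^ M r j = \prod_j qt j z0 ^ M r j.
  move=> x0 y0; rewrite -c20 prodz /phi.
  rewrite (eq_bigr (fun j => fo a j (fun l => y`_l) ^+ mp (M r j) * fo a j x ^+ mm (M r j))) => [|j _]; last by rewrite XE YE.
  rewrite [X in _ - X * _](eq_bigr (fun j => fo a j x ^+ mp (M r j) * fo a j (fun l => y`_l) ^+ mm (M r j))) => [|j _]; last by rewrite XE YE.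
  have B0 : \prod_j (fo a j x ^+ mp (M r j) * fo a j (fun l => y`_l) ^+ mm (M r j)) != 0.
    by apply/prodf_neq0 => j _; rewrite mulf_neq0 ?expf_neq0.
  move: (c10 r) B0; move: (\prod_j _) (\prod_j _) (c1 r) (c2 r) => A B d1 d2 d10 B0.
  by split=> [/eqP|/eqP]; rewrite ?subr_eq0 ?eqr_div// => /eqP E; apply/eqP; rewrite ?subr_eq0 ?eqr_div// E mulrC.
have [D [DP D0 [pos|neg]]] := solvable_generic (@C_infinite R) n.+1 n.+1 tphi tpsi.
  exists D; split=> // x Dx x0; have [y yn [Hy Hpsi]] := pos x Dx.
  have y0 j : fo a j (fun l => y`_l) != 0 by move: Hpsi => /prodf_neq0 /(_ j isT); rewrite YE.
  exists (fun l => y`_l); split=> // [r|]; first exact/(phiE x y r x0 y0).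
  by have := Hy None; rewrite /phi !XE !YE => /eqP; rewrite subr_eq0 => /eqP.
have [z [t [zO t0 Dt]]] := zariski_dense DP D0; exfalso; apply: (neg _ Dt).
have yE j : fo a j (fun l => (env (fun l => f l z))`_l) = F j z.
  by apply: eq_bigr => l _; rewrite nth_env.
have xE j : fo a j (fun l => t * g l z) = t * G j z.
  by rewrite /pull /fo mulr_sumr; apply: eq_bigr => l _; rewrite mulrCA.
exists (env (fun l => f l z)); first exact: size_env.
have F0 j : F j z != 0 by have [] := FGprod_neq0 j zO.
have G0 j : G j z != 0 by have [] := FGprod_neq0 j zO.
split; last by apply/prodf_neq0 => j _; rewrite YE yE.
case=> [r|].
  apply/phiE => [j|j|]; rewrite ?yE ?xE ?mulf_neq0//; have [M0 Mc] := Mrel r.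
  rewrite -(Mc z z0)//; transitivity (\prod_j (qt j z ^ M r j * t^-1 ^ M r j)).
    by apply: eq_bigr => j _; rewrite yE xE -expfzMl invfM mulrA mulrAC.
  by rewrite big_split /= prod_expz ?invr_eq0// M0 expr0z mulr1.
have hE j : F j z = qt j z * G j z by rewrite /hq divfK.
by rewrite /phi !XE !YE !yE !xE (hE i) (hE k) (Hc z zO); ring.
Qed.

(** The space of weights has dimension at most [n+1], because [no_block] excludes
    balanced weights.  At the median of a generic weight the units are
    proportional.  If there are more than [n+1] of them the maps agree; otherwise
    two degenerations show that the units are equal, which [no_block] excludes. *)
Theorem core : forall z l l', f l z * g l' z = f l' z * g l z.
Proof.
suff H z : Om z -> forall l l', f l z * g l' z = f l' z * g l z.
  move=> z l l'; apply/eqP; rewrite -subr_eq0 -mulN1r; apply/eqP.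
  apply: (identity_ext (E := fun z => f l z * g l' z + -1 * (f l' z * g l z))) => [|w /H h].
    by apply: lholD; [exact: lholM|apply: lholM; [exact: lhol_cst|exact: lholM]].
  by rewrite (h l l') mulN1r subrr.
move: z; have [d [W [p [M [Wf ML LW WL]]]]] := lattice_basis R relation.
have [z0 z0O] := FGprod_ex Fl Gl Fz Gz.
have logs z w : Om z -> Om w -> exists x : 'rV[R]_d, forall j, ln (nm (qt j z)) - ln (nm (qt j w)) = (x *m W) 0 j.
  move=> zO wO; apply: (LW (fun j => ln (nm (qt j z)) - ln (nm (qt j w)))) => r.
  rewrite (eq_bigr _ (fun j _ => mulrBr _ _ _)) sumrB -(ln_prod_exp M (f := fun j => qt j z) r (fun j => hq0 j zO)).
  rewrite -(ln_prod_exp M (f := fun j => qt j w) r (fun j => hq0 j wO)).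
  by have [_ h] := ML r; rewrite (h z w)// subrr.
(* Relations have sum zero, so the constant vectors are weights. *)
have [x1 hx1] : exists x : 'rV[R]_d, forall j, (x *m W) 0 j = 1.
  have [|x hx] := LW (fun=> 1); last by exists x.
  move=> r; have [h _] := ML r; have := congr1 (fun z : int => z%:~R : R) h; rewrite /= rmorph_sum /= => E.
  by rewrite -[RHS]E; apply: eq_bigr => j _; rewrite mulr1.
have dn : (d <= n.+1)%N.
  rewrite leqNgt; apply/negP => dn.
  have Wcol j : exists s, W s j != 0.
    apply: contrapT => /forallNP no; have := hx1 j; rewrite mxE big1 => [/eqP|s _]; first by rewrite eq_sym oner_eq0.
    by have /negP := no s; rewrite negbK => /eqP ->; rewrite mulr0.
  have [x [xp xm]] := balanced Wf Wcol dn.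
  set Q := [set j | 0 < _]%SET in xp; set P := [set j | _ < 0]%SET in xm.
  have PQ : P :&: Q = finset.set0 by apply/setP => j; rewrite !inE; case: ltgtP.
  have PQc : #|(P :|: Q)%SET| = N by rewrite cardsU PQ cards0 subn0 xp xm.
  have PQT : (P :|: Q)%SET = [set: 'I_N]%SET by apply/eqP; rewrite eqEcard finset.subsetT cardsT card_ord PQc leqnn.
  apply: (no_block (l := fun j => (x *m W) 0 j) (fun M' h => WL M' x h) z0O (erefl P) (erefl Q)).
  - by rewrite xm.
  - by rewrite xp.
  - by rewrite PQc leq_addr.
  - exact: (oner_neq0 C).
  - by move=> i iP iQ; have := finset.in_setT i; rewrite -PQT finset.in_setU (negPf iP) (negPf iQ).
have [x0 Hx0] := separating W.
have [i0 [up lo]] := median (fun j => (x0 *m W) 0 j).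
pose S := [set j | `[< forall y : 'rV[R]_d, (y *m W) 0 j = (y *m W) 0 i0 >]]%SET.
have SP j : reflect (forall y : 'rV[R]_d, (y *m W) 0 j = (y *m W) 0 i0) (j \in S) by rewrite inE; exact: asboolP.
have i0S : i0 \in S by apply/SP.
(* The vectors of logarithms are weights, so the quotient has constant modulus. *)
have ratio i k : (forall y : 'rV[R]_d, (y *m W) 0 i = (y *m W) 0 k) -> exists c, forall w, Om w -> qt i w = c * qt k w.
  move=> e; exists (qt i z0 / qt k z0) => w wO.
  have H w' : Om w' -> nm (qt i w' * qt k z0) = nm (qt i z0 * qt k w').
    move=> w'O; have [x Hx] := logs w' z0 w'O z0O; have E : ln (nm (qt i w')) - ln (nm (qt i z0)) = ln (nm (qt k w')) - ln (nm (qt k z0)) by rewrite !Hx e.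
    have p1 : 0 < nm (qt i w' * qt k z0) by rewrite nm_gt0 mulf_neq0 ?hq0.
    have p2 : 0 < nm (qt i z0 * qt k w') by rewrite nm_gt0 mulf_neq0 ?hq0.
    apply: ln_inj; rewrite ?posrE//.
    have aux (u v s t : R) : u - s = v - t -> u + t = s + v by move=> h; lra.
    have lnmM (u v : C) : u != 0 -> v != 0 -> ln (nm (u * v)) = ln (nm u) + ln (nm v).
      by move=> u0 v0; rewrite nmM lnM ?posrE ?nm_gt0.
    by rewrite (lnmM (qt i w') (qt k z0)) ?hq0// (lnmM (qt i z0) (qt k w')) ?hq0//; exact: aux.
  by rewrite mulrAC -(unit_const z0O H wO) mulfK// hq0.
have [big|small] := ltnP n.+1 #|S|.
  have /choice [c Hc] : forall j, exists c, j \in S -> forall w, Om w -> qt j w = c * qt i0 w.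
    move=> j; case jS : (j \in S); last by exists 0.
    by have [c Hc] := ratio j i0 (SP j jS); exists c.
  by move=> z; apply: (many_proportional big i0S (c := c)) => j w jS; exact: Hc.
suff eq i k : i \in S -> k \in S -> qt i z0 = qt k z0.
  exfalso; pose P := [set j | ((x0 *m W) 0 j < (x0 *m W) 0 i0)%R]%SET.
  pose Q := [set j | ((x0 *m W) 0 i0 < (x0 *m W) 0 j)%R]%SET.
  have inS j : j \notin P -> j \notin Q -> j \in S.
    by rewrite !inE -!leNgt => h1 h2; apply/asboolP; apply: Hx0; apply: le_anti; rewrite h1 h2.
  apply: (no_block (l := fun j => (x0 *m W) 0 j) (fun M' h => WL M' x0 h) z0O (erefl P) (erefl Q) lo up _ (hq0 i0 z0O)).
    have : (#|~: (P :|: Q)%SET| <= #|S|)%N.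
      by apply: subset_leq_card; apply/fintype.subsetP => j; rewrite finset.in_setC finset.in_setU negb_or => /andP[]; exact: inS.
    move=> h; have cC := cardsC (P :|: Q)%SET; rewrite card_ord in cC.
    by rewrite -(leq_add2r #|~: (P :|: Q)%SET|) cC leq_add2l; exact: leq_trans h small.
  by move=> j jP jQ; apply: eq => //; exact: inS.
move=> iS kS; have [->//|ik] := eqVneq i k.
have e (y : 'rV[R]_d) : (y *m W) 0 i = (y *m W) 0 k by rewrite (SP i iS) (SP k kS).
have [c Hc] := ratio i k e.
have [D [DP D0 sol]] := generic_solution z0O ML Hc.
have [|Y1 [Y2 [Y12 [s1 s2] [n1 n2] [i1 i2] [k1 k2]]]] := two_sets Wf n0 dn (ex_intro _ x1 hx1) ik e.
  apply: leq_trans small; apply: subset_leq_card; apply/fintype.subsetP => j; rewrite inE => /asboolP h.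
  by apply/SP => y; rewrite h (SP i iS).
have h00 j : qt j z0 != 0 by exact: hq0.
have Msum r : \sum_j M r j = 0 by have [] := ML r.
have deg (Y : {set 'I_N}) : spans W Y -> #|Y| = n.+2 -> i \in Y -> k \in Y -> #|~: Y| = n /\
  exists (U : {set 'I_N}) (al al' : C), [/\ #|U| = n, i \notin U, k \notin U, expands a U i k al & expands a (~: Y) i k al' /\ al = c * al'].
  move=> sY Yn iY kY; have Jn : #|~: Y| = n by have := cardsC Y; rewrite card_ord Yn; clear; lia.
  have iJ : i \notin ~: Y by rewrite finset.in_setC iY.
  have kJ : k \notin ~: Y by rewrite finset.in_setC kY.
  have sJ : spans W (~: (~: Y)) by rewrite finset.setCK.
  split=> //; by apply: (@degeneration R n d p a W M (fun j => qt j z0) ga h00 Msum LW (~: Y) i k c D).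
(* Eliminating [c] between the two degenerations. *)
have [J1 [U1 [al1 [al1' [Un1 iU1 kU1 e1 [e1' E1]]]]]] := deg Y1 s1 n1 i1 k1.
have [J2 [U2 [al2 [al2' [Un2 iU2 kU2 e2 [e2' E2]]]]]] := deg Y2 s2 n2 i2 k2.
have iY1 : i \notin ~: Y1 by rewrite finset.in_setC i1.
have kY1 : k \notin ~: Y1 by rewrite finset.in_setC k1.
have [UJ _] : U1 = ~: Y1 /\ U2 = ~: Y2.
  have iY2 : i \notin ~: Y2 by rewrite finset.in_setC i2.
  have kY2 : k \notin ~: Y2 by rewrite finset.in_setC k2.
  apply: (@gr (~: Y1) (~: Y2) U1 U2 i k al1 al1' al2 al2') => //.
    by apply: contraNneq Y12 => h; rewrite -[Y1]finset.setCK h finset.setCK.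
  by rewrite E1 E2; ring.
rewrite UJ in e1; have [E a0] := expands_uniq J1 iY1 kY1 e1 e1'.
have c1 : c = 1.
  have a0' : al1' != 0 by rewrite -E.
  by apply: (mulIf a0'); rewrite mul1r -E1 E.
by rewrite (Hc z0 z0O) c1 mul1r.
Qed.
End Core.

(** * Uniqueness of meromorphic maps *)

Lemma line_scale (K : fieldType) (k : nat) (u v : 'rV[K]_k) (c : K) : c != 0 -> u = c *: v -> <[u]>%VS = <[v]>%VS.
Proof.
move=> c0 ->; apply/eqP; rewrite eqEsubv -!memvE; apply/andP; split; first by apply: memvZ; exact: memv_line.
suff : c^-1 *: (c *: v) \in <[c *: v]>%VS by rewrite scalerA mulVf// scale1r.
by apply: memvZ; exact: memv_line.
Qed.

Lemma homogeneous_scale (K : fieldType) (k d : nat) (q : mpoly.mpoly k K) (s : K) (x : 'I_k -> K) :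
  q \is mpoly.ishomog1 d mpoly.mdeg -> meval (fun i => s * x i) q = s ^+ d * meval x q.
Proof.
move=> /dhomogP h; rewrite !mevalE mulr_sumr; apply: eq_big_seq => mon mm.
have hm : mdeg mon = d := h mon mm.
rewrite -hm [RHS]mulrCA; congr (_ * _); rewrite mdegE -prodrXr -big_split /=.
by apply: eq_bigr => i _; rewrite exprMn.
Qed.

(** The two representations have the same zeros by [compare], so that the identity
    of [core] gives equal values at every point. *)
Lemma generic_uniqueness (R : realType) (m n : nat) : (0 < n)%N ->
  exists V : set ('I_(n.+1 + n.+1) -> projspace R n),
    [/\ algebraic_subset V, V <> setT &
      forall H : 'I_(n.+1 + n.+1) -> projspace R n, ~ V H ->
      forall f g : Cn R m -> option (projspace R n),
        meromorphic_map f -> meromorphic_map g ->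
        (forall j, ~ mer_image f `<=` hyperplane (H j)) ->
        (forall j, ~ mer_image g `<=` hyperplane (H j)) ->
        (forall j, pullback f (H j) = pullback g (H j)) ->
        alg_nondegenerate g ->
        f = g].
Proof.
move=> n0; have [V [V1 V2 V3]] := generic_hyperplanes R n.
exists V; split=> // H /V3 [A [HA ga gr gb]] f g [_ fex] [_ gex] fH gH FGH gnd.
pose vp j := vpick (sval (H j)).
pose rF := xget (fun _ _ => 0) (reduced_rep f); have rfF : reduced_rep f rF by have [F0 HF0] := fex; exact: (xgetI _ HF0).
pose rG := xget (fun _ _ => 0) (reduced_rep g); have rgG : reduced_rep g rG by have [G0 HG0] := gex; exact: (xgetI _ HG0).
have vpE j : exists mu : R[i], mu != 0 /\ vp j = mu *: row j A.
  have /vlineP [mu E] : vp j \in <[row j A]>%VS by have h := HA j; rewrite /hcoord in h; rewrite -h memv_pick.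
  exists mu; split=> //; apply/eqP => mu0.
  have : vp j == 0 by rewrite E mu0 scale0r.
  rewrite vpick0 => /eqP E0; have : \dim (sval (H j)) == 1%N := svalP (H j).
  by rewrite E0 dimv0.
have [mu Hmu] := choice vpE.
pose a' : 'M[R[i]]_(n.+1 + n.+1, n.+1) := \matrix_(j, l) vp j 0 l.
have aE i l : a' i l = mu i * A i l by rewrite mxE; have [_ ->] := Hmu i; rewrite !mxE.
have mu0 i : mu i != 0 by case: (Hmu i).
have ga' := good_scale mu0 aE ga; have gr' := ratios_scale mu0 aE gr; have gb' := blocks_scale mu0 aE gb.
have pE (h : 'I_n.+1 -> Cn R m -> R[i]^o) j : pairing h (vp j) = pull a' h j.
  by apply/funext => z; apply: eq_bigr => l _; rewrite mxE.
have [Fh F0 Fp] := rfF; have [Gh G0 Gp] := rgG.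
have fl l : lhol (rF l) := holomorphic_lhol (Fh l).
have gl l : lhol (rG l) := holomorphic_lhol (Gh l).
have Fl j : lhol (pull a' rF j) by exact: (lhol_PF fl (PF_fo a' j)).
have Gl j : lhol (pull a' rG j) by exact: (lhol_PF gl (PF_fo a' j)).
have FGv j x k k' : vorder (pull a' rF j) x k -> vorder (pull a' rG j) x k' -> k = k'.
  by apply: divisor_vorder => //; rewrite -!pE; exact: (FGH j).
have nz (h : Cn R m -> option (projspace R n)) rh j : reduced_rep h rh -> ~ mer_image h `<=` hyperplane (H j) ->
    exists p, pull a' rh j p != 0.
  move=> [hh h0 hp] nsub; apply: contrapT => no; apply: nsub => p [z zp] b x bH xp.
  have Ez : pull a' rh j z = 0 by apply: contrapT => /eqP h'; apply: no; exists z.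
  have /vlineP [c cE] : x \in <[\row_i rh i z]>%VS.
    by have h1 := hp z p zp; rewrite /hcoord in h1 xp; rewrite -h1 xp memv_line.
  have /vlineP [e eE] : b \in <[row j A]>%VS.
    by have h1 := HA j; rewrite /hcoord in h1 bH; rewrite -h1 bH memv_line.
  transitivity (e * c * fo A j (fun l => rh l z)).
    by rewrite /fo mulr_sumr; apply: eq_bigr => l _; rewrite eE cE !mxE; ring.
  have := fo_scale aE j (fun l => rh l z); rewrite -/(pull a' rh j z) Ez => /esym /eqP.
  by rewrite mulf_eq0 (negPf (mu0 j)) /= => /eqP ->; rewrite mulr0.
have Fz j : exists p, pull a' rF j p != 0 by exact: nz rfF (fH j).
have Gz j : exists p, pull a' rG j p != 0 by exact: nz rgG (gH j).
have nd d (q : mpoly.mpoly n.+1 R[i]) : (0 < d)%N -> q != 0 -> q \is mpoly.ishomog1 d mpoly.mdeg ->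
    exists z, meval (fun l => rG l z) q != 0.
  move=> d0 q0 qh; apply: contrapT => no.
  apply: (gnd [set p | forall x : 'rV[R[i]]_n.+1, hcoord x p -> meval (fun i => x 0 i) q = 0]).
    by exists d, q.
  move=> p [z zp] x xp; have /vlineP [c ->] : x \in <[\row_i rG i z]>%VS.
    by have h1 := Gp z p zp; rewrite /hcoord in h1 xp; rewrite -h1 xp memv_line.
  have -> : (fun i => (c *: \row_i0 rG i0 z) 0 i) = (fun i => c * rG i z) by apply/funext => i; rewrite !mxE.
  rewrite (homogeneous_scale _ _ qh); have -> : meval (fun i => rG i z) q = 0.
    by apply: contrapT => /eqP h; apply: no; exists z.
  by rewrite mulr0.
have W := core n0 ga' gr' gb' fl gl Fz Gz FGv nd.
have nvs (z : 'rV[R[i]]_m) : nv (z - z) = 0 by rewrite subrr -[X in nv X](scale0r z) nvZ nm0 mul0r.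
have [T _ Tn] := @subset_card (n.+1 + n.+1) [set: 'I_(n.+1 + n.+1)]%SET n.+1 ltac:(by rewrite cardsT card_ord leq_addr).
have zero (h k : 'I_n.+1 -> Cn R m -> R[i]^o) z : (forall j, lhol (pull a' h j)) -> (forall j, lhol (pull a' k j)) ->
    (forall j, exists p, pull a' h j p != 0) -> (forall j, exists p, pull a' k j p != 0) ->
    (forall j x o o', vorder (pull a' h j) x o -> vorder (pull a' k j) x o' -> o = o') ->
    (forall l, k l z = 0) -> forall l, h l z = 0.
  move=> hl kl hz kz hk k0; apply: (ga' T Tn (fun l => h l z)) => j _.
  have [r [M [r0 HM]]] := compare (hl j) (kl j) (hz j) (kz j) (hk j) z.
  have := HM z; rewrite nvs => /(_ r0); have -> : pull a' k j z = 0 by apply: big1 => l _; rewrite k0 mulr0.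
  by rewrite nm0 mulr0 => h0; apply/eqP; rewrite -nm_eq0 eq_le h0 nm_ge0.
have zFG z : (forall l, rG l z = 0) -> forall l, rF l z = 0 by exact: zero.
have zGF z : (forall l, rF l z = 0) -> forall l, rG l z = 0.
  by apply: zero => // j x o o' h1 h2; apply/esym; exact: FGv h2 h1.
have pinj (p q : projspace R n) : sval p = sval q -> p = q.
  by case: p => L dL; case: q => L' dL' /= E; subst L'; congr exist; exact: bool_irrelevance.
have fN z : f z = None <-> forall l, rF l z = 0.
  by rewrite -[f z = None]/(indet f z) -F0.
have gN z : g z = None <-> forall l, rG l z = 0.
  by rewrite -[g z = None]/(indet g z) -G0.
apply/funext => z; case fz : (f z) => [p|]; last by have /fN /zGF /gN -> := fz.
case gz : (g z) => [p'|]; last by move: gz fz => /gN /zFG /fN ->.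
congr Some; apply: pinj; have hp := Fp z p fz; have hp' := Gp z p' gz; rewrite /hcoord in hp hp'.
have [l0 Gl0] : exists l0, rG l0 z != 0.
  apply: contrapT => /forallNP no; have : g z = None by apply/gN => l; have /negP := no l; rewrite negbK => /eqP.
  by rewrite gz.
have Fl0 : rF l0 z != 0.
  apply/eqP => Fl0; have : f z = None; last by rewrite fz.
  by apply/fN => l; apply: (mulIf Gl0); rewrite (W z l l0) Fl0 !mul0r.
rewrite hp hp'; apply: (line_scale (c := rF l0 z / rG l0 z)); first by rewrite mulf_neq0 ?invr_eq0.
by apply/rowP => l; rewrite !mxE; apply: (mulIf Gl0); rewrite W mulrAC divfK.
Qed.

Theorem theorem1p1 (R : realType) (m n : nat) (hm : (1 <= m)%N)
    (hn : (1 <= n)%N) :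
  exists V : set ('I_(2 * n + 2) -> projspace R n),
    [/\ algebraic_subset V, V <> setT &
      forall H : 'I_(2 * n + 2) -> projspace R n, ~ V H ->
      forall f g : Cn R m -> option (projspace R n),
        meromorphic_map f -> meromorphic_map g ->
        (forall j, ~ mer_image f `<=` hyperplane (H j)) ->
        (forall j, ~ mer_image g `<=` hyperplane (H j)) ->
        (forall j, pullback f (H j) = pullback g (H j)) ->
        alg_nondegenerate g ->
        f = g].
Proof.
have E : (2 * n + 2 = n.+1 + n.+1)%N by lia.
by rewrite E; exact: generic_uniqueness.
Qed.
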